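(* Let $\alpha,\beta,\gamma,\delta\in(0,1)$ with $\alpha+\beta+\gamma+\delta=2$, and let $A_1=1$, $A_2=0$, $A_3$, $A_4$ (with $\operatorname{Im}A_3>0$, $\operatorname{Im}A_4>0$) be the consecutive vertices of a convex polygonal quadrilateral whose exterior angles at $A_1,A_2,A_3,A_4$ are $\pi(1+\alpha)$, $\pi(1+\beta)$, $\pi(1+\gamma)$, $\pi(1+\delta)$, respectively. Let $Q^c$ be the exterior of this quadrilateral in the Riemann sphere. Then $$\mathrm{Mod}(Q^c;A_1,A_2,A_3,A_4)=\frac{K(\sqrt{1-r^2})}{K(r)},\qquad r=\frac1{\sqrt t},$$ where $t\in(1,\infty)$ is the unique solution of the equation $$|A_2A_3|=\frac{I(t)}{h_1(t)},$$ with $$h_1(t)=B(1+\alpha,1+\beta)\,F_D^{(3)}\!\left(1+\alpha;-\gamma,2,2;2+\alpha+\beta;\tfrac1t,\tfrac1{z_0},\tfrac1{\overline{z}_0}\right),$$ $$I(t)=\frac{(t-1)^{1+\beta+\gamma}|z_0|^4}{t^\gamma|z_0-1|^4}\,B(1+\beta,1+\gamma)\,F_D^{(3)}\!\left(1+\beta;-\alpha,2,2;2+\beta+\gamma;-(t-1),\tfrac{t-1}{z_0-1},\tfrac{t-1}{\overline{z}_0-1}\right),$$ and $z_0=z_0(t)=x_0(t)+i\sqrt{\rho(x_0(t))-x_0(t)^2}$, where $x_0(t)$ is the unique real solution $x$ of the cubic equation $Ax^3+Bx^2+Cx+D=0$ satisfying $x^2<\rho(x)$. Here $\rho$ and the coefficients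 $A,B,C,D$ (depending on $\alpha,\beta,\gamma,t$) are as defined in the context.
   Context: Modulus: a quadrilateral $(Q;z_1,z_2,z_3,z_4)$ is a Jordan domain $Q$ on the Riemann sphere with four boundary points labelled in the order of the positive traverse of $\partial Q$ (with $Q$ on the left). $\mathrm{Mod}(Q;z_1,z_2,z_3,z_4)$ is the unique $h>0$ such that there is a conformal map of $Q$ onto the rectangle $[0,1]\times[0,h]$ sending $z_1,z_2,z_3,z_4$ to $0,1,1+ih,ih$. $K(r)=\int_0^1\frac{du}{\sqrt{(1-u^2)(1-r^2u^2)}}$ is the complete elliptic integral of the first kind. $B(\cdot,\cdot)$ with two arguments is the Euler beta function. $F_D^{(n)}$ is the Lauricella hypergeometric function, given for $\operatorname{Re}c>\operatorname{Re}a>0$ (also outside the unit polydisk) by $$F_D^{(n)}(a;b_1,\dots,b_n;c;z_1,\dots,z_n)=\frac1{B(a,c-a)}\int_0^1u^{a-1}(1-u)^{c-a-1}\prod_{j=1}^n(1-uz_j)^{-b_j}\,du .$$ Notation for the cubic: $$E=\alpha+\beta+\gamma-1,\qquad A=2(E-1)^2,\qquad B=(E-1)[4-3(\alpha+\gamma)+(4-3(\alpha+\beta))t],$$ $$C=2-3(\alpha+\gamma)+(\alpha+\gamma)^2+2(3-5\alpha-2\beta-2\gamma+2\alpha^2+2\alpha\beta+2\alpha\gamma+\beta\gamma)t+(2-3(\alpha+\beta)+(\alpha+\beta)^2)t^2,$$ $$D=(1-\alpha)\bigl(\alpha+\gamma-1+(\alpha+\beta-1)t\bigr)t,\qquad \rho(x)=\frac{\alpha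 t x}{(1-E)x+E(t+1)-\gamma t-\beta},$$ where $\rho(x)$ is only considered at points $x$ where the denominator is nonzero (removable singularities are not filled in), and the condition $x^2<\rho(x)$ includes that $\rho(x)$ is defined. (The letter $B$ without arguments denotes the cubic coefficient.) *)

(* Defs.v *)
From HB Require Import structures.
From mathcomp Require Import all_boot all_order all_algebra.
From mathcomp Require Import complex.
From mathcomp Require Import all_classical all_reals all_analysis.

Set Implicit Arguments.
Unset Strict Implicit.
Unset Printing Implicit Defensive.

Import Order.TTheory GRing.Theory Num.Theory numFieldNormedType.Exports.

Local Open Scope classical_set_scope.
Local Open Scope ring_scope.
Local Open Scope complex_scope.

(* [R[i]^o] is R[i] with its topology and its structure of normed space over
   itself, so [derivable f z 1] for f : R[i]^o -> R[i]^o is complex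
   differentiability at z.  The point at infinity of the sphere is [None]. *)
Notation riemann_sphere R := (one_point_compactification (R[i])^o).

Definition sphere_inv (R : realType) (w : R[i]^o) : riemann_sphere R :=
  if w == 0 then None else Some w^-1.

Definition holomorphic_at (R : realType) (f : riemann_sphere R -> R[i]^o)
    (p : riemann_sphere R) : Prop :=
  match p with
  | Some z => derivable (fun w : R[i]^o => f (Some w) : R[i]^o) z 1
  | None => derivable (fun w : R[i]^o => f (sphere_inv w) : R[i]^o) 0 1
  end.

Definition open_rectangle (R : realType) (h : R) : set R[i]^o :=
  [set w | 0 < complex.Re w < 1 /\ 0 < complex.Im w < h].

Definition closed_rectangle (R : realType) (h : R) : set R[i]^o :=
  [set w | 0 <= complex.Re w <= 1 /\ 0 <= complex.Im w <= h].

(* A conformal map of Q onto the rectangle, with its boundary extension: a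
   continuous bijection between the closures, hence a homeomorphism, since they
   are compact Hausdorff.  Such an f exists only if Q is a Jordan domain whose
   boundary points z1, z2, z3, z4 are in the order of the positive traverse, so
   these two conditions are not repeated here. *)
Definition conformal_onto_rectangle (R : realType)
    (Q : set (riemann_sphere R)) (z1 z2 z3 z4 : riemann_sphere R) (h : R)
    (f : riemann_sphere R -> R[i]^o) : Prop :=
  [/\ forall p, Q p -> holomorphic_at f p,
      set_bij Q (open_rectangle h) f,
      {within closure Q, continuous f},
      set_bij (closure Q) (closed_rectangle h) f
    & [/\ closure Q z1 /\ f z1 = 0, closure Q z2 /\ f z2 = 1,
          closure Q z3 /\ f z3 = 1 +i* h & closure Q z4 /\ f z4 = 0 +i* h]].

(* [Mod] takes the junk value 0 when there is no such h, or more than one. *)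
Definition Mod (R : realType) (Q : set (riemann_sphere R))
    (z1 z2 z3 z4 : riemann_sphere R) : R :=
  xget 0 (unique (fun h : R =>
    0 < h /\ exists f, conformal_onto_rectangle Q z1 z2 z3 z4 h f)).

Definition convex_hull (R : realType) (n : nat) (A : n.-tuple R[i]) :
    set R[i]^o :=
  [set z | exists l : 'I_n -> R,
     [/\ forall i, 0 <= l i, \sum_i l i = 1
       & z = \sum_i (l i)%:C * tnth A i]].

Definition strictly_same_side (R : realType) (p q v w : R[i]) : Prop :=
  0 < complex.Im ((v - p) * (q - p)^*) * complex.Im ((w - p) * (q - p)^*).

Definition convex_quadrilateral (R : realType) (A1 A2 A3 A4 : R[i]) : Prop :=
  [/\ strictly_same_side A1 A2 A3 A4, strictly_same_side A2 A3 A4 A1,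
      strictly_same_side A3 A4 A1 A2 & strictly_same_side A4 A1 A2 A3].

Definition exterior_of (R : realType) (A1 A2 A3 A4 : R[i]) :
    set (riemann_sphere R) :=
  ~` (Some @` convex_hull [tuple A1; A2; A3; A4]).

(* The modulus |z| as a real number; [`|z|] lives in R[i]. *)
Definition cabs (R : realType) (z : R[i]) : R := complex.Re `|z|.

Definition interior_angle (R : realType) (p v q : R[i]) : R :=
  acos (complex.Re ((p - v) * (q - v)^*) / (cabs (p - v) * cabs (q - v))).

(* Exterior angles are the angles of the exterior domain, not turning angles. *)
Definition exterior_angle (R : realType) (p v q : R[i]) : R :=
  2 * pi - interior_angle p v q.

Definition elliptic_K (R : realType) (r : R) : R :=
  \int[lebesgue_measure]_(u in `[0, 1])
    (Num.sqrt ((1 - u ^+ 2) * (1 - r ^+ 2 * u ^+ 2)))^-1.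

Definition Beta (R : realType) (a b : R) : R :=
  \int[lebesgue_measure]_(u in `[0, 1]) (u `^ (a - 1) * (1 - u) `^ (b - 1)).

(* Principal argument, in ]-pi, pi] for w != 0. *)
Definition Arg (R : realType) (w : R[i]) : R :=
  let theta := acos (complex.Re w / cabs w) in
  if 0 <= complex.Im w then theta else - theta.

(* Principal branch of w ^ s for w != 0. *)
Definition cpow (R : realType) (w : R[i]) (s : R) : R[i] :=
  (cabs w `^ s)%:C * (cos (s * Arg w) +i* sin (s * Arg w)).

(* The Euler integral, for 0 < a < c and no z_j in [1, +oo[ *)
Definition Lauricella_FD (R : realType) (n : nat) (a : R) (b : n.-tuple R)
    (c : R) (z : n.-tuple R[i]) : R[i] :=
  let g (u : R) : R[i] :=
    (u `^ (a - 1) * (1 - u) `^ (c - a - 1))%:C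
    * \prod_(j < n) cpow (1 - u%:C * tnth z j) (- tnth b j) in
  ((Beta a (c - a))^-1)%:C
  * ((\int[lebesgue_measure]_(u in `[0, 1]) complex.Re (g u))
     +i* (\int[lebesgue_measure]_(u in `[0, 1]) complex.Im (g u))).

Definition coefE (R : realType) (alpha beta gamma : R) : R :=
  alpha + beta + gamma - 1.

Definition coefA (R : realType) (alpha beta gamma t : R) : R :=
  2 * (coefE alpha beta gamma - 1) ^+ 2.

Definition coefB (R : realType) (alpha beta gamma t : R) : R :=
  (coefE alpha beta gamma - 1)
  * (4 - 3 * (alpha + gamma) + (4 - 3 * (alpha + beta)) * t).

Definition coefC (R : realType) (alpha beta gamma t : R) : R :=
  2 - 3 * (alpha + gamma) + (alpha + gamma) ^+ 2
  + 2 * (3 - 5 * alpha - 2 * beta - 2 * gamma + 2 * alpha ^+ 2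
         + 2 * alpha * beta + 2 * alpha * gamma + beta * gamma) * t
  + (2 - 3 * (alpha + beta) + (alpha + beta) ^+ 2) * t ^+ 2.

Definition coefD (R : realType) (alpha beta gamma t : R) : R :=
  (1 - alpha) * (alpha + gamma - 1 + (alpha + beta - 1) * t) * t.

Definition rho_den (R : realType) (alpha beta gamma t x : R) : R :=
  (1 - coefE alpha beta gamma) * x + coefE alpha beta gamma * (t + 1)
  - gamma * t - beta.

Definition rho (R : realType) (alpha beta gamma t x : R) : R :=
  alpha * t * x / rho_den alpha beta gamma t x.

Definition admissible_root (R : realType) (alpha beta gamma t x : R) : Prop :=
  [/\ coefA alpha beta gamma t * x ^+ 3 + coefB alpha beta gamma t * x ^+ 2
      + coefC alpha beta gamma t * x + coefD alpha beta gamma t = 0,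
      rho_den alpha beta gamma t x != 0
    & x ^+ 2 < rho alpha beta gamma t x].

Definition x0 (R : realType) (alpha beta gamma t : R) : R :=
  xget 0 (admissible_root alpha beta gamma t).

Definition z0 (R : realType) (alpha beta gamma t : R) : R[i] :=
  let x := x0 alpha beta gamma t in
  x +i* Num.sqrt (rho alpha beta gamma t x - x ^+ 2).

Definition h1 (R : realType) (alpha beta gamma t : R) : R[i] :=
  let z := z0 alpha beta gamma t in
  (Beta (1 + alpha) (1 + beta))%:C
  * Lauricella_FD (1 + alpha) [tuple - gamma; 2; 2] (2 + alpha + beta)
      [tuple (1 / t)%:C; 1 / z; 1 / z^*].

Definition I_side (R : realType) (alpha beta gamma t : R) : R[i] :=
  let z := z0 alpha beta gamma t in
  ((t - 1) `^ (1 + beta + gamma) * cabs z ^+ 4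
   / (t `^ gamma * cabs (z - 1) ^+ 4))%:C
  * (Beta (1 + beta) (1 + gamma))%:C
  * Lauricella_FD (1 + beta) [tuple - alpha; 2; 2] (2 + beta + gamma)
      [tuple (- (t - 1))%:C; (t - 1)%:C / (z - 1); (t - 1)%:C / (z^* - 1)].

(* Main.v *)
(** Both the exterior of the quadrilateral and the rectangle are images of the unit disc under Schwarz-Christoffel maps with the
    same prevertices [e_1, ..., e_4]: the map [F] with [F' = z^-2 * \prod_k (1 - z / e_k) ^ a_k], where [pi (1 + a_k)] are the
    exterior angles, and the map [G] with [G' = \prod_k (1 - z / e_k) ^ (-1/2)].  The directions of the curves [F (r e^(i x))]
    and [G (r e^(i x))] turn monotonically, so these curves are convex and nested, which makes [F] and [G] injective up to the
    boundary; then [G \o F^-1] is the conformal map in the definition of the modulus, and Cauchy's theorem on the rectangle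
    shows that no other height is possible.

    [F] is single-valued if and only if [\sum_k a_k conj(e_k) = 0].  A Cayley transform taking [z_0] to 0 and 0, 1, t,
    infinity to the prevertices turns this into two real equations for [z_0], and eliminating [Im z_0] leaves the cubic.  The
    first two sides of the image of [F] have lengths [h_1(t)] and [I(t)] up to a common factor, and those of the image of [G]
    are [K(r)] and [K(sqrt (1 - r^2))] up to a common factor.

    The ratio [I / h_1] is continuous in [t].  When [t] tends to 1 or to infinity, two prevertices come together and the side
    between them collapses; since the angles are fixed and the polygon closes up, the ratio is then below, respectively above,
    [|A_2 A_3|], so that the intermediate value theorem provides [t].  It is unique because the modulus, [K' / K], is strictly
    increasing in [t]. *)
Require Import Defs.
From HB Require Import structures.
From mathcomp Require Import all_boot all_order all_algebra.
From mathcomp Require Import complex.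
From mathcomp Require Import all_classical all_reals all_analysis.
From mathcomp Require Import measurable_realfun.
From mathcomp Require Import ring lra.

Set Implicit Arguments.
Unset Strict Implicit.
Unset Printing Implicit Defensive.

Import Order.TTheory GRing.Theory Num.Theory numFieldNormedType.Exports.

Local Open Scope classical_set_scope.
Local Open Scope ring_scope.
Local Open Scope complex_scope.

(** * Complex arithmetic *)

(** The two maps differ only by a sign [kap]. With [V = z F'], [kap] times the rate of turning of
    [V] along a circle is [-1 + \sum_k kap a_k (...)]; each bracket is below 1/2 and the [kap a_k]
    are positive with sum 2. Maximising a linear functional on an annulus then nests the image
    curves. Surjectivity is continuation along segments: the attained points form an open set
    because the derivative does not vanish, and a closed one by compactness. Boundary limits exist
    because no [a_k] is below -1/2. Side lengths are increments of an arclength function rather than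
    integrals; the Euler and elliptic integrals are identified with such increments after the
    prevertices are moved to 0, 1, [t] and infinity. The collapse of sides needs no asymptotics. The
    balance condition bounds the sum of two adjacent chords from below, so a side over a short chord
    is much shorter than both neighbours. If the side opposite to the expected one collapses, the
    closing relations of polygons with these angles turn this into the same bound on the ratio. *)

Notation Re := complex.Re.
Notation Im := complex.Im.

Notation iC := (Complex 0 1).

Section complex_modulus.
Variable R : realType.
Implicit Types (z w : R[i]) (x y : R).

Lemma Cext z w : Re z = Re w -> Im z = Im w -> z = w.
Proof. by case: z w => [a b] [c d] /= -> ->. Qed.
Lemma ReD z w : Re (z + w) = Re z + Re w. Proof. by case: z w => [? ?] []. Qed.
Lemma ImD z w : Im (z + w) = Im z + Im w. Proof. by case: z w => [? ?] []. Qed.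
Lemma ReN z : Re (- z) = - Re z. Proof. by case: z. Qed.
Lemma ImN z : Im (- z) = - Im z. Proof. by case: z. Qed.
Lemma ReB z w : Re (z - w) = Re z - Re w. Proof. by rewrite ReD ReN. Qed.
Lemma ImB z w : Im (z - w) = Im z - Im w. Proof. by rewrite ImD ImN. Qed.
Lemma ReM z w : Re (z * w) = Re z * Re w - Im z * Im w.
Proof. by case: z w => [? ?] []. Qed.
Lemma ImM z w : Im (z * w) = Re z * Im w + Im z * Re w.
Proof. by case: z w => [? ?] []. Qed.
Lemma ReJ z : Re (conjc z) = Re z. Proof. by case: z. Qed.
Lemma ImJ z : Im (conjc z) = - Im z. Proof. by case: z. Qed.
Lemma ReC x : Re x%:C = x. Proof. by []. Qed.
Lemma ImC x : Im x%:C = 0. Proof. by []. Qed.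
Lemma Re0 : Re (0 : R[i]) = 0. Proof. by []. Qed.
Lemma Im0 : Im (0 : R[i]) = 0. Proof. by []. Qed.
Lemma Re1 : Re (1 : R[i]) = 1. Proof. by []. Qed.
Lemma Im1 : Im (1 : R[i]) = 0. Proof. by []. Qed.

Lemma ReX x y : Re (x +i* y) = x. Proof. by []. Qed.
Lemma ImX x y : Im (x +i* y) = y. Proof. by []. Qed.

Lemma ReCM x z : Re (x%:C * z) = x * Re z.
Proof. by rewrite ReM mul0r subr0. Qed.
Lemma ImCM x z : Im (x%:C * z) = x * Im z.
Proof. by rewrite ImM mul0r addr0. Qed.
Lemma rCD x y : (x + y)%:C = x%:C + y%:C :> R[i]. Proof. exact: rmorphD. Qed.
Lemma rCN x : (- x)%:C = - x%:C :> R[i]. Proof. exact: rmorphN. Qed.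
Lemma rCB x y : (x - y)%:C = x%:C - y%:C :> R[i]. Proof. exact: rmorphB. Qed.
Lemma rCM x y : (x * y)%:C = x%:C * y%:C :> R[i]. Proof. exact: rmorphM. Qed.
Lemma rCV x : (x^-1)%:C = (x%:C)^-1 :> R[i]. Proof. exact: fmorphV. Qed.
Lemma rC0 : 0%:C = 0 :> R[i]. Proof. by []. Qed.
Lemma rC1 : 1%:C = 1 :> R[i]. Proof. by []. Qed.
Lemma rC_eq0 x : (x%:C == 0 :> R[i]) = (x == 0). Proof. exact: fmorph_eq0. Qed.
Definition rCE := (rCD, rCN, rCB, rCM, rCV).

Definition ReImE := (ReX, ImX, ReB, ImB, ReD, ImD, ReN, ImN, ReM, ImM, ReJ, ImJ, ReC, ImC,
  Re0, Im0, Re1, Im1).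

Lemma conjCM z w : conjc (z * w) = conjc z * conjc w.
Proof. by apply: Cext; rewrite !ReImE; ring. Qed.
Lemma conjCR x : conjc x%:C = x%:C :> R[i]. Proof. exact: conjc_real. Qed.

Lemma cabsE z : cabs z = Num.sqrt (Re z ^+ 2 + Im z ^+ 2).
Proof. by case: z. Qed.

Lemma cabs_ge0 z : 0 <= cabs z. Proof. by rewrite cabsE sqrtr_ge0. Qed.

Lemma cabs_sqr z : cabs z ^+ 2 = Re z ^+ 2 + Im z ^+ 2.
Proof. by rewrite cabsE sqr_sqrtr // addr_ge0 // sqr_ge0. Qed.

Lemma cabs0 : cabs (0 : R[i]) = 0.
Proof. by rewrite cabsE /= expr0n addr0 sqrtr0. Qed.

Lemma cabs1 : cabs (1 : R[i]) = 1.
Proof. by rewrite cabsE /= expr0n addr0 expr1n sqrtr1. Qed.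

Lemma cabs_eq0 z : (cabs z == 0) = (z == 0).
Proof.
apply/eqP/eqP => [h|->]; last exact: cabs0.
exact: (@Normc.eq0_normc _ z).
Qed.

Lemma cabs_gt0 z : (0 < cabs z) = (z != 0).
Proof. by rewrite lt_def cabs_ge0 andbT cabs_eq0. Qed.

Lemma cabsM z w : cabs (z * w) = cabs z * cabs w.
Proof. exact: Normc.normcM. Qed.

Lemma cabsV z : cabs z^-1 = (cabs z)^-1.
Proof. exact: Normc.normcV. Qed.

Lemma cabsD z w : cabs (z + w) <= cabs z + cabs w.
Proof. exact: le_normcD. Qed.

Lemma cabsN z : cabs (- z) = cabs z.
Proof. by rewrite !cabsE !ReImE !sqrrN. Qed.

Lemma cabs_distrC z w : cabs (z - w) = cabs (w - z).
Proof. by rewrite -cabsN opprB. Qed.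

Lemma cabsB z w : cabs (z - w) <= cabs z + cabs w.
Proof. by rewrite -(cabsN w) cabsD. Qed.

Lemma cabs_leB z w : cabs z - cabs w <= cabs (z - w).
Proof. by rewrite lerBlDr -{1}(subrK w z) cabsD. Qed.

Lemma cabsR x : cabs x%:C = `|x|.
Proof. by rewrite cabsE /= expr0n addr0 sqrtr_sqr. Qed.

Lemma cabsJ z : cabs (conjc z) = cabs z.
Proof. by rewrite !cabsE !ReImE sqrrN. Qed.

Lemma cabs_Re z : `|Re z| <= cabs z.
Proof.
rewrite cabsE -[leLHS]sqrtr_sqr ler_sqrt ?addr_ge0 ?sqr_ge0 //.
by rewrite lerDl sqr_ge0.
Qed.

Lemma cabs_Im z : `|Im z| <= cabs z.
Proof.
rewrite cabsE -[leLHS]sqrtr_sqr ler_sqrt ?addr_ge0 ?sqr_ge0 //.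
by rewrite lerDr sqr_ge0.
Qed.

Lemma Re_le_cabs z : Re z <= cabs z.
Proof. by rewrite (le_trans (ler_norm _)) // cabs_Re. Qed.

Lemma cabs_le_ReIm z : cabs z <= `|Re z| + `|Im z|.
Proof.
rewrite {1}(_ : z = (Re z)%:C + iC * (Im z)%:C); last exact: complexE.
rewrite (le_trans (cabsD _ _)) // cabsM !cabsR lerD2l.
by rewrite (_ : cabs iC = 1) ?mul1r // cabsE /= expr0n add0r expr1n sqrtr1.
Qed.

Lemma cabs_i : cabs (iC : R[i]) = 1.
Proof. by rewrite cabsE /= expr0n add0r expr1n sqrtr1. Qed.

Lemma mulJ_cabs z : z * conjc z = (cabs z ^+ 2)%:C.
Proof. by apply: Cext; rewrite !ReImE ?cabs_sqr; ring. Qed.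

Lemma cabs_unitV z : cabs z = 1 -> z^-1 = conjc z.
Proof.
move=> z1; have z0 : z != 0 by rewrite -cabs_gt0 z1.
by apply: (mulfI z0); rewrite divff // mulJ_cabs z1 expr1n.
Qed.

(** The balls of [R[i]^o] have radii in [R[i]], but a positive element of [R[i]] is real, so real
    radii suffice. Later limits are tested in this form. *)
Lemma nbhsCP z (A : set R[i]^o) : nbhs (z : R[i]^o) A <->
  exists2 e : R, 0 < e & forall w, cabs (w - z) < e -> A w.
Proof.
have Ereal (w : R[i]) (e : R) : (`|z - w| < e%:C) = (cabs (w - z) < e).
  by rewrite cabs_distrC /cabs normc_def ltcR.
split=> [/nbhs_ballP [e /= e0 He]|[e e0 He]].
  have eR : e = (Re e)%:C.
    by move: e0; rewrite ltcE => /andP[/eqP h _]; apply: Cext.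
  exists (Re e); first by move: e0; rewrite {1}eR ltcR.
  by move=> w hw; apply: He; rewrite /ball/= eR Ereal.
apply/nbhs_ballP; exists e%:C; first by rewrite /= ltcR.
by move=> w /=; rewrite /ball/= Ereal; exact: He.
Qed.

Lemma continuousCP (T : topologicalType) (f : T -> R[i]^o) (F : set_system T) (l : R[i]) :
  Filter F ->
  (f x @[x --> F] --> (l : R[i]^o)) <->
  (forall e : R, 0 < e -> \forall x \near F, cabs (f x - l) < e).
Proof.
move=> FF; split=> [h e e0|h A /nbhsCP [e e0 hA]].
  by apply: (h [set w | cabs (w - l) < e]); apply/nbhsCP; exists e.
by near=> x; apply: hA; near: x; exact: h.
Unshelve. all: by end_near. Qed.

Lemma Re_continuous : continuous (@complex.Re R : R[i]^o -> R).
Proof.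
move=> z; apply/(@cvgrPdist_lt _ _ _ _ (nbhs_filter z)) => e e0; apply/nbhsCP; exists e => // w hw.
by rewrite -ReB (le_lt_trans (cabs_Re _)) // cabs_distrC.
Qed.

Lemma Im_continuous : continuous (@complex.Im R : R[i]^o -> R).
Proof.
move=> z; apply/(@cvgrPdist_lt _ _ _ _ (nbhs_filter z)) => e e0; apply/nbhsCP; exists e => // w hw.
by rewrite -ImB (le_lt_trans (cabs_Im _)) // cabs_distrC.
Qed.

Lemma cabs_continuous : continuous (@cabs R : R[i]^o -> R).
Proof.
move=> z; apply/(@cvgrPdist_lt _ _ _ _ (nbhs_filter z)) => e e0.
apply/nbhsCP; exists e => // w hw; rewrite ltr_norml ltrBlDr ltrBrDr; apply/andP; split.
  by have := cabs_leB w z; move: hw; lra.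
by have := cabs_leB z w; rewrite cabs_distrC; move: hw; lra.
Qed.

Lemma realC_continuous : continuous (real_complex R : R -> R[i]^o).
Proof.
move=> x; apply/(continuousCP _ _ (nbhs_filter x)) => e e0.
near=> y; rewrite -(rmorphB (real_complex R)) cabsR distrC.
by near: y; exact: (@cvgr_dist_lt _ _ _ (nbhs x) _ id).
Unshelve. all: by end_near. Qed.

Lemma cvg_ReIm (T : topologicalType) (f : T -> R[i]^o) (F : set_system T) (l : R[i]) :
  Filter F -> (Re (f x) @[x --> F] --> Re l) -> (Im (f x) @[x --> F] --> Im l) ->
  f x @[x --> F] --> (l : R[i]^o).
Proof.
move=> FF hr hi; apply/continuousCP => e e0; have e20 : 0 < e / 2 by rewrite divr_gt0.
near=> x; rewrite (le_lt_trans (cabs_le_ReIm _)) // (splitr e) ltrD //.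
  by rewrite ReB distrC; near: x; exact: (@cvgr_dist_lt _ _ _ _ FF _ _ hr).
by rewrite ImB distrC; near: x; exact: (@cvgr_dist_lt _ _ _ _ FF _ _ hi).
Unshelve. all: by end_near. Qed.

Lemma compact_Crectangle (a b c d : R) :
  compact ([set z | a <= Re z <= b /\ c <= Im z <= d] : set R[i]^o).
Proof.
have -> : [set z | a <= Re z <= b /\ c <= Im z <= d] =
    (fun p : R * R => (p.1 +i* p.2 : R[i]^o)) @` (`[a, b] `*` `[c, d]).
  apply/seteqP; split=> [[x y] /= [h1 h2]|_ [[x y] /= [h1 h2] <-]] /=.
    by exists (x, y) => //=; rewrite !in_itv.
  by move: h1 h2; rewrite !in_itv.
apply: continuous_compact; last by apply: compact_setX; exact: segment_compact.
apply: continuous_subspaceT => p; apply: cvg_ReIm => /=; [exact: cvg_fst|exact: cvg_snd].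
Qed.

Lemma compact_disc (c : R[i]) (r : R) : compact ([set z | cabs (z - c) <= r] : set R[i]^o).
Proof.
apply: (@subclosed_compact R[i]^o _ [set z | Re c - r <= Re z <= Re c + r /\
   Im c - r <= Im z <= Im c + r]).
- have -> : [set z : R[i]^o | cabs (z - c) <= r] =
      (fun z : R[i]^o => cabs (z - c)) @^-1` [set x | x <= r] by [].
  apply: closed_comp; last exact: closed_le.
  move=> z _; apply: continuous_comp; last exact: cabs_continuous.
  apply/(continuousCP _ _ (nbhs_filter z)) => e e0; apply/nbhsCP; exists e => // w.
  by rewrite opprB addrA subrK.
- exact: compact_Crectangle.
- move=> z /= h; have := cabs_Re (z - c); have := cabs_Im (z - c).
  by rewrite ReB ImB !ler_norml => /andP[? ?] /andP[? ?]; split; apply/andP; split; lra.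
Qed.

Lemma hausdorffC : hausdorff_space R[i]^o.
Proof. exact: norm_hausdorff. Qed.

End complex_modulus.

(** * Derivatives in Caratheodory's form *)

Section caratheodory_derivatives.
Variable R : realType.
Local Notation C := R[i].
Implicit Types (f g : R[i] -> R[i]) (z w d : R[i]) (p q : R -> R[i]) (x y : R).

(** A bare type with an arbitrary filter: this lets [Cnear] and [Rnear], which mention only real
    radii, share one set of limit rules. *)
Definition tends (T : Type) (F : set_system T) (u : T -> R[i]) (l : R[i]) :=
  forall e : R, 0 < e -> F [set x | cabs (u x - l) < e].

Lemma tendsP (T : Type) (F : set_system T) (FF : Filter F) (u : T -> R[i]) l :
  tends F u l <-> ((u : T -> R[i]^o) x @[x --> F] --> (l : R[i]^o)).
Proof.
split=> [h A /nbhsCP [e e0 hA]|h e e0].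
  by apply: filterS (h e e0) => x; exact: hA.
by apply: (h [set w | cabs (w - l) < e]); apply/nbhsCP; exists e.
Qed.

Section limits.
Context {T : Type} {F : set_system T} {FF : Filter F}.
Implicit Types (u v : T -> R[i]) (a b : R[i]).
Lemma tends_cst a : tends F (fun=> a) a.
Proof. by apply/tendsP; exact: cvg_cst. Qed.
Lemma tendsD u v a b : tends F u a -> tends F v b -> tends F (fun i => u i + v i) (a + b).
Proof. by move=> /tendsP h1 /tendsP h2; apply/tendsP; exact: cvgD h1 h2. Qed.
Lemma tendsM u v a b : tends F u a -> tends F v b -> tends F (fun i => u i * v i) (a * b).
Proof. by move=> /tendsP h1 /tendsP h2; apply/tendsP; exact: cvgM h1 h2. Qed.
Lemma tendsN u a : tends F u a -> tends F (fun i => - u i) (- a).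
Proof. by move=> /tendsP h1; apply/tendsP; exact: cvgN h1. Qed.
Lemma tendsV u a : a != 0 -> tends F u a -> tends F (fun i => (u i)^-1) a^-1.
Proof. by move=> a0 /tendsP h1; apply/tendsP; exact: cvgV a0 h1. Qed.
Lemma tends_near u v a : tends F u a -> F [set i | u i = v i] -> tends F v a.
Proof. by move=> h e r r0; apply: filterS2 (h r r0) e => x /= + <-. Qed.
End limits.

Definition Cnear z : set_system R[i] :=
  [set A | exists2 r : R, 0 < r & forall w, cabs (w - z) < r -> A w].
Definition Rnear x : set_system R :=
  [set A | exists2 r : R, 0 < r & forall y, `|y - x| < r -> A y].

Global Instance Cnear_filter z : Filter (Cnear z).
Proof.
split; first by exists 1.
  move=> A B [r r0 hA] [s s0 hB]; exists (Num.min r s); first by rewrite lt_min r0.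
  by move=> w; rewrite lt_min => /andP[h1 h2]; split; [exact: hA|exact: hB].
by move=> A B AB [r r0 hA]; exists r => // w /hA; exact: AB.
Qed.
Global Instance Rnear_filter x : Filter (Rnear x).
Proof.
split; first by exists 1.
  move=> A B [r r0 hA] [s s0 hB]; exists (Num.min r s); first by rewrite lt_min r0.
  by move=> w; rewrite lt_min => /andP[h1 h2]; split; [exact: hA|exact: hB].
by move=> A B AB [r r0 hA]; exists r => // w /hA; exact: AB.
Qed.

Lemma Cnear_self z (A : set R[i]) : Cnear z A -> A z.
Proof. by move=> [r r0]; apply; rewrite subrr cabs0. Qed.
Lemma CnearE z (A : set R[i]) : Cnear z A <-> nbhs (z : R[i]^o) A.
Proof. by symmetry; exact: nbhsCP. Qed.
Lemma RnearE x (A : set R) : Rnear x A <-> nbhs x A.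
Proof.
split=> [[r r0 h]|/nbhs_ballP [r /= r0 h]].
  by apply/nbhs_ballP; exists r => // y /=; rewrite /ball/= distrC; exact: h.
by exists r => // y; rewrite distrC; exact: h.
Qed.

Definition ccont f z := tends (Cnear z) f (f z).
Definition pcont p x := tends (Rnear x) p (p x).

Lemma ccontP f z : ccont f z <-> {for z, continuous (f : R[i]^o -> R[i]^o)}.
Proof.
have -> : ccont f z = tends (nbhs (z : R[i]^o)) f (f z).
  by rewrite /ccont; congr tends; apply/seteqP; split=> A /CnearE.
exact: tendsP.
Qed.
Lemma pcontP p x : pcont p x <-> {for x, continuous (p : R -> R[i]^o)}.
Proof.
have -> : pcont p x = tends (nbhs x) p (p x).
  by rewrite /pcont; congr tends; apply/seteqP; split=> A /RnearE.
exact: tendsP.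
Qed.

Lemma ccont_cst (c z : R[i]) : ccont (fun=> c) z. Proof. exact: tends_cst. Qed.
Lemma ccont_id z : ccont id z. Proof. by move=> e e0; exists e. Qed.
Lemma ccontD f g z : ccont f z -> ccont g z -> ccont (fun w => f w + g w) z.
Proof. exact: tendsD. Qed.
Lemma ccontM f g z : ccont f z -> ccont g z -> ccont (fun w => f w * g w) z.
Proof. exact: tendsM. Qed.
Lemma ccontN f z : ccont f z -> ccont (fun w => - f w) z.
Proof. exact: tendsN. Qed.
Lemma ccontV f z : f z != 0 -> ccont f z -> ccont (fun w => (f w)^-1) z.
Proof. exact: tendsV. Qed.
Lemma ccont_comp f g z : ccont f z -> ccont g (f z) -> ccont (fun w => g (f w)) z.
Proof.
move=> h1 h2 e /h2[r r0 hr]; have [s s0 hs] := h1 r r0.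
by exists s => // w /hs /hr.
Qed.
Lemma ccont_neq0 f z : ccont f z -> f z != 0 -> Cnear z [set w | f w != 0].
Proof.
move=> h fz0; have e0 : 0 < cabs (f z) by rewrite cabs_gt0.
have [r r0 hr] := h _ e0; exists r => // w /hr /=; apply: contraTneq => ->.
by rewrite sub0r cabsN ltxx.
Qed.
Lemma ccont_near f g z : ccont f z -> Cnear z [set w | f w = g w] -> ccont g z.
Proof. by move=> h e; rewrite /ccont -(Cnear_self e); exact: tends_near e. Qed.

(** The difference quotient is a total function, continuous at the point. Product, chain and inverse
    rules become algebraic identities, without punctured neighbourhoods or division by [w - z]. *)
Definition cder f z d := exists phi : R[i] -> R[i],
  [/\ forall w, f w - f z = phi w * (w - z), ccont phi z & phi z = d].
Definition pder p x d := exists phi : R -> R[i],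
  [/\ forall y, p y - p x = phi y * (y - x)%:C, pcont phi x & phi x = d].

Lemma cder_cont f z d : cder f z d -> ccont f z.
Proof.
move=> [phi [h c _]].
have -> : f = (fun w => f z + phi w * (w - z)) by apply/funext=> w; rewrite -h addrC subrK.
apply: ccontD; first exact: ccont_cst.
by apply: ccontM => //; apply: ccontD; [exact: ccont_id|exact: ccont_cst].
Qed.

Lemma cder_cst (c : R[i]) z : cder (fun=> c) z 0.
Proof. by exists (fun=> 0); split=> [w||//]; [rewrite subrr mul0r|exact: ccont_cst]. Qed.
Lemma cder_id z : cder id z 1.
Proof. by exists (fun=> 1); split=> [w||//]; [rewrite mul1r|exact: ccont_cst]. Qed.
Lemma cderD f g z d e : cder f z d -> cder g z e -> cder (fun w => f w + g w) z (d + e).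
Proof.
move=> [F [hF cF <-]] [G [hG cG <-]]; exists (fun w => F w + G w); split=> //.
  by move=> w; rewrite mulrDl -hF -hG; ring.
exact: ccontD.
Qed.
Lemma cderM f g z d e : cder f z d -> cder g z e ->
  cder (fun w => f w * g w) z (d * g z + f z * e).
Proof.
move=> df dg; have cg := cder_cont dg; move: df dg => [F [hF cF <-]] [G [hG cG <-]].
exists (fun w => F w * g w + f z * G w); split=> //.
  move=> w; transitivity (F w * (w - z) * g w + f z * (G w * (w - z))); last by ring.
  by rewrite -hF -hG; ring.
by apply: ccontD; apply: ccontM => //; exact: ccont_cst.
Qed.
Lemma cderZ (c : R[i]) f z d : cder f z d -> cder (fun w => c * f w) z (c * d).
Proof. by move=> df; have := cderM (cder_cst c z) df; rewrite mul0r add0r. Qed.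
Lemma cderN f z d : cder f z d -> cder (fun w => - f w) z (- d).
Proof.
move=> /(cderZ (-1)); rewrite mulN1r.
by under eq_fun do rewrite mulN1r.
Qed.
Lemma cderB f g z d e : cder f z d -> cder g z e -> cder (fun w => f w - g w) z (d - e).
Proof. by move=> df dg; apply: cderD => //; exact: cderN. Qed.
Lemma cder_comp f g z d e : cder f z d -> cder g (f z) e -> cder (fun w => g (f w)) z (e * d).
Proof.
move=> df; have cf := cder_cont df; move: df => [F [hF cF <-]] [G [hG cG <-]].
exists (fun w => G (f w) * F w); split=> //.
  by move=> w; rewrite hG hF mulrA.
by apply: ccontM => //; exact: (@ccont_comp f G).
Qed.
Lemma cder_near f g z d : cder f z d -> (Cnear z [set w | f w = g w]) -> cder g z d.
Proof.
move=> [F [hF cF <-]] e; have ez := Cnear_self e.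
exists (fun w => if w == z then F z else (g w - g z) / (w - z)); split; last by rewrite eqxx.
  move=> w; case: eqVneq => [->|wz]; first by rewrite !subrr mulr0.
  by rewrite divfK // subr_eq0.
apply: (ccont_near cF); apply: filterS e => w /= ew.
case: eqVneq => [->//|wz]; rewrite -ez -ew.
by rewrite hF mulfK // subr_eq0.
Qed.
Lemma cder_eq f z d d' : cder f z d -> d = d' -> cder f z d'. Proof. by move=> ? <-. Qed.
Lemma cder_ext f g z d : cder f z d -> f =1 g -> cder g z d.
Proof. by move=> h /funext <-. Qed.

Lemma cder_inv z : z != 0 -> cder (fun w => w^-1) z (- z^-1 ^+ 2).
Proof.
move=> z0; exists (fun w => if w == 0 then (z * z)^-1 else - (w^-1 * z^-1)); split.
- move=> w; case: eqVneq => [->|w0]; first by rewrite invr0 !sub0r invfM mulrN mulfVK.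
  by field; rewrite z0.
- apply: (@ccont_near (fun w => - (w^-1 * z^-1))).
    apply: ccontN; apply: ccontM; last exact: ccont_cst.
    by apply: (@ccontV id) => //; exact: ccont_id.
  by apply: filterS (ccont_neq0 (ccont_id z) z0) => w /= /negbTE ->.
- by rewrite (negbTE z0) expr2.
Qed.

Lemma cderV f z d : f z != 0 -> cder f z d -> cder (fun w => (f w)^-1) z (- d / f z ^+ 2).
Proof.
move=> fz df; have h := cder_comp df (cder_inv fz); apply: cder_eq h _.
by rewrite exprVn mulNr mulrC mulNr.
Qed.

Lemma cder_sum (I : Type) (r : seq I) (f : I -> R[i] -> R[i]) (d : I -> R[i]) z :
  (forall i, cder (f i) z (d i)) -> cder (fun w => \sum_(i <- r) f i w) z (\sum_(i <- r) d i).
Proof.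
move=> h; elim: r => [|i r IH].
  by rewrite big_nil; under eq_fun do rewrite big_nil; exact: cder_cst.
by rewrite big_cons; under eq_fun do rewrite big_cons; exact: cderD.
Qed.

(** Once a local right inverse is known to be continuous, its difference quotient is the reciprocal
    of that of [f], taken at [u w]. This serves both the logarithm and the inverses of the conformal
    maps. *)
Lemma cder_inverse (f u : R[i] -> R[i]) (w0 : R[i]) (d : R[i]) :
  Cnear w0 [set w | f (u w) = w] -> ccont u w0 -> d != 0 -> cder f (u w0) d ->
  cder u w0 d^-1.
Proof.
move=> fu cu d0 [F [hF cF Fd]]; have fu0 := Cnear_self fu.
have cFu : ccont (fun w => F (u w)) w0 by exact: (@ccont_comp u F).
exists (fun w => if w == w0 then d^-1 else (u w - u w0) / (w - w0)); split.
- move=> w; case: eqVneq => [->|ww]; first by rewrite !subrr mulr0.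
  by rewrite divfK // subr_eq0.
- apply: (@ccont_near (fun w => (F (u w))^-1)); first by apply: ccontV; rewrite ?Fd.
  have Fu0 : Cnear w0 [set w | F (u w) != 0] by apply: ccont_neq0 cFu _; rewrite Fd.
  apply: filterS2 fu Fu0 => w /= fuw Fuw; case: eqVneq => [->|ww]; first by rewrite Fd.
  have := hF (u w); rewrite fu0 fuw => h.
  have uu : u w - u w0 != 0.
    by apply: contra_neq ww => e; apply/eqP; rewrite -subr_eq0 h e mulr0.
  by rewrite h invfM mulrCA divff // mulr1.
- by rewrite eqxx.
Qed.

(** Together with its converse below, this is the passage to the notion of differentiability in
    [holomorphic_at]. *)
Lemma cder_derivable f z d : cder f z d -> derivable (f : R[i]^o -> R[i]^o) z 1.
Proof.
move=> [F [hF cF Fd]]; apply/cvg_ex; exists (F z).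
apply/(tendsP (dnbhs_filter _)) => e e0; apply/nbhsCP.
have [r r0 hr] := cF e e0; exists r => // h; rewrite subr0 => hh h0 /=.
have -> : h^-1 *: (f (h *: 1 + z) - f z : R[i]^o) = F (h + z).
  by rewrite /GRing.scale /= mulr1 hF addrK mulrCA mulVf // mulr1.
by apply: hr; rewrite addrK.
Qed.

Lemma derivable_cder f z : derivable (f : R[i]^o -> R[i]^o) z 1 -> exists d, cder f z d.
Proof.
move=> /cvg_ex[/= d hd]; exists d.
exists (fun w => if w == z then d else (f w - f z) / (w - z)); split; last by rewrite eqxx.
  move=> w; case: eqVneq => [->|ww]; first by rewrite !subrr mulr0.
  by rewrite divfK // subr_eq0.
move=> e e0; rewrite eqxx.
have /(tendsP (dnbhs_filter _))/(_ e e0)/nbhsCP [r r0 hr] := hd.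
exists r => // w hw /=.
case: eqVneq => [_|wz]; first by rewrite subrr cabs0.
have wz0 : w - z != 0 by rewrite subr_eq0.
have := hr (w - z); rewrite subr0 => /(_ hw wz0) /=.
by rewrite /GRing.scale /= mulr1 subrK mulrC.
Qed.

Lemma pcont_comp p f x : pcont p x -> ccont f (p x) -> pcont (fun y => f (p y)) x.
Proof.
move=> h1 h2 e /h2[r r0 hr]; have [s s0 hs] := h1 r r0.
by exists s => // w /hs /hr.
Qed.
Lemma pcontD p q x : pcont p x -> pcont q x -> pcont (fun y => p y + q y) x.
Proof. exact: tendsD. Qed.
Lemma pcontM p q x : pcont p x -> pcont q x -> pcont (fun y => p y * q y) x.
Proof. exact: tendsM. Qed.
Lemma pcont_cst c x : pcont (fun=> c) x. Proof. exact: tends_cst. Qed.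
Lemma pcont_C (h : R -> R) x : {for x, continuous h} -> pcont (fun y => (h y)%:C) x.
Proof.
move=> ch; apply/pcontP.
by apply: (@continuous_comp _ _ _ h (real_complex R : R -> R[i]^o)) => //; exact: realC_continuous.
Qed.
Lemma pcont_rcomp p (h : R -> R) x : {for x, continuous h} -> pcont p (h x) -> pcont (fun y => p (h y)) x.
Proof.
move=> ch /pcontP cp; apply/pcontP.
by apply: (@continuous_comp _ _ _ h (p : R -> R[i]^o)).
Qed.
Lemma pcont_Re p x : pcont p x -> {for x, continuous (fun y => Re (p y))}.
Proof.
move=> /pcontP h; apply: (@continuous_comp _ _ _ (p : R -> R[i]^o) (@complex.Re R)) => //.
exact: Re_continuous.
Qed.
Lemma pcont_Im p x : pcont p x -> {for x, continuous (fun y => Im (p y))}.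
Proof.
move=> /pcontP h; apply: (@continuous_comp _ _ _ (p : R -> R[i]^o) (@complex.Im R)) => //.
exact: Im_continuous.
Qed.
Lemma pcont_cabs p x : pcont p x -> {for x, continuous (fun y => cabs (p y))}.
Proof.
move=> /pcontP h; apply: (@continuous_comp _ _ _ (p : R -> R[i]^o) (@cabs R)) => //.
exact: cabs_continuous.
Qed.

Lemma pder_cont p x d : pder p x d -> pcont p x.
Proof.
move=> [phi [h c _]].
have -> : p = (fun y => p x + phi y * (y - x)%:C) by apply/funext=> w; rewrite -h addrC subrK.
apply: pcontD; first exact: pcont_cst.
apply: pcontM => //; apply: pcont_C; apply: cvgB; [exact: cvg_id|exact: cvg_cst].
Qed.
Lemma pder_eq p x d d' : pder p x d -> d = d' -> pder p x d'. Proof. by move=> ? <-. Qed.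
Lemma pder_cst c x : pder (fun=> c) x 0.
Proof. by exists (fun=> 0); split=> [w||//]; [rewrite subrr mul0r|exact: pcont_cst]. Qed.
Lemma pderD p q x d e : pder p x d -> pder q x e -> pder (fun y => p y + q y) x (d + e).
Proof.
move=> [F [hF cF <-]] [G [hG cG <-]]; exists (fun y => F y + G y); split=> //.
  by move=> w; rewrite mulrDl -hF -hG; ring.
exact: pcontD.
Qed.
Lemma pderM p q x d e : pder p x d -> pder q x e ->
  pder (fun y => p y * q y) x (d * q x + p x * e).
Proof.
move=> df dg; have cg := pder_cont dg; move: df dg => [F [hF cF <-]] [G [hG cG <-]].
exists (fun y => F y * q y + p x * G y); split=> //.
  move=> w; transitivity (F w * (w - x)%:C * q w + p x * (G w * (w - x)%:C)); last by ring.
  by rewrite -hF -hG; ring.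
by apply: pcontD; apply: pcontM => //; exact: pcont_cst.
Qed.
Lemma pderZ c q x d : pder q x d -> pder (fun y => c * q y) x (c * d).
Proof. by move=> df; have := pderM (pder_cst c x) df; rewrite mul0r add0r. Qed.
Lemma pder_comp f p x d e : pder p x d -> cder f (p x) e -> pder (fun y => f (p y)) x (e * d).
Proof.
move=> df; have cf := pder_cont df; move: df => [F [hF cF <-]] [G [hG cG <-]].
exists (fun y => G (p y) * F y); split=> //.
  by move=> w; rewrite hG hF mulrA.
by apply: pcontM => //; exact: (@pcont_comp p G).
Qed.
Lemma pder_C (h : R -> R) x a : is_derive x 1 h a -> pder (fun y => (h y)%:C) x a%:C.
Proof.
move=> /is_derive1_caratheodory[g [hg cg <-]]; exists (fun y => (g y)%:C); split=> //.
  by move=> y; rewrite -(rmorphB (real_complex R)) hg (rmorphM (real_complex R)).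
exact: pcont_C.
Qed.
Lemma pder_rcomp p (h : R -> R) x a d : is_derive x 1 h a -> pder p (h x) d ->
  pder (fun y => p (h y)) x (d * a%:C).
Proof.
move=> dh; have ch : {for x, continuous h} by apply: differentiable_continuous; apply/derivable1_diffP.
move: dh => /is_derive1_caratheodory[g [hg cg <-]] [F [hF cF <-]].
exists (fun y => F (h y) * (g y)%:C); split; last by [].
  by move=> y; rewrite hF hg -mulrA -(rmorphM (real_complex R)) (mulrC (g y)).
apply: pcontM; last exact: pcont_C.
exact: (@pcont_rcomp F h).
Qed.
Lemma pder_Re p x d : pder p x d -> is_derive x 1 (fun y => Re (p y)) (Re d).
Proof.
move=> [F [hF cF <-]]; apply/is_derive1_caratheodory; exists (fun y => Re (F y)); split=> //.
  by move=> y; rewrite -ReB hF !ReImE mulr0 subr0.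
exact: pcont_Re.
Qed.
Lemma pder_Im p x d : pder p x d -> is_derive x 1 (fun y => Im (p y)) (Im d).
Proof.
move=> [F [hF cF <-]]; apply/is_derive1_caratheodory; exists (fun y => Im (F y)); split=> //.
  by move=> y; rewrite -ImB hF !ReImE mulr0 add0r.
exact: pcont_Im.
Qed.
Lemma pder_id x : pder (fun y => y%:C) x 1.
Proof. exact: (@pder_C id x 1). Qed.

Lemma derive_ge0_le (h dh : R -> R) (a b : R) : a <= b ->
  (forall x, a < x < b -> is_derive x 1 h (dh x)) ->
  (forall x, a < x < b -> 0 <= dh x) -> {within `[a, b], continuous h} -> h a <= h b.
Proof.
rewrite le_eqVlt => /predU1P[->//|ab] d1 d2 ch.
have d1' x : x \in `]a, b[ -> is_derive x 1 h (dh x) by rewrite in_itv /=; exact: d1.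
have [c + e] := MVT ab d1' ch; rewrite in_itv /= => hc.
by rewrite -subr_ge0 e mulr_ge0 ?d2 // subr_ge0 ltW.
Qed.

Lemma derive_gt0_lt (h dh : R -> R) (a b : R) : a < b ->
  (forall x, a < x < b -> is_derive x 1 h (dh x)) ->
  (forall x, a < x < b -> 0 < dh x) -> {within `[a, b], continuous h} -> h a < h b.
Proof.
move=> ab d1 d2 ch.
have d1' x : x \in `]a, b[ -> is_derive x 1 h (dh x) by rewrite in_itv /=; exact: d1.
have [c + e] := MVT ab d1' ch; rewrite in_itv /= => hc.
by rewrite -subr_gt0 e mulr_gt0 ?d2 // subr_gt0.
Qed.

Lemma derive_eq0_eq (h : R -> R) (a b : R) : a <= b ->
  (forall x, a < x < b -> is_derive x 1 h 0) -> {within `[a, b], continuous h} -> h b = h a.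
Proof.
rewrite le_eqVlt => /predU1P[->//|ab] d1 ch.
have d1' x : x \in `]a, b[ -> is_derive x 1 h 0 by rewrite in_itv /=; exact: d1.
have [c _ e] := MVT ab d1' ch.
by apply/eqP; rewrite -subr_eq0 e mul0r.
Qed.

Lemma derive_cont (h : R -> R) (x d : R) : is_derive x 1 h d -> {for x, continuous h}.
Proof. by move=> dh; apply: differentiable_continuous; apply/derivable1_diffP. Qed.

Lemma within_ReM (A : set R) p (c : R[i]) : {within A, continuous (p : R -> R[i]^o)} ->
  {within A, continuous (fun y => Re (c * p y))}.
Proof.
move=> h x; apply: (@continuous_comp _ _ _ (p : subspace A -> R[i]^o) (fun z : R[i]^o => Re (c * z))).
  exact: h.
apply: (@continuous_comp _ _ _ (fun z : R[i]^o => c * z : R[i]^o) (@complex.Re R)).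
  apply/(ccontP (fun z => c * z)); apply: ccontM; [exact: ccont_cst|exact: ccont_id].
exact: Re_continuous.
Qed.

(** Mean value inequality for curves, by projecting on the direction of the increment. The majorant
    is a function, differentiable only inside the interval, so that integrable singularities such as
    [1 / sqrt x] at an endpoint are allowed. *)
Lemma path_le p (dp : R -> R[i]) (h dh : R -> R) (a b : R) : a <= b ->
  (forall x, a < x < b -> pder p x (dp x)) ->
  (forall x, a < x < b -> is_derive x 1 h (dh x)) ->
  (forall x, a < x < b -> cabs (dp x) <= dh x) ->
  {within `[a, b], continuous h} -> {within `[a, b], continuous (p : R -> R[i]^o)} ->
  cabs (p b - p a) <= h b - h a.
Proof.
move=> ab d1 d2 d3 ch cp; set D := p b - p a.
(* The rotation taking [D] to its modulus; for [D = 0] the convention [0^-1 = 0] makes [u] zero,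
   which is harmless. *)
set u := conjc D / (cabs D)%:C.
have u1 : cabs u <= 1.
  rewrite cabsM cabsJ cabsV cabsR ger0_norm ?cabs_ge0 //.
  by have [->|D0] := eqVneq (cabs D) 0; rewrite ?mul0r ?ler01 // divff.
have uD : Re (u * D) = cabs D.
  have [D0|D0] := eqVneq (cabs D) 0; first by have /eqP := D0; rewrite cabs_eq0 => /eqP ->; rewrite mulr0 cabs0.
  have -> : u * D = (cabs D)%:C.
    rewrite /u mulrAC (mulrC _ D) mulJ_cabs -[X in X / _]/(_%:C) expr2 (rmorphM (real_complex R)) mulfK //.
    by rewrite (inj_eq (@complexI R)).
  by [].
rewrite -uD -subr_ge0.
have -> : h b - h a - Re (u * D) = (h b - Re (u * p b)) - (h a - Re (u * p a)).
  by rewrite /D mulrBr ReB; ring.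
rewrite subr_ge0; apply: (@derive_ge0_le (fun y => h y - Re (u * p y)) (fun y => dh y - Re (u * dp y))) => //.
- by move=> x hx; apply: is_deriveB; [exact: d2|apply/pder_Re/pderZ; exact: d1].
- move=> x hx; rewrite subr_ge0 (le_trans _ (d3 x hx)) // (le_trans (Re_le_cabs _)) // cabsM.
  by rewrite ler_piMl ?cabs_ge0.
- by move=> x; apply: cvgB; [exact: ch|exact: (@within_ReM _ p u cp)].
Qed.

End caratheodory_derivatives.

Lemma is_derive_one_sub (R : realType) (x : R) : is_derive x 1 (fun y => 1 - y) (- 1).
Proof. by apply/is_derive1_caratheodory; exists (fun=> -1); split=> // [y|]; [ring|exact: cvg_cst]. Qed.

(** * Complex exponential and principal logarithm *)

Section exp_log.
Variable R : realType.
Implicit Types (z w : R[i]) (x y r : R).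

Definition cis x : R[i] := cos x +i* sin x.
Definition Cexp z : R[i] := (expR (Re z))%:C * cis (Im z).
(** The principal argument through the tangent of its half, [Im z / (|z| + Re z)]: one formula for
    the whole slit plane, continuous there without case distinctions. *)
Definition Clog z : R[i] := ln (cabs z) +i* (2 * atan (Im z / (cabs z + Re z))).
(** [|z| + Re z] vanishes exactly on the half-line of nonpositive reals, so this is the plane slit
    along it, and also the condition that the denominator in [Clog] is positive. *)
Definition slit z := 0 < cabs z + Re z.

Lemma cisD x y : cis (x + y) = cis x * cis y.
Proof. by apply: Cext; rewrite !ReImE /= ?cosD ?sinD //; ring. Qed.
Lemma cis0 : cis 0 = 1. Proof. by rewrite /cis cos0 sin0. Qed.
Lemma cabs_cis x : cabs (cis x) = 1.
Proof. by rewrite cabsE /= cos2Dsin2 sqrtr1. Qed.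
Lemma cis_neq0 x : cis x != 0. Proof. by rewrite -cabs_gt0 cabs_cis. Qed.
Lemma cisN x : cis (- x) = conjc (cis x).
Proof. by apply: Cext; rewrite !ReImE /= ?cosN ?sinN. Qed.
Lemma cisV x : (cis x)^-1 = cis (- x).
Proof. by rewrite cisN cabs_unitV // cabs_cis. Qed.
Lemma cis_conj r x : conjc (r%:C * cis x) = r%:C * cis (- x).
Proof. by apply: Cext; rewrite !ReImE /= ?cosN ?sinN; ring. Qed.

Lemma CexpD z w : Cexp (z + w) = Cexp z * Cexp w.
Proof. by rewrite /Cexp !ReImE expRD cisD (rmorphM (real_complex R)); ring. Qed.
Lemma Cexp0 : Cexp 0 = 1. Proof. by rewrite /Cexp expR0 cis0 mulr1. Qed.
Lemma cabs_Cexp z : cabs (Cexp z) = expR (Re z).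
Proof. by rewrite cabsM cabs_cis mulr1 cabsR ger0_norm // expR_ge0. Qed.
Lemma Cexp_neq0 z : Cexp z != 0. Proof. by rewrite -cabs_gt0 cabs_Cexp expR_gt0. Qed.
Lemma pder_cis x : pder cis x (iC * cis x).
Proof.
have h1 : pder (fun y => (cos y)%:C) x (- sin x)%:C by exact: pder_C.
have h2 : pder (fun y => iC * (sin y)%:C) x (iC * (cos x)%:C) by apply: pderZ; exact: pder_C.
have := pderD h1 h2; have -> : (fun y => (cos y)%:C + iC * (sin y)%:C) = cis.
  by apply/funext => y; apply: Cext; rewrite !ReImE /= ?mul0r ?mulr0 ?mul1r ?subr0 ?addr0 ?add0r.
by move=> h; apply: pder_eq h _; apply: Cext; rewrite !ReImE /= ?mul0r ?mulr0 ?mul1r ?subr0 ?addr0 ?add0r ?sub0r.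
Qed.

Lemma ccont_pRe (p : R -> R[i]) z : pcont p (Re z) -> ccont (fun w => p (Re w)) z.
Proof.
move=> h e /h [r r0 hr]; exists r => // w hw; apply: hr.
by rewrite -ReB (le_lt_trans (cabs_Re _)).
Qed.
Lemma ccont_pIm (p : R -> R[i]) z : pcont p (Im z) -> ccont (fun w => p (Im w)) z.
Proof.
move=> h e /h [r r0 hr]; exists r => // w hw; apply: hr.
by rewrite -ImB (le_lt_trans (cabs_Im _)).
Qed.

Lemma cder_Cexp0 : cder Cexp 0 1.
Proof.
have /is_derive1_caratheodory [a [ha ca a0]] : is_derive (0 : R) 1 expR 1.
  by have := @is_derive_expR R 0; rewrite expR0.
have [b [hb cb b0]] := pder_cis 0.
pose A w := (a (Re w))%:C * cis (Im w) - 1.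
pose B w := b (Im w) - iC.
have cA : ccont A 0.
  apply: ccontD; last exact: ccont_cst.
  apply: ccontM; first by apply: (@ccont_pRe (fun y => (a y)%:C)); exact: pcont_C.
  by apply: ccont_pIm; exact: pder_cont (pder_cis 0).
have cB : ccont B 0 by apply: ccontD; [exact: ccont_pIm|exact: ccont_cst].
have A0 : A 0 = 0 by rewrite /A /= a0 cis0 mulr1 subrr.
have B0 : B 0 = 0 by rewrite /B /= b0 cis0 mulr1 subrr.
(* [A] and [B] are the deviations of the quotients of the real exponential and of [cis] from their
   values at 0. As [|Re w|] and [|Im w|] are at most [|w|], the correction tends to 0; at [w = 0] it
   is 0 because [0^-1 = 0]. *)
exists (fun w => 1 + ((Re w)%:C * A w + (Im w)%:C * B w) / w); split.
- move=> w; have [->|w0] := eqVneq w 0; first by rewrite !subrr mulr0.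
  rewrite subr0 mulrDl mul1r divfK // Cexp0 /A /B.
  have e1 : (expR (Re w))%:C = 1 + (a (Re w))%:C * (Re w)%:C.
    have := ha (Re w); rewrite expR0 subr0 => e; rewrite -(rmorphM (real_complex R)) -e.
    by rewrite (rmorphB (real_complex R)) addrC subrK.
  have e2 : cis (Im w) = 1 + b (Im w) * (Im w)%:C.
    by have := hb (Im w); rewrite cis0 subr0 => e; rewrite -e addrC subrK.
  have e3 : w = (Re w)%:C + iC * (Im w)%:C by exact: complexE.
  rewrite /Cexp e1 e2 [X in _ = X + _]e3; ring.
- move=> e e0; have e20 : 0 < e / 2 by rewrite divr_gt0.
  apply: filterS2 (cA _ e20) (cB _ e20) => w /=; rewrite A0 B0 !subr0 => hA hB.
  rewrite !mulr0 addr0 mul0r addr0 addrAC subrr add0r.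
  have [->|w0] := eqVneq w 0; first by rewrite invr0 mulr0 cabs0.
  rewrite cabsM cabsV ltr_pdivrMr ?cabs_gt0 // (le_lt_trans (cabsD _ _)) // (splitr e) mulrDl.
  rewrite !cabsM !cabsR; apply: ltr_leD.
    apply: le_lt_trans (_ : cabs w * cabs (A w) < _); first by rewrite ler_wpM2r ?cabs_ge0 ?cabs_Re.
    by rewrite mulrC ltr_pM2r ?cabs_gt0.
  apply: (@le_trans _ _ (cabs w * cabs (B w))); first by rewrite ler_wpM2r ?cabs_ge0 ?cabs_Im.
  by rewrite mulrC ler_wpM2r ?cabs_ge0 // ltW.
- by rewrite invr0 mulr0 addr0.
Qed.

Lemma cder_Cexp z : cder Cexp z (Cexp z).
Proof.
have h0 : cder (fun w => w - z) z 1.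
  by have := cderB (cder_id z) (cder_cst z z); rewrite subr0.
have h1 : cder Cexp (z - z) 1 by rewrite subrr; exact: cder_Cexp0.
have := cderZ (Cexp z) (cder_comp h0 h1); rewrite !mulr1 => h.
by apply: cder_ext h _ => w /=; rewrite -CexpD addrC subrK.
Qed.

Lemma slit_neq0 z : slit z -> z != 0.
Proof. by apply: contraTneq => ->; rewrite /slit cabs0 add0r ltxx. Qed.
Lemma slit_Re z : 0 < Re z -> slit z.
Proof. by move=> h; rewrite /slit ltr_wpDl ?cabs_ge0. Qed.
Lemma slit_Re_ge0 z : 0 <= Re z -> z != 0 -> slit z.
Proof. by move=> h z0; rewrite /slit ltr_wpDr ?cabs_gt0. Qed.

Lemma ClogK z : slit z -> Cexp (Clog z) = z.
Proof.
move=> sz; have z0 := slit_neq0 sz; have c0 : 0 < cabs z by rewrite cabs_gt0.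
have sz' : cabs z + Re z != 0 by rewrite gt_eqF.
rewrite /Cexp /Clog /= lnK ?posrE //.
(* With [1 + t ^+ 2 = 2 |z| / (|z| + Re z)], the double-angle formulas give back [Re z / |z|] and
   [Im z / |z|]. *)
set t := Im z / (cabs z + Re z); set c := cos (atan t).
have c2 : c ^+ 2 = (1 + t ^+ 2)^-1.
  by rewrite /c cos_atan exprVn sqr_sqrtr // addr_ge0 // sqr_ge0.
have st : sin (atan t) = t * c.
  have cn0 : c != 0 by rewrite /c cos_atan invr_eq0 sqrtr_eq0 -ltNge ltr_pwDl // sqr_ge0.
  by rewrite -[X in X * c](atanK t) /tan -/c divfK.
have q : 1 + t ^+ 2 = 2 * cabs z / (cabs z + Re z).
  apply: (mulIf (expf_neq0 2 sz')); rewrite mulrDl mul1r -exprMn divfK //.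
  by rewrite expr2 mulrA divfK //; have := cabs_sqr z; lra.
have cz : cabs z != 0 by rewrite gt_eqF.
have q' : (1 + t ^+ 2)^-1 = (cabs z + Re z) / (2 * cabs z) by rewrite q invf_div.
have hc : cos (2 * atan t) = Re z / cabs z.
  rewrite mulr_natl cos_mulr2n -/c c2 q' -mulr_natl; field; by rewrite cz.
have hs : sin (2 * atan t) = Im z / cabs z.
  rewrite mulr_natl sin_mulr2n -/c st mulrCA -expr2 c2 q' -mulr_natl /t; field.
  by rewrite cz sz'.
by apply: Cext; rewrite !ReImE /= hc hs mul0r ?subr0 ?addr0 mulrC divfK.
Qed.

Lemma atan_continuous : continuous (@atan R).
Proof. by move=> x; apply: differentiable_continuous; apply/derivable1_diffP; exact: ex_derive. Qed.

Lemma slit_near z : slit z -> Cnear z slit.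
Proof.
move=> sz; exists ((cabs z + Re z) / 2); first by rewrite divr_gt0.
move=> w hw; rewrite /slit.
have h1 := cabs_leB z w; have h2 := Re_le_cabs (z - w).
rewrite cabs_distrC in hw; move: h2; rewrite ReB => h2.
by move: sz; rewrite /slit => sz; lra.
Qed.

Lemma Clog_cont z : slit z -> ccont Clog z.
Proof.
move=> sz; have z0 := slit_neq0 sz; apply/ccontP; apply: (cvg_ReIm (nbhs_filter (z : R[i]^o))) => /=.
  apply: (@continuous_comp _ _ _ (@cabs R : R[i]^o -> R) (@ln R)); first exact: cabs_continuous.
  by apply: continuous_ln; rewrite cabs_gt0.
apply: cvgM; first exact: cvg_cst.
apply: (@continuous_comp _ _ _ (fun z : R[i]^o => Im z / (cabs z + Re z)) atan); last exact: atan_continuous.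
have h1 : ccont (fun w => (Im w)%:C) z by apply: (@ccont_pIm (fun y => y%:C)); exact: pcont_C.
have h2 : ccont (fun w => (cabs w + Re w)%:C) z.
  under eq_fun do rewrite (rmorphD (real_complex R)); apply: ccontD.
    apply/ccontP; apply: (@continuous_comp _ _ _ (@cabs R : R[i]^o -> R) (real_complex R : R -> R[i]^o)).
      exact: cabs_continuous.
    exact: realC_continuous.
  by apply: (@ccont_pRe (fun y => y%:C)); exact: pcont_C.
have sz' : (cabs z + Re z)%:C != 0 by rewrite (inj_eq (@complexI R)) gt_eqF.
have h3 := ccontM h1 (ccontV sz' h2).
have h4 : ccont (fun w => (Im w / (cabs w + Re w))%:C) z.
  have -> : (fun w : R[i] => (Im w / (cabs w + Re w))%:C) = (fun w => (Im w)%:C * ((cabs w + Re w)%:C)^-1) by apply/funext => w; rewrite -(fmorphV (real_complex R)) -(rmorphM (real_complex R)).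
  exact: h3.
apply: (@continuous_comp _ _ _ (fun w : R[i]^o => (Im w / (cabs w + Re w))%:C : R[i]^o) (@complex.Re R)).
  by move/ccontP: h4.
exact: Re_continuous.
Qed.

Lemma cder_Clog z : slit z -> cder Clog z z^-1.
Proof.
move=> sz; apply: (@cder_inverse _ Cexp Clog z z).
- by apply: filterS (slit_near sz) => w; exact: ClogK.
- exact: Clog_cont.
- exact: slit_neq0.
- by rewrite -{2}(ClogK sz); exact: cder_Cexp.
Qed.

Lemma cos_half_gt0 x : - pi < x < pi -> 0 < cos (x / 2).
Proof. by move=> h; apply: cos_gt0_pihalf; move: h; lra. Qed.

Lemma Clog_polar (r x : R) : 0 < r -> - pi < x < pi -> Clog (r%:C * cis x) = ln r +i* x.
Proof.
move=> r0 hx; have cr : cabs (r%:C * cis x) = r by rewrite cabsM cabs_cis mulr1 cabsR gtr0_norm.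
have c0 := cos_half_gt0 hx.
apply: Cext; first by rewrite /Clog [LHS]/= cr.
rewrite /Clog [LHS]/= cr (_ : _ + _ = r + r * cos x); last by rewrite /= mul0r subr0.
rewrite /= mul0r addr0.
have -> : r * sin x / (r + r * cos x) = tan (x / 2).
  have [ex ey] : cos x = cos (x / 2) ^+ 2 *+ 2 - 1 /\ sin x = cos (x / 2) * sin (x / 2) *+ 2.
    by rewrite -cos_mulr2n -sin_mulr2n; split; [congr cos|congr sin]; rewrite mulr2n -splitr.
  rewrite /tan; move: c0 ex ey; set c := cos (x / 2); set s := sin (x / 2) => c0 -> ->.
  rewrite (_ : r + _ = 2 * r * c ^+ 2); last by rewrite -mulr_natl; ring.
  by rewrite -mulr_natl; field; rewrite !gt_eqF.
rewrite tanK; first by rewrite mulrC divfK.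
by rewrite in_itv /=; move: hx => /andP[h1 h2]; apply/andP; split; lra.
Qed.

Lemma Clog_Im z : `|Im (Clog z)| < pi.
Proof.
rewrite /Clog /=; set a := _ / _; have := atan_gtNpi2 a; have := atan_ltpi2 a.
by rewrite ltr_norml; move=> *; apply/andP; split; lra.
Qed.

End exp_log.

(** * Cauchy's theorem *)

Section segment_integrals.
Variable R : realType.
Implicit Types (f g : R[i] -> R[i]) (a b c z w : R[i]) (q A : R -> R[i]) (x y s r e u v : R).

Lemma is_derive_affine u v x : is_derive x 1 (fun s => u + v * s) v.
Proof.
apply/is_derive1_caratheodory; exists (fun=> v); split=> //; last exact: cvg_cst.
by move=> z; ring.
Qed.
Lemma is_derive_linear v x : is_derive x 1 (fun s => v * s) v.
Proof.
apply/is_derive1_caratheodory; exists (fun=> v); split=> //; last exact: cvg_cst.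
by move=> z; ring.
Qed.

Lemma real_antiderivative (h : R -> R) : continuous h ->
  (* The integral is taken from -1 and inside [[-1, 2]], so that 0 and 1 are interior points and the
     derivative is two-sided there as well. *)
  exists H : R -> R, forall x, 0 <= x <= 1 -> is_derive x 1 H (h x).
Proof.
move=> ch; exists (fun x => \int[lebesgue_measure]_(t in [set` Interval (BLeft (- 1 : R)) (BRight x)]) h t).
move=> x /andP[x0 x1].
have x2 : x < 2 by apply: le_lt_trans x1 _; rewrite ltr1n.
have hi : lebesgue_measure.-integrable [set` Interval (BLeft (-1)) (BRight (2 : R))] (EFin \o h).
  apply: continuous_compact_integrable; first exact: segment_compact.
  exact: continuous_subspaceT.
have [|d1 d2] := continuous_FTC1 x2 hi _ (ch x).
  first [by apply: (_ : (BLeft (-1) < BRight x)%O); rewrite bnd_simp; lra | by rewrite /Order.lt /=; lra | by rewrite /Order.lt /= ; apply: lt_le_trans x0; rewrite oppr_lt0].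
by have := derivableP d1; rewrite -derive1E d2.
Qed.

(** Precomposition with this 1-Lipschitz retraction extends a curve on [[0, 1]] continuously to the
    whole line. *)
Definition clamp x : R := Num.max 0 (Num.min 1 x).
Lemma clamp_lip x y : `|clamp y - clamp x| <= `|y - x|.
Proof.
rewrite /clamp /Num.max /Num.min.
by case: (ltrP 1 x); case: (ltrP 1 y) => h1 h2; repeat case: ifP => ?; rewrite ?subrr ?normr0 //;
  rewrite !ler_norml; apply/andP; split; move: (ler_norm (y - x)) (ler_norm (x - y)); rewrite (distrC x y); lra.
Qed.
Lemma clamp01 x : 0 <= clamp x <= 1.
Proof.
rewrite /clamp; apply/andP; split; first by rewrite le_max lexx.
by rewrite ge_max ler01 ge_min lexx.
Qed.
Lemma clamp_id x : 0 <= x <= 1 -> clamp x = x.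
Proof. by move=> /andP[h1 h2]; rewrite /clamp min_r // max_r. Qed.

Lemma path_antiderivative q : (forall x, 0 <= x <= 1 -> pcont q x) ->
  exists A, forall x, 0 <= x <= 1 -> pder A x (q x).
Proof.
move=> cq; have cq' x : pcont (fun y => q (clamp y)) x.
  move=> e e0; have [r r0 hr] := cq _ (clamp01 x) e e0.
  by exists r => // y hy; apply: hr; exact: le_lt_trans (clamp_lip _ _) hy.
have [H1 h1] := real_antiderivative (fun x => pcont_Re (cq' x)).
have [H2 h2] := real_antiderivative (fun x => pcont_Im (cq' x)).
exists (fun y => (H1 y)%:C + iC * (H2 y)%:C) => x hx.
apply: pder_eq (pderD (pder_C (h1 x hx)) (pderZ iC (pder_C (h2 x hx)))) _.
by rewrite clamp_id //; symmetry; exact: complexE.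
Qed.

Lemma within_pcont A x y : (forall t, x <= t <= y -> pcont A t) ->
  {within `[x, y], continuous (A : R -> R[i]^o)}.
Proof.
move=> h; apply: continuous_in_subspaceT => t; rewrite inE /= in_itv /= => /h /pcontP.
exact.
Qed.

Lemma antiderivative_uniq A B q : (forall x, 0 <= x <= 1 -> pder A x (q x)) ->
  (forall x, 0 <= x <= 1 -> pder B x (q x)) -> A 1 - A 0 = B 1 - B 0.
Proof.
move=> hA hB.
have hd x : 0 <= x <= 1 -> pder (fun y => A y + (-1) * B y) x 0.
  move=> hx; apply: pder_eq (pderD (hA x hx) (pderZ (-1) (hB x hx))) _.
  by rewrite mulN1r subrr.
have c : {within `[0, 1], continuous ((fun y => A y + (-1) * B y) : R -> R[i]^o)}.
  by apply: within_pcont => t /hd /pder_cont.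
have := @path_le R (fun y => A y + (-1) * B y) (fun=> 0) (fun=> 0) (fun=> 0) 0 1 ler01.
rewrite subrr => /(_ _ _ _ _ c) h.
have /eqP : cabs (A 1 + -1 * B 1 - (A 0 + -1 * B 0)) = 0.
  apply/eqP; rewrite eq_le cabs_ge0 andbT; apply: h.
  - by move=> x /andP[/ltW h1 /ltW h2]; apply: hd; rewrite h1.
  - by move=> x _; rewrite cabs0.
  - by apply: continuous_subspaceT => ?; exact: cvg_cst.
rewrite cabs_eq0 !mulN1r => /eqP e; apply/eqP; rewrite -subr_eq0 -e; apply/eqP; ring.
Qed.

(** The integral over [[0, 1]] as the increment of an antiderivative, well defined by
    [antiderivative_uniq]; the value is 0 when there is no antiderivative. Linearity and subdivision
    then reduce to choosing antiderivatives. *)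
Definition pint q : R[i] := xget 0 [set v | exists A,
  (forall x, 0 <= x <= 1 -> pder A x (q x)) /\ v = A 1 - A 0].

Lemma pintE A q : (forall x, 0 <= x <= 1 -> pder A x (q x)) -> pint q = A 1 - A 0.
Proof.
move=> hA; rewrite /pint; case: xgetP => [v _ [B [hB ->]]|/(_ (A 1 - A 0)) h].
  exact: antiderivative_uniq hB hA.
by exfalso; apply: h; exists A.
Qed.

Definition spath a b s := a + s%:C * (b - a).
Definition seg f a b := (b - a) * pint (fun s => f (spath a b s)).
Definition seg_cont f a b := forall s, 0 <= s <= 1 -> ccont f (spath a b s).

Lemma spath0 a b : spath a b 0 = a. Proof. by rewrite /spath mul0r addr0. Qed.
Lemma spath1 a b : spath a b 1 = b. Proof. by rewrite /spath mul1r addrC subrK. Qed.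
Lemma pder_spath a b s : pder (spath a b) s (b - a).
Proof.
have := pderD (pder_cst a s) (pderM (pder_id s) (pder_cst (b - a) s)).
by rewrite add0r mul1r mulr0 addr0.
Qed.

Lemma seg_ant f a b : seg_cont f a b -> exists A,
  (forall s, 0 <= s <= 1 -> pder A s ((b - a) * f (spath a b s))) /\ seg f a b = A 1 - A 0.
Proof.
move=> cf; have [|A hA] := @path_antiderivative (fun s => f (spath a b s)).
  by move=> x hx; apply: pcont_comp; [exact: pder_cont (pder_spath a b x)|exact: cf].
exists (fun s => (b - a) * A s); split; first by move=> s hs; apply: pderZ; exact: hA.
by rewrite /seg (pintE hA) mulrBr.
Qed.

Lemma segE f a b A : (forall s, 0 <= s <= 1 -> pder A s ((b - a) * f (spath a b s))) ->
  seg f a b = A 1 - A 0.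
Proof.
have [->|ab] := eqVneq a b.
  move=> h; rewrite /seg subrr mul0r; rewrite -(subrr 0); apply: (@antiderivative_uniq (fun=> 0) A (fun=> 0)).
    by move=> x _; exact: pder_cst.
  by move=> x hx; have := h x hx; rewrite subrr mul0r.
move=> hA; have ba : b - a != 0 by rewrite subr_eq0 eq_sym.
rewrite /seg (@pintE (fun s => (b - a)^-1 * A s)); first by rewrite -mulrBr mulVKf.
by move=> x hx; apply: pder_eq (pderZ (b - a)^-1 (hA x hx)) _; rewrite mulKf.
Qed.

Lemma seg_primitive f K a b : (forall s, 0 <= s <= 1 -> cder K (spath a b s) (f (spath a b s))) ->
  seg f a b = K b - K a.
Proof.
move=> h; rewrite (@segE f a b (fun s => K (spath a b s))) ?spath0 ?spath1 //.
move=> s hs; apply: pder_eq (pder_comp (pder_spath a b s) (h s hs)) _.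
by rewrite mulrC.
Qed.

Lemma seg_rev f a b : seg_cont f a b -> seg f b a = - seg f a b.
Proof.
move=> /seg_ant [A [hA ->]].
rewrite (@segE f b a (fun s => A (1 - s))) ?subr0 ?subrr ?opprB // => s hs.
have hs' : 0 <= 1 - s <= 1 by lra.
have d : is_derive s 1 (fun s => 1 - s) (- 1).
  exact: is_derive_one_sub.
apply: pder_eq (pder_rcomp d (hA _ hs')) _.
rewrite (_ : spath a b (1 - s) = spath b a s); first by rewrite (rmorphN1 (real_complex R)); ring.
by rewrite /spath (rmorphB (real_complex R)) (rmorph1 (real_complex R)); ring.
Qed.

Lemma seg_scale f a b (A : R -> R[i]) (u v : R) : 0 <= u -> 0 <= v -> u + v <= 1 ->
  (forall s, 0 <= s <= 1 -> pder A s ((b - a) * f (spath a b s))) ->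
  seg f (spath a b u) (spath a b (u + v)) = A (u + v) - A u.
Proof.
move=> u0 v0 uv hA.
rewrite (@segE f _ _ (fun s => A (u + v * s))) ?mulr1 ?mulr0 ?addr0 // => s hs.
have hs' : 0 <= u + v * s <= 1.
  have : 0 <= v * s by rewrite mulr_ge0 //; lra.
  have : v * s <= v by rewrite ler_piMr //; lra.
  lra.
have d : is_derive s 1 (fun s => u + v * s) v.
  exact: is_derive_affine.
apply: pder_eq (pder_rcomp d (hA _ hs')) _.
rewrite (_ : spath _ _ _ = spath (spath a b u) (spath a b (u + v)) s); first by rewrite /spath (rmorphD (real_complex R)); ring.
by rewrite /spath !(rmorphD (real_complex R)) (rmorphM (real_complex R)); ring.
Qed.

Definition cmid a b := spath a b (1 / 2).

Lemma seg_mid f a b : seg_cont f a b -> seg f a b = seg f a (cmid a b) + seg f (cmid a b) b.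
Proof.
move=> /seg_ant [A [hA ->]].
have e1 : seg f a (cmid a b) = A (1 / 2) - A 0.
  by have := @seg_scale f a b A 0 (1 / 2); rewrite !add0r spath0; apply=> //; lra.
have e2 : seg f (cmid a b) b = A 1 - A (1 / 2).
  have e : 1 / 2 + 1 / 2 = 1 :> R by lra.
  by have := @seg_scale f a b A (1 / 2) (1 / 2); rewrite e spath1; apply=> //; lra.
rewrite e1 e2; ring.
Qed.

Lemma segB f g a b : seg_cont f a b -> seg_cont g a b ->
  seg (fun z => f z - g z) a b = seg f a b - seg g a b.
Proof.
move=> /seg_ant [A [hA ->]] /seg_ant [B [hB ->]].
rewrite (@segE _ a b (fun s => A s + (-1) * B s)); first by rewrite !mulN1r; ring.
move=> s hs; apply: pder_eq (pderD (hA s hs) (pderZ (-1) (hB s hs))) _; ring.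
Qed.

Lemma seg_le f a b M : seg_cont f a b ->
  (forall s, 0 <= s <= 1 -> cabs (f (spath a b s)) <= M) -> cabs (seg f a b) <= M * cabs (b - a).
Proof.
move=> cf hM; have [A [hA ->]] := seg_ant cf.
have := @path_le R A (fun s => (b - a) * f (spath a b s)) (fun s => M * cabs (b - a) * s) (fun=> M * cabs (b - a)) 0 1 ler01.
rewrite mulr1 mulr0 subr0; apply.
- by move=> x /andP[/ltW h1 /ltW h2]; apply: hA; rewrite h1.
- by move=> x _; exact: is_derive_linear.
- move=> x /andP[/ltW h1 /ltW h2]; rewrite cabsM mulrC ler_wpM2r ?cabs_ge0 ?hM //.
  by rewrite h1.
- by apply: continuous_subspaceT => x; apply: cvgM; [exact: cvg_cst|exact: cvg_id].
- by apply: within_pcont => t /hA /pder_cont.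
Qed.

(** A one-sided bound on a real functional of the integral. [seg_le] controls only the modulus,
    while [rectangle_height] has to estimate imaginary parts from both sides. *)
Lemma seg_Re_le f a b (u : R[i]) (M : R) : seg_cont f a b ->
  (forall s, 0 <= s <= 1 -> Re (u * ((b - a) * f (spath a b s))) <= M) -> Re (u * seg f a b) <= M.
Proof.
move=> cf hM; have [A [hA ->]] := seg_ant cf.
have := @derive_ge0_le R (fun s => M * s - Re (u * A s)) (fun s => M - Re (u * ((b - a) * f (spath a b s)))) 0 1 ler01.
rewrite mulr1 mulr0 sub0r => h.
have : - Re (u * A 0) <= M - Re (u * A 1).
  apply: h.
  - move=> x /andP[/ltW h1 /ltW h2]; have hx : 0 <= x <= 1 by rewrite h1.
    apply: is_deriveB; last by apply/pder_Re/pderZ; exact: hA.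
    exact: is_derive_linear.
  - by move=> x /andP[/ltW h1 /ltW h2]; rewrite subr_ge0 hM // h1.
  - move=> x; apply: cvgB.
      by apply: (@continuous_subspaceT _ _ _ (fun s : R => M * s)) => y; apply: cvgM; [exact: cvg_cst|exact: cvg_id].
    by apply: (@within_ReM R _ A u); apply: within_pcont => t /hA /pder_cont.
by rewrite mulrBr ReB; lra.
Qed.

End segment_integrals.

(** * Goursat's theorem for triangles *)

Section goursat.
Variable R : realType.
Implicit Types (f g : R[i] -> R[i]) (a b c z w : R[i]) (x y s r e : R).

Definition hull3 a b c : set R[i]^o := [set p | exists x y z : R,
  [/\ [/\ 0 <= x, 0 <= y & 0 <= z], x + y + z = 1 & p = x%:C * a + y%:C * b + z%:C * c]].

Definition tri f a b c := seg f a b + seg f b c + seg f c a.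

Lemma hull3_rot a b c p : hull3 a b c p -> hull3 b c a p.
Proof.
move=> [x [y [z [[x0 y0 z0] s ->]]]]; exists y, z, x; split => //; first by rewrite -s; ring.
by ring.
Qed.

Lemma hull3_spath a b c s : 0 <= s <= 1 -> hull3 a b c (spath a b s).
Proof.
move=> /andP[s0 s1]; exists (1 - s), s, 0; split; first by split; rewrite ?subr_ge0.
  by ring.
by rewrite /spath (rmorphB (real_complex R)) (rmorph1 (real_complex R)) (rmorph0 (real_complex R)); ring.
Qed.

Lemma hull3_sub a b c a' b' c' : hull3 a b c a' -> hull3 a b c b' -> hull3 a b c c' ->
  hull3 a' b' c' `<=` hull3 a b c.
Proof.
move=> [x1 [y1 [z1 [[x10 y10 z10] s1 ->]]]] [x2 [y2 [z2 [[x20 y20 z20] s2 ->]]]].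
move=> [x3 [y3 [z3 [[x30 y30 z30] s3 ->]]]] p [x [y [z [[x0 y0 z0] s ->]]]].
exists (x * x1 + y * x2 + z * x3), (x * y1 + y * y2 + z * y3), (x * z1 + y * z2 + z * z3).
split; first by split; rewrite !addr_ge0 // mulr_ge0.
  transitivity (x * (x1 + y1 + z1) + y * (x2 + y2 + z2) + z * (x3 + y3 + z3)); first by ring.
  by rewrite s1 s2 s3 !mulr1.
by rewrite !(rmorphD (real_complex R)) !(rmorphM (real_complex R)); ring.
Qed.

Lemma hull3_compact a b c : compact (hull3 a b c).
Proof.
pose F (p : R * R) : R[i]^o := spath a (spath b c p.2) p.1.
have -> : hull3 a b c = F @` (`[0, 1] `*` `[0, 1]).
  apply/seteqP; split => [p [x [y [z [[x0 y0 z0] s ->]]]]|_ [[s r] [/= h1 h2] <-]].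
    have [yz|yz] := eqVneq (y + z) 0.
      have [y00 z00] : y = 0 /\ z = 0 by split; lra.
      exists (0, 0); first by split; rewrite /= in_itv /= lexx ler01.
      rewrite /F /= spath0 y00 z00 (rmorph0 (real_complex R)) (_ : x = 1); last by lra.
      by rewrite (rmorph1 (real_complex R)); ring.
    have yz0 : 0 < y + z by rewrite lt_def yz addr_ge0.
    exists (y + z, z / (y + z)) => /=.
      split; rewrite /= in_itv /=; first by apply/andP; split; lra.
      by rewrite divr_ge0 ?addr_ge0 //= ler_pdivrMr // mul1r; lra.
    rewrite /F /spath /= (_ : x = 1 - (y + z)); last by lra.
    have yzC : (y + z)%:C != 0 by rewrite (inj_eq (@complexI R)).
    rewrite (rmorphM (real_complex R)) fmorphV.
    rewrite mulrDr mulrDr mulrA (mulrCA (y + z)%:C) mulfV // mulr1.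
    by rewrite (rmorphB (real_complex R)) (rmorph1 (real_complex R)) (rmorphD (real_complex R)); ring.
  move: h1 h2; rewrite !in_itv /= => /andP[s0 s1] /andP[r0 r1].
  exists (1 - s), (s * (1 - r)), (s * r); split.
  - by split; rewrite ?mulr_ge0 ?subr_ge0.
  - by ring.
  - by rewrite /F /spath /= !(rmorphM (real_complex R)) !(rmorphB (real_complex R)) (rmorph1 (real_complex R)); ring.
apply: continuous_compact; last by apply: compact_setX; exact: segment_compact.
have cC (h : R * R -> R) (u : R * R) : {for u, continuous h} -> {for u, continuous (fun v => (h v)%:C : R[i]^o)}.
  by move=> ch; apply: (@continuous_comp _ _ _ h (real_complex R : R -> R[i]^o)) => //; exact: realC_continuous.
apply: continuous_subspaceT => p; rewrite /F /spath.
apply: (@cvgD _ (R[i]^o)); first exact: cvg_cst.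
apply: (@cvgM _ _ _ _ (fun p : R * R => p.1%:C) (fun p : R * R => b + p.2%:C * (c - b) - a)).
  by apply: cC; exact: cvg_fst.
apply: (@cvgB _ (R[i]^o)); last exact: cvg_cst.
apply: (@cvgD _ (R[i]^o)); first exact: cvg_cst.
apply: (@cvgM _ _ _ _ (fun p : R * R => p.2%:C) (fun p : R * R => c - b)).
  by apply: cC; exact: cvg_snd.
exact: cvg_cst.
Qed.

Definition perim a b c := cabs (b - a) + cabs (c - b) + cabs (a - c).

Lemma hull3_vertex_dist a b c p : hull3 a b c p -> cabs (p - a) <= perim a b c.
Proof.
move=> [x [y [z [[x0 y0 z0] s ->]]]].
have -> : x%:C * a + y%:C * b + z%:C * c - a = y%:C * (b - a) + z%:C * (c - a).
  rewrite (_ : x = 1 - (y + z)); last by lra.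
  by rewrite (rmorphB (real_complex R)) (rmorph1 (real_complex R)) (rmorphD (real_complex R)); ring.
rewrite (le_trans (cabsD _ _)) // !cabsM !cabsR !ger0_norm // /perim.
have h1 : y * cabs (b - a) <= cabs (b - a) by rewrite ler_piMl ?cabs_ge0 //; lra.
have h2 : z * cabs (c - a) <= cabs (c - a) by rewrite ler_piMl ?cabs_ge0 //; lra.
by have := cabs_ge0 (c - b); rewrite (cabs_distrC a c); lra.
Qed.

Lemma hull3_dist a b c p q : hull3 a b c p -> hull3 a b c q -> cabs (p - q) <= perim a b c.
Proof.
move=> hp hq; have va := hull3_vertex_dist hq; have vb := hull3_vertex_dist (hull3_rot hq).
have vc := hull3_vertex_dist (hull3_rot (hull3_rot hq)).
move: hp => [x [y [z [[x0 y0 z0] s ->]]]].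
have -> : x%:C * a + y%:C * b + z%:C * c - q = x%:C * (a - q) + y%:C * (b - q) + z%:C * (c - q).
  rewrite (_ : x = 1 - (y + z)); last by lra.
  by rewrite (rmorphB (real_complex R)) (rmorph1 (real_complex R)) (rmorphD (real_complex R)); ring.
rewrite (le_trans (cabsD _ _)) // (le_trans (lerD (cabsD _ _) (lexx _))) //.
rewrite !cabsM !cabsR !ger0_norm // !(cabs_distrC _ q).
have e1 : perim b c a = perim a b c by rewrite /perim; ring.
have e2 : perim c a b = perim a b c by rewrite /perim; ring.
rewrite e1 in vb; rewrite e2 in vc.
rewrite -[leRHS]mul1r -s !mulrDl; rewrite !lerD // ler_wpM2l //.
Qed.

Variable f : R[i] -> R[i].

Let T := (R[i] * R[i] * R[i])%type.
Let tr (t : T) := tri f t.1.1 t.1.2 t.2.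
Let pr (t : T) := perim t.1.1 t.1.2 t.2.
Let hu (t : T) := hull3 t.1.1 t.1.2 t.2.
(** The three corner triangles and the middle one, oriented so that every inner edge is traversed
    once in each direction and cancels in the sum. *)
Let child (k : 'I_4) (t : T) : T := let: (a, b, c) := t in
  nth t [:: (a, cmid a b, cmid c a); (cmid a b, b, cmid b c); (cmid c a, cmid b c, c);
            (cmid a b, cmid b c, cmid c a)] k.

Lemma hull3_mid a b c : hull3 a b c (cmid a b).
Proof. by apply: hull3_spath; lra. Qed.

Lemma hull3_a a b c : hull3 a b c a.
Proof. by have := @hull3_spath a b c 0; rewrite spath0 lexx ler01; apply. Qed.

Lemma cmid_sym a b : cmid a b = cmid b a.
Proof.
rewrite /cmid /spath (_ : a + _ = (1 - 1/2)%:C * a + (1/2)%:C * b); last first.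
  by rewrite (rmorphB (real_complex R)) (rmorph1 (real_complex R)); ring.
rewrite (_ : 1 - 1/2 = 1/2 :> R); last by lra.
have h : (1/2)%:C + (1/2)%:C = 1 :> R[i].
  by rewrite -(rmorphD (real_complex R)) -(rmorph1 (real_complex R)); congr (_%:C); lra.
by rewrite -[X in _ = X + _](mul1r b) -h; ring.
Qed.

Lemma hull3_rot' a b c p : hull3 b c a p -> hull3 a b c p.
Proof. by move=> h; do 2 apply: hull3_rot. Qed.

Lemma seg_cont_sub (a b c a' b' : R[i]) : (forall p, hull3 a b c p -> ccont f p) ->
  hull3 a b c a' -> hull3 a b c b' -> seg_cont f a' b'.
Proof.
move=> cf ha hb s hs; apply: cf.
by apply: (@hull3_sub a b c a' b' b') => //; exact: hull3_spath.
Qed.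

Lemma child_sub k t : hu (child k t) `<=` hu t.
Proof.
case: t => [[a b] c]; rewrite /hu /child.
have ha : hull3 a b c a := hull3_a a b c.
have hb : hull3 a b c b by apply: hull3_rot'; exact: hull3_a.
have hc : hull3 a b c c by apply: hull3_rot; exact: hull3_a.
have hab : hull3 a b c (cmid a b) := hull3_mid a b c.
have hbc : hull3 a b c (cmid b c) by apply: hull3_rot'; exact: hull3_mid.
have hca : hull3 a b c (cmid c a) by apply: hull3_rot; exact: hull3_mid.
by case: k => [[|[|[|[|k]]]] //= hk]; apply: hull3_sub.
Qed.

Lemma cmid_sub a b c : cabs (cmid a b - cmid a c) = cabs (b - c) / 2 :> R.
Proof.
rewrite /cmid /spath (_ : _ - _ = (1/2)%:C * (b - c)); last by ring.
by rewrite cabsM cabsR ger0_norm; [ring|lra].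
Qed.
Lemma cmid_subl a b : cabs (cmid a b - a) = cabs (b - a) / 2 :> R.
Proof.
rewrite /cmid /spath addrAC subrr add0r.
by rewrite cabsM cabsR ger0_norm; [ring|lra].
Qed.
Lemma cmid_subr a b : cabs (b - cmid a b) = cabs (b - a) / 2 :> R.
Proof. by rewrite cmid_sym cabs_distrC cmid_subl cabs_distrC. Qed.

Lemma child_perim k t : pr (child k t) = pr t / 2.
Proof.
case: t => [[a b] c]; rewrite /pr /child /perim.
have e1 := cmid_sub; have e2 := cmid_subl; have e3 := cmid_subr.
case: k => [[|[|[|[|k]]]] //= hk].
- by rewrite e2 (cmid_sym c a) e1 (cabs_distrC a) e2 (cabs_distrC c a) (cabs_distrC c b); field.
- by rewrite e3 e2 (cmid_sym a b) e1 (cabs_distrC a c); field.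
- by rewrite e3 (cmid_sym b c) e1 e2 (cabs_distrC b a) ; field.
- by rewrite (cmid_sym a b) e1 (cmid_sym b c) e1 (cmid_sym b a) (cmid_sym c a) e1 (cabs_distrC a c) (cabs_distrC b a) (cabs_distrC c b); field.
Qed.

Lemma tri_child a b c : (forall p, hull3 a b c p -> ccont f p) ->
  tri f a b c = \sum_(k < 4) tr (child k (a, b, c)).
Proof.
move=> cf.
have ha : hull3 a b c a := hull3_a a b c.
have hb : hull3 a b c b by apply: hull3_rot'; exact: hull3_a.
have hc : hull3 a b c c by apply: hull3_rot; exact: hull3_a.
have hab : hull3 a b c (cmid a b) := hull3_mid a b c.
have hbc : hull3 a b c (cmid b c) by apply: hull3_rot'; exact: hull3_mid.
have hca : hull3 a b c (cmid c a) by apply: hull3_rot; exact: hull3_mid.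
have C a' b' : hull3 a b c a' -> hull3 a b c b' -> seg_cont f a' b' := seg_cont_sub cf.
rewrite !big_ord_recl big_ord0 /tr /child /= /tri.
rewrite (seg_mid (C _ _ ha hb)) (seg_mid (C _ _ hb hc)) (seg_mid (C _ _ hc ha)).
rewrite (seg_rev (C _ _ hab hbc)) (seg_rev (C _ _ hbc hca)) (seg_rev (C _ _ hca hab)).
ring.
Qed.

Lemma tri_child_big t : (forall p, hu t p -> ccont f p) ->
  exists k, cabs (tr t) <= 4 * cabs (tr (child k t)).
Proof.
case: t => [[a b] c] cf; apply/existsP; rewrite -[X in is_true X]negbK negb_exists; apply/negP => /forallP h.
have h' k : 4 * cabs (tr (child k (a, b, c))) < cabs (tr (a, b, c)) by rewrite ltNge h.
have := tri_child cf; rewrite -[tri f a b c]/(tr (a, b, c)) => e.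
have : cabs (tr (a, b, c)) <= \sum_(k < 4) cabs (tr (child k (a, b, c))).
  rewrite {1}e; elim/big_rec2: _ => [|k y1 y2 _ IH]; first by rewrite cabs0.
  by rewrite (le_trans (cabsD _ _)) // lerD2l.
rewrite !big_ord_recl big_ord0.
by have h0 := h' ord0; have h1 := h' (lift ord0 ord0); have h2 := h' (lift ord0 (lift ord0 ord0));
  have h3 := h' (lift ord0 (lift ord0 (lift ord0 ord0))); lra.
Qed.

(** Repeated bisection: always keep a quarter carrying at least a fourth of the integral, and
    compare [f] with its affine approximation at the point common to all the triangles. *)
Theorem goursat a b c : (forall p, hull3 a b c p -> exists d, cder f p d) -> tri f a b c = 0.
Proof.
move=> df; have cf p : hull3 a b c p -> ccont f p by move=> /df [d /cder_cont].
have /choice [nx hnx] : forall t, exists k,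
    (forall p, hu t p -> ccont f p) -> cabs (tr t) <= 4 * cabs (tr (child k t)).
  move=> t; have [ct|ct] := pselect (forall p, hu t p -> ccont f p); last by exists ord0.
  by have [k hk] := tri_child_big ct; exists k.
pose tn n : T := iter n (fun t => child (nx t) t) (a, b, c).
have sub n m : (n <= m)%N -> hu (tn m) `<=` hu (tn n).
  elim: m => [|m IH]; first by rewrite leqn0 => /eqP ->.
  rewrite leq_eqVlt => /predU1P [->//|]; rewrite ltnS => /IH h p hp; apply: h.
  exact: child_sub hp.
have sub0 n : hu (tn n) `<=` hull3 a b c := sub 0%N n isT.
have prn n : pr (tn n) = perim a b c / 2 ^+ n.
  by elim: n => [|n IH]; rewrite ?expr0 ?divr1 // [LHS]child_perim IH exprS invfM mulrA mulrAC.
have trn n : cabs (tri f a b c) <= 4 ^+ n * cabs (tr (tn n)).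
  elim: n => [|n IH]; first by rewrite expr0 mul1r.
  rewrite (le_trans IH) // exprSr -mulrA ler_wpM2l ?exprn_ge0 //.
  by apply: hnx => p /sub0; exact: cf.
(* A cluster point of the first vertices: each triangle is closed and contains all later first
   vertices. *)
have [p [hp clp]] : exists p, hull3 a b c p /\ forall n, hu (tn n) p.
  have := @hull3_compact a b c ((fun n => (tn n).1.1 : R[i]^o) @ \oo) _.
  case; first by exists 0%N => // n _; apply: (sub0 n); exact: hull3_a.
  move=> p [hp clp]; exists p; split => // n.
  have cl : closed (hu (tn n)) by apply: compact_closed; [exact: hausdorffC|exact: hull3_compact].
  apply: cl => B hB.
  have hA : \forall m \near \oo, hu (tn n) (tn m).1.1.
    by exists n => // m /= nm; apply: (sub n m nm); exact: hull3_a.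
  by have [q hq] := clp _ B hA hB; exists q.
have [d [phi [hphi cphi phid]]] := df p hp.
have P0 : 0 <= perim a b c by rewrite !addr_ge0 ?cabs_ge0.
apply/eqP; rewrite -cabs_eq0 eq_le cabs_ge0 andbT.
apply/ler_addgt0Pr => e e0; rewrite add0r.
(* The factor [4 ^ n] from the bisection meets the square of the perimeter [perim / 2 ^ n], so the
   final bound is this tolerance times [perim ^ 2]; the 1 covers a degenerate triangle. *)
have e'0 : 0 < e / (1 + perim a b c ^+ 2) by rewrite divr_gt0 // ltr_pwDl // sqr_ge0.
have [r r0 hr] := cphi _ e'0.
have [n hn] : exists n, perim a b c / 2 ^+ n < r.
  exists (Num.trunc (perim a b c / r)).+1; set N := Num.trunc _.
  have h1 : perim a b c / r < N.+1%:R := truncnS_gt _.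
  have h2 : N.+1%:R <= (2 : R) ^+ N.+1.
    by rewrite -natrX ler_nat ltnW // ltn_expl.
  rewrite ltr_pdivrMr ?exprn_gt0 //; move: h1; rewrite ltr_pdivrMr // => h1.
  by apply: lt_le_trans h1 _; rewrite mulrC ler_wpM2l // ltW.
set t := tn n in hn.
have hpt q : hu t q -> cabs (q - p) < r by move=> hq; apply: le_lt_trans (hull3_dist hq (clp n)) _; rewrite -/(pr t) prn.
(* The affine approximation has the explicit primitive [G], so its integral around the small
   triangle is zero and may be subtracted. *)
pose g w := f p + d * (w - p).
have dg w : cder g w d.
  have := cderD (cder_cst (f p) w) (cderZ d (cderB (cder_id w) (cder_cst p w))).
  by rewrite add0r subr0 mulr1.
pose G w := f p * w + d * ((w - p) * (w - p)) / 2.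
have dG w : cder G w (g w).
  have h1 := cderB (cder_id w) (cder_cst p w).
  have h2 := cderM (cderZ d (cderM h1 h1)) (cder_cst 2^-1 w).
  have h3 := cderD (cderZ (f p) (cder_id w)) h2.
  by apply: cder_eq h3 _; rewrite /g; field.
have segG u v : seg g u v = G v - G u by apply: seg_primitive => s _; exact: dG.
have cg u v : seg_cont g u v by move=> s _; exact: cder_cont (dg _).
have bnd u v : hu t u -> hu t v -> cabs (seg f u v - seg g u v) <= e / (1 + perim a b c ^+ 2) * pr t * cabs (v - u).
  move=> hut hvt; have cfu : seg_cont f u v.
    by apply: (@seg_cont_sub t.1.1 t.1.2 t.2) => // q /sub0; exact: cf.
  rewrite -segB //; apply: seg_le.
    move=> s hs; apply: ccontD; first exact: cfu.
    by apply: ccontN; exact: cg.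
  move=> s hs; have hq : hu t (spath u v s).
    apply: (@hull3_sub _ _ _ u v v hut hvt hvt); exact: hull3_spath.
  rewrite (_ : f _ - g _ = (phi (spath u v s) - d) * (spath u v s - p)); last first.
    by rewrite /g mulrBl -hphi; ring.
  rewrite cabsM ler_pM ?cabs_ge0 //.
    by rewrite -phid ltW // ; apply: hr; exact: hpt.
  exact: hull3_dist hq (clp n).
have va : hu t t.1.1 := hull3_a _ _ _.
have vb : hu t t.1.2 by apply: hull3_rot'; exact: hull3_a.
have vc : hu t t.2 by apply: hull3_rot; exact: hull3_a.
have trg : tri g t.1.1 t.1.2 t.2 = 0 by rewrite /tri !segG; ring.
have key : cabs (tr t) <= e / (1 + perim a b c ^+ 2) * pr t * pr t.
  rewrite -[tr t]subr0 -trg /tr /tri.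
  rewrite (_ : _ - _ = (seg f t.1.1 t.1.2 - seg g t.1.1 t.1.2) + (seg f t.1.2 t.2 - seg g t.1.2 t.2) + (seg f t.2 t.1.1 - seg g t.2 t.1.1)); last by ring.
  rewrite (le_trans (cabsD _ _)) // (le_trans (lerD (cabsD _ _) (lexx _))) //.
  set K := e / _ * pr t.
  apply: le_trans (_ : K * cabs (t.1.2 - t.1.1) + K * cabs (t.2 - t.1.2) + K * cabs (t.1.1 - t.2) <= _); last by rewrite -!mulrDr.
  apply: lerD; last exact: (bnd t.2 t.1.1).
  by apply: lerD; [exact: (bnd t.1.1 t.1.2)|exact: (bnd t.1.2 t.2)].
apply: le_trans (trn n) _.
apply: le_trans (_ : 4 ^+ n * (e / (1 + perim a b c ^+ 2) * pr t * pr t) <= _).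
  by rewrite ler_wpM2l // exprn_ge0.
rewrite prn (_ : 4 ^+ n = 2 ^+ n * 2 ^+ n :> R); last by rewrite -exprMn; congr (_ ^+ _); ring.
have tw0 : 2 ^+ n != 0 :> R by rewrite expf_neq0.
rewrite (_ : _ * _ = e / (1 + perim a b c ^+ 2) * perim a b c ^+ 2); last by field; rewrite tw0 gt_eqF // ltr_pwDl // sqr_ge0.
have P2 : 0 < 1 + perim a b c ^+ 2 by rewrite ltr_pwDl // sqr_ge0.
by rewrite mulrAC ler_pdivrMr // ler_pM2l // lerDr ler01.
Qed.

End goursat.

Section primitives.
Variable R : realType.
Implicit Types (f : R[i] -> R[i]) (z w : R[i]).

(** Goursat on the triangle 0, [z], [w] identifies the increment of the radial integral with the
    integral over [[z, w]]. Every point of that triangle is a point of [[z, w]] scaled by a factor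
    in [[0, 1]], so the triangle stays in the star-shaped [U]. *)
Lemma star_primitive (U : set R[i]) f : (forall z, U z -> Cnear z U) ->
  (forall z s, U z -> 0 <= s <= 1 -> U (s%:C * z)) ->
  (forall z, U z -> exists d, cder f z d) -> forall z, U z -> cder (seg f 0) z (f z).
Proof.
move=> oU sU df z Uz; have [r0 r00 hU] := oU z Uz.
have sc w s : spath 0 w s = s%:C * w by rewrite /spath subr0 add0r.
have cU w : U w -> ccont f w by move=> /df[d /cder_cont].
have cf0 w : U w -> seg_cont f 0 w by move=> Uw s hs; rewrite sc; apply/cU/sU.
have ballU w s : cabs (w - z) < r0 -> 0 <= s <= 1 -> cabs (spath z w s - z) < r0 /\ cabs (spath z w s - z) <= cabs (w - z).
  move=> hw /andP[s0 s1]; rewrite /spath addrAC subrr add0r cabsM cabsR ger0_norm //.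
  have h : s * cabs (w - z) <= cabs (w - z) by rewrite ler_piMl ?cabs_ge0.
  by split => //; exact: le_lt_trans h hw.
have cfz w : cabs (w - z) < r0 -> seg_cont f z w.
  by move=> hw s hs; apply/cU/hU; have [] := ballU w s hw hs.
have key w : cabs (w - z) < r0 -> seg f 0 w - seg f 0 z = seg f z w.
  move=> hw; have Uw := hU _ hw.
  have := @goursat R f 0 z w; rewrite /tri (seg_rev (cf0 _ Uw)) => h.
  have {}h : seg f 0 z + seg f z w - seg f 0 w = 0.
    apply: h => p [x [y [v [[x0 y0 v0] s ->]]]]; apply: df.
    rewrite mulr0 add0r.
    have [yv|yv] := eqVneq (y + v) 0.
      have [-> ->] : y = 0 /\ v = 0 by split; lra.
      rewrite !mul0r addr0 (_ : 0 = 0%:C * z); last by rewrite mul0r.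
      by apply: sU => //; rewrite lexx ler01.
    have yv0 : 0 < y + v by rewrite lt_def yv addr_ge0.
    have yvC : (y + v)%:C != 0 by rewrite (inj_eq (@complexI R)).
    rewrite (_ : _ + _ = (y + v)%:C * spath z w (v / (y + v))); last first.
      rewrite /spath (rmorphM (real_complex R)) fmorphV mulrDr mulrA (mulrCA (y + v)%:C) mulfV // mulr1.
      by rewrite (rmorphD (real_complex R)); ring.
    apply: sU; last by apply/andP; split; lra.
    apply: hU; apply: (ballU w _ hw _).1.
    by rewrite divr_ge0 ?addr_ge0 //= ler_pdivrMr // mul1r; lra.
  by move/eqP: h; rewrite subr_eq0 => /eqP <-; ring.
exists (fun w => if w == z then f z else (seg f 0 w - seg f 0 z) / (w - z)); split; last by rewrite eqxx.
  move=> w; case: eqVneq => [->|ww]; first by rewrite !subrr mulr0.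
  by rewrite divfK // subr_eq0.
move=> e e0; rewrite eqxx; have e20 : 0 < e / 2 by rewrite divr_gt0.
have [r rp hr] := cU z Uz _ e20.
exists (Num.min r r0); first by rewrite lt_min rp.
move=> w; rewrite lt_min => /andP[h1 h2] /=.
case: eqVneq => [_|wz]; first by rewrite subrr cabs0.
have wz0 : w - z != 0 by rewrite subr_eq0.
rewrite key //.
have -> : f z = seg (fun=> f z) z w / (w - z).
  rewrite (@seg_primitive _ _ (fun v => f z * v)) ?mulrBr //; first by field.
  by move=> s _; apply: cder_eq (cderZ (f z) (cder_id _)) _; rewrite mulr1.
rewrite -mulrBl -segB; [|exact: cfz|by move=> s _; exact: ccont_cst].
rewrite cabsM cabsV ltr_pdivrMr ?cabs_gt0 //.
apply: (@le_lt_trans _ _ (e / 2 * cabs (w - z))).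
  apply: seg_le.
    by move=> s hs; apply: ccontD; [exact: cfz|exact: ccont_cst].
  move=> s hs; rewrite ltW //; apply: hr.
  by apply: le_lt_trans h1; have [] := ballU w s h2 hs.
rewrite ltr_pM2r ?cabs_gt0 //; lra.
Qed.

End primitives.

(** * Rigidity of the height of a rectangle *)

Section rectangles.
Variable R : realType.
Implicit Types (k f : R[i] -> R[i]) (z w : R[i]) (e h r : R) (A : set R[i]).

Definition cwithin A k := forall z, A z -> forall e, 0 < e ->
  exists2 r, 0 < r & forall w, A w -> cabs (w - z) < r -> cabs (k w - k z) < e.

Lemma cwithinP A k : cwithin A k <-> {within (A : set R[i]^o), continuous (k : R[i]^o -> R[i]^o)}.
Proof.
split.
  move=> h; apply/(@subspace_continuousP R[i]^o) => z Az.
  apply/(continuousCP _ _ (within_filter _ (nbhs_filter (z : R[i]^o)))) => e e0.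
  have [r r0 hr] := h z Az e e0.
  by apply/nbhsCP; exists r => // w h1 Aw; exact: hr.
move=> /(@subspace_continuousP R[i]^o) h z Az e e0.
have /(continuousCP _ _ (within_filter _ (nbhs_filter (z : R[i]^o))))/(_ e e0) := h z Az.
by move=> /nbhsCP [r r0 hr]; exists r => // w Aw hw; exact: hr.
Qed.

Lemma ccont_within A k : (forall z, A z -> ccont k z) -> cwithin A k.
Proof. by move=> h z /h hz e /hz[r r0 hr]; exists r => // w _; exact: hr. Qed.

Lemma compact_uniform A k : compact (A : set R[i]^o) -> cwithin A k -> forall e, 0 < e ->
  exists2 r, 0 < r & forall z w, A z -> A w -> cabs (w - z) < r -> cabs (k w - k z) < e.
Proof.
move=> /compact_near_coveringP cA ck e e0; have e20 : 0 < e / 2 by rewrite divr_gt0.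
pose P (d : R) z := A z -> forall w, A w -> cabs (w - z) < d -> cabs (k w - k z) < e.
have := cA R (0 : R)^'+ P (at_right_proper_filter 0) _.
case.
  move=> z Az; have [r r0 hr] := ck z Az _ e20; have r20 : 0 < r / 2 by rewrite divr_gt0.
  exists ([set w | cabs (w - z) < r / 2], [set d | d < r / 2]) => /=.
    split; first by apply/nbhsCP; exists (r / 2).
    by apply: nbhs_right_lt.
  move=> [z' d] /= [h1 h2] Az' w Aw hw.
  rewrite (_ : k w - k z' = (k w - k z) + (k z - k z')); last by ring.
  rewrite (le_lt_trans (cabsD _ _)) // (splitr e) ltrD //; last first.
    by rewrite cabs_distrC; apply: hr => //; lra.
  apply: hr => //; rewrite (_ : w - z = (w - z') + (z' - z)); last by ring.
  by rewrite (le_lt_trans (cabsD _ _)) //; lra.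
move=> r /= r0 hr; exists (r / 2); first by rewrite divr_gt0.
move=> z w Az Aw hw; apply: (hr (r / 2)) => //=; last by rewrite divr_gt0.
rewrite sub0r normrN ger0_norm; lra.
Qed.

(** The integral of [k] around the rectangle is zero. Its imaginary part receives 0 from the bottom
    and left edges, [h] from the right edge, where [Re k = 1], and [- h'] from the top, where
    [Im k = h']. As [k] is only continuous on the boundary, Cauchy's theorem is applied to a
    slightly smaller rectangle. *)
Lemma rectangle_height k h h' : 0 < h ->
  cwithin (closed_rectangle h) k ->
  (forall z, open_rectangle h z -> exists d, cder k z d) ->
  (forall z, closed_rectangle h z -> Re z = 0 -> Re (k z) = 0) ->
  (forall z, closed_rectangle h z -> Re z = 1 -> Re (k z) = 1) ->
  (forall z, closed_rectangle h z -> Im z = 0 -> Im (k z) = 0) ->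
  (forall z, closed_rectangle h z -> Im z = h -> Im (k z) = h') -> h' = h.
Proof.
move=> h0 ck dk kl kr kb kt.
have cpt : compact (closed_rectangle h : set R[i]^o) by exact: compact_Crectangle.
(* The bracket collects an error [e] per unit of length on the four edges and the shortening of each
   edge by [2 * d], where [d <= e]. *)
suff H e : 0 < e -> `|h' - h| <= e * (4 + 2 * h + 2 * `|h'|).
  apply/eqP; rewrite -subr_eq0 -normr_eq0 eq_le normr_ge0 andbT.
  apply/ler_addgt0Pr => e e0; rewrite add0r.
  have c0 : 0 < 4 + 2 * h + 2 * `|h'| by have := normr_ge0 h'; lra.
  by have := H _ (divr_gt0 e0 c0); rewrite divfK // gt_eqF.
move=> e0; have [r r0 hr] := compact_uniform cpt ck e0.
(* The inset of the inner rectangle: below the radius of uniform continuity, and small enough to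
   leave a nondegenerate rectangle. *)
pose d := Num.min (Num.min (r / 2) (e / 2)) (Num.min (1 / 4) (h / 4)).
have [d0 dr de d1 dh] : [/\ 0 < d, d < r, d <= e, d < 1 / 2 & d < h / 2].
  have d1 : d <= r / 2 by rewrite /d !ge_min lexx.
  have d2 : d <= e / 2 by rewrite /d !ge_min lexx orbT.
  have d3 : d <= 1 / 4 by rewrite /d !ge_min lexx !orbT.
  have d4 : d <= h / 4 by rewrite /d !ge_min lexx !orbT.
  by split; [rewrite /d !lt_min !divr_gt0|lra..].
pose a : R[i] := d +i* d; pose b : R[i] := (1 - d) +i* d.
pose c : R[i] := (1 - d) +i* (h - d); pose q : R[i] := d +i* (h - d).
have opq z : d <= Re z <= 1 - d -> d <= Im z <= h - d -> open_rectangle h z.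
  by move=> /andP[x1 x2] /andP[y1 y2]; split; apply/andP; split; lra.
have hullo a' b' c' z : (forall v, v \in [:: a'; b'; c'] -> d <= Re v <= 1 - d /\ d <= Im v <= h - d) ->
    hull3 a' b' c' z -> open_rectangle h z.
  move=> hv [x [y [t [[x1 y1 t1] s ->]]]].
  have [/andP[a1 a2] /andP[a3 a4]] := hv a' (mem_head _ _).
  have /hv [/andP[b1 b2] /andP[b3 b4]] : b' \in [:: a'; b'; c'] by rewrite !inE eqxx orbT.
  have /hv [/andP[c1 c2] /andP[c3 c4]] : c' \in [:: a'; b'; c'] by rewrite !inE eqxx !orbT.
  have xe : x = 1 - y - t by lra.
  by apply: opq; rewrite !ReImE !mul0r ?subr0 ?addr0; subst x; clear -a1 a2 a3 a4 b1 b2 b3 b4 c1 c2 c3 c4 x1 y1 t1; apply/andP; split; nra.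
have va : d <= Re a <= 1 - d /\ d <= Im a <= h - d by clear -d0 d1 dh; split; apply/andP; split => /=; lra.
have vb : d <= Re b <= 1 - d /\ d <= Im b <= h - d by clear -d0 d1 dh; split; apply/andP; split => /=; lra.
have vc : d <= Re c <= 1 - d /\ d <= Im c <= h - d by clear -d0 d1 dh; split; apply/andP; split => /=; lra.
have vq : d <= Re q <= 1 - d /\ d <= Im q <= h - d by clear -d0 d1 dh; split; apply/andP; split => /=; lra.
(* The inner rectangle is cut along its diagonal [a c] into two triangles; the two integrals over
   the diagonal cancel in [sum0]. *)
have g1 : tri k a b c = 0.
  apply: goursat => z hz; apply: dk; apply: hullo hz => v.
  by rewrite !inE => /or3P[] /eqP ->.
have g2 : tri k a c q = 0.
  apply: goursat => z hz; apply: dk; apply: hullo hz => v.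
  by rewrite !inE => /or3P[] /eqP ->.
have sc u v : (d <= Re u <= 1 - d /\ d <= Im u <= h - d) -> (d <= Re v <= 1 - d /\ d <= Im v <= h - d) ->
    forall s, 0 <= s <= 1 -> open_rectangle h (spath u v s).
  move=> hu hv s hs; apply: (hullo u v v); last exact: hull3_spath.
  by move=> w; rewrite !inE => /or3P[] /eqP ->.
have co u v : (d <= Re u <= 1 - d /\ d <= Im u <= h - d) -> (d <= Re v <= 1 - d /\ d <= Im v <= h - d) ->
    seg_cont k u v.
  by move=> hu hv s hs; have [D /cder_cont] := dk _ (sc u v hu hv s hs).
have sum0 : seg k a b + seg k b c + seg k c q + seg k q a = 0.
  move: g1 g2; rewrite /tri (seg_rev (co _ _ va vc)) => g1 g2.
  by rewrite -[RHS]addr0 -{1}g1 -g2; ring.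
have ocl z : open_rectangle h z -> closed_rectangle h z.
  by move=> [/andP[x1 x2] /andP[y1 y2]]; split; apply/andP; split; exact: ltW.
have near_bdry u z : closed_rectangle h u -> closed_rectangle h z ->
    (Re z - Re u) ^+ 2 + (Im z - Im u) ^+ 2 = d ^+ 2 ->
    `|Re (k z) - Re (k u)| <= e /\ `|Im (k z) - Im (k u)| <= e.
  move=> hu hz zu'; have zu : cabs (z - u) = d by rewrite cabsE ReB ImB zu' sqrtr_sqr gtr0_norm.
  have hk : cabs (k z - k u) < e by apply: hr => //; rewrite zu.
  by split; rewrite -?ReB -?ImB ltW //; [exact: le_lt_trans (cabs_Re _) hk|exact: le_lt_trans (cabs_Im _) hk].
have bot s : 0 <= s <= 1 -> `|Im (k (spath a b s))| <= e.
  move=> hs; have ho := sc _ _ va vb _ hs; set z := spath a b s in ho *.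
  have zi : Im z = d by rewrite /z /spath /a /b !ReImE /= subrr !mulr0 mul0r !addr0.
  have [[/andP[x1 x2] _]] := ocl _ ho.
  have hu : closed_rectangle h (Re z +i* 0) by split; rewrite /= ?x1 ?x2 ?lexx ?ltW.
  have [|_] := near_bdry _ z hu (ocl _ ho).
    by rewrite zi /=; ring.
  by rewrite (kb _ hu) // subr0.
have top s : 0 <= s <= 1 -> `|Im (k (spath c q s)) - h'| <= e.
  move=> hs; have ho := sc _ _ vc vq _ hs; set z := spath c q s in ho *.
  have zi : Im z = h - d by rewrite /z /spath /c /q !ReImE /= subrr !mulr0 mul0r !addr0.
  have [[/andP[x1 x2] _]] := ocl _ ho.
  have hu : closed_rectangle h (Re z +i* h) by split; rewrite /= ?x1 ?x2 ?lexx ?ltW.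
  have [|_] := near_bdry _ z hu (ocl _ ho).
    by rewrite zi /=; ring.
  by rewrite (kt _ hu).
have lft s : 0 <= s <= 1 -> `|Re (k (spath q a s))| <= e.
  move=> hs; have ho := sc _ _ vq va _ hs; set z := spath q a s in ho *.
  have zi : Re z = d by rewrite /z /spath /a /q !ReImE /= subrr !mulr0 mul0r subr0 addr0.
  have [[_ /andP[x1 x2]]] := ocl _ ho.
  have hu : closed_rectangle h (0 +i* Im z) by split; rewrite /= ?x1 ?x2 ?lexx ?ler01.
  have [|+ _] := near_bdry _ z hu (ocl _ ho).
    by rewrite zi /=; ring.
  by rewrite (kl _ hu) // subr0.
have rgt s : 0 <= s <= 1 -> `|Re (k (spath b c s)) - 1| <= e.
  move=> hs; have ho := sc _ _ vb vc _ hs; set z := spath b c s in ho *.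
  have zi : Re z = 1 - d by rewrite /z /spath /b /c !ReImE /= subrr !mulr0 mul0r subr0 addr0.
  have [[_ /andP[x1 x2]]] := ocl _ ho.
  have hu : closed_rectangle h (1 +i* Im z) by split; rewrite /= ?x1 ?x2 ?lexx ?ler01.
  have [|+ _] := near_bdry _ z hu (ocl _ ho).
    by rewrite zi /=; ring.
  by rewrite (kr _ hu).
pose L : R := 1 - 2 * d; pose H : R := h - 2 * d.
have L0 : 0 < L by rewrite /L; clear -d1; lra.
have H0 : 0 < H by rewrite /H; clear -dh; lra.
have ba : b - a = L +i* 0 by apply: Cext; rewrite /b /a /L !ReImE; ring.
have cb : c - b = 0 +i* H by apply: Cext; rewrite /b /c /H !ReImE; ring.
have qc : q - c = (- L) +i* 0 by apply: Cext; rewrite /q /c /L !ReImE; ring.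
have aq : a - q = 0 +i* (- H) by apply: Cext; rewrite /q /a /H !ReImE; ring.
have imr (x : R) (K : R[i]) : Im ((x +i* 0) * K) = x * Im K by rewrite ImM mul0r addr0.
have imi (x : R) (K : R[i]) : Im ((0 +i* x) * K) = x * Re K by rewrite ImM mul0r add0r.
have bd (u v : R[i]) (m M : R) : seg_cont k u v ->
    (forall s, 0 <= s <= 1 -> m <= Im ((v - u) * k (spath u v s)) <= M) -> m <= Im (seg k u v) <= M.
  move=> cs hs; apply/andP; split.
    rewrite -lerN2.
    have -> : - Im (seg k u v) = Re (iC * seg k u v) by rewrite ReM /=; ring.
    apply: seg_Re_le => // s /hs /andP[h1 _].
    by rewrite (_ : Re _ = - Im ((v - u) * k (spath u v s))) ?lerN2 // ReM /=; ring.
  have -> : Im (seg k u v) = Re (- iC * seg k u v) by rewrite ReM /=; ring.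
  apply: seg_Re_le => // s /hs /andP[_ h2].
  by rewrite (_ : Re _ = Im ((v - u) * k (spath u v s))) // ReM /=; ring.
have B1 : - (L * e) <= Im (seg k a b) <= L * e.
  apply: bd; first exact: co.
  move=> s hs; have := bot s hs; rewrite ler_norml => /andP[h1 h2].
  by rewrite ba imr -mulrN !ler_pM2l // h1.
have B2 : H * (1 - e) <= Im (seg k b c) <= H * (1 + e).
  apply: bd; first exact: co.
  move=> s hs; have := rgt s hs; rewrite ler_norml => /andP[h1 h2].
  by rewrite cb imi !ler_pM2l //; clear -h1 h2; apply/andP; split; lra.
have B3 : - (L * (h' + e)) <= Im (seg k c q) <= - (L * (h' - e)).
  apply: bd; first exact: co.
  move=> s hs; have := top s hs; rewrite ler_norml => /andP[h1 h2].
  by rewrite qc imr mulNr !lerN2 !ler_pM2l //; clear -h1 h2; apply/andP; split; lra.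
have B4 : - (H * e) <= Im (seg k q a) <= H * e.
  apply: bd; first exact: co.
  move=> s hs; have := lft s hs; rewrite ler_norml => /andP[h1 h2].
  rewrite aq imi mulNr; apply/andP; split; first by rewrite lerN2 ler_pM2l.
  by rewrite lerNl -mulrN ler_pM2l.
have := congr1 (@complex.Im R) sum0; rewrite !ImD Im0 => S.
have n1 : h' <= `|h'| := ler_norm _; have n2 : - h' <= `|h'| by rewrite -normrN ler_norm.
have dn : d * `|h'| <= e * `|h'| by rewrite ler_wpM2r.
have p1 : d * h' <= d * `|h'| by rewrite ler_wpM2l // ltW.
have p2 : - (d * h') <= d * `|h'| by rewrite -mulrN ler_wpM2l // ltW.
have eh : 0 <= e * h by rewrite mulr_ge0 // ltW.
have ed : 0 <= e * d by rewrite mulr_ge0 // ltW.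
move: B1 B2 B3 B4; rewrite /L /H => /andP[b1 b1'] /andP[b2 b2'] /andP[b3 b3'] /andP[b4 b4'].
rewrite ler_norml; clear -S b1 b1' b2 b2' b3 b3' b4 b4' n1 n2 dn p1 p2 eh ed e0 d0 de d1 dh.
by apply/andP; split; lra.
Qed.

End rectangles.

(** * The Schwarz-Christoffel product *)

Section convex_turning.
Variable R : realType.
Implicit Types (h rho w : R -> R) (x y t : R).

(* A closed curve whose direction turns monotonically once around stays on one side of each of its tangent lines. *)
Lemma convex_turn h rho w t : (forall x, is_derive x 1 h (rho x * sin (w x - w t))) ->
  (forall x, 0 < rho x) -> (forall x y, x < y -> w y < w x) ->
  w (t + 2 * pi) = w t - 2 * pi -> h (t + 2 * pi) = h t ->
  forall x, t < x < t + 2 * pi -> h x < h t.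
Proof.
move=> dh rho0 dec wp hp x /andP[tx xt].
have ch y : {for y, continuous h}.
  exact: derive_cont (dh y).
have cw a b : {within `[a, b], continuous h} by apply: continuous_subspaceT => y; exact: ch.
have cwN a b : {within `[a, b], continuous (fun y => - h y)}.
  by apply: continuous_subspaceT => y; apply: cvgN; exact: ch.
have pi0 := pi_gt0 R.
have [hw|hw] := lerP (- pi) (w x - w t).
  rewrite -ltrN2; apply: (@derive_gt0_lt R (fun y => - h y) (fun y => - (rho y * sin (w y - w t)))) => //.
  move=> y /andP[ty yx]; rewrite -mulrN mulr_gt0 // -sinN sin_gt0_pi // opprB.
  by have h1 := dec _ _ ty; have h2 := dec _ _ yx; apply/andP; split; lra.
rewrite -hp; apply: (@derive_gt0_lt R h (fun y => rho y * sin (w y - w t))) => //.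
move=> y /andP[xy yt]; rewrite mulr_gt0 //.
have h1 := dec _ _ xy; have h2 := dec _ _ yt; rewrite wp in h2.
rewrite -sinD2pi sin_gt0_pi //; apply/andP; rewrite -mulr_natl; split; lra.
Qed.

End convex_turning.

Section sc_product.
Variable R : realType.
Variables (n : nat) (a th : 'I_n -> R).
Implicit Types (z w : R[i]) (k : 'I_n) (x r : R).

Definition vtx k : R[i] := cis (th k).
Definition fac k z : R[i] := 1 - z * cis (- th k).
(** The plane cut along the outward rays from the prevertices: open, star-shaped about 0, and
    containing the closed disc without the prevertices, so one branch of the product serves up to
    the boundary. *)
Definition Om : set R[i] := [set z | forall k, slit (fac k z)].
Definition scL z : R[i] := \sum_k (a k)%:C * Clog (fac k z).
Definition scP z : R[i] := Cexp (scL z).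
Definition scLp z : R[i] := \sum_k (a k)%:C * (- cis (- th k) / fac k z).

(** [- w / (1 - w) = 1 - 1 / (1 - w)], and [1 / (1 - w)] maps the disc into the half-plane of real
    part above 1/2. This is the estimate behind the monotone turning. *)
Lemma Re_geom w : cabs w < 1 -> Re (- w / (1 - w)) < 1 / 2.
Proof.
move=> w1; have w0 : 1 - w != 0.
  by apply: contraTneq w1 => /eqP; rewrite subr_eq0 => /eqP <-; rewrite cabs1 ltxx.
have w2 : Re w ^+ 2 + Im w ^+ 2 < 1 by rewrite -cabs_sqr expr_lt1 // cabs_ge0.
have f2 : 0 < cabs (1 - w) ^+ 2 by rewrite exprn_gt0 // cabs_gt0.
have -> : - w / (1 - w) = - w * conjc (1 - w) * ((cabs (1 - w) ^+ 2)^-1)%:C.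
  have c0 : conjc (1 - w) != 0 by rewrite conjc_eq0.
  by rewrite rCV -mulJ_cabs invfM -[RHS]mulrA (mulrCA (conjc _)) divff // mulr1.
rewrite ReM ReC ImC mulr0 subr0 -ltr_pdivlMr ?invr_gt0 // invrK cabs_sqr !ReImE.
by case: w w2 {w1 w0 f2} => x y /=; nra.
Qed.

Lemma slitP z : slit z <-> (Im z != 0 \/ 0 < Re z).
Proof.
rewrite /slit; split.
  have [i0|i0] := eqVneq (Im z) 0; last by left.
  move=> h; right; move: h; rewrite cabsE i0 expr0n addr0 sqrtr_sqr.
  by case: (lerP (Re z) 0) => // hr; rewrite ler0_norm // addNr ltxx.
case=> [i0|r0]; last by rewrite ltr_wpDl // cabs_ge0.
have h : `|Re z| < cabs z.
  rewrite -(@ltr_pXn2r _ 2) ?nnegrE ?cabs_ge0 ?normr_ge0 // cabs_sqr -normrX ger0_norm ?sqr_ge0 //.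
  by rewrite ltrDl lt_def sqr_ge0 andbT sqrf_eq0.
by have := ler_norm (- Re z); rewrite normrN; lra.
Qed.

Lemma cder_fac k z : cder (fac k) z (- cis (- th k)).
Proof.
have := cderB (cder_cst 1 z) (cderM (cder_id z) (cder_cst (cis (- th k)) z)).
by rewrite mulr0 addr0 mul1r sub0r.
Qed.

Lemma fac_dist k z : cabs (fac k z) = cabs (z - vtx k).
Proof.
rewrite -[RHS]mulr1 -(cabs_cis (- th k)) -cabsM mulrBl -cisD subrr cis0.
by rewrite cabs_distrC.
Qed.

Lemma fac_Re k z : 1 - cabs z <= Re (fac k z).
Proof.
rewrite /fac ReB Re1 lerD2l lerN2 (le_trans (Re_le_cabs _)) //.
by rewrite cabsM cabs_cis mulr1.
Qed.

Lemma Om_disc z : cabs z < 1 -> Om z.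
Proof. by move=> z1 k; apply: slit_Re; apply: lt_le_trans (fac_Re k z); lra. Qed.

Lemma Om_closed_disc z : cabs z <= 1 -> (forall k, z != vtx k) -> Om z.
Proof.
move=> z1 hz k; apply: slit_Re_ge0; first by apply: le_trans (fac_Re k z); lra.
by rewrite -cabs_gt0 fac_dist cabs_gt0 subr_eq0.
Qed.

Lemma Om_near z : Om z -> Cnear z Om.
Proof.
move=> oz; have h k : Cnear z [set w | slit (fac k w)].
  have [r r0 hr] := slit_near (oz k); have [s s0 hs] := cder_cont (cder_fac k z) r0.
  by exists s => // w /hs; exact: hr.
have H := @filter_forall _ _ (fun k w => slit (fac k w)) (Cnear z) _ h.
exact: H (Cnear_filter z).
Qed.

Lemma Om_star z s : Om z -> 0 <= s <= 1 -> Om (s%:C * z).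
Proof.
(* Each factor at [s z] is a convex combination of 1 and the factor at [z], and the slit plane is
   star-shaped about 1. *)
move=> oz /andP[s0 s1] k; have /slitP := oz k.
have -> : fac k (s%:C * z) = (1 - s)%:C + s%:C * fac k z.
  by rewrite /fac (rmorphB (real_complex R)) (rmorph1 (real_complex R)); ring.
move: (fac k z) => u h; apply/slitP; move: s0; rewrite le_eqVlt => /predU1P [<-|s0].
  by right; rewrite !ReImE !mul0r !subr0 addr0.
case: h => h; [left|right]; rewrite !ReImE !mul0r ?addr0 ?subr0 ?add0r ?addr0.
  by rewrite mulf_neq0 // gt_eqF.
by apply: ltr_wpDl; [lra|rewrite mulr_gt0].
Qed.

Lemma Om0 : Om 0. Proof. by apply: Om_disc; rewrite cabs0. Qed.

Lemma fac_neq0 k z : Om z -> fac k z != 0.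
Proof. by move=> /(_ k) /slit_neq0. Qed.

Lemma cder_scL z : Om z -> cder scL z (scLp z).
Proof.
move=> oz; apply: cder_sum => k; apply: cderZ.
by apply: cder_eq (cder_comp (cder_fac k z) (cder_Clog (oz k))) _; rewrite mulrC.
Qed.

Lemma cder_scP z : Om z -> cder scP z (scP z * scLp z).
Proof. by move=> oz; exact: cder_comp (cder_scL oz) (cder_Cexp _). Qed.

Lemma scP0 : scP 0 = 1.
Proof.
rewrite /scP /scL big1 ?Cexp0 // => k _.
rewrite /fac mul0r subr0 /Clog cabs1 ln1 (_ : Im 1 = 0) // mul0r atan0 mulr0.
by apply: Cext; rewrite !ReImE !mulr0 ?subr0 ?addr0.
Qed.

Lemma cabs_scP z : cabs (scP z) = expR (\sum_k a k * ln (cabs (fac k z))).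
Proof.
rewrite cabs_Cexp; congr expR; rewrite /scL.
elim/big_rec2: _ => [//|k x y _ <-]; rewrite ReD; congr (_ + _).
by rewrite !ReImE mul0r subr0.
Qed.

Lemma scP_primitive z : Om z -> cder (seg scP 0) z (scP z).
Proof.
apply: (star_primitive Om_near); first by move=> w s; exact: Om_star.
by move=> w /cder_scP; exists (scP w * scLp w).
Qed.

End sc_product.

Lemma min_max_sign (R : realType) (kap r x s : R) : kap = 1 \/ kap = -1 -> 0 < kap * (x - r) ->
  Num.min r x <= s <= Num.max r x -> s != r -> 0 < kap * (s - r).
Proof.
move=> [->|->]; rewrite ?mul1r ?mulN1r ?oppr_gt0 ?subr_gt0 ?subr_lt0 => rx /andP[h1 h2] sr.
  by move: h1; rewrite (min_l (ltW rx)) lt_neqAle eq_sym sr.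
by move: h2; rewrite (max_l (ltW rx)) lt_neqAle sr.
Qed.

(** * Convexity and nesting of the images of circles *)

Section nesting.
Variable R : realType.
Variables (n : nat) (a th : 'I_n -> R) (kap : R) (F V : R[i] -> R[i]).
Implicit Types (z w c : R[i]) (k : 'I_n) (r x y t : R).
Local Notation L := (scL a th).
Local Notation P := (scP a th).
Local Notation Om := (Om th).
Hypothesis kap2 : kap * kap = 1.
Hypothesis akap : forall k, 0 < kap * a k.
Hypothesis suma : \sum_k a k = 2 * kap.
Hypothesis VE : forall r x, 0 < r -> V (r%:C * cis x) = Cexp ((- kap * ln r) +i* (- kap * x)) * P (r%:C * cis x).
Hypothesis dF : forall z, Om z -> z != 0 -> cder F z (V z / z).

Let kap_pm : kap = 1 \/ kap = -1.
Proof.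
have : (kap - 1) * (kap + 1) = 0 by rewrite mulrDr !mulrDl kap2; ring.
by move/eqP; rewrite mulf_eq0 subr_eq0 addr_eq0 => /orP [/eqP h|/eqP h]; [left|right].
Qed.

Definition circ r x : R[i] := r%:C * cis x.
(** A continuous argument of [V] on the circle of radius [r]. The derivative of [F (circ r x)] in
    [x] is [i V], so this is the tangent direction of the image curve up to a quarter turn. *)
Definition vrg r x : R := - kap * x + Im (L (circ r x)).

Lemma cabs_circ r x : 0 <= r -> cabs (circ r x) = r.
Proof. by move=> r0; rewrite cabsM cabs_cis mulr1 cabsR ger0_norm. Qed.

Lemma circ_neq0 r x : 0 < r -> circ r x != 0.
Proof. by move=> r0; rewrite -cabs_gt0 cabs_circ // ltW. Qed.

Lemma cis2pi x : cis (x + 2 * pi) = cis x :> R[i].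
Proof. by rewrite cisD mulr_natl /cis cos2pi -[pi *+ 2]add0r sinD2pi sin0 mulr1. Qed.

Lemma circ2pi r x : circ r (x + 2 * pi) = circ r x.
Proof. by rewrite /circ cis2pi. Qed.

Lemma pder_circ r x : pder (circ r) x (iC * circ r x).
Proof. by apply: pder_eq (pderZ r%:C (pder_cis x)) _; rewrite mulrCA. Qed.

Lemma polar_unit z : cabs z = 1 -> exists2 x, 0 <= x < 2 * pi & z = cis x.
Proof.
move=> z1; have pi0 := pi_gt0 R.
have [s|/negP] := boolP (slit z); last first.
  move=> s; exists pi; first by apply/andP; split; lra.
  have hr : Re z <= 0 /\ Im z = 0.
    have [i0|i0] := eqVneq (Im z) 0; last by case: s; apply/slitP; left.
    by split => //; case: (lerP (Re z) 0) => // h; case: s; apply/slitP; right.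
  have [h1 h2] := hr; have := cabs_sqr z; rewrite z1 h2 expr0n addr0 expr1n => h3.
  have h4 : (Re z - 1) * (Re z + 1) = 0 by transitivity (Re z ^+ 2 - 1); [ring|rewrite -h3 subrr].
  have h5 : Re z = -1.
    by move/eqP: h4; rewrite mulf_eq0 => /orP [/eqP h|/eqP h]; lra.
  by apply: Cext; rewrite /cis /= ?cospi ?sinpi.
have zE := ClogK s; have hI := Clog_Im z; set y := Im (Clog z) in hI *.
have zc : z = cis y.
  by rewrite -{1}zE /Cexp -/y /Clog /= z1 ln1 expR0 mul1r.
move: hI; rewrite ltr_norml => /andP[h1 h2].
have [y0|y0] := lerP 0 y; first by exists y => //; apply/andP; split; lra.
by exists (y + 2 * pi); [apply/andP; split; lra|rewrite cis2pi].
Qed.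

(** The parameter [kap * x] reverses the circle when [kap = -1], so that the tangent turns clockwise
    in both cases and [convex_turn] applies to both. *)
Lemma circ_from t z : 0 < cabs z -> exists2 x, t <= x < t + 2 * pi & z = circ (cabs z) (kap * x).
Proof.
move=> z0; set r := cabs z in z0 *.
pose u := z / circ r (kap * t).
have rC : r%:C != 0 by rewrite (inj_eq (@complexI R)) gt_eqF.
have u1 : cabs u = 1 by rewrite cabsM cabsV cabs_circ ?ltW // divff // gt_eqF.
have zu : z = circ r (kap * t) * u by rewrite /u mulrC divfK // circ_neq0.
have kk := kap_pm.
have [x hx ux] : exists2 x, 0 <= x < 2 * pi & u = cis (kap * x).
  case: kk => ->.
    by have [x hx ->] := polar_unit u1; exists x; rewrite ?mul1r.
  have uJ : cabs (conjc u) = 1 by rewrite cabsJ.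
  have [x hx hu] := polar_unit uJ; exists x => //.
  by rewrite mulN1r cisN -hu conjcK.
exists (t + x); first by move: hx => /andP[h1 h2]; apply/andP; split; lra.
by rewrite zu ux /circ -mulrA -cisD mulrDr.
Qed.

Lemma Om_circ r x : 0 < r < 1 -> Om (circ r x).
Proof. by move=> /andP[r0 r1]; apply: Om_disc; rewrite cabs_circ // ltW. Qed.

Lemma V_polar r x : 0 < r -> V (circ r x) = (cabs (V (circ r x)))%:C * cis (vrg r x).
Proof.
move=> r0; rewrite VE // -/(circ r x) /scP -CexpD cabs_Cexp [LHS]/Cexp.
by congr (_ * cis _); rewrite ImD.
Qed.

Lemma V_neq0 r x : 0 < r -> V (circ r x) != 0.
Proof. by move=> r0; rewrite VE // mulf_neq0 // Cexp_neq0. Qed.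

Lemma vrg2pi r x : vrg r (x + 2 * pi) = vrg r x - 2 * pi * kap.
Proof. by rewrite /vrg circ2pi; ring. Qed.

Lemma derive_vrg r x : 0 < r < 1 ->
  is_derive x 1 (vrg r) (- kap + Re (circ r x * scLp a th (circ r x))).
Proof.
move=> hr; have o := Om_circ x hr.
have h1 := pder_Im (pder_comp (pder_circ r x) (cder_scL a o)).
have h2 := is_deriveD (is_derive_linear (- kap) x) h1.
by apply: is_derive_eq h2 _; rewrite !ReImE /=; ring.
Qed.

(** By [Re_geom] each prevertex contributes less than [kap * a k / 2]; these weights are positive
    and their sum is exactly the 1 to be beaten. *)
Lemma vrg_deriv_lt0 r x : 0 < r < 1 -> (0 < n)%N ->
  kap * (- kap + Re (circ r x * scLp a th (circ r x))) < 0.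
Proof.
move=> hr n0; set z := circ r x.
have z1 : cabs z < 1 by rewrite cabs_circ; move: hr => /andP[]; [|lra].
have key k : Re (z * (- cis (- th k) / fac th k z)) < 1 / 2.
  have -> : z * (- cis (- th k) / fac th k z) = - (z * cis (- th k)) / (1 - z * cis (- th k)).
    by rewrite mulrA mulrN.
  by apply: Re_geom; rewrite cabsM cabs_cis mulr1.
have ReS : Re (z * scLp a th z) = \sum_k a k * Re (z * (- cis (- th k) / fac th k z)).
  rewrite /scLp mulr_sumr; elim/big_rec2: _ => [//|k y1 y2 _ <-]; rewrite ReD; congr (_ + _).
  by rewrite mulrCA ReCM.
rewrite mulrDr mulrN kap2 ReS mulr_sumr addrC subr_lt0.
have e1 : \sum_k kap * a k * (1 / 2) = 1.
  by rewrite -mulr_suml -mulr_sumr suma -[RHS]kap2; field.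
rewrite -[ltRHS]e1; apply: ltr_sum => [|k _].
  by apply/hasP; exists (Ordinal n0); rewrite ?mem_index_enum.
by rewrite mulrA ltr_pM2l.
Qed.

Hypothesis n_gt0 : (0 < n)%N.

Lemma vrg_dec r x y : 0 < r < 1 -> x < y -> vrg r (kap * y) < vrg r (kap * x).
Proof.
move=> hr xy; rewrite -ltrN2.
have d t : is_derive t 1 (fun t => - vrg r (kap * t)) (- (kap * (- kap + Re (circ r (kap * t) * scLp a th (circ r (kap * t)))))).
  apply: is_deriveN; have := is_derive1_comp (derive_vrg (kap * t) hr) (is_derive_linear kap t).
  by rewrite mulrC.
apply: (@derive_gt0_lt R (fun t => - vrg r (kap * t)) _ x y xy (fun t _ => d t)).
  by move=> t _; rewrite oppr_gt0; exact: vrg_deriv_lt0.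
apply: continuous_subspaceT => t.
exact: derive_cont (d t).
Qed.

Lemma V_neq0' z : z != 0 -> V z != 0.
Proof.
move=> z0; have z1 : 0 < cabs z by rewrite cabs_gt0.
by have [x _ ->] := circ_from 0 z1; apply: V_neq0; rewrite cabs_gt0.
Qed.

(** Multiplication by it followed by [Re] is the functional normal to the image curve at [F z], with
    the sign for which [F z] is the maximum. *)
Definition normal z : R[i] := (- kap)%:C * conjc (V z).

(** Strict convexity of the image of a circle: the functional normal at [z1], followed along the
    circle, has the derivative required by [convex_turn]. *)
Lemma circle_max z1 z : 0 < cabs z1 < 1 -> cabs z = cabs z1 -> z != z1 ->
  Re (normal z1 * F z) < Re (normal z1 * F z1).
Proof.
move=> hr zz1 ne; have r0 : 0 < cabs z1 by case/andP: hr.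
set r := cabs z1 in hr r0 zz1 *.
have [t _ z1E] := @circ_from 0 z1 r0; rewrite -/r in z1E.
have rz0 : 0 < cabs z by rewrite zz1.
have [x hx zE] := circ_from t rz0.
rewrite zz1 in zE.
pose h y := Re (normal z1 * F (circ r (kap * y))).
pose rho y := cabs (V z1) * cabs (V (circ r (kap * y))).
have -> : Re (normal z1 * F z) = h x by rewrite zE.
have -> : Re (normal z1 * F z1) = h t by rewrite [X in F X]z1E.
have xt : x != t by apply: contra_neq ne => xt; rewrite zE xt -z1E.
apply: (@convex_turn R h rho (fun y => vrg r (kap * y)) t).
- move=> y; have o := Om_circ (kap * y) hr.
  have z0 := circ_neq0 (kap * y) r0.
  have p1 := pder_rcomp (is_derive_linear kap y) (pder_circ r (kap * y)).
  have p2 := pder_Re (pderZ (normal z1) (pder_comp p1 (dF o z0))).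
  apply: is_derive_eq p2 _.
  have -> : normal z1 * (V (circ r (kap * y)) / circ r (kap * y) * (iC * circ r (kap * y) * kap%:C)) =
     (- (kap * kap))%:C * (conjc (V z1) * V (circ r (kap * y)) * iC).
    rewrite /normal !(rmorphN (real_complex R)) (rmorphM (real_complex R)).
    rewrite (_ : _ / _ * _ = V (circ r (kap * y)) * iC * kap%:C); last by field.
    by ring.
  have hN : conjc (V z1) = (cabs (V z1))%:C * cis (- vrg r (kap * t)).
    by rewrite {1}z1E (V_polar (kap * t) r0) -z1E; exact: cis_conj.
  rewrite kap2 hN (V_polar (kap * y) r0) /rho.
  rewrite (_ : _ * _ * iC = (cabs (V z1) * cabs (V (circ r (kap * y))))%:C * (cis (- vrg r (kap * t)) * cis (vrg r (kap * y)) * iC)); last first.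
    by rewrite (rmorphM (real_complex R)); ring.
  rewrite -cisD addrC !ReImE /=; ring.
- by move=> y; rewrite mulr_gt0 // cabs_gt0 V_neq0' // ?circ_neq0 // -cabs_gt0.
- by move=> y y'; exact: vrg_dec.
- have kk := kap_pm.
  case: kk => k1; rewrite k1 ?mul1r ?mulN1r.
    by rewrite vrg2pi k1; ring.
  have := vrg2pi r (- (t + 2 * pi)); rewrite (_ : - _ + _ = - t); last by ring.
  by rewrite k1 => ->; ring.
- rewrite /h mulrDr; have kk := kap_pm.
  case: kk => k1; rewrite k1 ?mul1r ?mulN1r ?circ2pi //.
  by have := circ2pi r (- t - 2 * pi); rewrite subrK => <-.
- by move: hx => /andP[h1 h2]; rewrite lt_def xt h1.
Qed.

Lemma derive_pos_increase (l : R -> R) x d (s : R) : is_derive x 1 l d -> 0 < s * d ->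
  forall e, 0 < e -> exists y, [/\ 0 < s * (y - x), `|y - x| < e & l x < l y].
Proof.
move=> /is_derive1_caratheodory [q [hq cq qx]] sd e e0.
have s0 : s != 0 by apply: contraTneq sd => ->; rewrite mul0r ltxx.
have sp : 0 < `|s| by rewrite normr_gt0.
have cs : {for x, continuous (fun y => s * q y)} by apply: cvgM => //; exact: cvg_cst.
have /RnearE [r r0 hr] : \forall y \near x, 0 < s * q y.
  apply: (cs [set u | 0 < u]); rewrite -qx in sd; apply/RnearE; exists (s * q x) => // u /=.
  by rewrite ltr_norml => /andP[]; lra.
pose m := Num.min e r / (2 * `|s|).
have m0 : 0 < m by rewrite divr_gt0 ?mulr_gt0 // lt_min e0.
have ms : `|x + m * s - x| = Num.min e r / 2.
  rewrite addrC addKr normrM (gtr0_norm m0) /m; field; by rewrite normr_eq0.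
have mn : Num.min e r <= e /\ Num.min e r <= r by rewrite !ge_min !lexx orbT.
have mp : 0 < Num.min e r by rewrite lt_min e0.
exists (x + m * s); split.
- by rewrite addrC addKr mulrCA mulr_gt0 // -expr2 lt_def sqr_ge0 sqrf_eq0 s0.
- by rewrite ms; case: mn; lra.
- rewrite -subr_gt0 hq (_ : x + m * s - x = m * s); last by ring.
  rewrite mulrCA mulr_gt0 // mulrC; apply: hr.
  by rewrite ms; case: mn; lra.
Qed.

(** Nesting: the image of the circle of radius [r] reaches farther in every direction [c] than that
    of [z'], which lies on its inner side (larger radii for [kap = 1], smaller ones for [kap = -1]).
    If not, [Re (c F)] would be maximal over the annulus at a point off the circle of radius [r].
    There [c] is a real multiple of the normal, and either sign is contradictory. *)
Lemma annulus_max r (z' c : R[i]) : 0 < r < 1 -> 0 < cabs z' < 1 -> c != 0 ->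
  0 < kap * (cabs z' - r) -> exists2 z, cabs z = r & Re (c * F z') < Re (c * F z).
Proof.
move=> /andP[r0 r1] /andP[z0 z1] c0 hk; apply: contrapT => hno.
have {}hno z : cabs z = r -> Re (c * F z) <= Re (c * F z').
  by move=> zr; rewrite leNgt; apply/negP => h; apply: hno; exists z.
pose m := Num.min r (cabs z'); pose M := Num.max r (cabs z').
pose A : set R[i]^o := [set z | m <= cabs z <= M].
have m0 : 0 < m by rewrite lt_min r0.
have M1 : M < 1 by rewrite gt_max r1.
have cA : compact A.
  apply: (@subclosed_compact R[i]^o _ [set z | cabs (z - 0) <= M]); last 1 first.
  - by move=> z /= /andP[_]; rewrite subr0.
  - have -> : A = (fun z : R[i]^o => cabs z) @^-1` [set x | m <= x <= M] by [].
    apply: closed_comp; first by move=> z _; exact: cabs_continuous.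
    have -> : [set x : R | m <= x <= M] = `[m, M]%classic by apply/seteqP; split => x /=; rewrite in_itv.
    exact: itv_closed.
  - exact: compact_disc.
have Az' : A z' by rewrite /A /= ge_min lexx orbT le_max lexx orbT.
have AO z : A z -> Om z /\ z != 0.
  move=> /andP[h1 h2]; split; first by apply: Om_disc; lra.
  by rewrite -cabs_gt0; lra.
have cF z : A z -> ccont F z by move=> /AO [oz nz]; exact: cder_cont (dF oz nz).
have cFA : {within A, continuous (fun z : R[i]^o => Re (c * F z))}.
  apply: continuous_in_subspaceT => z; rewrite inE => Az.
  apply: (@continuous_comp _ _ _ (fun z : R[i]^o => c * F z : R[i]^o) (@complex.Re R)); last exact: Re_continuous.
  by apply/(ccontP (fun z => c * F z)); apply: ccontM; [exact: ccont_cst|exact: cF].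
have A0 : A !=set0 by exists z'.
have [zs + hzs] := compact_EVT_max A0 cA cFA.
rewrite inE => Azs.
have {}hzs z : A z -> Re (c * F z) <= Re (c * F zs) by move=> Az; apply: hzs; rewrite inE.
(* If the maximum lies on the circle of radius [r], the assumed failure makes [z'] a maximum too,
   and [z'] has another radius. *)
wlog zsr : zs Azs hzs / cabs zs != r.
  move=> hw; have [e|ne] := eqVneq (cabs zs) r; last exact: (hw zs).
  apply: (hw z' Az') => [z Az|].
    by rewrite (le_trans (hzs z Az)) // hno.
  by apply: contraTneq hk => ->; rewrite subrr mulr0 ltxx.
have [oz z_0] := AO _ Azs; set s := cabs zs in zsr.
have s0 : 0 < s by rewrite cabs_gt0.
have s1 : s < 1 by move: Azs => /andP[_]; rewrite -/s; lra.
have [t _ zE] := @circ_from 0 zs s0; rewrite -/s in zE; set t' := kap * t in zE.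
have V0 := V_neq0' z_0.
(* the derivative along the circle vanishes, so [c * V zs] is real *)
have dth : is_derive t' 1 (fun x => Re (c * F (circ s x))) (Re (c * (V zs * iC))).
  have o : Om (circ s t') by rewrite -zE.
  have n0 : circ s t' != 0 by rewrite -zE.
  apply: is_derive_eq (pder_Re (pderZ c (pder_comp (pder_circ s t') (dF o n0)))) _.
  by rewrite -zE; congr Re; field.
have imcV : Im (c * V zs) = 0.
  have e0 : Re (c * (V zs * iC)) = 0.
    apply/eqP; case: (eqVneq (Re (c * (V zs * iC))) 0) => // ne0; exfalso.
    have [|y [_ _]] := derive_pos_increase dth (s := Re (c * (V zs * iC))) _ ltr01.
      by rewrite -expr2 lt_def sqr_ge0 sqrf_eq0 ne0.
    have Ay : A (circ s y) by rewrite /A /= cabs_circ ?(ltW s0).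
    by have := hzs _ Ay; rewrite {1}zE leNgt => /negP.
  by move: e0; rewrite mulrA ReM /=; lra.
set la := Re (c * V zs) in imcV *.
have cVE : c * V zs = la%:C by apply: Cext; rewrite ?ReC ?ImC ?imcV.
have la0 : la != 0.
  apply: contraTneq (mulf_neq0 c0 V0) => l0; rewrite cVE l0 eqxx //.
have cE : c = (- (kap * la) / cabs (V zs) ^+ 2)%:C * normal zs.
  have v2 : (cabs (V zs) ^+ 2)%:C != 0 by rewrite (inj_eq (@complexI R)) expf_neq0 // cabs_eq0.
  apply: (mulIf V0); rewrite cVE /normal -mulrA -[X in _ * X]mulrA (mulrC (conjc (V zs))) mulJ_cabs.
  have v2' : cabs (V zs) ^+ 2 != 0 by rewrite expf_neq0 // cabs_eq0.
  rewrite -!rCM; congr (_%:C); rewrite -[LHS]mul1r -kap2.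
  by move: v2'; set N := _ ^+ 2 => N0; field.
have hs1 : 0 < cabs zs < 1 by rewrite s0.
have [lneg|lpos] : (0 < kap * la) \/ (kap * la < 0).
- have : kap * la != 0 by rewrite mulf_neq0 //; apply: contra_eq_neq kap2 => ->; rewrite mul0r eq_sym oner_eq0.
  by rewrite neq_lt => /orP[]; [right|left].
- (* [zs] would be a strict minimum on its circle *)
  have nz : - zs != zs by rewrite eqNr.
  have := circle_max hs1 (cabsN zs) nz.
  have ANz : A (- zs) by rewrite /A /= cabsN.
  have := hzs _ ANz; rewrite cE -!mulrA !ReM !ReC !ImC !mul0r !subr0.
  rewrite ler_nM2l; last by rewrite mulNr oppr_lt0 divr_gt0 // exprn_gt0 // cabs_gt0.
  by rewrite leNgt => /negP.
(* Here [c] is a positive multiple of the normal, so [Re (c F)] increases strictly when the radius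
   moves towards [r]; a short move stays in the annulus. *)
- have dr : is_derive s 1 (fun x => Re (c * F (circ x t'))) (la / s).
    have o : Om (circ s t') by rewrite -zE.
    have n0 : circ s t' != 0 by rewrite -zE.
    have p1 : pder (fun x => circ x t') s (cis t').
      by apply: pder_eq (pderM (pder_id s) (pder_cst (cis t') s)) _; rewrite mul1r mulr0 addr0.
    apply: is_derive_eq (pder_Re (pderZ c (pder_comp p1 (dF o n0)))) _.
    rewrite -zE (_ : c * (V zs / zs * cis t') = c * V zs * (cis t' / zs)); last by ring.
    rewrite cVE.
    have -> : cis t' / zs = (s^-1)%:C.
      have sC : s%:C != 0 by rewrite (inj_eq (@complexI R)) gt_eqF.
      by rewrite zE /circ fmorphV invfM mulrCA divff ?mulr1 // cis_neq0.
    by rewrite -(rmorphM (real_complex R)).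
  have hks : 0 < kap * (s - r).
    exact: (min_max_sign kap_pm hk Azs zsr).
  have sgn : 0 < - kap * (la / s) by rewrite mulrA mulNr divr_gt0 // oppr_gt0.
  have d0 : 0 < `|s - r| by rewrite normr_gt0 subr_eq0.
  have [y [y1 y2]] := derive_pos_increase dr sgn d0.
  have y0 : 0 <= y.
    have kk := kap_pm.
    move: y1 y2 hks; rewrite ltr_norml; case: kk => ->; rewrite ?mul1r ?mulN1r ?opprK => h1 /andP[h2 h3] h4; last lra.
    by move: h2; rewrite gtr0_norm; lra.
  suff Ay : A (circ y t') by have := hzs _ Ay; rewrite {1}zE leNgt => /negP.
  rewrite /A /= cabs_circ //.
  have kk := kap_pm.
  move: Azs y1 y2 hks; rewrite /A /= -/s /m /M => /andP[h5 h6].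
  case: kk => ->; rewrite ?mul1r ?mulN1r ?opprK => h1 h2 h3.
    move: h2; rewrite (gtr0_norm h3) ltr_norml => /andP[h2 _].
    apply/andP; split; last by apply: le_trans h6; lra.
    by rewrite ge_min; apply/orP; left; lra.
  move: h2; rewrite ltr_norml ltr0_norm ?opprB; last by lra.
  move=> /andP[_ h2]; apply/andP; split; first by apply: (le_trans h5); lra.
  by rewrite le_max; apply/orP; left; lra.
Qed.

Lemma normal_neq0 z : z != 0 -> normal z != 0.
Proof.
move=> z0; have k0 : kap != 0 by apply: contra_eq_neq kap2 => ->; rewrite mul0r eq_sym oner_eq0.
by rewrite mulf_neq0 ?rC_eq0 ?oppr_eq0 // conjc_eq0 V_neq0'.
Qed.

Lemma sep_open z w : 0 < cabs z < 1 -> 0 < cabs w < 1 -> 0 < kap * (cabs w - cabs z) ->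
  Re (normal z * F w) < Re (normal z * F z).
Proof.
move=> hz hw hk; have z0 : z != 0 by rewrite -cabs_gt0; case/andP: hz.
have [z' z'r h] := annulus_max hz hw (normal_neq0 z0) hk.
have [e|ne] := eqVneq z' z; first by rewrite -e in h *; exact: h.
exact: lt_trans h (circle_max hz z'r ne).
Qed.

Lemma inj_open z w : 0 < cabs z < 1 -> 0 < cabs w < 1 -> F z = F w -> z = w.
Proof.
move=> hz hw e; apply/eqP; apply: contrapT => /negP ne.
have k0 : kap != 0 by apply: contra_eq_neq kap2 => ->; rewrite mul0r eq_sym oner_eq0.
have [er|ner] := eqVneq (cabs z) (cabs w).
  by have := circle_max hw er ne; rewrite e ltxx.
have : kap * (cabs w - cabs z) != 0 by rewrite mulf_neq0 // subr_eq0 eq_sym.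
rewrite neq_lt => /orP[h|h].
  have h' : 0 < kap * (cabs z - cabs w) by rewrite -opprB mulrN oppr_gt0.
  by have := sep_open hw hz h'; rewrite e ltxx.
by have := sep_open hz hw h; rewrite e ltxx.
Qed.

Lemma circle_compact r : compact ([set z | cabs z = r] : set R[i]^o).
Proof.
apply: (@subclosed_compact R[i]^o _ [set z | cabs (z - 0) <= r]); last 1 first.
- by move=> z /= <-; rewrite subr0.
- have -> : [set z : R[i]^o | cabs z = r] = (fun z : R[i]^o => cabs z) @^-1` [set r] by [].
  apply: closed_comp; first by move=> z _; exact: cabs_continuous.
  exact: closed_eq.
- exact: compact_disc.
Qed.

Lemma circle_EVT r c : 0 < r < 1 -> exists2 z, cabs z = r & forall w, cabs w = r -> Re (c * F w) <= Re (c * F z).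
Proof.
move=> hr; have r0 : 0 < r by case/andP: hr.
pose A : set R[i]^o := [set z | cabs z = r].
have cFA : {within A, continuous (fun z : R[i]^o => Re (c * F z))}.
  apply: continuous_in_subspaceT => z; rewrite inE /A /= => zr.
  apply: (@continuous_comp _ _ _ (fun z : R[i]^o => c * F z : R[i]^o) (@complex.Re R)); last exact: Re_continuous.
  apply/(ccontP (fun z => c * F z)); apply: ccontM; first exact: ccont_cst.
  apply: cder_cont (dF _ _); last by rewrite -cabs_gt0 zr.
  by apply: Om_disc; rewrite zr; case/andP: hr.
have A0 : A !=set0 by exists (circ r 0); rewrite /A /= cabs_circ // ltW.
have [z + hz] := compact_EVT_max A0 (@circle_compact r) cFA.
by rewrite inE => zr; exists z => // w wr; apply: hz; rewrite inE.
Qed.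

(** Passing to the limit in [sep_open] would lose strictness. The intermediate circle of radius [r']
    keeps a fixed gap, because its image has a compact extremum. The lemma is applied to boundary
    values of the exterior map and to the value at 0 of the interior map. *)
Lemma sep_limit z (r' : R) v : 0 < cabs z < 1 -> 0 < r' < 1 -> 0 < kap * (r' - cabs z) ->
  (forall e, 0 < e -> exists w, [/\ 0 < cabs w < 1, 0 < kap * (cabs w - r') & cabs (F w - v) < e]) ->
  Re (normal z * v) < Re (normal z * F z).
Proof.
move=> hz hr hk hv; have z0 : z != 0 by rewrite -cabs_gt0; case/andP: hz.
set c := normal z; have c0 : c != 0 := normal_neq0 z0.
have [z' z'r hz'] := circle_EVT c hr.
have h1 : Re (c * F z') < Re (c * F z).
  by apply: sep_open => //; rewrite z'r.
apply: le_lt_trans h1; apply/ler_addgt0Pr => e e0.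
have c1 : 0 < cabs c by rewrite cabs_gt0.
have [w [hw hkw hwv]] := hv _ (divr_gt0 e0 c1).
have [z'' z''r h2] := annulus_max hr hw c0 hkw.
have h3 := hz' _ z''r.
have : Re (c * v) - Re (c * F w) <= e.
  rewrite -ReB -mulrBr (le_trans (Re_le_cabs _)) // cabsM cabs_distrC mulrC.
  by rewrite -ler_pdivlMr // ltW.
lra.
Qed.

End nesting.

(** * Limits at the prevertices *)

Section extension.
Variable R : realType.
Implicit Types (z w e : R[i]) (F dF : R[i] -> R[i]) (M rho : R).

Lemma sqrt_within (a b c : R) : {within `[a, b], continuous (fun x => c * Num.sqrt x)}.
Proof. by apply: continuous_subspaceT => x; apply: cvgM; [exact: cvg_cst|exact: sqrt_continuous]. Qed.

Lemma is_derive_sqrt (x : R) : 0 < x -> is_derive x 1 Num.sqrt (2 * Num.sqrt x)^-1.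
Proof.
move=> x0; apply/is_derive1_caratheodory.
have sx : 0 < Num.sqrt x by rewrite sqrtr_gt0.
pose g y := if y <= 0 then (Num.sqrt y - Num.sqrt x) / (y - x) else (Num.sqrt y + Num.sqrt x)^-1.
have gx : g x = (Num.sqrt x + Num.sqrt x)^-1 by rewrite /g leNgt x0.
exists g; split.
- move=> y; rewrite /g; case: ifPn => [y0|]; first by rewrite divfK // subr_eq0 lt_eqF //; exact: le_lt_trans x0.
  rewrite -ltNge => y0; have sy : 0 < Num.sqrt y by rewrite sqrtr_gt0.
  have n0 : Num.sqrt y + Num.sqrt x != 0 by rewrite gt_eqF // addr_gt0.
  apply: (mulfI n0); rewrite mulVKf // -[in RHS](@sqr_sqrtr _ y) ?ltW // -[in RHS](@sqr_sqrtr _ x) ?ltW //; ring.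
- have cV : {for x, continuous (fun y => (Num.sqrt y + Num.sqrt x)^-1)}.
    apply: cvgV; first by rewrite gt_eqF // addr_gt0.
    by apply: cvgD; [exact: sqrt_continuous|exact: cvg_cst].
  rewrite /prop_for /continuous_at gx.
  apply: cvg_trans cV; apply: near_eq_cvg; apply/RnearE; exists x => // y.
  by rewrite ltr_norml => /andP[h _]; rewrite /g ifF //; apply/negbTE; rewrite -ltNge; lra.
- by rewrite gx mulr_natl mulr2n.
Qed.

(* A derivative of order |z - e|^(-1/2) at a boundary point leaves room for a limit there (Hardy-Littlewood). *)
Lemma boundary_oscillation F dF e M (r0 : R) : cabs e = 1 -> 0 < r0 <= 1 / 4 -> 0 <= M ->
  (forall z, cabs z <= 1 -> z != e -> cabs (z - e) <= 2 * r0 ->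
     cder F z (dF z) /\ cabs (dF z) <= M / Num.sqrt (cabs (z - e))) ->
  forall rho z w, 0 < rho <= r0 -> cabs z <= 1 -> z != e -> cabs (z - e) <= rho ->
    cabs w <= 1 -> w != e -> cabs (w - e) <= rho -> cabs (F z - F w) <= 6 * M * Num.sqrt rho.
Proof.
move=> e1 /andP[r00 r04] M0 hF rho z w /andP[rho0 rhor].
have sr0 : 0 < Num.sqrt rho by rewrite sqrtr_gt0.
(* Moving inwards to [(1 - x) u] keeps a distance of at least [x] from [e], so the derivative is at
   most [M / sqrt x], which integrates to [2 * M * sqrt rho]. *)
have rad u : cabs u <= 1 -> u != e -> cabs (u - e) <= rho ->
    cabs (F u - F ((1 - rho)%:C * u)) <= 2 * M * Num.sqrt rho.
  move=> u1 ue uer.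
  have pt x : 0 <= x <= rho -> [/\ cabs ((1 - x)%:C * u) <= 1, (1 - x)%:C * u != e,
      cabs ((1 - x)%:C * u - e) <= 2 * r0 & x <= cabs ((1 - x)%:C * u - e)].
    move=> /andP[x0 xr].
    have c1 : cabs ((1 - x)%:C * u) <= 1 - x.
      by rewrite cabsM cabsR ger0_norm ?ler_piMr //; lra.
    have c2 : x <= cabs ((1 - x)%:C * u - e).
      by have := cabs_leB e ((1 - x)%:C * u); rewrite e1 cabs_distrC; lra.
    split; [lra| |  |exact: c2].
      have [x00|xn] := eqVneq x 0; first by rewrite x00 subr0 mul1r.
      by rewrite -subr_eq0 -cabs_gt0; apply: lt_le_trans c2; rewrite lt_def xn.
    rewrite (_ : _ - e = (u - e) - x%:C * u); last by rewrite rCB rC1; ring.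
    rewrite (le_trans (cabsB _ _)) // cabsM cabsR ger0_norm //.
    have : x * cabs u <= x by rewrite ler_piMr.
    lra.
  pose p x := F ((1 - x)%:C * u).
  have dp x : 0 <= x <= rho -> pder p x (dF ((1 - x)%:C * u) * (- u)).
    move=> hx; have [h1 h2 h3 _] := pt x hx; have [h5 _] := hF _ h1 h2 h3.
    apply: pder_comp h5.
    have d1 : is_derive x 1 (fun y => 1 - y) (- 1).
      exact: is_derive_one_sub.
    by apply: pder_eq (pderM (pder_C d1) (pder_cst u x)) _; rewrite mulr0 addr0 rCN mulN1r.
  have := @path_le R p (fun x => dF ((1 - x)%:C * u) * (- u)) (fun x => 2 * M * Num.sqrt x) (fun x => 2 * M * (2 * Num.sqrt x)^-1) 0 rho (ltW rho0).
  rewrite sqrtr0 mulr0 subr0 /p subr0 mul1r cabs_distrC; apply.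
  - by move=> x /andP[/ltW h1 /ltW h2]; apply: dp; rewrite h1.
  - move=> x /andP[h1 _]; have := is_deriveM (is_derive_cst (2 * M) x 1) (is_derive_sqrt h1).
    by move=> h; apply: is_derive_eq h _; rewrite scaler0 addr0.
  - move=> x /andP[x0 xr]; have hx : 0 <= x <= rho by rewrite !ltW.
    have [h1 h2 h3 h4] := pt x hx; have [_ h5] := hF _ h1 h2 h3.
    rewrite cabsM cabsN; apply: (@le_trans _ _ (cabs (dF ((1 - x)%:C * u)))); first by rewrite ler_piMr ?cabs_ge0.
    apply: le_trans h5 _; rewrite invfM mulrACA divff ?mul1r ?pnatr_eq0 //.
    by rewrite ler_wpM2l // lef_pV2 ?posrE ?sqrtr_gt0 // ?ler_wsqrtr //; exact: lt_le_trans h4.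
  - exact: sqrt_within.
  - by apply: within_pcont => t ht; exact: pder_cont (dp t ht).
move=> z1 ze zr w1 we wr.
have h1 := rad z z1 ze zr; have h2 := rad w w1 we wr.
set z' := (1 - rho)%:C * z in h1 *; set w' := (1 - rho)%:C * w in h2 *.
(* The inner endpoints are at most [2 * rho] apart, and the segment between them stays at distance
   at least [rho] from [e]. With the two radial moves this gives the factor 6. *)
have h3 : cabs (F z' - F w') <= 2 * M * Num.sqrt rho.
  have pt s : 0 <= s <= 1 -> [/\ cabs (spath w' z' s) <= 1, spath w' z' s != e,
      cabs (spath w' z' s - e) <= 2 * r0 & rho <= cabs (spath w' z' s - e)].
    move=> /andP[s0 s1].
    have e3 : spath w' z' s = (1 - rho)%:C * ((1 - s)%:C * w + s%:C * z).
      by rewrite /spath /w' /z' !rCB rC1; ring.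
    have c1 : cabs ((1 - s)%:C * w + s%:C * z) <= 1.
      rewrite (le_trans (cabsD _ _)) // !cabsM !cabsR !ger0_norm //; last by lra.
      have : (1 - s) * cabs w <= 1 - s by rewrite ler_piMr //; lra.
      have : s * cabs z <= s by rewrite ler_piMr.
      lra.
    have c2 : cabs ((1 - s)%:C * w + s%:C * z - e) <= rho.
      rewrite (_ : _ - e = (1 - s)%:C * (w - e) + s%:C * (z - e)); last by rewrite rCB rC1; ring.
      rewrite (le_trans (cabsD _ _)) // !cabsM !cabsR !ger0_norm //; last by lra.
      have : (1 - s) * cabs (w - e) <= (1 - s) * rho by rewrite ler_wpM2l //; lra.
      have : s * cabs (z - e) <= s * rho by rewrite ler_wpM2l.
      lra.
    set v := (1 - s)%:C * w + s%:C * z in e3 c1 c2.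
    have c3 : cabs (spath w' z' s) <= 1 - rho.
      by rewrite e3 cabsM cabsR ger0_norm ?ler_piMr //; lra.
    have c4 : rho <= cabs (spath w' z' s - e).
      by have := cabs_leB e (spath w' z' s); rewrite e1 cabs_distrC; lra.
    split; [lra| | |exact: c4].
      by rewrite -subr_eq0 -cabs_gt0; exact: lt_le_trans c4.
    rewrite e3 (_ : _ - e = (v - e) - rho%:C * v); last by rewrite rCB rC1; ring.
    rewrite (le_trans (cabsB _ _)) // [cabs (_ * _)]cabsM cabsR ger0_norm; last exact: ltW.
    have : rho * cabs v <= rho by rewrite ler_piMr // ltW.
    lra.
  have dp s : 0 <= s <= 1 -> pder (fun s => F (spath w' z' s)) s (dF (spath w' z' s) * (z' - w')).
    move=> hs; have [h3 h4 h5 _] := pt s hs; have [h6 _] := hF _ h3 h4 h5.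
    exact: pder_comp (pder_spath w' z' s) h6.
  have := @path_le R (fun s => F (spath w' z' s)) (fun s => dF (spath w' z' s) * (z' - w'))
    (fun s => 2 * M * Num.sqrt rho * s) (fun=> 2 * M * Num.sqrt rho) 0 1 ler01.
  rewrite mulr1 mulr0 subr0 spath0 spath1; apply.
  - by move=> x /andP[/ltW h3 /ltW h4]; apply: dp; rewrite h3.
  - by move=> x _; exact: is_derive_linear.
  - move=> x /andP[/ltW h3 /ltW h4]; have hx : 0 <= x <= 1 by rewrite h3.
    have [h5 h6 h7 h8] := pt x hx; have [_ h9] := hF _ h5 h6 h7.
    have zw : cabs (z' - w') <= 2 * rho.
      rewrite /z' /w' -mulrBr cabsM cabsR ger0_norm; last by lra.
      have : cabs (z - w) <= 2 * rho.
        rewrite (_ : z - w = (z - e) - (w - e)); last by ring.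
        by rewrite (le_trans (cabsB _ _)) //; lra.
      have := cabs_ge0 (z - w); nra.
    have h10 : cabs (dF (spath w' z' x)) <= M / Num.sqrt rho.
      apply: le_trans h9 _; rewrite ler_wpM2l // lef_pV2 ?posrE ?sqrtr_gt0 ?ler_wsqrtr //.
      exact: lt_le_trans h8.
    rewrite cabsM; apply: (@le_trans _ _ (M / Num.sqrt rho * (2 * rho))).
      by rewrite ler_pM ?cabs_ge0.
    have hq : rho = Num.sqrt rho ^+ 2 by rewrite sqr_sqrtr // ltW.
    rewrite [leLHS](_ : _ = 2 * M * Num.sqrt rho) // [X in 2 * X]hq.
    by move: sr0; set q := Num.sqrt rho => q0; field; rewrite gt_eqF.
  - apply: continuous_subspaceT => x; apply: cvgM; [exact: cvg_cst|exact: cvg_id].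
  - by apply: within_pcont => t ht; exact: pder_cont (dp t ht).
rewrite (_ : F z - F w = (F z - F z') + (F z' - F w') - (F w - F w')); last by ring.
rewrite (le_trans (cabsB _ _)) // (le_trans (lerD (cabsD _ _) (lexx _))) //; lra.
Qed.

(** The values along a radial sequence stay in a disc and hence cluster; the oscillation estimate
    makes the cluster value a limit over the closed disc. *)
Lemma boundary_limit F dF e M (r0 : R) : cabs e = 1 -> 0 < r0 <= 1 / 4 -> 0 <= M ->
  (forall z, cabs z <= 1 -> z != e -> cabs (z - e) <= 2 * r0 ->
     cder F z (dF z) /\ cabs (dF z) <= M / Num.sqrt (cabs (z - e))) ->
  exists v, forall d, 0 < d -> exists2 s, 0 < s &
    forall z, cabs z <= 1 -> z != e -> cabs (z - e) < s -> cabs (F z - v) < d.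
Proof.
move=> e1 hr M0 hF; have osc := boundary_oscillation e1 hr M0 hF.
have /andP[r00 r04] := hr.
pose u n : R[i] := (1 - r0 / n.+1%:R)%:C * e.
have rn n : 0 < r0 / n.+1%:R <= r0.
  by rewrite divr_gt0 //= ler_pdivrMr // -{1}(mulr1 r0) ler_pM2l // ler1n.
have un n : [/\ cabs (u n) <= 1, u n != e & cabs (u n - e) = r0 / n.+1%:R].
  have /andP[h1 h2] := rn n.
  have h3 : cabs (u n - e) = r0 / n.+1%:R.
    rewrite (_ : u n - e = - (r0 / n.+1%:R)%:C * e); last by rewrite /u rCB rC1; ring.
    by rewrite cabsM e1 mulr1 cabsN cabsR gtr0_norm.
  split => //; last by rewrite -subr_eq0 -cabs_gt0 h3.
  rewrite /u cabsM e1 mulr1 cabsR; move: h1 h2; set x := _ / _ => h1 h2.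
  by rewrite ger0_norm; lra.
pose B := 6 * M * Num.sqrt r0.
have cB : compact ([set z | cabs (z - F (u 0%N)) <= B] : set R[i]^o) := @compact_disc R _ _.
have hc : ((fun n => F (u n) : R[i]^o) @ \oo) [set z | cabs (z - F (u 0%N)) <= B].
  exists 0%N => // n _ /=; have [u1 u2 u3] := un n; have [w1 w2 w3] := un 0%N.
  apply: (osc r0) => //; rewrite ?u3 ?w3; first by rewrite r00 lexx.
    by case/andP: (rn n).
  by case/andP: (rn 0%N).
have [v [_ hv]] := cB ((fun n => F (u n) : R[i]^o) @ \oo) _ hc.
exists v => d d0; have d20 : 0 < d / 2 by rewrite divr_gt0.
(* Chosen so that the oscillation [6 * M * sqrt s] falls below [d / 2]; the 1 covers [M = 0]. *)
pose s0 := (d / 2 / (6 * M + 1)) ^+ 2.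
have M1 : 0 < 6 * M + 1 by lra.
have s00 : 0 < s0 by rewrite exprn_gt0 // !divr_gt0.
pose s := Num.min s0 r0.
have s1 : 0 < s <= r0 by rewrite lt_min s00 r00 ge_min lexx orbT.
have sq : 6 * M * Num.sqrt s < d / 2.
  have h1 : Num.sqrt s <= d / 2 / (6 * M + 1).
    rewrite (_ : _ / _ = Num.sqrt s0); last by rewrite sqrtr_sqr ger0_norm // !divr_ge0 // ltW.
    by apply: ler_wsqrtr; rewrite ge_min lexx.
  have h2 : 0 < Num.sqrt s by rewrite sqrtr_gt0; case/andP: s1.
  have h3 : 6 * M * Num.sqrt s < (6 * M + 1) * Num.sqrt s by rewrite ltr_pM2r //; lra.
  by apply: lt_le_trans h3 _; rewrite mulrC -ler_pdivlMr.
exists s; first by case/andP: s1.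
move=> z z1 ze zs.
have hA : \forall n \near \oo, [set w : R[i]^o | cabs (F z - w) <= 6 * M * Num.sqrt s] (F (u n)).
  exists (Num.trunc (r0 / s)) => // n /= hn; have [u1 u2 u3] := un n.
  apply: (osc s) => //; first exact: ltW.
  rewrite u3 ler_pdivrMr // mulrC -ler_pdivrMr; last by case/andP: s1.
  apply: ltW; apply: (lt_le_trans (truncnS_gt _)); by rewrite ler_nat.
have hB : nbhs (v : R[i]^o) [set w | cabs (w - v) < d / 2] by apply/nbhsCP; exists (d / 2).
have [w [/= h1 h2]] := hv _ _ hA hB.
rewrite (_ : F z - v = (F z - w) + (w - v)); last by ring.
by rewrite (le_lt_trans (cabsD _ _)) //; lra.
Qed.

End extension.

(** * Boundary values of a Schwarz-Christoffel map *)

(* [V] is [z F'], the product of the [(1 - z / e_k) ^ a_k] over the prevertices [e_k = cis (th k)], divided by [z] for the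
   exterior of a polygon ([kap = 1]) and multiplied by [z] for its interior ([kap = -1]). *)
Record sc_data (R : realType) (th a : nat -> R) (kap : R) (F V : R[i] -> R[i]) : Prop := ScData {
  sc_th_lt : forall k, th k < th k.+1;
  sc_th_per : forall k, th k.+4 = th k + 2 * pi;
  sc_a_per : forall k, a k.+4 = a k;
  sc_kap2 : kap * kap = 1;
  sc_akap : forall k, 0 < kap * a k < 1;
  sc_a_ge : forall k, - (1 / 2) <= a k;
  sc_suma : \sum_(k < 4) a k = 2 * kap;
  sc_VE : forall r x, 0 < r -> V (r%:C * cis x) =
    Cexp ((- kap * ln r) +i* (- kap * x)) * scP (fun k : 'I_4 => a k) (fun k : 'I_4 => th k) (r%:C * cis x);
  sc_dF : forall z, Om (fun k : 'I_4 => th k) z -> z != 0 -> cder F z (V z / z)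
}.

Section polygon_map.
Variable R : realType.
Variables (th a : nat -> R) (kap : R) (F V : R[i] -> R[i]).
Implicit Types (z w c : R[i]) (k m j : nat) (r x y t : R).
Local Notation thI := (fun k : 'I_4 => th k).
Local Notation aI := (fun k : 'I_4 => a k).
Hypothesis H : sc_data th a kap F V.
Let th_lt := sc_th_lt H.
Let th_per := sc_th_per H.
Let a_per := sc_a_per H.
Let kap2 := sc_kap2 H.
Let akap := sc_akap H.
Let a_ge := sc_a_ge H.
Let suma := sc_suma H.
Let VE := sc_VE H.
Let dF := sc_dF H.

Lemma kap1 : kap = 1 \/ kap = -1.
Proof.
have : (kap - 1) * (kap + 1) = 0 by rewrite mulrDr !mulrDl kap2; ring.
by move/eqP; rewrite mulf_eq0 => /orP [/eqP h|/eqP h]; [left|right]; lra.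
Qed.

(** Prevertices are indexed by [nat] with period 4 and arguments growing by [2 * pi] per period. Any
    four consecutive indices then list the vertices in increasing order of argument, which removes
    modular case distinctions. *)
Lemma window (T : nmodType) (g : nat -> T) m : (forall k, g k.+4 = g k) ->
  \sum_(k < 4) g k = g m + g m.+1 + g m.+2 + g m.+3.
Proof.
move=> gp; elim: m => [|m ->]; first by rewrite !big_ord_recr big_ord0 /= add0r.
by rewrite gp -!addrA [LHS]addrC !addrA.
Qed.

Lemma periodic_all (Q : nat -> Prop) m : (forall k, Q k <-> Q k.+4) ->
  Q m -> Q m.+1 -> Q m.+2 -> Q m.+3 -> forall k, Q k.
Proof.
move=> QP; elim: m => [q0 q1 q2 q3|m IH q1 q2 q3 q4]; last first.
  by apply: IH => //; apply/QP.
move=> k; suff : [/\ Q k, Q k.+1, Q k.+2 & Q k.+3] by case.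
by elim: k => [//|k [h0 h1 h2 h3]]; split => //; apply/(QP k).
Qed.

Lemma window_th m : [/\ th m < th m.+1, th m.+1 < th m.+2, th m.+2 < th m.+3 & th m.+3 < th m + 2 * pi].
Proof. by split; rewrite -?th_per. Qed.

Lemma one_sub_cis x : 1 - cis x = (2 * sin (x / 2))%:C * cis ((x - pi) / 2).
Proof.
have hx : x = x / 2 + x / 2 by field.
rewrite mulrBl; apply: Cext; rewrite !ReImE /cis /= ?sub0r.
  rewrite cosB cos_pihalf sin_pihalf mulr0 mulr1 add0r [in LHS]hx cosD.
  by have := cos2Dsin2 (x / 2); lra.
by rewrite sinB cos_pihalf sin_pihalf mulr0 mulr1 [in LHS]hx sinD; lra.
Qed.

Lemma Clog_one_sub_cis x : 0 < x < 2 * pi ->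
  Clog (1 - cis x) = ln (2 * sin (x / 2)) +i* ((x - pi) / 2).
Proof.
move=> /andP[h0 h1]; rewrite one_sub_cis Clog_polar //; last by apply/andP; split; lra.
by rewrite mulr_gt0 // sin_gt0_pi //; apply/andP; split; lra.
Qed.

Lemma cis_sep x y : x < y < x + 2 * pi -> cis y != cis x :> R[i].
Proof.
move=> /andP[h0 h1]; rewrite -subr_eq0 -oppr_eq0 opprB.
have -> : cis x - cis y = (1 - cis (y - x)) * cis x :> R[i].
  by rewrite mulrBl mul1r -cisD subrK.
rewrite mulf_neq0 ?cis_neq0 // one_sub_cis mulf_neq0 ?cis_neq0 // rC_eq0 gt_eqF //.
by rewrite mulr_gt0 // sin_gt0_pi //; apply/andP; split; lra.
Qed.

Definition ev k : R[i] := cis (th k).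

Lemma ev_per k : ev k.+4 = ev k. Proof. by rewrite /ev th_per cis2pi. Qed.

Lemma cabs_ev k : cabs (ev k) = 1. Proof. exact: cabs_cis. Qed.

Lemma ev_neq k : [/\ ev k.+1 != ev k, ev k.+2 != ev k & ev k.+3 != ev k].
Proof.
by have [h1 h2 h3 h4] := window_th k; split; apply: cis_sep; apply/andP; split; lra.
Qed.

Lemma Om_ev z : cabs z <= 1 -> (forall k, z != ev k) -> Om thI z.
Proof. by move=> z1 h; apply: Om_closed_disc => // k; exact: h. Qed.

Lemma ev_notin k : ~ Om thI (ev k).
Proof.
have q (i : 'I_4) : ~ Om thI (ev i).
  by move=> /(_ i) /slit_neq0; rewrite /fac /ev -cisD subrr cis0 subrr eqxx.
move: k; apply: (@periodic_all (fun k => ~ Om thI (ev k)) 0); first by move=> j; rewrite ev_per.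
- exact: (q (@Ordinal 4 0 isT)).
- exact: (q (@Ordinal 4 1 isT)).
- exact: (q (@Ordinal 4 2 isT)).
- exact: (q (@Ordinal 4 3 isT)).
Qed.

Lemma ev_isolated k : exists2 d, 0 < d <= 1 & forall j, ev j = ev k \/ d <= cabs (ev j - ev k).
Proof.
have [n1 n2 n3] := ev_neq k.
pose d := Num.min (Num.min 1 (cabs (ev k.+1 - ev k))) (Num.min (cabs (ev k.+2 - ev k)) (cabs (ev k.+3 - ev k))).
exists d; first by rewrite /d !lt_min !ge_min lexx !cabs_gt0 !subr_eq0 n1 n2 n3 ltr01.
apply: (@periodic_all (fun j => _ \/ _) k); first by move=> j; rewrite ev_per.
- by left.
- by right; rewrite /d !ge_min lexx !orbT.
- by right; rewrite /d !ge_min lexx !orbT.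
- by right; rewrite /d !ge_min lexx !orbT.
Qed.

(** Near [ev k] only its own factor can be singular, and [a k >= -1/2] bounds it by
    [|z - ev k| ^ (-1/2)]; the other factors are controlled by the separation of the prevertices. *)
Lemma Fder_bound k : exists M r0, [/\ 0 <= M, 0 < r0 <= 1 / 4 & forall z, cabs z <= 1 -> z != ev k ->
  cabs (z - ev k) <= 2 * r0 -> Om thI z /\ cabs (V z / z) <= M / Num.sqrt (cabs (z - ev k))].
Proof.
have [d /andP[d0 d1] hd] := ev_isolated k.
have l2 : 0 <= ln 2 :> R by rewrite ln_ge0 // ler1n.
(* Bounds [a j * ln |z - ev j|] for the other prevertices: their distance lies between [d / 2] and
   2, and [|a j| < 1]. *)
pose B : R := ln 2 - ln (d / 2).
have lB : ln (d / 2) <= 0 :> R by rewrite -ln1 ler_ln ?posrE ?divr_gt0 //; lra.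
have B0 : 0 <= B by rewrite /B; lra.
pose r0 : R := d / 8; exists (4 * expR (3 * B)), r0; split; first by rewrite mulr_ge0 // expR_ge0.
  by rewrite /r0; apply/andP; split; lra.
move=> z z1 ze hz.
have far j : ev j != ev k -> d / 2 <= cabs (z - ev j).
  move=> ne; have [e|h] := hd j; first by rewrite e eqxx in ne.
  by have := cabs_leB (ev j - ev k) (z - ev k); rewrite opprB addrA subrK [X in _ <= X -> _]cabs_distrC; move: hz; rewrite /r0; lra.
have zO : Om thI z.
  apply: Om_ev => // j; apply: contraTneq hz => zj; rewrite -ltNge.
  have ne : ev j != ev k by rewrite -zj.
  by have := far j ne; rewrite zj subrr cabs0; lra.
split=> //.
have z2 : 1 / 2 <= cabs z.
  by have := cabs_leB (ev k) z; rewrite cabs_ev cabs_distrC; move: hz; rewrite /r0; lra.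
have z0 : 0 < cabs z by lra.
have aB j : ev j != ev k -> a j * ln (cabs (z - ev j)) <= B.
  move=> ne; have h1 := far j ne; have h2 : cabs (z - ev j) <= 2.
    by rewrite (le_trans (cabsB _ _)) // cabs_ev; lra.
  have hp : 0 < cabs (z - ev j) by lra.
  have h3 : ln (cabs (z - ev j)) <= ln 2 by rewrite ler_ln ?posrE.
  have h4 : ln (d / 2) <= ln (cabs (z - ev j)) by rewrite ler_ln ?posrE ?divr_gt0.
  have ha : - 1 < a j < 1.
    have := akap j; case: kap1 => ->; rewrite ?mul1r ?mulN1r => /andP[]; [|]; lra.
  move: ha h3 h4; rewrite /B; set A := a j; set L := ln _ => /andP[]; nra.
have LB : \sum_(j < 4) aI j * ln (cabs (fac thI j z)) <= 3 * B - (1 / 2) * ln (cabs (z - ev k)).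
  pose g j := a j * ln (cabs (z - ev j)).
  rewrite (_ : \sum_(j < 4) _ = \sum_(j < 4) g j); last first.
    by apply: eq_bigr => j _; rewrite fac_dist.
  rewrite (window k); last by move=> j; rewrite /g ev_per a_per.
  have [n1 n2 n3] := ev_neq k.
  have := aB _ n1; have := aB _ n2; have := aB _ n3; rewrite -/(g _) -/(g _) -/(g _).
  have h1 : ln (cabs (z - ev k)) <= 0.
    rewrite -ln1 ler_ln ?posrE ?cabs_gt0 ?subr_eq0 //; move: hz; rewrite /r0; lra.
  have : g k <= - (1 / 2) * ln (cabs (z - ev k)).
    by rewrite /g ler_wnM2r.
  lra.
have [x _ zE] := circ_from kap2 0 z0.
(* [|V / z|] is [|z|^-2] or 1 times the product, according to [kap], and [|z| >= 1/2]. *)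
have hV : cabs (V z / z) <= 4 * cabs (scP aI thI z).
  have hl : ln (cabs z) <= 0 by rewrite -ln1 ler_ln ?posrE.
  have hV' : cabs (V z) = expR (- kap * ln (cabs z)) * cabs (scP aI thI z).
    by rewrite {1}zE VE // -/(circ (cabs z) (kap * x)) -zE cabsM cabs_Cexp.
  rewrite cabsM cabsV hV' mulrAC ler_wpM2r ?cabs_ge0 // ler_pdivrMr //.
  case: kap1 => ->.
    rewrite mulN1r expRN lnK ?posrE // -[leLHS]mul1r ler_pdivrMr //; nra.
  rewrite opprK mul1r lnK ?posrE //; lra.
rewrite (le_trans hV) // -mulrA ler_pM2l // cabs_scP.
have s0 : 0 < cabs (z - ev k) by rewrite cabs_gt0 subr_eq0.
have -> : (Num.sqrt (cabs (z - ev k)))^-1 = expR (- (1 / 2 * ln (cabs (z - ev k)))).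
  rewrite expRN; congr (_^-1); rewrite -[RHS]ger0_norm ?expR_ge0 // -sqrtr_sqr; congr Num.sqrt.
  rewrite expr2 -expRD (_ : _ + _ = ln (cabs (z - ev k))) ?lnK ?posrE //; by field.
by rewrite -expRD ler_expR.
Qed.

Definition lim_at z (v : R[i]) := forall d, 0 < d -> exists2 s, 0 < s &
  forall w, cabs w <= 1 -> w != z -> cabs (w - z) < s -> cabs (F w - v) < d.

(** [F] is controlled only on [Om], which omits the prevertices; there it is replaced by its limit
    from the closed disc, which [Fh_ev] shows to exist. *)
Definition Fh z : R[i] := if `[< exists k, z = ev k >] then xget 0 [set v | lim_at z v] else F z.

Lemma Fh_ev k : lim_at (ev k) (Fh (ev k)).
Proof.
rewrite /Fh; case: ifPn => [_|/asboolP []]; last by exists k.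
have [M [r0 [M0 hr hM]]] := Fder_bound k.
have [|v hv] := @boundary_limit R F (fun z => V z / z) (ev k) M r0 (cabs_ev k) hr M0.
  move=> z z1 ze hz; have [oz dz] := hM z z1 ze hz; split=> //; apply: dF => //.
  rewrite -cabs_gt0; have /andP[_ r4] := hr.
  by have := cabs_leB (ev k) z; rewrite cabs_ev cabs_distrC; lra.
exact: (@xgetI _ 0 _ v hv).
Qed.

Lemma Fh_Om z : Om thI z -> Fh z = F z.
Proof. by rewrite /Fh; case: ifPn => // /asboolP [k ->] /ev_notin. Qed.

Lemma Fh_near z : Om thI z -> Cnear z [set w | F w = Fh w].
Proof. by move=> /Om_near [r r0 h]; exists r => // w /h /Fh_Om. Qed.

Lemma Fh_cder z : Om thI z -> z != 0 -> cder Fh z (V z / z).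
Proof. by move=> o z0; apply: cder_near (dF o z0) (Fh_near o). Qed.

Lemma Fh_cont z : cabs z <= 1 -> z != 0 -> forall e, 0 < e -> exists2 r, 0 < r &
  forall w, cabs w <= 1 -> cabs (w - z) < r -> cabs (Fh w - Fh z) < e.
Proof.
move=> z1 z0 e e0.
have [[k ->]|nk] := pselect (exists k, z = ev k); last first.
  have o : Om thI z by apply: Om_ev => // k; apply/eqP => h; apply: nk; exists k.
  have [r r0 hr] := cder_cont (Fh_cder o z0) e0.
  by exists r => // w _; exact: hr.
have [d /andP[d0 d1] hd] := ev_isolated k.
have [s s0 hs] := Fh_ev k e0.
exists (Num.min s d); first by rewrite lt_min s0.
move=> w w1; rewrite lt_min => /andP[ws wd].
have [->|ne] := eqVneq w (ev k); first by rewrite subrr cabs0.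
have o : Om thI w.
  apply: Om_ev => // j; apply/eqP => wj; have [ej|] := hd j; first by rewrite wj ej eqxx in ne.
  by rewrite -wj leNgt wd.
by rewrite Fh_Om //; exact: hs.
Qed.

(** The logarithm of [|V|] on arc [m], which runs from [th m.+3] to [th m.+4]: with this shift all
    four differences lie between 0 and [2 * pi], where [Clog_one_sub_cis] applies. *)
Definition wl m x : R := a m * ln (2 * sin ((x - th m) / 2)) + a m.+1 * ln (2 * sin ((x - th m.+1) / 2))
  + a m.+2 * ln (2 * sin ((x - th m.+2) / 2)) + a m.+3 * ln (2 * sin ((x - th m.+3) / 2)).
(** The argument of [V] on arc [m]. It does not depend on [x], since each factor contributes [x / 2]
    times its exponent and these cancel [kap * x]; hence the image of the arc is straight. *)
Definition cd m : R := - (a m * (th m + pi) + a m.+1 * (th m.+1 + pi)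
  + a m.+2 * (th m.+2 + pi) + a m.+3 * (th m.+3 + pi)) / 2.
Definition dir m : R[i] := iC * cis (cd m).

Lemma Om_arc m x : th m.+3 < x < th m.+4 -> Om thI (cis x).
Proof.
rewrite th_per => /andP[h1 h2]; apply: Om_ev; first by rewrite cabs_cis.
have [h3 h4 h5 h6] := window_th m.
apply: (@periodic_all (fun k => cis x != ev k) m); first by move=> k; rewrite ev_per.
all: by apply: cis_sep; apply/andP; split; lra.
Qed.

Lemma V_arc m x : th m.+3 < x < th m.+4 -> V (cis x) = (expR (wl m x))%:C * cis (cd m).
Proof.
rewrite th_per => /andP[h1 h2]; have [h3 h4 h5 h6] := window_th m.
have := VE x ltr01; rewrite rC1 mul1r ln1 mulr0 => ->.
rewrite /scP -CexpD /scL.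
pose g k : R[i] := (a k)%:C * Clog (1 - cis x * cis (- th k)).
rewrite (_ : \sum_(k < 4) _ = \sum_(k < 4) g k); last by apply: eq_bigr.
rewrite (window m); last first.
  by move=> k; rewrite /g a_per th_per -!cisD opprD addrA -(cis2pi (_ - 2 * pi)) subrK.
have sm : a m + a m.+1 + a m.+2 + a m.+3 = 2 * kap by rewrite -(window m) //.
rewrite /g -!cisD !Clog_one_sub_cis; try by apply/andP; split; lra.
rewrite /Cexp !ReImE !mul0r !subr0 !addr0 !add0r; congr ((expR _)%:C * cis _).
rewrite (_ : kap = (a m + a m.+1 + a m.+2 + a m.+3) / 2); last by rewrite sm; field.
by rewrite /cd; field.
Qed.

Lemma cabs_dir m : cabs (dir m) = 1.
Proof. by rewrite cabsM cabs_i cabs_cis mulr1. Qed.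

Lemma dir_turn m : dir m.+1 = cis (- (pi * a m)) * dir m.
Proof.
rewrite /dir mulrCA -cisD; congr (_ * cis _).
by rewrite /cd th_per a_per; field.
Qed.

Lemma dir_per m : dir m.+4 = dir m.
Proof.
rewrite !dir_turn !mulrA -!cisD.
have -> : - (pi * a m.+3) - pi * a m.+2 - pi * a m.+1 - pi * a m = - (kap * (2 * pi)).
  have sm : a m + a m.+1 + a m.+2 + a m.+3 = 2 * kap by rewrite -(window m) //.
  rewrite (_ : kap = (a m + a m.+1 + a m.+2 + a m.+3) / 2); last by rewrite sm; field.
  by field.
case: kap1 => ->; rewrite ?mul1r ?mulN1r ?opprK.
  by rewrite -(cis2pi (- _)) addNr cis0 mul1r.
by rewrite -[2 * pi]add0r cis2pi cis0 mul1r.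
Qed.

(** Arclength along side [m], measured from its initial vertex; its derivative is [|V|]. *)
Definition lam m x : R := Re (conjc (dir m) * (Fh (cis x) - Fh (ev m.+3))).
Definition vv m : R[i] := Fh (ev m).
Definition len m : R := lam m (th m.+4).

Lemma vv_per m : vv m.+4 = vv m. Proof. by rewrite /vv ev_per. Qed.

Lemma pcont_Fh x : pcont (fun x => Fh (cis x)) x.
Proof.
move=> e e0; have c1 : cabs (cis x : R[i]) <= 1 by rewrite cabs_cis.
have [r r0 hr] := Fh_cont c1 (cis_neq0 x) e0.
have [s s0 hs] := pder_cont (pder_cis x) r0; exists s => // y /hs; apply: hr.
by rewrite cabs_cis.
Qed.

Lemma pder_Fh m x : th m.+3 < x < th m.+4 ->
  pder (fun x => Fh (cis x)) x ((expR (wl m x))%:C * dir m).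
Proof.
move=> hx; have o := Om_arc hx.
apply: pder_eq (pder_comp (pder_cis x) (Fh_cder o (cis_neq0 x))) _.
rewrite mulrCA -mulrA mulVf ?cis_neq0 // mulr1 (V_arc hx) /dir; ring.
Qed.

Lemma conj_dir m : conjc (dir m) * dir m = 1.
Proof. by rewrite mulrC mulJ_cabs cabs_dir expr1n. Qed.

Lemma lam_deriv m x : th m.+3 < x < th m.+4 -> is_derive x 1 (lam m) (expR (wl m x)).
Proof.
move=> hx; have h := pderZ (conjc (dir m)) (pderD (pder_Fh hx) (pder_cst (- Fh (ev m.+3)) x)).
apply: is_derive_eq (pder_Re h) _.
by rewrite addr0 mulrCA conj_dir mulr1.
Qed.

Lemma lam_cont m x : {for x, continuous (lam m)}.
Proof.
exact: pcont_Re (pcontM (pcont_cst (conjc (dir m)) x) (pcontD (pcont_Fh x) (pcont_cst (- Fh (ev m.+3)) x))).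
Qed.

Lemma lam_within m (A : set R) : {within A, continuous (lam m)}.
Proof. by apply: continuous_subspaceT => x; exact: lam_cont. Qed.

Lemma lam0 m : lam m (th m.+3) = 0.
Proof. by rewrite /lam subrr mulr0. Qed.

Lemma lam_lt m x y : th m.+3 <= x -> x < y -> y <= th m.+4 -> lam m x < lam m y.
Proof.
move=> hx xy hy; apply: (@derive_gt0_lt R (lam m) (fun x => expR (wl m x))) => //.
- by move=> t /andP[h1 h2]; apply: lam_deriv; apply/andP; split; [exact: le_lt_trans h1|exact: lt_le_trans h2 _].
- by move=> t _; exact: expR_gt0.
- exact: lam_within.
Qed.

Lemma len_gt0 m : 0 < len m.
Proof. by rewrite -(lam0 m); apply: lam_lt. Qed.

(** The component of [Fh] orthogonal to [dir m] has zero derivative inside the arc and is continuous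
    up to the endpoints. *)
Lemma Fh_arc m x : th m.+3 <= x <= th m.+4 -> Fh (cis x) = vv m.+3 + (lam m x)%:C * dir m.
Proof.
move=> /andP[h1 h2].
pose g y := Im (conjc (dir m) * (Fh (cis y) - Fh (ev m.+3))).
have gE : g x = g (th m.+3).
  apply: derive_eq0_eq => // [y /andP[h3 h4]|].
    have hy : th m.+3 < y < th m.+4 by rewrite h3; exact: lt_le_trans h2.
    have h := pderZ (conjc (dir m)) (pderD (pder_Fh hy) (pder_cst (- Fh (ev m.+3)) y)).
    by apply: is_derive_eq (pder_Im h) _; rewrite addr0 mulrCA conj_dir mulr1.
  apply: continuous_subspaceT => y.
  exact: pcont_Im (pcontM (pcont_cst (conjc (dir m)) y) (pcontD (pcont_Fh y) (pcont_cst (- Fh (ev m.+3)) y))).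
have gx : g x = 0 by rewrite gE /g subrr mulr0.
have e1 : (lam m x)%:C = conjc (dir m) * (Fh (cis x) - vv m.+3) by apply: Cext; rewrite ?ReC ?ImC.
by rewrite e1 mulrAC conj_dir mul1r addrC subrK.
Qed.

Lemma vv_next m : vv m.+4 = vv m.+3 + (len m)%:C * dir m.
Proof. by rewrite /vv -Fh_arc // lexx ltW. Qed.

(** Height across side [m]. The factor [kap] compensates for the sense of traversal, so that the
    polygon always lies where this is at most [top m]. *)
Definition side m z : R := kap * Im (conjc (dir m) * z).

Lemma sideD m z w : side m (z + w) = side m z + side m w.
Proof. by rewrite /side mulrDr ImD mulrDr. Qed.

Lemma sideZ m x z : side m (x%:C * z) = x * side m z.
Proof. by rewrite /side mulrCA ImCM mulrCA. Qed.

Lemma side_dir m : side m (dir m) = 0.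
Proof. by rewrite /side conj_dir mulr0. Qed.

Lemma sin_akap k : 0 < sin (pi * (kap * a k)).
Proof.
have /andP[h1 h2] := akap k; have p0 := pi_gt0 R.
by rewrite sin_gt0_pi // mulr_gt0 //= -[ltRHS]mulr1 ltr_pM2l.
Qed.

Lemma side_next m : side m (dir m.+1) < 0.
Proof.
rewrite /side dir_turn mulrCA conj_dir mulr1 /cis /= sinN mulrN oppr_lt0.
have := sin_akap m; case: kap1 => ->; rewrite ?mul1r // !mulN1r mulrN sinN //.
Qed.

Lemma side_prev m : 0 < side m (dir m.+3).
Proof.
have -> : side m (dir m.+3) = kap * Im (cis (pi * a m.+3)).
  have cc y : conjc (cis y) = cis (- y) :> R[i] by apply: Cext; rewrite /= ?cosN ?sinN.
  by rewrite /side -(dir_per m) dir_turn conjCM cc opprK -mulrA conj_dir mulr1.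
have := sin_akap m.+3; case: kap1 => ->; rewrite ?mul1r // !mulN1r mulrN sinN //.
Qed.

Definition top m : R := side m (vv m.+3).

Lemma side_vv4 m : side m (vv m.+4) = top m.
Proof. by rewrite vv_next sideD sideZ side_dir mulr0 addr0. Qed.

Lemma side_vv5 m : side m (vv m.+4.+1) < top m.
Proof.
by rewrite vv_next sideD sideZ side_vv4 gtrDl nmulr_llt0 ?len_gt0 // side_next.
Qed.

Lemma side_vv6 m : side m (vv m.+2) < top m.
Proof.
have := vv_next m.+3; rewrite (vv_per m.+3) (vv_per m.+2) /top => ->.
by rewrite sideD sideZ ltrDl mulr_gt0 ?len_gt0 ?side_prev.
Qed.

Lemma circle_from t z : cabs z = 1 -> exists2 x, t <= x < t + 2 * pi & z = cis x.
Proof.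
move=> z1; have c1 : cabs (z * cis (- t)) = 1 by rewrite cabsM z1 cabs_cis mulr1.
have [x /andP[h1 h2] e] := polar_unit c1; exists (t + x).
  by apply/andP; split; lra.
by rewrite cisD -e mulrCA -cisD subrr cis0 mulr1.
Qed.

Lemma lam_bounds m x : th m.+3 <= x <= th m.+4 -> 0 <= lam m x <= len m.
Proof.
move=> /andP[h1 h2]; rewrite -(lam0 m) /len; apply/andP; split.
  by move: h1; rewrite le_eqVlt => /predU1P[->//|h1]; rewrite ltW // lam_lt.
by move: h2; rewrite le_eqVlt => /predU1P[->//|h2]; rewrite ltW // lam_lt.
Qed.

(** The side after side [m] descends from its line, the side before it climbs back to it, and on the
    opposite side the height is affine between two values already below [top m]. *)
Lemma boundary_support m z : cabs z = 1 ->
  (exists2 x, th m.+3 <= x <= th m.+4 & z = cis x) \/ side m (Fh z) < top m.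
Proof.
move=> /(circle_from (th m.+3)) [x]; rewrite -th_per => /andP[h1 h2] ->.
have [l1|l1] := lerP x (th m.+4); first by left; exists x => //; rewrite h1.
right; have [l2|l2] := lerP x (th m.+4.+1).
  have hx : th m.+1.+3 <= x <= th m.+1.+4 by rewrite ltW.
  rewrite (Fh_arc hx) sideD side_vv4 sideZ gtrDl nmulr_llt0 ?side_next //.
  by rewrite -(lam0 m.+1) lam_lt.
have [l3|l3] := lerP x (th m.+4.+2).
  have hx : th m.+2.+3 <= x <= th m.+2.+4 by rewrite ltW.
  have /andP[h3 h4] := lam_bounds hx; have l0 := len_gt0 m.+2.
  have v5 := side_vv5 m; have v6 := side_vv6 m.
  have : side m (vv m.+4.+2) = side m (vv m.+4.+1) + len m.+2 * side m (dir m.+2).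
    by rewrite vv_next sideD sideZ.
  rewrite vv_per (Fh_arc hx) sideD sideZ.
  move: h3 h4 l0 v5 v6; set A := lam _ _; set L := len _; set D := side m (dir _).
  set s5 := side m _; set s2 := side m _; set T := top m => h3 h4 l0 v5 v6 e.
  have h5 : (T - s5) * (L - A) + (T - s2) * A = (T - s5 - A * D) * L by rewrite e; ring.
  have : 0 < (T - s5 - A * D) * L.
    rewrite -h5; move: h3; rewrite le_eqVlt => /predU1P[<-|h3]; first by rewrite subr0 mulr0 addr0 mulr_gt0 ?subr_gt0.
    by apply: ltr_wpDl; [apply: mulr_ge0; lra|apply: mulr_gt0; lra].
  by rewrite pmulr_lgt0 // subr_gt0; lra.
have hx : th m.+3.+3 <= x <= th m.+3.+4 by rewrite !ltW.
rewrite (Fh_arc hx) -[ltRHS]/(side m (vv m.+3)) -(vv_per m.+3) (vv_next m.+3) !sideD ltrD2l !sideZ ltr_pM2r ?side_prev //.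
by rewrite /len lam_lt // ltW.
Qed.

Lemma side_arc m x : th m.+3 <= x <= th m.+4 -> side m (Fh (cis x)) = top m.
Proof. by move=> hx; rewrite (Fh_arc hx) sideD sideZ side_dir mulr0 addr0. Qed.

Lemma side_le m z : cabs z = 1 -> side m (Fh z) <= top m.
Proof. by move=> /(boundary_support m) [[x hx ->]|/ltW //]; rewrite side_arc. Qed.

Lemma arc_from z : cabs z = 1 -> exists m x, th m.+3 <= x < th m.+4 /\ z = cis x.
Proof.
move=> /(circle_from (th 3)) [x]; rewrite -th_per => /andP[h1 h2] ->.
have [l1|l1] := ltrP x (th 4); first by exists 0%N, x; rewrite h1.
have [l2|l2] := ltrP x (th 5); first by exists 1%N, x; rewrite l1.
have [l3|l3] := ltrP x (th 6); first by exists 2%N, x; rewrite l2.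
by exists 3%N, x; rewrite l3.
Qed.

(** Height [top m] forces [w] onto the arc of [z], where arclength is strictly increasing. *)
Lemma Fh_inj_circle z w : cabs z = 1 -> cabs w = 1 -> Fh z = Fh w -> z = w.
Proof.
move=> /arc_from [m [x [hx ->]]] w1 e; have /andP[h1 h2] := hx.
have hx' : th m.+3 <= x <= th m.+4 by rewrite h1 ltW.
have [[y hy ey]|] := boundary_support m w1; last by rewrite -e side_arc // ltxx.
have : lam m x = lam m y.
  move: e; rewrite ey (Fh_arc hx') (Fh_arc hy) => /addrI.
  by move=> /(mulIf _) h; apply: complexI; apply: h; rewrite -cabs_eq0 cabs_dir oner_eq0.
have /andP[h3 h4] := hy; case: (ltgtP x y) => [l|l|->]; last by rewrite ey.
  by have := lam_lt h1 l h4; move=> + e'; rewrite e' ltxx.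
by have := lam_lt h3 l (ltW h2); move=> + e'; rewrite e' ltxx.
Qed.

End polygon_map.

Lemma sideE (R : realType) (th a : nat -> R) (kap : R) m z : side th a kap m z = kap * Im (conjc (dir th a m) * z).
Proof. by []. Qed.

Lemma topE (R : realType) (th a : nat -> R) (kap : R) F m : top th a kap F m = side th a kap m (vv th F m.+3).
Proof. by []. Qed.

(** * Maps onto a rectangle and onto the exterior of a polygon *)

Section images.
Variable R : realType.
Implicit Types (z w c : R[i]) (f k : R[i] -> R[i]) (r e : R).

Lemma cwithin_min (A : set R[i]) k (w : R[i]) : compact (A : set R[i]^o) -> A !=set0 -> cwithin A k ->
  exists2 z, A z & forall z', A z' -> cabs (k z - w) <= cabs (k z' - w).
Proof.
move=> cA A0 /cwithinP ck.
have cd : {within (A : set R[i]^o), continuous (fun z : R[i]^o => cabs (k z - w))}.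
  move=> x; apply: (@continuous_comp _ _ _ (k : subspace (A : set R[i]^o) -> R[i]^o) (fun z : R[i]^o => cabs (z - w))).
    exact: ck.
  apply: (@continuous_comp _ _ _ (fun z : R[i]^o => z - w : R[i]^o) (@cabs R)); last exact: cabs_continuous.
  by apply/(ccontP (fun z => z - w)); apply: ccontD; [exact: ccont_id|exact: ccont_cst].
have [z + hz] := compact_EVT_min (A0 : (A : set R[i]^o) !=set0) cA cd.
by rewrite inE => Az; exists z => // z' Az'; apply: hz; rewrite inE.
Qed.

Lemma cwithin_limit (A : set R[i]) k (w : R[i]) : compact (A : set R[i]^o) -> cwithin A k ->
  (forall e, 0 < e -> exists2 z, A z & cabs (k z - w) < e) -> exists2 z, A z & k z = w.
Proof.
move=> cA ck h; have [z0 A0 _] := h _ ltr01.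
have [z Az hz] := cwithin_min w cA (ex_intro _ z0 A0) ck.
exists z => //; apply/eqP; rewrite -subr_eq0 -cabs_eq0 eq_le cabs_ge0 andbT leNgt.
apply/negP => /h [z' Az']; apply/negP; rewrite -leNgt; exact: hz.
Qed.

Lemma cabs1_compact : compact ([set z | cabs z <= 1] : set R[i]^o).
Proof.
have -> : [set z : R[i] | cabs z <= 1] = [set z | cabs (z - 0) <= 1] by apply/seteqP; split=> x /=; rewrite subr0.
exact: compact_disc.
Qed.

Lemma circle_around_compact (c : R[i]) r : compact ([set z | cabs (z - c) = r] : set R[i]^o).
Proof.
apply: (@subclosed_compact R[i]^o _ [set z | cabs (z - c) <= r]); last 1 first.
- by move=> z /= ->.
- have -> : [set z : R[i]^o | cabs (z - c) = r] = (fun z : R[i]^o => cabs (z - c)) @^-1` [set r] by [].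
  apply: closed_comp; last exact: closed_eq.
  move=> z _; apply: (@continuous_comp _ _ _ (fun z : R[i]^o => z - c : R[i]^o) (@cabs R)); last exact: cabs_continuous.
  by apply/(ccontP (fun z => z - c)); apply: ccontD; [exact: ccont_id|exact: ccont_cst].
- exact: compact_disc.
Qed.

(** For [w] close to [f z0] the minimum of [|f z - w|] over the disc is attained inside. If it were
    positive, the nonzero derivative there would allow a step bringing [f] closer to [w]. *)
Lemma open_image f (z0 : R[i]) r : 0 < r ->
  (forall z, cabs (z - z0) <= r -> exists2 d, d != 0 & cder f z d) ->
  (forall z, cabs (z - z0) = r -> f z != f z0) ->
  exists2 m, 0 < m & forall w, cabs (w - f z0) < m -> exists2 z, cabs (z - z0) < r & f z = w.
Proof.
move=> r0 df fc.
pose S : set R[i] := [set z | cabs (z - z0) = r]; pose B : set R[i] := [set z | cabs (z - z0) <= r].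
have cB : cwithin B f by apply: ccont_within => z /df [d _ /cder_cont].
have cS : cwithin S f by apply: ccont_within => z hz; have [d _ /cder_cont] : exists2 d, d != 0 & cder f z d by apply: df; rewrite hz.
have S0 : S !=set0.
  by exists (z0 + r%:C); rewrite /S /= addrAC subrr add0r cabsR gtr0_norm.
have [zm Szm hm] := cwithin_min (f z0) (@circle_around_compact z0 r) S0 cS.
have m0 : 0 < cabs (f zm - f z0) by rewrite cabs_gt0 subr_eq0 fc.
exists (cabs (f zm - f z0) / 2); first by rewrite divr_gt0.
move=> w hw.
have B0 : B !=set0 by exists z0; rewrite /B /= subrr cabs0 ltW.
have [zs Bzs hs] := cwithin_min w (@compact_disc R z0 r) B0 cB.
have hs0 : cabs (f zs - w) < cabs (f zm - f z0) / 2.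
  by apply: le_lt_trans (hs z0 _) _; rewrite /B /= ?subrr ?cabs0 ?(ltW r0) // cabs_distrC.
have int : cabs (zs - z0) < r.
  rewrite lt_def [_ <= _]Bzs andbT; apply/eqP => e.
  have := hm zs (esym e); have := cabsD (f zs - w) (w - f z0); rewrite addrA subrK; lra.
exists zs => //; apply/eqP; rewrite -subr_eq0 -cabs_eq0 eq_le cabs_ge0 andbT leNgt; apply/negP => pos.
have [d d0 [phi [hphi cphi phid]]] := df zs Bzs.
have dp : 0 < cabs d / 2 by rewrite divr_gt0 ?cabs_gt0.
have [s s0 hs'] := cphi _ dp.
pose c := w - f zs; have c0 : c != 0 by rewrite -cabs_gt0 cabs_distrC.
pose q := Num.min s (r - cabs (zs - z0)); have q0 : 0 < q by rewrite lt_min s0 subr_gt0.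
(* A fraction [x] of the Newton step [c / d], short enough to stay in the disc and where the
   difference quotient differs from [d] by less than half of [|d|]. *)
pose x : R := Num.min 1 (q / (2 * cabs (c / d))).
have cd0 : 0 < cabs (c / d) by rewrite cabs_gt0 mulf_neq0 ?invr_eq0.
have x0 : 0 < x by rewrite lt_min ltr01 divr_gt0 // mulr_gt0.
have x1 : x <= 1 by rewrite ge_min lexx.
have xq : x * cabs (c / d) < q.
  have : x <= q / (2 * cabs (c / d)) by rewrite ge_min lexx orbT.
  by rewrite ler_pdivlMr ?mulr_gt0 // mulrCA; lra.
pose z := zs + x%:C * (c / d).
have zd : cabs (z - zs) < q by rewrite /z addrC addKr cabsM cabsR gtr0_norm.
have /andP[zs1 zs2] : (cabs (z - zs) < s) && (cabs (z - zs) < r - cabs (zs - z0)) by rewrite -lt_min.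
have Bz : B z.
  by rewrite /B /= (_ : z - z0 = (z - zs) + (zs - z0)) ?(le_trans (cabsD _ _)) //; [lra|ring].
have := hs z Bz; apply/negP; rewrite -ltNge.
have h1 := hs' z zs1; rewrite /= phid in h1.
have -> : f z - w = - c * ((1 - x)%:C - x%:C * ((phi z - d) / d)).
  have -> : f z - w = (f z - f zs) - c by rewrite /c; ring.
  by rewrite hphi /z (addrC zs) addrK rCB rC1; field.
have -> : cabs (f zs - w) = cabs c by rewrite cabs_distrC.
rewrite cabsM cabsN -[ltRHS]mulr1 ltr_pM2l ?cabs_gt0 //.
apply: le_lt_trans (cabsB _ _) _; rewrite cabsR !cabsM cabsV cabsR !ger0_norm ?subr_ge0 //; last exact: ltW.
have : cabs (phi z - d) / cabs d < 1 / 2 by rewrite ltr_pdivrMr ?cabs_gt0 //; lra.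
nra.
Qed.

(** Connectedness of the unit interval, in the form used for surjectivity: [S s] will say that the
    point of parameter [s] on a segment is attained. *)
Lemma segment_open_closed (S : R -> Prop) : S 0 ->
  (forall s, 0 <= s <= 1 -> S s -> exists2 e, 0 < e & forall s', 0 <= s' <= 1 -> `|s' - s| < e -> S s') ->
  (forall s, 0 <= s <= 1 -> (forall e, 0 < e -> exists s', [/\ 0 <= s' <= 1, `|s' - s| < e & S s']) -> S s) ->
  S 1.
Proof.
move=> S0 op cl.
pose T : set R := [set s | 0 <= s <= 1 /\ forall s', 0 <= s' <= s -> S s'].
have T0 : T 0.
  split=> [|s' h]; first by rewrite lexx ler01.
  by have -> : s' = 0; [apply/eqP; rewrite eq_le andbC|].
have ubT : ubound T 1 by move=> s [/andP[]].
have hT : has_sup T by split; [exists 0|exists 1].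
pose b := sup T.
have b0 : 0 <= b by apply: sup_upper_bound.
have b1 : b <= 1 by apply: ge_sup => //; exists 0.
have hb : 0 <= b <= 1 by rewrite b0.
have below s : 0 <= s < b -> S s.
  move=> /andP[s0 sb]; have e0 : 0 < b - s by rewrite subr_gt0.
  have [s1 [_ h1] h2] := sup_adherent e0 hT.
  by apply: h1; rewrite s0 /=; move: h2; rewrite -/b; lra.
have Sb : S b.
  apply: cl => // e e0; move: b0; rewrite le_eqVlt => /predU1P [<-|b0].
    by exists 0; rewrite lexx ler01 subrr normr0.
  pose s' := Num.max 0 (b - e / 2); exists s'.
  have h1 : 0 <= s' < b by rewrite /s' le_max lexx gt_max b0 /=; lra.
  have h2 : b - e / 2 <= s' by rewrite le_max lexx orbT.
  split; last exact: below.
    by case/andP: h1 => h3 h4; rewrite h3; lra.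
  by case/andP: h1 => h3 h4; rewrite ltr_norml; apply/andP; split; lra.
move: b1; rewrite le_eqVlt => /predU1P [<- //|b1].
have [e e0 he] := op b hb Sb.
pose s' := Num.min 1 (b + e / 2).
have h1 : b < s' <= 1 by rewrite /s' lt_min b1 ge_min lexx /= andbT; lra.
have h2 : s' <= b + e / 2 by rewrite ge_min lexx orbT.
have /andP[h3 h4] := h1.
have : s' <= b.
  apply: sup_upper_bound => //; split; first by apply/andP; split; lra.
  move=> s /andP[g1 g2]; have [g3|g3] := ltrP s b; first by apply: below; rewrite g1.
  by apply: he; [apply/andP; split; lra|rewrite ltr_norml; apply/andP; split; lra].
by rewrite leNgt h3.
Qed.

End images.

(** With [ext_map] below, the interface between the two Schwarz-Christoffel maps and the computation
    of the modulus, which uses nothing else about them. *)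
Definition rect_map (R : realType) (g : R[i] -> R[i]) (e : nat -> R[i]) (h : R) : Prop :=
  [/\ 0 < h, cwithin [set z | cabs z <= 1] g,
      forall z w, cabs z <= 1 -> cabs w <= 1 -> g z = g w -> z = w,
      forall z, cabs z < 1 -> open_rectangle h (g z) /\ exists2 d, d != 0 & cder g z d
    & [/\ forall w, open_rectangle h w -> exists2 z, cabs z < 1 & g z = w,
          forall z, cabs z <= 1 -> closed_rectangle h (g z),
          forall w, closed_rectangle h w -> exists2 z, cabs z <= 1 & g z = w
        & [/\ g (e 0%N) = 0, g (e 1%N) = 1, g (e 2%N) = 1 +i* h & g (e 3%N) = 0 +i* h]]].

Definition hull4 (R : realType) (v : nat -> R[i]) (z : R[i]) : Prop :=
  exists l0 l1 l2 l3 : R, [/\ [/\ 0 <= l0, 0 <= l1, 0 <= l2 & 0 <= l3], l0 + l1 + l2 + l3 = 1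
    & z = l0%:C * v 0%N + l1%:C * v 1%N + l2%:C * v 2%N + l3%:C * v 3%N].

(** [f] in the coordinate [1 / w] at infinity: a simple pole at 0 is a nonzero derivative of this
    function there. *)
Definition pole_inv (R : realType) (f : R[i] -> R[i]) (z : R[i]) : R[i] := if z == 0 then 0 else (f z)^-1.

Definition ext_map (R : realType) (f : R[i] -> R[i]) (e v : nat -> R[i]) : Prop :=
  [/\ cwithin [set z | cabs z <= 1 /\ z != 0] f,
      forall z w, cabs z <= 1 -> z != 0 -> cabs w <= 1 -> w != 0 -> f z = f w -> z = w,
      forall z, cabs z < 1 -> z != 0 -> ~ hull4 v (f z) /\ exists2 d, d != 0 & cder f z d,
      forall w, ~ hull4 v w -> exists2 z, cabs z < 1 /\ z != 0 & f z = w
    & (exists2 d, d != 0 & cder (pole_inv f) 0 d) /\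
      forall k, (k < 4)%N -> cabs (e k) = 1 /\ f (e k) = v k].

Lemma pole_inv0 (R : realType) (f : R[i] -> R[i]) : pole_inv f 0 = 0.
Proof. by rewrite /pole_inv eqxx. Qed.

(** Because [0^-1 = 0], zeros of [f] are also zeros of [pole_inv f]; near the pole the nonzero
    derivative excludes them. *)
Lemma pole_nonzero (R : realType) (f : R[i] -> R[i]) : (exists2 d, d != 0 & cder (pole_inv f) 0 d) ->
  exists2 r : R, 0 < r < 1 & forall z, cabs z < r -> z != 0 -> f z != 0.
Proof.
move=> [d d0 [phi [hphi cphi phid]]].
have dp : 0 < cabs d by rewrite cabs_gt0.
have [s s0 hs] := cphi _ dp.
have m1 : Num.min s (1 / 2) <= s by rewrite ge_min lexx.
have m2 : Num.min s (1 / 2) <= 1 / 2 by rewrite ge_min lexx orbT.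
exists (Num.min s (1 / 2)); first by rewrite lt_min s0 /=; apply/andP; split; lra.
move=> z zs z0; have /= := hphi z; rewrite pole_inv0 !subr0 /pole_inv (negbTE z0) => e.
have zs' : cabs (z - 0) < s by rewrite subr0; lra.
rewrite -invr_eq0 e mulf_neq0 //; apply: contraTneq (hs z zs') => ->.
by rewrite phid sub0r cabsN -leNgt.
Qed.

(** * The interior map onto a rectangle *)

Section interior_map.
Variable R : realType.
Variables (th : nat -> R) (F V : R[i] -> R[i]).
Implicit Types (z w c : R[i]) (k m j : nat) (r x y t : R).
Local Notation thI := (fun k : 'I_4 => th k).
Local Notation a := (fun k : nat => - (1 / 2) : R).
Local Notation aI := (fun k : 'I_4 => - (1 / 2) : R).
Hypothesis H : sc_data th a (-1) F V.
Hypothesis dF0 : exists2 d, d != 0 & cder F 0 d.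

Let kap2 := sc_kap2 H.
Let akap' (k : 'I_4) : 0 < (-1) * aI k. Proof. by have /andP[] := sc_akap H k. Qed.
Let suma := sc_suma H.
Let VE := sc_VE H.
Let dF := sc_dF H.
Local Notation Fh := (Fh th F).
Local Notation side := (side th a (-1)).
Local Notation top := (top th a (-1) F).
Local Notation dir := (dir th a).
Local Notation len := (len th a F).
Local Notation vv := (vv th F).

Lemma disc_Om z : cabs z < 1 -> Om thI z.
Proof. exact: Om_disc. Qed.

Lemma disc_der z : cabs z < 1 -> exists2 d, d != 0 & cder F z d.
Proof.
move=> z1; have [->|z0] := eqVneq z 0; first exact: dF0.
exists (V z / z); last exact: dF (disc_Om z1) z0.
by rewrite mulf_neq0 ?invr_eq0 //; exact: V_neq0' kap2 VE _ z0.
Qed.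

Lemma disc_Fh z : cabs z < 1 -> Fh z = F z.
Proof. by move=> z1; apply: (Fh_Om H); exact: disc_Om. Qed.

Lemma Fh_within : cwithin [set z | cabs z <= 1] Fh.
Proof.
move=> z /= z1 e e0; have [z0|z0] := eqVneq z 0; last first.
  exact: (Fh_cont H z1 z0 e0).
have [d _ /cder_cont /(_ e e0) [r r0 hr]] := dF0.
exists (Num.min r 1); first by rewrite lt_min r0 ltr01.
rewrite z0 => w w1; rewrite lt_min => /andP[wr w2]; rewrite !disc_Fh ?cabs0 ?ltr01 //; first exact: hr.
by move: w2; rewrite subr0.
Qed.

(** No linear functional of [F] has an interior maximum: off the centre by comparison with a larger
    circle, at the centre because [F] has a nonzero derivative. *)
Lemma inner_better c z : c != 0 -> cabs z < 1 -> exists2 z', cabs z' < 1 & Re (c * F z) < Re (c * F z').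
Proof.
move=> c0 z1; have [->|z0] := eqVneq z 0; last first.
  have zp : 0 < cabs z by rewrite cabs_gt0.
  have hr : 0 < (1 + cabs z) / 2 < 1 by apply/andP; split; lra.
  have hk : 0 < -1 * (cabs z - (1 + cabs z) / 2) by lra.
  have hz : 0 < cabs z < 1 by rewrite zp.
  have [z' z'r h] := annulus_max kap2 akap' suma VE dF isT hr hz c0 hk.
  by exists z' => //; rewrite z'r; case/andP: hr.
have [d d0 hd] := dF0.
pose p x : R[i] := x%:C * conjc (c * d).
have p0 : p 0 = 0 by rewrite /p mul0r.
have cd0 : 0 < cabs (c * d) by rewrite cabs_gt0 mulf_neq0.
have dp : pder p 0 (conjc (c * d)).
  by apply: pder_eq (pderM (pder_id 0) (pder_cst (conjc (c * d)) 0)) _; rewrite mul1r mulr0 addr0.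
have hd' : cder F (p 0) d by rewrite p0.
have dl := pder_Re (pderZ c (pder_comp dp hd')).
have h0 : 0 < 1 * Re (c * (d * conjc (c * d))).
  by rewrite mul1r mulrA mulJ_cabs ReC exprn_gt0.
have e0 : 0 < (1 + cabs (c * d))^-1 by rewrite invr_gt0; lra.
have [y [y1 y2 y3]] := derive_pos_increase dl h0 e0.
exists (p y); last by move: y3; rewrite p0.
move: y1 y2; rewrite subr0 mul1r => y1; rewrite gtr0_norm // => y2.
rewrite /p cabsM cabsR cabsJ gtr0_norm //.
have : y * (1 + cabs (c * d)) < 1 by rewrite -ltr_pdivlMr ?mul1r //; lra.
lra.
Qed.

Lemma side_open z m : cabs z < 1 -> side m (F z) < top m.
Proof.
move=> z1; pose c : R[i] := (-1)%:C * (- iC) * conjc (dir m).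
have sideE w : side m w = Re (c * w).
  by rewrite /c -[_ * _ * _ * w]mulrA -[_ * _ * (_ * w)]mulrA ReCM; congr (_ * _); rewrite !ReImE; ring.
have c0 : c != 0 by rewrite -cabs_gt0 !cabsM cabsJ cabs_dir cabsR cabsN cabs_i normrN1 !mulr1 ltr01.
pose A : set R[i] := [set z | cabs z <= 1].
have cA : compact (A : set R[i]^o).
  have -> : A = [set z | cabs (z - 0) <= 1] by apply/seteqP; split=> x /=; rewrite subr0.
  exact: compact_disc.
have cc : {within (A : set R[i]^o), continuous (fun z : R[i]^o => Re (c * Fh z))}.
  have /cwithinP h := Fh_within; move=> x.
  apply: (@continuous_comp _ _ _ (Fh : subspace (A : set R[i]^o) -> R[i]^o) (fun z : R[i]^o => Re (c * z))); first exact: h.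
  apply: (@continuous_comp _ _ _ (fun z : R[i]^o => c * z : R[i]^o) (@complex.Re R)); last exact: Re_continuous.
  by apply/(ccontP (fun z => c * z)); apply: ccontM; [exact: ccont_cst|exact: ccont_id].
have A0 : (A : set R[i]^o) !=set0 by exists 0; rewrite /A /= cabs0.
have [zs + hzs] := compact_EVT_max A0 cA cc; rewrite inE => Azs.
have {}hzs w : A w -> Re (c * Fh w) <= Re (c * Fh zs) by move=> Aw; apply: hzs; rewrite inE.
have zs1 : cabs zs = 1.
  apply/eqP; rewrite eq_le [_ <= 1]Azs /= leNgt; apply/negP => h.
  have [z' z'1 h'] := inner_better c0 h.
  have := hzs z' (ltW z'1); rewrite !disc_Fh // leNgt h' //.
have [z' z'1 h'] := inner_better c0 z1.
rewrite sideE; apply: lt_le_trans h' _; rewrite -(disc_Fh z'1).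
apply: le_trans (hzs z' (ltW z'1)) _; rewrite -sideE.
exact: (side_le H).
Qed.

Lemma circle_top z : cabs z = 1 -> exists m, side m (Fh z) = top m.
Proof.
move=> /(arc_from H) [m [x [/andP[h1 h2] ->]]]; exists m.
by apply: (side_arc H); rewrite h1 ltW.
Qed.

(** Boundary and interior points are told apart by a height equal to or below [top m]. The centre is
    treated separately, because the nesting lemmas concern circles of positive radius. *)
Lemma Fh_inj_disc z w : cabs z <= 1 -> cabs w <= 1 -> Fh z = Fh w -> z = w.
Proof.
have mixed u v : cabs u < 1 -> cabs v = 1 -> Fh u <> Fh v.
  move=> u1 v1 e; have [m hm] := circle_top v1; have := side_open m u1.
  by rewrite -disc_Fh // e hm ltxx.
have zero u : 0 < cabs u < 1 -> F 0 <> F u.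
  move=> hu e; have /andP[u0 u1] := hu.
  have hr : 0 < cabs u / 2 < 1 by apply/andP; split; lra.
  have hk : 0 < -1 * (cabs u / 2 - cabs u) by lra.
  have := @sep_limit R 4 aI thI (-1) F V kap2 akap' suma VE dF isT u (cabs u / 2) (F 0) hu hr hk.
  rewrite e ltxx => hno; have : false; last by []; apply: hno => d d0; rewrite -e.
  have [d' _ /cder_cont /(_ d d0) [s s0 hs]] := dF0.
  pose y := Num.min s (cabs u / 2) / 2; have y0 : 0 < y by rewrite divr_gt0 // lt_min s0; case/andP: hr.
  have m1 : Num.min s (cabs u / 2) <= s by rewrite ge_min lexx.
  have m2 : Num.min s (cabs u / 2) <= cabs u / 2 by rewrite ge_min lexx orbT.
  have ym : y = Num.min s (cabs u / 2) / 2 by []; clearbody y.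
  exists y%:C; rewrite cabsR gtr0_norm //; split; first by rewrite y0; lra.
    by lra.
  by apply: hs; rewrite subr0 cabsR gtr0_norm //; lra.
move=> z1 w1 e; have [|z2] := ltrP (cabs z) 1; last first.
  have {}z1 : cabs z = 1 by apply/eqP; rewrite eq_le z1.
  have [|w2] := ltrP (cabs w) 1; first by move=> w2; case: (mixed w z).
  have {}w1 : cabs w = 1 by apply/eqP; rewrite eq_le w1.
  exact: (Fh_inj_circle H).
move=> z2; have [|w2] := ltrP (cabs w) 1; last first.
  have {}w1 : cabs w = 1 by apply/eqP; rewrite eq_le w1.
  by case: (mixed z w).
move=> w2; move: e; rewrite !disc_Fh // => e.
have [z0|z0] := eqVneq z 0; have [w0|w0] := eqVneq w 0.
- by rewrite z0 w0.
- by case: (zero w); rewrite ?cabs_gt0 ?w0 ?w2 // -z0.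
- by case: (zero z); rewrite ?cabs_gt0 ?z0 ?z2 // -w0.
- by apply: (inj_open kap2 akap' suma VE dF isT) => //; rewrite cabs_gt0 ?z0 ?w0.
Qed.

(** Continuation along the segment from [F 0] to [w]. By convexity the segment stays strictly below
    every side, so a limit of preimages cannot lie on the circle. *)
Lemma disc_onto w : (forall m, side m w < top m) -> exists2 z, cabs z < 1 & F z = w.
Proof.
move=> hw; pose p s : R[i] := F 0 + s%:C * (w - F 0).
have p0 : p 0 = F 0 by rewrite /p mul0r addr0.
have p1 : p 1 = w by rewrite /p rC1 mul1r addrC subrK.
have pd s s' : cabs (p s' - p s) = `|s' - s| * cabs (w - F 0).
  by rewrite -cabsR -cabsM /p rCB; congr cabs; ring.
have ps s m : 0 <= s <= 1 -> side m (p s) < top m.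
  move=> /andP[s0 s1]; have h0 : side m (F 0) < top m by apply: side_open; rewrite cabs0.
  have := hw m; rewrite (_ : p s = (1 - s)%:C * F 0 + s%:C * w); last by rewrite /p rCB rC1; ring.
  rewrite sideD !sideZ; move: h0 s0; set X := side m _; set Y := side m _; set T := top m => h0.
  rewrite le_eqVlt => /predU1P[<-|s0] h1; first by rewrite subr0 mul1r mul0r addr0.
  have : 0 < s * (T - Y) by rewrite mulr_gt0 // subr_gt0.
  have : 0 <= (1 - s) * (T - X) by rewrite mulr_ge0 ?subr_ge0 // ltW.
  lra.
have wF : 0 < 1 + cabs (w - F 0) by rewrite ltr_pwDl ?cabs_ge0.
have [|||z z1 h] := @segment_open_closed R (fun s => exists2 z, cabs z < 1 & F z = p s); last by exists z => //; rewrite h.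
- by exists 0; rewrite ?cabs0.
- move=> s hs [z z1 zE]; pose r := (1 - cabs z) / 2.
  have r0 : 0 < r by rewrite divr_gt0 // subr_gt0.
  have sub z' : cabs (z' - z) <= r -> cabs z' < 1.
    by have := cabs_leB z' z; rewrite /r; lra.
  have [||m m0 hm] := @open_image R F z r r0.
  - by move=> z' /sub; exact: disc_der.
  - move=> z' hz'; have z'1 : cabs z' < 1 by apply: sub; rewrite hz'.
    apply/eqP => e; have zz : z' = z by apply: Fh_inj_disc; rewrite ?ltW // !disc_Fh.
    by move: hz' r0; rewrite zz subrr cabs0 => <-; rewrite ltxx.
  exists (m / (1 + cabs (w - F 0))); first by rewrite divr_gt0.
  move=> s' hs'; rewrite ltr_pdivlMr // => h.
  have [|z' z'1 e] := hm (p s').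
    rewrite zE pd; apply: le_lt_trans h; rewrite ler_wpM2l //; lra.
  by exists z' => //; apply: sub; exact: ltW.
- move=> s hs h.
  have [|z /= z1 zE] := @cwithin_limit R [set z | cabs z <= 1] Fh (p s) (@cabs1_compact R) Fh_within.
  - move=> e e0; have [|s' [hs' h1 [z z1 zE]]] := h (e / (1 + cabs (w - F 0))); first by rewrite divr_gt0.
    exists z; first exact: ltW.
    rewrite disc_Fh // zE pd; move: h1; rewrite ltr_pdivlMr //; apply: le_lt_trans.
    by rewrite ler_wpM2l //; lra.
  have [z2|z2] := ltrP (cabs z) 1; first by exists z => //; rewrite -disc_Fh.
  have {}z1 : cabs z = 1 by apply/eqP; rewrite eq_le z1.
  by have [m hm] := circle_top z1; have := ps s m hs; rewrite -zE hm ltxx.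
Qed.

Local Notation ev := (ev th).

Lemma side_per m z : side m.+4 z = side m z.
Proof. by rewrite !sideE (dir_per H). Qed.

Lemma top_per m : top m.+4 = top m.
Proof. by rewrite !topE side_per -(vv_per H m.+3). Qed.

(** Side 1 joins the images of [ev 0] and [ev 1]; this similarity places it on the unit interval,
    and [rect_fun] undoes it. *)
Definition rect_pt w : R[i] := vv 4 + (len 1)%:C * w * dir 1.
Definition rect_fun z : R[i] := (Fh z - vv 4) / ((len 1)%:C * dir 1).
Definition rect_h : R := len 2 / len 1.

Let base0 : (len 1)%:C * dir 1 != 0.
Proof. by rewrite mulf_neq0 ?rC_eq0 ?(gt_eqF (len_gt0 H 1)) // -cabs_eq0 cabs_dir oner_eq0. Qed.

Lemma rect_ptK w : (rect_pt w - vv 4) / ((len 1)%:C * dir 1) = w.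
Proof. by rewrite /rect_pt (addrC (vv 4)) addrK (mulrAC _ w) mulrC mulKf. Qed.

Lemma rect_funE z : Fh z = rect_pt (rect_fun z).
Proof. by rewrite /rect_pt mulrAC [_ * rect_fun z]mulrC divfK // addrC subrK. Qed.

Lemma dir_quarter m : dir m.+1 = iC * dir m.
Proof.
rewrite (dir_turn H); congr (_ * _).
have -> : - (pi * - (1 / 2)) = pi / 2 :> R by field.
by rewrite /cis cos_pihalf sin_pihalf.
Qed.

Let dirs : [/\ dir 2 = iC * dir 1, dir 3 = - dir 1 & dir 4 = - (iC * dir 1)].
Proof.
have ii : iC * iC = -1 :> R[i] by apply: Cext; rewrite !ReImE; ring.
have e2 : dir 2 = iC * dir 1 := dir_quarter 1.
have e3 : dir 3 = - dir 1 by rewrite (dir_quarter 2) e2 mulrA ii mulN1r.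
by split; rewrite ?(dir_quarter 3) ?e3 ?mulrN.
Qed.

(** Exponents -1/2 give four quarter turns, and the closing of the polygon then forces opposite
    sides to be equal. *)
Lemma rect_vv : [/\ vv 5 = rect_pt 1, vv 6 = rect_pt (1 +i* rect_h), vv 7 = rect_pt (0 +i* rect_h) & vv 8 = rect_pt 0].
Proof.
have l1 := gt_eqF (len_gt0 H 1).
have hC : (len 1)%:C * (rect_h)%:C = (len 2)%:C by rewrite -rCM /rect_h mulrC divfK ?l1.
have v5 : vv 5 = vv 4 + (len 1)%:C * dir 1 := vv_next H 1.
have v6 : vv 6 = vv 5 + (len 2)%:C * dir 2 := vv_next H 2.
have v7 : vv 7 = vv 6 + (len 3)%:C * dir 3 := vv_next H 3.
have v8 : vv 8 = vv 7 + (len 4)%:C * dir 4 := vv_next H 4.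
have [d2 d3 d4] := dirs.
have e6 : vv 6 = rect_pt (1 +i* rect_h).
  rewrite v6 v5 d2 /rect_pt -hC -addrA; congr (_ + _).
  have -> : 1 +i* rect_h = 1 + iC * rect_h%:C by apply: Cext; rewrite !ReImE; ring.
  by ring.
have e8 : vv 8 = vv 4 by rewrite -(vv_per H 4).
have key : rect_h%:C * iC * (len 1)%:C + (len 1)%:C - (len 3)%:C - (len 4)%:C * iC = 0.
  have : vv 8 - vv 4 = (rect_h%:C * iC * (len 1)%:C + (len 1)%:C - (len 3)%:C - (len 4)%:C * iC) * dir 1.
    rewrite v8 v7 v6 v5 d4 d3 d2 -hC; ring.
  rewrite e8 subrr => /esym/eqP; rewrite mulf_eq0 => /orP[/eqP //|/eqP h].
  by move: base0; rewrite h mulr0 eqxx.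
have k3 : len 3 = len 1.
  have := congr1 (@complex.Re R) key; rewrite !ReImE; lra.
split.
- by rewrite v5 /rect_pt mulr1.
- exact: e6.
- rewrite v7 e6 d3 k3 /rect_pt.
  have -> : 1 +i* rect_h = 1 + iC * rect_h%:C by apply: Cext; rewrite !ReImE; ring.
  have -> : 0 +i* rect_h = iC * rect_h%:C by apply: Cext; rewrite !ReImE; ring.
  by ring.
- by rewrite e8 /rect_pt mulr0 mul0r addr0.
Qed.

Lemma side_rect w : [/\ side 1 (rect_pt w) - top 1 = - (len 1 * Im w),
  side 2 (rect_pt w) - top 2 = len 1 * (Re w - 1),
  side 3 (rect_pt w) - top 3 = len 1 * (Im w - rect_h) &
  side 4 (rect_pt w) - top 4 = - (len 1 * Re w)].
Proof.
have [v5 v6 v7 v8] := rect_vv.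
have diff m u v : side m (rect_pt u) - side m (rect_pt v) = - Im (conjc (dir m) * dir 1 * ((len 1)%:C * (u - v))).
  rewrite !sideE -mulrBr -ImB mulN1r; congr (- Im _); rewrite /rect_pt; ring.
have cc : conjc (dir 1) * dir 1 = 1 := conj_dir _ _ 1.
have [d2 d3 d4] := dirs.
have c2 : conjc (dir 2) * dir 1 = - iC.
  by rewrite d2 conjCM -mulrA cc mulr1; apply: Cext; rewrite !ReImE ?oppr0.
have c3 : conjc (dir 3) * dir 1 = -1.
  by rewrite d3 raddfN mulNr cc.
have c4 : conjc (dir 4) * dir 1 = iC.
  rewrite d4 (_ : conjc (- _) = iC * conjc (dir 1)); last by apply: Cext; rewrite !ReImE; ring.
  by rewrite -mulrA cc mulr1.
have v4 : vv 4 = rect_pt 0 by rewrite /rect_pt mulr0 mul0r addr0.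
have t4 : top 4 = side 4 (vv 8) by rewrite -(side_vv4 H 4).
split.
- by rewrite topE v4 diff cc mul1r ImCM subr0.
- rewrite topE v5 diff c2 !ReImE; ring.
- rewrite topE v6 diff c3 !ReImE; ring.
- rewrite t4 v8 diff c4 !ReImE; ring.
Qed.

Lemma rect_h_gt0 : 0 < rect_h.
Proof. by rewrite divr_gt0 ?(len_gt0 H). Qed.

Lemma side_open_rect w : (forall m, side m (rect_pt w) < top m) <-> open_rectangle rect_h w.
Proof.
have l1 := len_gt0 H 1; have [s1 s2 s3 s4] := side_rect w; split=> [h|[/andP[h1 h2] /andP[h3 h4]]].
  have h1 := h 1%N; have h2 := h 2%N; have h3 := h 3%N; have h4 := h 4%N.
  rewrite -subr_lt0 s1 oppr_lt0 pmulr_rgt0 // in h1; rewrite -subr_lt0 s2 pmulr_rlt0 // subr_lt0 in h2.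
  rewrite -subr_lt0 s3 pmulr_rlt0 // subr_lt0 in h3; rewrite -subr_lt0 s4 oppr_lt0 pmulr_rgt0 // in h4.
  by rewrite /open_rectangle /= h1 h2 h3 h4.
apply: (@periodic_all (fun m => side m (rect_pt w) < top m) 1).
- by move=> k; rewrite side_per top_per.
- by rewrite -subr_lt0 s1 oppr_lt0 mulr_gt0.
- by rewrite -subr_lt0 s2 pmulr_rlt0 // subr_lt0.
- by rewrite -subr_lt0 s3 pmulr_rlt0 // subr_lt0.
- by rewrite -subr_lt0 s4 oppr_lt0 mulr_gt0.
Qed.

Lemma rect_within : cwithin [set z | cabs z <= 1] rect_fun.
Proof.
move=> z z1 e e0; have b0 : 0 < cabs ((len 1)%:C * dir 1) by rewrite cabs_gt0.
have [r r0 hr] := Fh_within z1 (mulr_gt0 e0 b0); exists r => // w w1 wz.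
rewrite /rect_fun -mulrBl opprB addrA subrK cabsM cabsV ltr_pdivrMr //; exact: hr.
Qed.

Lemma rect_mapP : rect_map rect_fun ev rect_h.
Proof.
have hop z : cabs z < 1 -> open_rectangle rect_h (rect_fun z).
  move=> z1; apply/side_open_rect => m; rewrite -rect_funE disc_Fh //; exact: side_open.
have hsurj w : open_rectangle rect_h w -> exists2 z, cabs z < 1 & rect_fun z = w.
  move=> /side_open_rect /disc_onto [z z1 e]; exists z => //.
  by rewrite /rect_fun disc_Fh // e rect_ptK.
have l1 := len_gt0 H 1; have h0 := rect_h_gt0.
split => //.
- exact: rect_within.
- move=> z w z1 w1 e; apply: Fh_inj_disc => //; by rewrite !rect_funE e.
- move=> z z1; split; first exact: hop.
  have [d d0 hd] := disc_der z1; exists (d / ((len 1)%:C * dir 1)); first by rewrite mulf_neq0 ?invr_eq0.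
  have hF := cder_near hd (Fh_near H (disc_Om z1)).
  have := cderM (cderB hF (cder_cst (vv 4) z)) (cder_cst ((len 1)%:C * dir 1)^-1 z).
  by rewrite mulr0 addr0 subr0.
- split => //.
  + move=> z z1; have [z2|z2] := ltrP (cabs z) 1.
      have [/andP[h1 h2] /andP[h3 h4]] := hop z z2.
      by split; apply/andP; split; exact: ltW.
    have {}z1 : cabs z = 1 by apply/eqP; rewrite eq_le z1.
    have [s1 s2 s3 s4] := side_rect (rect_fun z).
    have g1 := side_le H 1 z1; have g2 := side_le H 2 z1; have g3 := side_le H 3 z1; have g4 := side_le H 4 z1.
    rewrite rect_funE -subr_le0 s1 oppr_le0 pmulr_rge0 // in g1; rewrite rect_funE -subr_le0 s2 pmulr_rle0 // subr_le0 in g2.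
    rewrite rect_funE -subr_le0 s3 pmulr_rle0 // subr_le0 in g3; rewrite rect_funE -subr_le0 s4 oppr_le0 pmulr_rge0 // in g4.
    by rewrite /closed_rectangle /= g1 g2 g3 g4.
  (* Points between [w] and the centre [c] are interior, hence attained, and they tend to [w];
     compactness of the disc does the rest. *)
  + move=> w [/andP[h1 h2] /andP[h3 h4]]; apply: (cwithin_limit (@cabs1_compact R) rect_within) => e e0.
    pose c : R[i] := (1 / 2) +i* (rect_h / 2).
    have wc : 0 < 1 + cabs (c - w) by have := cabs_ge0 (c - w); lra.
    pose s := Num.min 1 (e / (1 + cabs (c - w))).
    have s0 : 0 < s by rewrite lt_min ltr01 divr_gt0.
    have s1 : s <= 1 by rewrite ge_min lexx.
    have se : s * (1 + cabs (c - w)) <= e by rewrite -ler_pdivlMr // ge_min lexx orbT.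
    clearbody s.
    have [|z z1 zE] := hsurj (w + s%:C * (c - w)).
      move: h1 h2 h3 h4; case: w {wc se} => x y /= h1 h2 h3 h4.
      split; rewrite /= ?mul0r ?subr0 ?addr0; apply/andP; split; nra.
    exists z; first exact: ltW.
    rewrite zE addrC addKr cabsM cabsR gtr0_norm //; move: se; lra.
  + have [v5 v6 v7 v8] := rect_vv.
    have v k : vv k.+4 = Fh (ev k) by rewrite (vv_per H k).
    split; rewrite /rect_fun -v ?v5 ?v6 ?v7 ?rect_ptK // subrr mul0r //.
Qed.

End interior_map.

(** * The exterior map and its pole *)

Section exterior_map.
Variable R : realType.
Variables (th a : nat -> R) (F V : R[i] -> R[i]).
Implicit Types (z w c : R[i]) (k m j : nat) (r x y t : R).
Local Notation thI := (fun k : 'I_4 => th k).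
Local Notation aI := (fun k : 'I_4 => a k).
Hypothesis H : sc_data th a 1 F V.
Hypothesis pole : exists2 d, d != 0 & cder (pole_inv F) 0 d.
Let kap2 := sc_kap2 H.
Let akap' (k : 'I_4) : 0 < 1 * aI k. Proof. by have /andP[] := sc_akap H k. Qed.
Let suma := sc_suma H.
Let VE := sc_VE H.
Let dF := sc_dF H.
Local Notation Fh := (Fh th F).
Local Notation dir := (dir th a).
Local Notation len := (len th a F).
Local Notation lam := (lam th a F).
Local Notation vv := (vv th F).
Local Notation ev := (ev th).

Let disc_Om z : cabs z < 1 -> Om thI z.
Proof. exact: Om_disc. Qed.

Lemma ext_Fh z : cabs z < 1 -> Fh z = F z.
Proof. by move=> z1; apply: (Fh_Om H); exact: disc_Om. Qed.

Lemma ext_der z : cabs z < 1 -> z != 0 -> exists2 d, d != 0 & cder F z d.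
Proof.
move=> z1 z0; exists (V z / z); last exact: dF (disc_Om z1) z0.
by rewrite mulf_neq0 ?invr_eq0 //; exact: V_neq0' kap2 VE _ z0.
Qed.

Lemma ext_sep z b : 0 < cabs z < 1 -> cabs b = 1 -> Re (normal 1 V z * Fh b) < Re (normal 1 V z * F z).
Proof.
move=> hz b1; have /andP[z0 z1] := hz.
have hr : 0 < (1 + cabs z) / 2 < 1 by apply/andP; split; lra.
have hk : 0 < 1 * ((1 + cabs z) / 2 - cabs z) by lra.
apply: (@sep_limit R 4 aI thI 1 F V kap2 akap' suma VE dF isT z ((1 + cabs z) / 2) (Fh b) hz hr hk) => e e0.
have b0 : b != 0 by rewrite -cabs_gt0 b1.
have b1' : cabs b <= 1 by rewrite b1.
have [s s0 hs] := Fh_cont H b1' b0 e0.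
pose x := Num.min s ((1 - cabs z) / 2) / 2.
have m1 : Num.min s ((1 - cabs z) / 2) <= s by rewrite ge_min lexx.
have m2 : Num.min s ((1 - cabs z) / 2) <= (1 - cabs z) / 2 by rewrite ge_min lexx orbT.
have m0 : 0 < Num.min s ((1 - cabs z) / 2) by rewrite lt_min s0; lra.
have xE : x = Num.min s ((1 - cabs z) / 2) / 2 by []; clearbody x.
have wb : (1 - x)%:C * b - b = - (x%:C * b) by rewrite rCB rC1; ring.
have wc : cabs ((1 - x)%:C * b) = 1 - x by rewrite cabsM b1 mulr1 cabsR ger0_norm //; lra.
exists ((1 - x)%:C * b); rewrite wc; split; [lra|lra|].
rewrite -ext_Fh ?wc; last by lra.
by apply: hs; rewrite ?wc ?wb ?cabsN ?cabsM ?b1 ?mulr1 ?cabsR ?gtr0_norm; lra.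
Qed.

Lemma ext_inj z w : cabs z <= 1 -> z != 0 -> cabs w <= 1 -> w != 0 -> Fh z = Fh w -> z = w.
Proof.
have mixed u v : cabs u < 1 -> u != 0 -> cabs v = 1 -> Fh u <> Fh v.
  move=> u1 u0 v1 e; have hu : 0 < cabs u < 1 by rewrite cabs_gt0 u0.
  by have := ext_sep hu v1; rewrite -e ext_Fh // ltxx.
move=> z1 z0 w1 w0 e; have [|z2] := ltrP (cabs z) 1; last first.
  have {}z1 : cabs z = 1 by apply/eqP; rewrite eq_le z1.
  have [w2|w2] := ltrP (cabs w) 1; first by case: (mixed w z).
  have {}w1 : cabs w = 1 by apply/eqP; rewrite eq_le w1.
  exact: (Fh_inj_circle H).
move=> z2; have [w2|w2] := ltrP (cabs w) 1; last first.
  have {}w1 : cabs w = 1 by apply/eqP; rewrite eq_le w1.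
  by case: (mixed z w).
by apply: (inj_open kap2 akap' suma VE dF isT); rewrite ?cabs_gt0 ?z0 ?w0 // -!ext_Fh.
Qed.

Lemma hull4_convex (v : nat -> R[i]) z w s : 0 <= s <= 1 -> hull4 v z -> hull4 v w ->
  hull4 v ((1 - s)%:C * z + s%:C * w).
Proof.
move=> /andP[s0 s1] [l0 [l1 [l2 [l3 [[a0 a1 a2 a3] al ->]]]]] [k0 [k1 [k2 [k3 [[b0 b1 b2 b3] bl ->]]]]].
have s1' : 0 <= 1 - s by lra.
exists ((1 - s) * l0 + s * k0), ((1 - s) * l1 + s * k1), ((1 - s) * l2 + s * k2), ((1 - s) * l3 + s * k3).
split; first by split; apply: addr_ge0; apply: mulr_ge0.
  transitivity ((1 - s) * (l0 + l1 + l2 + l3) + s * (k0 + k1 + k2 + k3)); first by ring.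
  by rewrite al bl; ring.
by rewrite !rCE rC1; ring.
Qed.

Lemma hull4_vertex (v : nat -> R[i]) : [/\ hull4 v (v 0%N), hull4 v (v 1%N), hull4 v (v 2%N) & hull4 v (v 3%N)].
Proof.
by split; [exists 1, 0, 0, 0|exists 0, 1, 0, 0|exists 0, 0, 1, 0|exists 0, 0, 0, 1];
  split; rewrite ?ler01 ?lexx //; rewrite ?rC1 ?rC0; ring.
Qed.

Lemma hull4_half (v : nat -> R[i]) c z x : (forall k, (k < 4)%N -> Re (c * v k) < x) -> hull4 v z -> Re (c * z) < x.
Proof.
move=> h [l0 [l1 [l2 [l3 [[a0 a1 a2 a3] al ->]]]]].
have h0 := h 0%N isT; have h1 := h 1%N isT; have h2 := h 2%N isT; have h3 := h 3%N isT.
rewrite !mulrDr !ReD 4!(mulrCA c) !ReCM.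
move: h0 h1 h2 h3; set X := Re _; set Y := Re _; set Z := Re _; set T := Re _ => h0 h1 h2 h3.
have : 0 <= l0 * (x - X) + l1 * (x - Y) + l2 * (x - Z) + l3 * (x - T).
  by rewrite !addr_ge0 // mulr_ge0 // subr_ge0 ltW.
rewrite le_eqVlt => /predU1P[e|]; last first.
  have -> : l0 * (x - X) + l1 * (x - Y) + l2 * (x - Z) + l3 * (x - T) =
    (l0 + l1 + l2 + l3) * x - (l0 * X + l1 * Y + l2 * Z + l3 * T) by ring.
  by rewrite al mul1r; lra.
have g0 : 0 <= l0 * (x - X) by rewrite mulr_ge0 // subr_ge0 ltW.
have g1 : 0 <= l1 * (x - Y) by rewrite mulr_ge0 // subr_ge0 ltW.
have g2 : 0 <= l2 * (x - Z) by rewrite mulr_ge0 // subr_ge0 ltW.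
have g3 : 0 <= l3 * (x - T) by rewrite mulr_ge0 // subr_ge0 ltW.
have zz y u : y < x -> l0 + l1 + l2 + l3 = 1 -> u * (x - y) = 0 -> u = 0.
  by move=> yx _ /eqP; rewrite mulf_eq0 => /orP[/eqP //|/eqP hh]; lra.
have e0 : l0 = 0 by apply: (zz X) => //; lra.
have e1 : l1 = 0 by apply: (zz Y) => //; lra.
have e2 : l2 = 0 by apply: (zz Z) => //; lra.
have e3 : l3 = 0 by apply: (zz T) => //; lra.
by move: al; rewrite e0 e1 e2 e3 !addr0 => /eqP; rewrite eq_sym oner_eq0.
Qed.

(** The functional normal at [F z] is strictly smaller at all four vertices, hence on their hull. *)
Lemma ext_notin_hull z : cabs z < 1 -> z != 0 -> ~ hull4 vv (F z).
Proof.
move=> z1 z0 h; have hz : 0 < cabs z < 1 by rewrite cabs_gt0 z0.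
suff : Re (normal 1 V z * F z) < Re (normal 1 V z * F z) by rewrite ltxx.
apply: hull4_half h => k _; apply: ext_sep => //; exact: cabs_ev.
Qed.

Lemma vv_hull k : hull4 vv (vv k).
Proof.
have [h0 h1 h2 h3] := hull4_vertex vv.
by apply: (@periodic_all (fun k => hull4 vv (vv k)) 0) => // j; rewrite (vv_per H).
Qed.

Lemma circle_hull z : cabs z = 1 -> hull4 vv (Fh z).
Proof.
move=> /(arc_from H) [m [x [/andP[h1 h2] ->]]].
have hx : th m.+3 <= x <= th m.+4 by rewrite h1 ltW.
have l0 := len_gt0 H m; have lC : (len m)%:C != 0 by rewrite rC_eq0 gt_eqF.
rewrite (Fh_arc H hx).
have -> : vv m.+3 + (lam m x)%:C * dir m = (1 - lam m x / len m)%:C * vv m.+3 + (lam m x / len m)%:C * vv m.+4.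
  by rewrite (vv_next H m) !rCE rC1; field.
apply: hull4_convex; [|exact: vv_hull|exact: vv_hull].
have /andP[g1 g2] := lam_bounds H hx.
by rewrite divr_ge0 ?(ltW l0) // ler_pdivrMr // mul1r.
Qed.

Lemma ext_big (K : R) : exists2 r, 0 < r < 1 & forall z, cabs z < r -> z != 0 -> K < cabs (F z).
Proof.
have [r /andP[r0 r1] hr] := (pole_nonzero pole); have [d _ /cder_cont cp] := pole.
have K0 : 0 < (1 + `|K|)^-1 by rewrite invr_gt0 ltr_pwDl.
have [s s0 hs] := cp _ K0.
have m1 : Num.min s r <= s by rewrite ge_min lexx.
have m2 : Num.min s r <= r by rewrite ge_min lexx orbT.
exists (Num.min s r); first by rewrite lt_min s0 r0 /=; lra.
move=> z zs z0; have zs' : cabs (z - 0) < s by rewrite subr0; lra.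
have /= := hs z zs'; rewrite pole_inv0 subr0 /pole_inv (negbTE z0) cabsV.
have F0 : 0 < cabs (F z) by rewrite cabs_gt0; apply: hr => //; lra.
rewrite ltf_pV2 ?posrE // ?ltr_pwDl //; have := ler_norm K; lra.
Qed.

(** [open_image] for [pole_inv F] covers a neighbourhood of 0, which is a neighbourhood of infinity
    for [F]. *)
Lemma ext_far : exists R0 : R, forall w, R0 < cabs w -> exists2 z, cabs z < 1 /\ z != 0 & F z = w.
Proof.
have [r /andP[r0 r1] hr] := (pole_nonzero pole); have [d d0 hd] := pole.
have r20 : 0 < r / 2 by lra.
have [||m m0 hm] := @open_image R (pole_inv F) 0 (r / 2) r20.
- move=> z; rewrite subr0 => zr; have [->|z0] := eqVneq z 0; first by exists d.
  have Fz : F z != 0 by apply: hr => //; lra.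
  have z1 : cabs z < 1 by lra.
  have [d' d'0 hd'] := ext_der z1 z0.
  exists (- d' / F z ^+ 2); first by rewrite mulf_neq0 ?oppr_eq0 // invr_eq0 expf_neq0.
  apply: cder_near (cderV Fz hd') _.
  exists (cabs z); first by rewrite cabs_gt0.
  move=> w /= wz; rewrite /pole_inv ifF //; apply/negbTE; apply: contraTneq wz => ->.
  by rewrite sub0r cabsN -leNgt.
- move=> z; rewrite subr0 => zr; have z0 : z != 0 by rewrite -cabs_gt0 zr.
  rewrite pole_inv0 /pole_inv (negbTE z0) invr_eq0; apply: hr => //; lra.
exists m^-1 => w hw; have w0 : 0 < cabs w by apply: lt_trans hw; rewrite invr_gt0.
have [|z] := hm w^-1.
  by rewrite pole_inv0 subr0 cabsV -[ltRHS]invrK ltf_pV2 ?posrE ?invr_gt0.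
rewrite subr0 => zr; rewrite /pole_inv; case: eqVneq => [_ e|z0 /invr_inj e].
  by move: w0; rewrite -[w]invrK -e invr0 cabs0 ltxx.
by exists z => //; split => //; lra.
Qed.

Lemma annulus_compact r : compact ([set z | r <= cabs z <= 1] : set R[i]^o).
Proof.
apply: (@subclosed_compact R[i]^o _ [set z | cabs z <= 1]); last 1 first.
- by move=> z /= /andP[].
- have -> : [set z : R[i]^o | r <= cabs z <= 1] = (fun z : R[i]^o => cabs z) @^-1` `[r, 1]%classic.
    by apply/seteqP; split=> z /=; rewrite in_itv.
  apply: closed_comp; first by move=> z _; exact: cabs_continuous.
  exact: itv_closed.
- exact: cabs1_compact.
Qed.

(** Continuation along the ray from a vertex through [w], starting far out. A hull point on the ray
    beyond [w] would, with the vertex, put [w] into the hull, so this part of the ray avoids the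
    hull. *)
Lemma ext_onto w : ~ hull4 vv w -> exists2 z, cabs z < 1 /\ z != 0 & F z = w.
Proof.
move=> hw; have [R0 hR] := ext_far.
have wp : w - vv 0 != 0.
  by rewrite subr_eq0; apply: contra_notN hw => /eqP ->; exact: vv_hull.
have wp0 : 0 < cabs (w - vv 0) by rewrite cabs_gt0.
(* Makes the starting point [vv 0 + t0 (w - vv 0)] larger than [R0] in modulus, so that [ext_far]
   applies to it. *)
pose t0 : R := 1 + (`|R0| + cabs (vv 0) + 1) / cabs (w - vv 0).
have t01 : 1 < t0 by rewrite ltrDl divr_gt0 //; have := normr_ge0 R0; have := cabs_ge0 (vv 0); lra.
have tE : t0 * cabs (w - vv 0) = cabs (w - vv 0) + (`|R0| + cabs (vv 0) + 1).
  by rewrite /t0 mulrDl divfK ?gt_eqF // mul1r.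
pose p (s : R) : R[i] := vv 0 + (t0 + s * (1 - t0))%:C * (w - vv 0).
have p1 : p 1 = w by rewrite /p mul1r (addrC t0) subrK rC1 mul1r addrC subrK.
have tge s : 0 <= s <= 1 -> 1 <= t0 + s * (1 - t0).
  move=> /andP[s0 s1]; have : 0 <= (1 - s) * (t0 - 1) by rewrite mulr_ge0 ?subr_ge0 // ltW.
  by clearbody t0; lra.
have pn s : 0 <= s <= 1 -> ~ hull4 vv (p s).
  move=> hs h; apply: hw; have t1 := tge s hs; move: t1 h; rewrite /p; move: (t0 + s * (1 - t0) : R) => t t1 h.
  have tC : t%:C != 0 by rewrite rC_eq0 gt_eqF //; lra.
  have ht : 0 <= t^-1 <= 1 by rewrite invr_ge0 invf_le1; [apply/andP; split; lra|lra].
  have := hull4_convex ht (vv_hull 0) h; rewrite !rCE rC1.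
  by rewrite (_ : (1 - _) * _ + _ = w) //; field.
have pd s s' : cabs (p s' - p s) = `|s' - s| * ((t0 - 1) * cabs (w - vv 0)).
  rewrite (_ : p s' - p s = ((s' - s) * (1 - t0))%:C * (w - vv 0)); last by rewrite /p !rCE; ring.
  by rewrite cabsM cabsR normrM -mulrA distrC (distrC 1) [`|t0 - 1|]gtr0_norm // subr_gt0.
set L := _ * cabs _ in pd.
have L0 : 0 < L by rewrite mulr_gt0 // subr_gt0.
have [|||z z1 h] := @segment_open_closed R (fun s => exists2 z, cabs z < 1 /\ z != 0 & F z = p s); last by exists z => //; rewrite h.
- apply: hR; rewrite /p mul0r addr0.
  have := cabs_leB (t0%:C * (w - vv 0)) (- vv 0); rewrite opprK cabsN (addrC _ (vv 0)) cabsM cabsR ger0_norm; last by rewrite ltW // (lt_trans ltr01).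
  by rewrite tE; move: (cabs (vv 0 + _)) (cabs (vv 0)) (ler_norm R0) wp0; set N := `|R0| => x y; lra.
- move=> s hs [z [z1 z0] zE]; pose r := Num.min (cabs z) (1 - cabs z) / 2.
  have zp : 0 < cabs z by rewrite cabs_gt0.
  have m1 : Num.min (cabs z) (1 - cabs z) <= cabs z by rewrite ge_min lexx.
  have m2 : Num.min (cabs z) (1 - cabs z) <= 1 - cabs z by rewrite ge_min lexx orbT.
  have m0 : 0 < Num.min (cabs z) (1 - cabs z) by rewrite lt_min zp subr_gt0.
  have r0 : 0 < r by rewrite /r; lra.
  have sub z' : cabs (z' - z) <= r -> cabs z' < 1 /\ z' != 0.
    move=> h; have := cabs_leB z' z; have := cabs_leB z z'; rewrite cabs_distrC -(cabs_gt0 z'); move: h; rewrite /r => *; split; lra.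
  have [||m m3 hm] := @open_image R F z r r0.
  - by move=> z' /sub [z'1 z'0]; exact: ext_der.
  - move=> z' hz'; have [z'1 z'0] : cabs z' < 1 /\ z' != 0 by apply: sub; rewrite hz'.
    apply/eqP => e; have zz : z' = z by apply: ext_inj; rewrite ?ltW // !ext_Fh.
    by move: hz' r0; rewrite zz subrr cabs0 => <-; rewrite ltxx.
  exists (m / L); first by rewrite divr_gt0.
  move=> s' hs'; rewrite ltr_pdivlMr // => h.
  have [|z' z'1 e] := hm (p s'); first by rewrite zE pd.
  by exists z' => //; apply: sub; exact: ltW.
(* Preimages of points near [p s] cannot approach the pole, so they remain in a compact annulus. *)
- move=> s hs h; have [r /andP[r0 r1] hr] := ext_big (cabs (p s) + 1).
  have [||z /= /andP[z2 z1] zE] := @cwithin_limit R [set z | r <= cabs z <= 1] Fh (p s) (@annulus_compact r).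
  + move=> z /= /andP[z2 z1] e e0; have z0 : z != 0 by rewrite -cabs_gt0; lra.
    have [q q0 hq] := Fh_cont H z1 z0 e0.
    by exists q => // w' /= /andP[_ w1]; exact: hq.
  + move=> e e0; have e1 : 0 < Num.min e 1 by rewrite lt_min e0 ltr01.
    have [|s' [hs' h1 [z [z1 z0] zE]]] := h (Num.min e 1 / L); first by rewrite divr_gt0.
    have h2 : cabs (F z - p s) < Num.min e 1 by rewrite zE pd -ltr_pdivlMr.
    have m1 : Num.min e 1 <= e by rewrite ge_min lexx.
    have m2 : Num.min e 1 <= 1 by rewrite ge_min lexx orbT.
    exists z; last by rewrite ext_Fh //; lra.
    rewrite /= (ltW z1) andbT leNgt; apply/negP => zr.
    have := hr z zr z0; have := cabs_leB (F z) (p s); lra.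
  have z0 : z != 0 by rewrite -cabs_gt0; lra.
  have [z3|z3] := ltrP (cabs z) 1; first by exists z => //; rewrite -ext_Fh.
  have {}z1 : cabs z = 1 by apply/eqP; rewrite eq_le z1.
  by case: (pn s hs); rewrite -zE; exact: circle_hull.
Qed.

Lemma hull4_affine (v : nat -> R[i]) (s b z : R[i]) : s != 0 ->
  hull4 (fun k => s * v k + b) (s * z + b) <-> hull4 v z.
Proof.
move=> s0; have sum (l0 l1 l2 l3 : R) : l0 + l1 + l2 + l3 = 1 ->
    l0%:C * (s * v 0%N + b) + l1%:C * (s * v 1%N + b) + l2%:C * (s * v 2%N + b) + l3%:C * (s * v 3%N + b)
    = s * (l0%:C * v 0%N + l1%:C * v 1%N + l2%:C * v 2%N + l3%:C * v 3%N) + b.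
  by move=> h; rewrite -[X in _ = _ + X]mul1r -rC1 -h !rCD; ring.
split=> - [l0 [l1 [l2 [l3 [h0 h1 h2]]]]]; exists l0, l1, l2, l3; split => //.
  by move: h2; rewrite (sum _ _ _ _ h1) => /addIr /(mulfI s0).
by rewrite (sum _ _ _ _ h1) h2.
Qed.

Lemma ext_mapP (s b : R[i]) (v : nat -> R[i]) : s != 0 -> (forall k, (k < 4)%N -> v k = s * vv k + b) ->
  ext_map (fun z => s * Fh z + b) ev v.
Proof.
move=> s0 hv.
have hullE z : hull4 v (s * z + b) <-> hull4 vv z.
  rewrite -(hull4_affine vv b z s0).
  by split=> - [l0 [l1 [l2 [l3 [h0 h1 h2]]]]]; exists l0, l1, l2, l3; split => //; move: h2; rewrite !hv.
split.
- move=> z [z1 z0] e e0; have sp : 0 < cabs s by rewrite cabs_gt0.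
  have [r r0 hr] := Fh_cont H z1 z0 (divr_gt0 e0 sp); exists r => // w [w1 _] wz.
  rewrite (_ : _ - _ = s * (Fh w - Fh z)); last by ring.
  by rewrite cabsM mulrC -ltr_pdivlMr //; exact: hr.
- by move=> z w z1 z0 w1 w0 /addIr /(mulfI s0); exact: ext_inj.
- move=> z z1 z0; split.
    by rewrite ext_Fh // => /hullE; exact: ext_notin_hull.
  have [d d0 hd] := ext_der z1 z0; exists (s * d); first by rewrite mulf_neq0.
  have hF := cder_near hd (Fh_near H (disc_Om z1)).
  by have := cderD (cderZ s hF) (cder_cst b z); rewrite addr0.
- move=> w hw; have [|z [z1 z0] zE] := @ext_onto ((w - b) / s).
    by move=> /hullE; rewrite mulrC divfK // subrK.
  by exists z => //; rewrite ext_Fh // zE mulrC divfK // subrK.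
- split; last first.
    by move=> k k4; split; [exact: cabs_ev|rewrite hv].
  have [d d0 hd] := pole; have [r /andP[r0 r1] hr] := (pole_nonzero pole).
  exists (d / s); first by rewrite mulf_neq0 ?invr_eq0.
  (* 1 / (s F + b) = J / (s + b J) for J = 1 / F *)
  have den0 : s + b * pole_inv F 0 != 0 by rewrite pole_inv0 mulr0 addr0.
  have dden : cder (fun z => s + b * pole_inv F z) 0 (0 + b * d) := cderD (cder_cst s 0) (cderZ b hd).
  have := cderM hd (@cderV R (fun z => s + b * pole_inv F z) 0 _ den0 dden); rewrite pole_inv0 mul0r addr0 mulr0 addr0.
  move=> hh; apply: (cder_near hh); exists r => // z; rewrite /= subr0 => zr.
  rewrite /pole_inv; case: eqVneq => [_|z0]; first by rewrite mul0r.
  have Fz := hr z zr z0.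
  rewrite ext_Fh; last by lra.
  by rewrite -invfM mulrDr mulrCA divff // mulr1 mulrC.
Qed.

End exterior_map.

(** * The modulus of the exterior *)

Section topology.

(** A continuous map from a compact set to a Hausdorff space is closed, so continuity descends along
    it. This gives continuity of the inverses of the disc maps up to the boundary. *)
Lemma quotient_continuous (X Y Z : topologicalType) (A : set X) (p : X -> Y) (q : X -> Z) (F : Y -> Z) :
  hausdorff_space Y -> compact A -> {within A, continuous p} -> {within A, continuous q} ->
  (forall a, A a -> F (p a) = q a) -> {within p @` A, continuous F}.
Proof.
move=> hY cA cp cq FE; apply/subspace_continuousP => y [a Aa pa] W hW.
have {}hW : nbhs (F y) W by [].
rewrite nbhsE in hW; have [W0 [oW0 W0y] W0W] := hW.
have /continuous_closedP cq' := cq.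
have /closed_subspaceP [C clC CE] := cq' (~` W0) (open_closedC oW0).
have cK : compact (A `&` C) by apply: compact_closedI.
have cpK : {within A `&` C, continuous p}.
  by apply: continuous_subspaceW cp; apply: subIsetl.
have clK := compact_closed hY (continuous_compact cpK cK).
have yK : (~` (p @` (A `&` C))) y.
  move=> [b [Ab Cb] pb].
  have : (C `&` A) b by [].
  rewrite CE => -[/= hb _]; apply: hb.
  by change (W0 (q b)); rewrite -FE // pb.
have nK : nbhs y (~` (p @` (A `&` C))) by apply: open_nbhs_nbhs; split => //; exact: closed_openC.
change (within (p @` A) (nbhs y) (F @^-1` W)); rewrite /within /=.
apply: filterS nK => y' hy' [b Ab pb]; apply: W0W; rewrite -pb FE //.
apply: contrapT => hn; apply: hy'; exists b => //; split => //.
have : ((q @^-1` (~` W0)) `&` A) b by [].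
by rewrite -CE => -[].
Qed.

Lemma within_comp (X Y Z : topologicalType) (A : set X) (B : set Y) (p : X -> Y) (F : Y -> Z) :
  {within A, continuous p} -> {within B, continuous F} -> (forall a, A a -> B (p a)) ->
  {within A, continuous (fun x => F (p x))}.
Proof.
move=> /subspace_continuousP cp /subspace_continuousP cF h; apply/subspace_continuousP => x Ax W hW.
have h1 : within B (nbhs (p x)) (F @^-1` W) := cF (p x) (h x Ax) W hW.
have h2 : within A (nbhs x) (p @^-1` [set y | B y -> W (F y)]) := cp x Ax _ h1.
change (within A (nbhs x) ((fun x => F (p x)) @^-1` W)); rewrite /within /=.
by apply: (@filterS _ (nbhs x) _ _ _ _ h2) => z hz Az; exact: hz Az (h z Az).
Qed.

End topology.

Section punctured_side.
Variable R : realType.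

(* A path on the boundary of a rectangle, off the corners except at its ends, stays on one pair of opposite sides; leaving its own side would take it across the middle of the rectangle. *)
Lemma side_path (a b : R) (X Y : R -> R) : 0 < a -> 0 < b ->
  {within `[0, 1], continuous X} -> {within `[0, 1], continuous Y} ->
  (forall x, 0 <= x <= 1 -> [/\ 0 <= X x <= a, 0 <= Y x <= b & X x * (a - X x) = 0 \/ Y x * (b - Y x) = 0]) ->
  (forall x, 0 < x < 1 -> ~ (X x * (a - X x) = 0 /\ Y x * (b - Y x) = 0)) ->
  X 0 * (a - X 0) = 0 -> X 1 * (a - X 1) = 0 -> X 0 <> X 1 ->
  Y 0 * (b - Y 0) = 0 -> Y 1 * (b - Y 1) = 0 ->
  forall x, 0 <= x <= 1 -> Y x = Y 0.
Proof.
move=> a0 b0 cX cY hB hc X0 X1 X01 Y0 Y1.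
have two (Z : R -> R) (c : R) : 0 < c -> {within `[0, 1], continuous Z} -> (forall x, 0 <= x <= 1 -> Z x * (c - Z x) = 0) ->
    forall x, 0 <= x <= 1 -> Z x = Z 0.
  move=> c0 cZ hZ x hx; have /andP[x0 x1] := hx.
  have v y : 0 <= y <= 1 -> Z y = 0 \/ Z y = c.
    move=> /hZ /eqP; rewrite mulf_eq0 => /orP[/eqP|/eqP h]; [by left|right; lra].
  apply: contrapT => ne.
  have cZ' : {within `[0, x], continuous Z}.
    by apply: continuous_subspaceW cZ => y /=; rewrite !in_itv /= => /andP[-> h]; lra.
  have h0 : 0 <= (0 : R) <= 1 by rewrite lexx ler01.
  have hv : Num.min (Z 0) (Z x) <= c / 2 <= Num.max (Z 0) (Z x).
    by rewrite ge_min le_max; case: (v 0 h0) => e0; case: (v x hx) => e1; move: ne; rewrite e0 e1 => // _;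
      apply/andP; split; apply/orP; (try by left; lra); right; lra.
  have [y + hy] := IVT x0 cZ' hv; rewrite in_itv /= => /andP[y0 y1].
  have hy1 : 0 <= y <= 1 by rewrite y0; lra.
  case: (v y hy1); lra.
(* On the boundary [B] is positive on one pair of opposite sides, negative on the other and zero
   only at corners, so it keeps its sign along the path. *)
pose B x := X x * (a - X x) - Y x * (b - Y x).
have cB : {within `[0, 1], continuous B}.
  move=> x; apply: cvgB.
    by apply: cvgM; [exact: cX|apply: cvgB; [exact: cvg_cst|exact: cX]].
  by apply: cvgM; [exact: cY|apply: cvgB; [exact: cvg_cst|exact: cY]].
have B0 x : 0 < x < 1 -> B x != 0.
  move=> hx; apply/eqP => /eqP; rewrite subr_eq0 => /eqP e; apply: (hc x hx).
  have hx' : 0 <= x <= 1 by case/andP: hx => h1 h2; rewrite !ltW.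
  by have [_ _ []] := hB x hx'; rewrite e.
have sgn x y : 0 < x -> x <= y -> y < 1 -> 0 < B x * B y.
  move=> x0 xy y1; have hx : 0 < x < 1 by rewrite x0 (le_lt_trans xy).
  have hy : 0 < y < 1 by rewrite (lt_le_trans x0).
  have bx := B0 x hx; have by_ := B0 y hy.
  rewrite lt_neqAle eq_sym mulf_neq0 //= leNgt; apply/negP => neg.
  have cB' : {within `[x, y], continuous B}.
    by apply: continuous_subspaceW cB => z /=; rewrite !in_itv /= => /andP[h1 h2]; apply/andP; split; lra.
  have hv : Num.min (B x) (B y) <= 0 <= Num.max (B x) (B y).
    rewrite ge_min le_max; have [p|p] := ltrP 0 (B x); have [q|q] := ltrP 0 (B y).
    - by have := mulr_gt0 p q; rewrite ltNge (ltW neg).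
    - by rewrite (ltW p) ?orbT.
    - by rewrite (ltW q) ?orbT.
    - by have hp := mulr_le0 p q; rewrite leNgt neg in hp.
  have [z + hz] := IVT xy cB' hv; rewrite in_itv /= => /andP[z0 z1].
  have hz1 : 0 < z < 1 by apply/andP; split; lra.
  by have := B0 z hz1; rewrite hz eqxx.
have half : 0 < (1 / 2 : R) < 1 by apply/andP; split; lra.
have sg x : 0 < x < 1 -> 0 < B (1 / 2) * B x.
  move=> /andP[h1 h2]; case: (lerP x (1 / 2)) => h; last by apply: sgn; lra.
  by rewrite mulrC; apply: sgn => //; lra.
have ends (x : R) : 0 <= x <= 1 -> [\/ x = 0, x = 1 | 0 < x < 1].
  move=> /andP[]; rewrite le_eqVlt => /predU1P[<-|h1]; first by constructor 1.
  by rewrite le_eqVlt => /predU1P[->|h2]; [constructor 2|constructor 3; rewrite h1].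
(* A negative sign would keep [X] in [{0, a}] and hence constant, although its two end values
   differ. *)
have [neg|pos] := ltrP (B (1 / 2)) 0.
  case: X01; symmetry; apply: (two X a a0 cX); last by rewrite ler01 lexx.
  move=> x hx; case: (ends x hx) => [->|->|hx'] //.
  have [/andP[h1 h2] /andP[h3 h4] [//|h5]] := hB x hx.
  have := sg x hx'; rewrite nmulr_rgt0 // /B h5 subr0.
  by rewrite ltNge mulr_ge0 // subr_ge0.
have {}pos : 0 < B (1 / 2) by rewrite lt_def pos B0.
apply: (two Y b b0 cY) => x hx; case: (ends x hx) => [->|->|hx'] //.
have [/andP[h1 h2] /andP[h3 h4] [h5|//]] := hB x hx.
have := sg x hx'; rewrite pmulr_rgt0 // /B h5 sub0r oppr_gt0.
by rewrite ltNge mulr_ge0 // subr_ge0.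
Qed.

End punctured_side.

Section sphere.
Variable R : realType.
Variables (f g : R[i] -> R[i]) (e v : nat -> R[i]) (h : R) (A1 A2 A3 A4 : R[i]).
Implicit Types (z w : R[i]) (p : riemann_sphere R).
Hypothesis hf : ext_map f e v.
Hypothesis hg : rect_map g e h.
Hypothesis vE : [/\ v 0%N = A1, v 1%N = A2, v 2%N = A3 & v 3%N = A4].
Local Notation D := ([set z | cabs z <= 1] : set R[i]^o).
Local Notation Q := (exterior_of A1 A2 A3 A4).

(** The exterior map as a map to the sphere, with its pole sent to the point at infinity. *)
Definition sph z : riemann_sphere R := if z == 0 then None else Some (f z).

Lemma convex_hull4 z : convex_hull [tuple A1; A2; A3; A4] z <-> hull4 v z.
Proof.
have [<- <- <- <-] := vE; split.
  move=> [l [l0 l1 ->]].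
  exists (l (@Ordinal 4 0 isT)), (l (@Ordinal 4 1 isT)), (l (@Ordinal 4 2 isT)), (l (@Ordinal 4 3 isT)); split => //.
    rewrite -l1 !big_ord_recr big_ord0 /= add0r.
    by do !congr (_ + _); congr l; apply/val_inj.
  rewrite !big_ord_recr big_ord0 /= add0r.
  by do !congr (_ + _); congr (_%:C * _); congr l; apply/val_inj.
move=> [l0 [l1 [l2 [l3 [[h0 h1 h2 h3] hs hz]]]]].
exists (fun i : 'I_4 => nth 0 [:: l0; l1; l2; l3] i); split.
- by move=> [[|[|[|[|?]]]]].
- by rewrite !big_ord_recr big_ord0 /= add0r.
- by rewrite !big_ord_recr big_ord0 /= add0r.
Qed.

Lemma ext_None : Q None.
Proof. by move=> [z _]. Qed.

Lemma ext_Some w : Q (Some w) <-> ~ hull4 v w.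
Proof.
rewrite -convex_hull4; split=> [hq hw|hw [z hz [zw]]]; first by apply: hq; exists w.
by apply: hw; rewrite -zw.
Qed.

Let f_within : cwithin [set z | cabs z <= 1 /\ z != 0] f. Proof. by case: hf. Qed.
Let f_inj z w : cabs z <= 1 -> z != 0 -> cabs w <= 1 -> w != 0 -> f z = f w -> z = w.
Proof. by case: hf => _ + _ _ _; apply. Qed.
Let f_out z : cabs z < 1 -> z != 0 -> ~ hull4 v (f z).
Proof. by case: hf => _ _ hh _ _ h1 h2; case: (hh z h1 h2). Qed.
Let f_der z : cabs z < 1 -> z != 0 -> exists2 d, d != 0 & cder f z d.
Proof. by case: hf => _ _ hh _ _ h1 h2; case: (hh z h1 h2). Qed.
Let f_onto w : ~ hull4 v w -> exists2 z, cabs z < 1 /\ z != 0 & f z = w.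
Proof. by case: hf => _ _ _ + _; apply. Qed.
Let f_pole : exists2 d, d != 0 & cder (pole_inv f) 0 d. Proof. by case: hf => _ _ _ _ []. Qed.
Let f_e k : (k < 4)%N -> cabs (e k) = 1 /\ f (e k) = v k. Proof. by case: hf => _ _ _ _ [_]; apply. Qed.
Let h_gt0 : 0 < h. Proof. by case: hg. Qed.
Let g_within : cwithin [set z | cabs z <= 1] g. Proof. by case: hg. Qed.
Let g_inj z w : cabs z <= 1 -> cabs w <= 1 -> g z = g w -> z = w.
Proof. by case: hg => _ _ + _ _; apply. Qed.
Let g_open z : cabs z < 1 -> open_rectangle h (g z).
Proof. by case: hg => _ _ _ hh _ h1; case: (hh z h1). Qed.
Let g_der z : cabs z < 1 -> exists2 d, d != 0 & cder g z d.
Proof. by case: hg => _ _ _ hh _ h1; case: (hh z h1). Qed.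
Let g_onto w : open_rectangle h w -> exists2 z, cabs z < 1 & g z = w.
Proof. by case: hg => _ _ _ _ [+ _ _ _]; apply. Qed.
Let g_closed z : cabs z <= 1 -> closed_rectangle h (g z).
Proof. by case: hg => _ _ _ _ [_ + _ _]; apply. Qed.
Let g_conto w : closed_rectangle h w -> exists2 z, cabs z <= 1 & g z = w.
Proof. by case: hg => _ _ _ _ [_ _ + _]; apply. Qed.
Let g_e : [/\ g (e 0%N) = 0, g (e 1%N) = 1, g (e 2%N) = 1 +i* h & g (e 3%N) = 0 +i* h].
Proof. by case: hg => _ _ _ _ []. Qed.

Lemma sphere_hausdorff : hausdorff_space (riemann_sphere R).
Proof.
apply: one_point_compactification_hausdorff; last exact: hausdorffC.
move=> z _; rewrite withinET; exists [set w | cabs (w - z) <= 1].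
  by apply/nbhsCP; exists 1 => // w /ltW.
by split; [exact: compact_disc|apply: compact_closed; [exact: hausdorffC|exact: compact_disc]].
Qed.

Lemma nbhs_infty (B : set (riemann_sphere R)) : nbhs (None : riemann_sphere R) B ->
  exists2 M : R, 0 < M & forall w, M < cabs w -> B (Some w).
Proof.
move=> [C [cC _] CB].
have [C0|/set0P [c0 Cc0]] := eqVneq C set0; last first.
  pose c : R := 0; have [M hM] : exists M : R, forall z, C z -> cabs z <= M.
    have cc : {within C, continuous (@cabs R : R[i]^o -> R)} by apply: continuous_subspaceT; exact: cabs_continuous.
    have [z + hz] := compact_EVT_max (ex_intro _ c0 Cc0) cC cc; rewrite inE => Cz.
    by exists (cabs z) => w Cw; apply: hz; rewrite inE.
  exists (1 + `|M|); first by rewrite ltr_pwDl.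
  move=> w hw; apply: CB; left; exists w => // /hM; have := ler_norm M; lra.
by exists 1 => // w _; apply: CB; left; exists w; rewrite // C0.
Qed.

Lemma sph_inj z w : D z -> D w -> sph z = sph w -> z = w.
Proof.
rewrite /sph => Dz Dw; case: eqVneq => [->|z0]; case: eqVneq => [->|w0] // [].
exact: f_inj.
Qed.

Lemma sph_within : {within D, continuous sph}.
Proof.
apply/subspace_continuousP => z Dz W hW; change (within D (nbhs (z : R[i]^o)) (sph @^-1` W)); rewrite /within /=; apply/nbhsCP.
have {}hW : nbhs (sph z) W by [].
have [z0|z0] := eqVneq z 0; last first.
  move: hW; rewrite /sph (negbTE z0) => hW.
  have /nbhsCP [r r0 hr] : nbhs (f z : R[i]^o) (Some @^-1` W) by [].
  have [s s0 hs] := f_within (conj Dz z0) r0.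
  exists (Num.min s (cabs z)); first by rewrite lt_min s0 cabs_gt0.
  move=> w; rewrite lt_min => /andP[ws wz] Dw.
  have w0 : w != 0 by apply: contraTneq wz => ->; rewrite sub0r cabsN ltxx.
  by rewrite (negbTE w0); apply: hr; apply: hs.
move: hW; rewrite /sph z0 eqxx => hW; have WN := nbhs_singleton hW.
have [M M0 hM] := nbhs_infty hW.
have [r /andP[r0 r1] hr] := (pole_nonzero f_pole); have [d _ /cder_cont cp] := f_pole.
have [s s0 hs] := cp _ (etrans (invr_gt0 M) M0).
exists (Num.min s r); first by rewrite lt_min s0 r0.
move=> w; rewrite subr0 lt_min => /andP[ws wr] _; case: eqVneq => // w0.
apply: hM; have ws' : cabs (w - 0) < s by rewrite subr0.
have /= := hs w ws'; rewrite pole_inv0 subr0 /pole_inv (negbTE w0) cabsV ltf_pV2 ?posrE //.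
by rewrite cabs_gt0; exact: hr.
Qed.

Lemma sph_open z : cabs z < 1 -> Q (sph z).
Proof.
move=> z1; rewrite /sph; case: eqVneq => [_|z0]; first exact: ext_None.
by apply/ext_Some; exact: f_out.
Qed.

Lemma sph_onto p : Q p -> exists2 z, cabs z < 1 & sph z = p.
Proof.
case: p => [w|_]; last by exists 0; rewrite ?cabs0 // /sph eqxx.
by move=> /ext_Some /f_onto [z [z1 z0] <-]; exists z => //; rewrite /sph (negbTE z0).
Qed.

(** The image of the compact disc is closed and contains [Q]; conversely [sph z] is the limit of the
    values at [(1 - x) z], which lie in [Q]. *)
Lemma closure_exterior : closure Q = sph @` D.
Proof.
apply/seteqP; split=> p.
  have cl : closed (sph @` D).
    apply: (compact_closed sphere_hausdorff); apply: continuous_compact; first exact: sph_within.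
    exact: cabs1_compact.
  move=> hp; have /closure_id -> := cl; apply: closureS hp => q /sph_onto [z z1 <-].
  by exists z => //; exact: ltW.
move=> [z Dz <-] B hB.
have /subspace_continuousP /(_ z Dz) cs := sph_within.
have : within D (nbhs (z : R[i]^o)) (sph @^-1` B) := cs B hB.
rewrite /within /= => /nbhsCP [r r0 hr].
pose x : R := Num.min r 1 / 2.
have m0 : 0 < Num.min r 1 by rewrite lt_min r0 ltr01.
have m1 : Num.min r 1 <= r by rewrite ge_min lexx.
have m2 : Num.min r 1 <= 1 by rewrite ge_min lexx orbT.
have xE : x = Num.min r 1 / 2 by []; clearbody x.
have x1 : cabs ((1 - x)%:C * z) < 1.
  rewrite cabsM cabsR ger0_norm; last by lra.
  have := Dz; have := cabs_ge0 z; rewrite /=; nra.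
exists (sph ((1 - x)%:C * z)); split; first exact: sph_open.
apply: hr; last exact: ltW.
rewrite (_ : _ - z = - (x%:C * z)); last by rewrite rCB rC1; ring.
rewrite cabsN cabsM cabsR ger0_norm; last by lra.
by have := Dz; have := cabs_ge0 z; rewrite /=; nra.
Qed.

Definition sph_inv p : R[i] := xget 0 [set z | D z /\ sph z = p].

Lemma sph_invK z : D z -> sph_inv (sph z) = z.
Proof.
move=> Dz; have [h1 h2] : D (sph_inv (sph z)) /\ sph (sph_inv (sph z)) = sph z by apply: (@xgetI _ 0 [set z' | D z' /\ sph z' = sph z] z).
exact: sph_inj.
Qed.

Definition g_inv w : R[i] := xget 0 [set z | D z /\ g z = w].

Lemma g_invK z : D z -> g_inv (g z) = z.
Proof.
move=> Dz; have [h1 h2] : D (g_inv (g z)) /\ g (g_inv (g z)) = g z by apply: (@xgetI _ 0 [set z' | D z' /\ g z' = g z] z).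
exact: g_inj.
Qed.

(** [open_image] on arbitrarily small discs makes the left inverse continuous at [k z0], after which
    [cder_inverse] applies. *)
Lemma inverse_cder (k u : R[i] -> R[i]) z0 r : 0 < r ->
  (forall z, cabs (z - z0) <= r -> exists2 d, d != 0 & cder k z d) ->
  (forall z, cabs (z - z0) <= r -> k z = k z0 -> z = z0) ->
  (forall z, cabs (z - z0) <= r -> u (k z) = z) ->
  exists d, cder u (k z0) d.
Proof.
move=> r0 dk ik uk.
have op s : 0 < s <= r -> exists2 m, 0 < m & forall w, cabs (w - k z0) < m -> exists2 z, cabs (z - z0) < s & k z = w.
  move=> /andP[s0 sr]; apply: open_image => //.
    by move=> z hz; apply: dk; exact: le_trans sr.
  move=> z hz; apply/eqP => kz; have hzr : cabs (z - z0) <= r by rewrite hz.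
  by move: hz s0; rewrite (ik z hzr kz) subrr cabs0 => <-; rewrite ltxx.
have z0r : cabs (z0 - z0) <= r by rewrite subrr cabs0 ltW.
have uz : u (k z0) = z0 by exact: uk.
have [d d0 hd] := dk z0 z0r.
exists d^-1; apply: (@cder_inverse R k); rewrite ?uz //.
- have [|m m0 hm] := op r; first by rewrite r0 lexx.
  by exists m => // w /hm [z zr <-] /=; rewrite uk // ltW.
- move=> s s0; have [|m m0 hm] := op (Num.min s r).
    by rewrite lt_min s0 r0 ge_min lexx orbT.
  exists m => // w /hm [z zr <-]; move: zr; rewrite lt_min => /andP[zs zr] /=.
  by rewrite uk ?(ltW zr) // uz.
Qed.

Lemma conformal_exists : exists f0, conformal_onto_rectangle Q (Some A1) (Some A2) (Some A3) (Some A4) h f0.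
Proof.
pose f0 p : R[i]^o := g (sph_inv p).
have f0E z : D z -> f0 (sph z) = g z by move=> Dz; rewrite /f0 sph_invK.
have [v0 v1 v2 v3] := vE; have [g0 g1 g2 g3] := g_e.
have corner k (k4 : (k < 4)%N) : closure Q (Some (v k)) /\ f0 (Some (v k)) = g (e k).
  have [e1 fe] := f_e k4; have De : D (e k) by rewrite /= e1.
  have se : sph (e k) = Some (v k) by rewrite /sph ifF ?fe //; apply/negbTE; rewrite -cabs_gt0 e1.
  by rewrite -se closure_exterior; split; [exists (e k)|rewrite f0E].
exists f0; split.
- move=> p /sph_onto [z z1 <-]; rewrite /sph; case: eqVneq => [_|z0] /=; last first.
    pose r := Num.min (cabs z) (1 - cabs z) / 2.
    have zp : 0 < cabs z by rewrite cabs_gt0.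
    have m1 : Num.min (cabs z) (1 - cabs z) <= cabs z by rewrite ge_min lexx.
    have m2 : Num.min (cabs z) (1 - cabs z) <= 1 - cabs z by rewrite ge_min lexx orbT.
    have m0 : 0 < Num.min (cabs z) (1 - cabs z) by rewrite lt_min zp subr_gt0.
    have r0 : 0 < r by rewrite /r; lra.
    have sub z' : cabs (z' - z) <= r -> cabs z' < 1 /\ z' != 0.
      move=> hz'; have := cabs_leB z' z; have := cabs_leB z z'; rewrite cabs_distrC -(cabs_gt0 z'); move: hz'; rewrite /r => *; split; lra.
    have [d hd] : exists d, cder (fun w => sph_inv (Some w)) (f z) d.
      apply: (@inverse_cder f (fun w => sph_inv (Some w)) z r) => //.
      - by move=> z' /sub [h1 h2]; exact: f_der.
      - by move=> z' /sub [h1 h2]; apply: f_inj => //; exact: ltW.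
      - move=> z' /sub [h1 h2]; have := @sph_invK z' (ltW h1).
        by rewrite /sph (negbTE h2).
    have sz : sph_inv (Some (f z)) = z by have := @sph_invK z (ltW z1); rewrite /sph (negbTE z0).
    have [d' _ hd'] := g_der z1; rewrite -sz in hd'.
    exact: (@cder_derivable R (fun w => g (sph_inv (Some w))) (f z) _ (cder_comp hd hd')).
  have [r /andP[r0 r1] hr] := (pole_nonzero f_pole).
  (* In the chart [1 / w] at infinity the map to be inverted is [pole_inv f], whose derivative at 0
     is not zero. *)
  have sph_pole z' : cabs z' < r -> sphere_inv (pole_inv f z') = sph z'.
    move=> zr; rewrite /pole_inv /sph; case: eqVneq => [_|z0]; first by rewrite /sphere_inv eqxx.
    by rewrite /sphere_inv invr_eq0 (negbTE (hr z' zr z0)) invrK.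
  have r20 : 0 < r / 2 by lra.
  have lt2 z' : cabs (z' - 0) <= r / 2 -> cabs z' < r by rewrite subr0; lra.
  have uK z' : cabs (z' - 0) <= r / 2 -> sph_inv (sphere_inv (pole_inv f z')) = z'.
    move=> /lt2 h1; rewrite sph_pole // sph_invK //=; lra.
  have [d hd] : exists d, cder (fun w => sph_inv (sphere_inv w)) (pole_inv f 0) d.
    apply: (@inverse_cder (pole_inv f) (fun w => sph_inv (sphere_inv w)) 0 (r / 2)) => //.
    - move=> z' /lt2 zr; have [->|z0] := eqVneq z' 0; first exact: f_pole.
      have Fz := hr z' zr z0; have z'1 : cabs z' < 1 by lra.
      have [d' d'0 hd'] := f_der z'1 z0.
      exists (- d' / f z' ^+ 2); first by rewrite mulf_neq0 ?oppr_eq0 // invr_eq0 expf_neq0.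
      apply: cder_near (cderV Fz hd') _.
      exists (cabs z'); first by rewrite cabs_gt0.
      move=> w /= wz; rewrite /pole_inv ifF //; apply/negbTE; apply: contraTneq wz => ->.
      by rewrite sub0r cabsN -leNgt.
    - move=> z' hz' ee; have := uK z' hz'; rewrite ee uK // subrr cabs0; lra.
  rewrite pole_inv0 in hd.
  have sz : sph_inv (sphere_inv 0) = 0 by rewrite -{1}(pole_inv0 f) uK // subrr cabs0 ltW.
  have c0 : cabs (0 : R[i]) < 1 by rewrite cabs0 ltr01.
  have [d' _ hd'] := g_der c0; rewrite -sz in hd'.
  exact: (@cder_derivable R (fun w => g (sph_inv (sphere_inv w))) 0 _ (cder_comp hd hd')).
- split.
  + by move=> p /sph_onto [z z1 <-]; rewrite f0E; [exact: g_open|exact: ltW].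
  + move=> p q; rewrite !inE => /sph_onto [z z1 <-] /sph_onto [w w1 <-].
    by rewrite !f0E; [move=> /g_inj ->; rewrite ?ltW|exact: ltW|exact: ltW].
  + move=> w /g_onto [z z1 <-]; exists (sph z); first exact: sph_open.
    by rewrite f0E //; exact: ltW.
- rewrite closure_exterior; apply: (quotient_continuous sphere_hausdorff (@cabs1_compact R) sph_within _ f0E).
  by apply/cwithinP.
- rewrite closure_exterior; split.
  + by move=> p [z Dz <-]; rewrite f0E //; exact: g_closed.
  + move=> p q; rewrite !inE => -[z Dz <-] [w Dw <-].
    by rewrite !f0E // => /g_inj ->.
  + move=> w /g_conto [z Dz <-]; exists (sph z); first by exists z.
    by rewrite f0E.
- have c0 := corner 0%N isT; have c1 := corner 1%N isT; have c2 := corner 2%N isT; have c3 := corner 3%N isT.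
  by rewrite v0 g0 in c0; rewrite v1 g1 in c1; rewrite v2 g2 in c2; rewrite v3 g3 in c3.
Qed.

(** A competitor [f'] gives the map [k] from the rectangle of height [h] to that of height [h'],
    holomorphic inside and continuous on the closure, with corners sent to corners. Once every side
    is known to go into its counterpart, [rectangle_height] compares the heights. *)
Lemma conformal_height h' f' : 0 < h' ->
  conformal_onto_rectangle Q (Some A1) (Some A2) (Some A3) (Some A4) h' f' -> h' = h.
Proof.
move=> h'0 [f'hol [f'fun f'inj f'surj] f'cont [f'cfun f'cinj f'csurj] [[_ f1] [_ f2] [_ f3] [_ f4]]].
have [v0 v1 v2 v3] := vE; have [g0 g1 g2 g3] := g_e.
pose k w : R[i] := f' (sph (g_inv w)).
have kE z : D z -> k (g z) = f' (sph z) by move=> Dz; rewrite /k g_invK.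
have ck : {within (closed_rectangle h : set R[i]^o), continuous (k : R[i]^o -> R[i]^o)}.
  have -> : closed_rectangle h = g @` D.
    apply/seteqP; split=> [w /g_conto [z Dz <-]|w [z Dz <-]]; last exact: g_closed.
    by exists z.
  have gw : {within D, continuous (g : R[i]^o -> R[i]^o)} by apply/cwithinP.
  have c1 : {within (g : R[i]^o -> R[i]^o) @` D, continuous (fun w : R[i]^o => sph (g_inv w))}.
    by apply: (quotient_continuous (@hausdorffC R) (@cabs1_compact R) gw sph_within) => z Dz; rewrite g_invK.
  apply: (within_comp c1 f'cont) => w [z Dz <-]; rewrite g_invK // closure_exterior; by exists z.
have kcorner j (j4 : (j < 4)%N) : k (g (e j)) = f' (Some (v j)).
  have [e1 fe] := f_e j4; have De : D (e j) by rewrite /= e1.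
  by rewrite kE // /sph ifF ?fe //; apply/negbTE; rewrite -cabs_gt0 e1.
have k0 : k 0 = 0 by rewrite -{1}g0 kcorner // v0.
have k1 : k 1 = 1 by rewrite -{1}g1 kcorner // v1.
have k2 : k (1 +i* h) = 1 +i* h' by rewrite -g2 kcorner // v2.
have k3 : k (0 +i* h) = 0 +i* h' by rewrite -g3 kcorner // v3.
have k00 : k (0 +i* 0) = 0 := k0.
have k10 : k (1 +i* 0) = 1 := k1.
have kclosed w : closed_rectangle h w -> closed_rectangle h' (k w).
  move=> /g_conto [z Dz <-]; rewrite kE //; apply: f'cfun.
  by rewrite closure_exterior; exists z.
have kinj w w' : closed_rectangle h w -> closed_rectangle h w' -> k w = k w' -> w = w'.
  move=> /g_conto [z Dz <-] /g_conto [z' Dz' <-]; rewrite !kE // => ee; congr g.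
  apply: sph_inj => //; apply: f'cinj => //; rewrite inE closure_exterior; by [exists z|exists z'].
(* Used contrapositively: boundary points go to boundary points. It follows from the injectivity of
   [f'] on the closure of [Q]. *)
have kbound w : closed_rectangle h w -> open_rectangle h' (k w) -> open_rectangle h w.
  move=> /g_conto [z Dz <-]; rewrite kE // => /f'surj [p Qp pE].
  have [z' z'1 z'E] := sph_onto Qp.
  have zz : z' = z.
    apply: sph_inj => //; first exact: ltW.
    rewrite z'E; apply: f'cinj => //; rewrite inE; first exact: subset_closure.
    by rewrite closure_exterior; exists z.
  by rewrite -zz; exact: g_open.
have kder w : open_rectangle h w -> exists d, cder k w d.
  move=> /g_onto [z z1 <-].
  have r0 : 0 < (1 - cabs z) / 2 by lra.
  have sub z' : cabs (z' - z) <= (1 - cabs z) / 2 -> cabs z' < 1.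
    have := cabs_leB z' z; lra.
  have [d hd] : exists d, cder g_inv (g z) d.
    apply: (@inverse_cder g g_inv z _ r0).
    - by move=> z' /sub; exact: g_der.
    - by move=> z' /sub h1; apply: g_inj; exact: ltW.
    - by move=> z' /sub h1; rewrite g_invK //= ltW.
  have gz : g_inv (g z) = z by rewrite g_invK //= ltW.
  suff [d' hd'] : exists d', cder (fun z => f' (sph z)) (g_inv (g z)) d' by exists (d' * d); exact: cder_comp hd hd'.
  rewrite gz; have hol := f'hol _ (sph_open z1).
  have [z0|z0] := eqVneq z 0; last first.
    move: hol; rewrite /sph (negbTE z0) /= => /derivable_cder [d1 hd1].
    have [d2 _ hd2] := f_der z1 z0; exists (d1 * d2).
    apply: (cder_near (cder_comp hd2 hd1)); exists (cabs z); first by rewrite cabs_gt0.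
    by move=> u /= uz; rewrite ifF //; apply/negbTE; apply: contraTneq uz => ->; rewrite sub0r cabsN ltxx.
  move: hol; rewrite z0 {1}/sph eqxx /= => /derivable_cder [d1 hd1].
  have [d2 _ hd2] := f_pole; rewrite -(pole_inv0 f) in hd1; exists (d1 * d2).
  apply: (cder_near (cder_comp hd2 hd1)).
  have [r /andP[rr0 r1] hr] := (pole_nonzero f_pole); exists r => // u; rewrite /= subr0 => ur.
  congr f'; rewrite /pole_inv /sph; case: eqVneq => [_|u0]; first by rewrite /sphere_inv eqxx.
  by rewrite /sphere_inv invr_eq0 (negbTE (hr u ur u0)) invrK.
have h_0 := h_gt0.
have bd w : closed_rectangle h w -> ~ open_rectangle h w ->
    [/\ 0 <= Re (k w) <= 1, 0 <= Im (k w) <= h' & Re (k w) * (1 - Re (k w)) = 0 \/ Im (k w) * (h' - Im (k w)) = 0].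
  move=> cw ow; have [r1 r2] := kclosed w cw; split=> //.
  apply: contrapT => hn; apply: ow; apply: kbound => //.
  have n1 : Re (k w) * (1 - Re (k w)) <> 0 by move=> ee; apply: hn; left.
  have n2 : Im (k w) * (h' - Im (k w)) <> 0 by move=> ee; apply: hn; right.
  move: r1 r2 => /andP[a1 a2] /andP[a3 a4]; split; rewrite !lt_neqAle ?a1 ?a2 ?a3 ?a4 !andbT; apply/andP; split; apply/eqP => ee.
  - by apply: n1; rewrite -ee mul0r.
  - by apply: n1; rewrite ee subrr mulr0.
  - by apply: n2; rewrite -ee mul0r.
  - by apply: n2; rewrite ee subrr mulr0.
have corners w : closed_rectangle h w -> Re (k w) * (1 - Re (k w)) = 0 -> Im (k w) * (h' - Im (k w)) = 0 ->
    [\/ w = 0, w = 1, w = 1 +i* h | w = 0 +i* h].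
  move=> cw /eqP + /eqP; rewrite !mulf_eq0 !subr_eq0.
  have c0 : closed_rectangle h 0 by rewrite /closed_rectangle /= !lexx ler01 ltW.
  have c1 : closed_rectangle h 1 by rewrite /closed_rectangle /= !lexx ler01 ltW.
  have c2 : closed_rectangle h (1 +i* h) by rewrite /closed_rectangle /= !lexx ler01 ltW.
  have c3 : closed_rectangle h (0 +i* h) by rewrite /closed_rectangle /= !lexx ler01 ltW.
  move=> /orP[/eqP a1|/eqP a1] /orP[/eqP a2|/eqP a2].
  - by constructor 1; apply: kinj => //; rewrite k0; apply: Cext.
  - by constructor 4; apply: kinj => //; rewrite k3; apply: Cext.
  - by constructor 2; apply: kinj => //; rewrite k1; apply: Cext.
  - by constructor 3; apply: kinj => //; rewrite k2; apply: Cext.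
have path (p : R -> R[i]) : (forall x, pcont p x) -> (forall x, 0 <= x <= 1 -> closed_rectangle h (p x)) ->
    {within `[0, 1], continuous (fun x : R => Re (k (p x)))} /\ {within `[0, 1], continuous (fun x : R => Im (k (p x)))}.
  move=> cp hp; have cp' : {within `[0, 1], continuous (p : R -> R[i]^o)} by apply: within_pcont => t _.
  pose q : R -> R[i]^o := fun x => k (p x).
  have ckp : {within `[0, 1], continuous q}.
    by apply: (within_comp cp' ck) => x /=; rewrite in_itv /= => /hp.
  split=> x.
    by apply: (@continuous_comp _ _ _ (q : subspace `[0, 1]%classic -> R[i]^o) (@complex.Re R)); [exact: ckp|exact: Re_continuous].
  by apply: (@continuous_comp _ _ _ (q : subspace `[0, 1]%classic -> R[i]^o) (@complex.Im R)); [exact: ckp|exact: Im_continuous].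
have plin (a b : R[i]) x : pcont (fun x : R => a + x%:C * b) x.
  exact: pder_cont (pderD (pder_cst a x) (pderM (pder_id x) (pder_cst b x))).
(* Along a horizontal edge [k] follows the boundary, meets corners only at the ends, by injectivity,
   and joins the sides of real part 0 and 1; [side_path] then fixes its height. The vertical edges
   exchange the two coordinates. *)
have horiz (y : R) : y = 0 \/ y = h -> forall x, 0 <= x <= 1 -> Im (k (x +i* y)) = Im (k (0 +i* y)).
  move=> hy.
  have yc x : 0 <= x <= 1 -> closed_rectangle h (x +i* y).
    by move=> hx; rewrite /closed_rectangle /= hx; case: hy => ->; rewrite ?lexx ltW.
  have [l1 l2] : Re (k (0 +i* y)) = 0 /\ Im (k (0 +i* y)) * (h' - Im (k (0 +i* y))) = 0.
    by case: hy => ->; rewrite ?k3 ?k00 ?ReX ?ImX ?Re0 ?Im0 ?mul0r ?subrr ?mulr0.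
  have [l3 l4] : Re (k (1 +i* y)) = 1 /\ Im (k (1 +i* y)) * (h' - Im (k (1 +i* y))) = 0.
    by case: hy => ->; rewrite ?k2 ?k10 ?ReX ?ImX ?Re1 ?Im1 ?mul0r ?subrr ?mulr0.
  have yo x : ~ open_rectangle h (x +i* y) by case: hy => -> [_] /=; rewrite ltxx ?andbF.
  have pE x : (0 +i* y) + x%:C * 1 = x +i* y by apply: Cext; rewrite !ReImE; ring.
  have [c1 c2] := path _ (plin (0 +i* y) 1) (fun x hx => eq_ind_r (fun z => closed_rectangle h z) (yc x hx) (pE x)).
  have := @side_path R 1 h' (fun x => Re (k (0 +i* y + x%:C * 1))) (fun x => Im (k (0 +i* y + x%:C * 1))) ltr01 h'0 c1 c2.
  move=> sp x hx; have := sp _ _ _ _ _ _ _ x hx; rewrite !pE; apply.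
  - by move=> t ht; rewrite pE; apply: bd; [exact: yc|exact: yo].
  - move=> t /andP[t0 t1] []; rewrite pE => a1 a2; have ht : 0 <= t <= 1 by rewrite !ltW.
    by have [] := corners _ (yc t ht) a1 a2 => /(congr1 (@complex.Re R)) /= ee; move: t0 t1; rewrite ee !ltxx.
  - by rewrite l1 mul0r.
  - by rewrite l3 subrr mulr0.
  - by rewrite l1 l3 => /esym/eqP; rewrite oner_eq0.
  - exact: l2.
  - exact: l4.
have vert (x : R) : x = 0 \/ x = 1 -> forall y, 0 <= y <= 1 -> Re (k (x +i* (y * h))) = Re (k (x +i* 0)).
  move=> hx.
  have xc y : 0 <= y <= 1 -> closed_rectangle h (x +i* (y * h)).
    move=> /andP[y0 y1]; rewrite /closed_rectangle /= mulr_ge0 ?(ltW h_0) //= ler_piMl ?(ltW h_0) //.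
    by case: hx => ->; rewrite lexx ler01.
  have [l1 l2] : Im (k (x +i* 0)) = 0 /\ Re (k (x +i* 0)) * (1 - Re (k (x +i* 0))) = 0.
    by case: hx => ->; rewrite ?k00 ?k10 ?Re0 ?Im0 ?Re1 ?Im1 ?mul0r ?subrr ?mulr0.
  have [l3 l4] : Im (k (x +i* h)) = h' /\ Re (k (x +i* h)) * (1 - Re (k (x +i* h))) = 0.
    by case: hx => ->; rewrite ?k3 ?k2 ?ReX ?ImX ?mul0r ?subrr ?mulr0.
  have xo y : ~ open_rectangle h (x +i* (y * h)) by case: hx => -> [] /=; rewrite ltxx ?andbF.
  have pE y : (x +i* 0) + y%:C * (0 +i* h) = x +i* (y * h) by apply: Cext; rewrite !ReImE; ring.
  have [c1 c2] := path _ (plin (x +i* 0) (0 +i* h)) (fun y hy => eq_ind_r (fun z => closed_rectangle h z) (xc y hy) (pE y)).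
  have := @side_path R h' 1 (fun y => Im (k (x +i* 0 + y%:C * (0 +i* h)))) (fun y => Re (k (x +i* 0 + y%:C * (0 +i* h)))) h'0 ltr01 c2 c1.
  move=> sp y hy; have := sp _ _ _ _ _ _ _ y hy; rewrite !pE !mul0r !mul1r; apply.
  - move=> t ht; rewrite pE; have [a1 a2 a3] := bd _ (xc t ht) (xo t); split => //; by case: a3; [right|left].
  - move=> t /andP[t0 t1] []; rewrite pE => a1 a2; have ht : 0 <= t <= 1 by rewrite !ltW.
    have th0 : 0 < t * h by rewrite mulr_gt0.
    have th1 : t * h < h by rewrite -[ltRHS]mul1r ltr_pM2r.
    by have [] := corners _ (xc t ht) a2 a1 => /(congr1 (@complex.Im R)) /= ee; move: th0 th1; rewrite ee !ltxx.
  - by rewrite l1 mul0r.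
  - by rewrite l3 subrr mulr0.
  - by rewrite l1 l3 => ee; move: h'0; rewrite -ee ltxx.
  - exact: l2.
  - exact: l4.
have hdiv y : 0 <= y <= h -> 0 <= y / h <= 1 /\ y / h * h = y.
  move=> /andP[y0 y1]; rewrite divr_ge0 ?(ltW h_0) // ler_pdivrMr // mul1r y1 divfK //.
  by rewrite gt_eqF.
apply: (@rectangle_height R k) => //.
- by apply/cwithinP.
- move=> [x y] [/= _ /hdiv [hy yE]] x0; rewrite x0 -yE vert //; last by left.
  by rewrite k00.
- move=> [x y] [/= _ /hdiv [hy yE]] x0; rewrite x0 -yE vert //; last by right.
  by rewrite k10.
- move=> [x y] [/= hx _] y0; rewrite y0 horiz //; last by left.
  by rewrite k00.
- move=> [x y] [/= hx _] y0; rewrite y0 horiz //; last by right.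
  by rewrite k3.
Qed.

Theorem Mod_exterior : Mod Q (Some A1) (Some A2) (Some A3) (Some A4) = h.
Proof.
rewrite /Mod; set P := (X in unique X).
have Ph : P h by split; [exact: h_gt0|exact: conformal_exists].
have uP x : P x -> x = h by move=> [x0 [f' hf']]; exact: conformal_height hf'.
have U : unique P h by split=> // x /uP.
have [Px _] : unique P (xget 0 (unique P)) := @xgetI _ 0 (unique P) h U.
exact: uP.
Qed.

End sphere.

(** * Existence of the two Schwarz-Christoffel maps *)

Section sc_maps.
Variable R : realType.
Variables (th a : nat -> R).
Implicit Types (z w : R[i]) (k m : nat) (r x : R).
Local Notation thI := (fun k : 'I_4 => th k).
Local Notation aI := (fun k : 'I_4 => a k).
Local Notation P := (scP aI thI).
Local Notation fac := (fac thI).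

Lemma Cexp_circ r x : 0 < r -> Cexp ((- (-1) * ln r) +i* (- (-1) * x)) = r%:C * cis x.
Proof. by move=> r0; rewrite !opprK !mul1r /Cexp /= lnK. Qed.

Lemma Cexp_circV r x : 0 < r -> Cexp ((- 1 * ln r) +i* (- 1 * x)) = (r%:C * cis x)^-1.
Proof. by move=> r0; rewrite !mulN1r /Cexp /= expRN lnK ?posrE // invfM -cisV rCV. Qed.

(** Integration by parts turns the integral of [P / z ^ 2] into [- P / z] plus the integral of
    [P' / z]. By the balance condition the latter integrand is regular at 0 and is the sum
    integrated here, so no logarithm arises. *)
Definition ext_core z : R[i] := \sum_(k < 4) (- (a k)%:C * cis (- th k) ^+ 2) * seg (fun w => P w / fac k w) 0 z.
Definition ext_sc z : R[i] := - (P z / z) + ext_core z.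

Lemma cder_core z : Om thI z -> cder ext_core z (\sum_(k < 4) (- (a k)%:C * cis (- th k) ^+ 2) * (P z / fac k z)).
Proof.
move=> oz; apply: cder_sum => k; apply: cderZ.
apply: (star_primitive (U := Om thI)) => //.
- exact: Om_near.
- by move=> w s; exact: Om_star.
- move=> w ow; eexists; apply: cderM; first exact: cder_scP.
  by apply: (@cderV R (fac k)); [exact: fac_neq0|exact: cder_fac].
Qed.

Lemma cder_ext_sc z : \sum_(k < 4) (a k)%:C * cis (- th k) = 0 -> Om thI z -> z != 0 ->
  cder ext_sc z (P z / z / z).
Proof.
move=> balance oz z0.
have h1 := cderM (cder_scP aI oz) (cder_inv z0).
apply: cder_eq (cderD (cderN h1) (cder_core oz)) _.
have e1 (k : 'I_4) : (a k)%:C * (- cis (- th k) / fac k z) / z =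
    - (a k)%:C * cis (- th k) ^+ 2 / fac k z - (a k)%:C * cis (- th k) / z.
  have := fac_neq0 k oz; rewrite (_ : fac k z = 1 - z * cis (- th k)) // => f0.
  by field; rewrite f0 z0.
have e2 : P z * scLp aI thI z / z = \sum_(k < 4) - (a k)%:C * cis (- th k) ^+ 2 * (P z / fac k z).
  rewrite -mulrA /scLp mulr_suml (eq_bigr _ (fun (k : 'I_4) _ => e1 k)) sumrB.
  rewrite -[X in _ - X]mulr_suml balance mul0r subr0 mulr_sumr; apply: eq_bigr => k _; ring.
by rewrite -e2 expr2; field.
Qed.

Lemma ext_sc_data : (forall k, th k < th k.+1) -> (forall k, th k.+4 = th k + 2 * pi) ->
  (forall k, a k.+4 = a k) -> (forall k, 0 < a k < 1) -> \sum_(k < 4) a k = 2 ->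
  \sum_(k < 4) (a k)%:C * cis (- th k) = 0 -> sc_data th a 1 ext_sc (fun z => P z / z).
Proof.
move=> h1 h2 h3 h4 h5 h6; split => //.
- by rewrite mulr1.
- by move=> k; rewrite mul1r.
- by move=> k; have /andP[] := h4 k; lra.
- by rewrite mulr1.
- by move=> r x r0; rewrite Cexp_circV // mulrC.
- by move=> z oz z0; exact: cder_ext_sc.
Qed.

(** The reciprocal is [z / (- P + z * ext_core)], whose derivative at 0 is -1 because [P 0 = 1]. *)
Lemma ext_sc_pole : exists2 d, d != 0 & cder (pole_inv ext_sc) 0 d.
Proof.
have o0 := Om0 thI.
pose den z : R[i] := - P z + z * ext_core z.
have den0 : den 0 = -1 by rewrite /den mul0r addr0 scP0.
have [d hd] : exists d, cder den 0 d.
  eexists; exact: cderD (cderN (cder_scP aI o0)) (cderM (cder_id 0) (cder_core o0)).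
exists (-1); first by rewrite oppr_eq0 oner_eq0.
have dn : den 0 != 0 by rewrite den0 oppr_eq0 oner_eq0.
have h := cderM (cder_id 0) (@cderV R den 0 d dn hd).
rewrite mul1r mul0r addr0 den0 in h.
have e : (-1)^-1 = -1 :> R[i] by rewrite invrN invr1.
rewrite e in h; apply: (cder_near h); exists 1 => // z _ /=.
rewrite /pole_inv; case: eqVneq => [->|z0]; first by rewrite mul0r.
have -> : ext_sc z = den z / z by rewrite /ext_sc /den; field.
by rewrite invf_div mulrC.
Qed.

End sc_maps.

Section sc_rectangle.
Variable R : realType.
Variable th : nat -> R.
Local Notation thI := (fun k : 'I_4 => th k).
Local Notation aI := (fun k : 'I_4 => - (1 / 2) : R).
Local Notation P := (scP aI thI).

Definition rect_sc : R[i] -> R[i] := seg P 0.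

Lemma rect_sc_data : (forall k, th k < th k.+1) -> (forall k, th k.+4 = th k + 2 * pi) ->
  sc_data th (fun=> - (1 / 2)) (-1) rect_sc (fun z => z * P z).
Proof.
move=> h1 h2; split => //.
- by rewrite mulrNN mulr1.
- by move=> k; apply/andP; split; lra.
- by rewrite !big_ord_recr big_ord0 /=; field.
- by move=> r x r0; rewrite Cexp_circ.
- by move=> z oz z0; rewrite mulrC mulKf //; exact: scP_primitive.
Qed.

Lemma rect_sc_der0 : exists2 d, d != 0 & cder rect_sc 0 d.
Proof.
exists 1; first exact: oner_neq0.
by apply: cder_eq (scP_primitive aI (Om0 thI)) _; exact: scP0.
Qed.

End sc_rectangle.

(** * Recovering the quadrilateral from its angles and one ratio of sides *)

Section polygon_shape.
Variable R : realType.
Implicit Types (z w : R[i]).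

Lemma acos_polar (w : R[i]) (x : R) : w != 0 -> 0 <= x <= pi -> 0 <= Im w ->
  acos (Re w / cabs w) = x -> w = (cabs w)%:C * cis x.
Proof.
move=> w0 hx iw e; have c0 : 0 < cabs w by rewrite cabs_gt0.
have hb : -1 <= Re w / cabs w <= 1.
  have := cabs_Re w; rewrite ler_norml => /andP[h1 h2].
  by rewrite ler_pdivlMr // mulN1r h1 ler_pdivrMr // mul1r.
have cx : cos x = Re w / cabs w by rewrite -e acosK.
have rw : Re w = cabs w * cos x by rewrite cx mulrC divfK // gt_eqF.
apply: Cext; rewrite !ReImE /= ?mul0r ?subr0 ?addr0 //.
have s0 : 0 <= sin x by rewrite sin_ge0_pi.
have h : Im w ^+ 2 = (cabs w * sin x) ^+ 2.
  have := cabs_sqr w; rewrite rw => h; have := cos2Dsin2 x => h'.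
  rewrite exprMn; have : cabs w ^+ 2 * (cos x ^+ 2 + sin x ^+ 2) = cabs w ^+ 2 by rewrite h' mulr1.
  by move: h; rewrite exprMn; lra.
apply/eqP; rewrite -(@eqrXn2 _ 2) ?h //.
by rewrite mulr_ge0 // ltW.
Qed.

Variables (th al : nat -> R) (F V : R[i] -> R[i]) (alpha beta gamma delta : R) (A1 A2 A3 A4 : R[i]).
Hypothesis H : sc_data th al 1 F V.
Hypothesis alE : [/\ al 0%N = alpha, al 1%N = beta, al 2%N = gamma & al 3%N = delta].
Hypotheses (hA1 : A1 = 1) (hA2 : A2 = 0) (hA3 : 0 < Im A3) (hA4 : 0 < Im A4).
Hypothesis hconvex : convex_quadrilateral A1 A2 A3 A4.
Hypothesis hangle1 : exterior_angle A4 A1 A2 = pi * (1 + alpha).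
Hypothesis hangle2 : exterior_angle A1 A2 A3 = pi * (1 + beta).
Hypothesis hangle3 : exterior_angle A2 A3 A4 = pi * (1 + gamma).
Local Notation len := (len th al F).
Local Notation dir := (dir th al).
Local Notation vv := (vv th F).
Hypothesis hratio : cabs (A3 - A2) = len 2 / len 1.

(** The angles in the hypotheses are unsigned. The position of [A3] and [A4] in the upper
    half-plane, and convexity at [A3], select the signs and turn them into directions of sides. *)
Lemma quad_angles : 0 < alpha < 1 -> 0 < beta < 1 -> 0 < gamma < 1 ->
  [/\ A3 = (cabs A3)%:C * cis (pi * (1 - beta)), A4 - 1 = (cabs (A4 - 1))%:C * cis (pi * alpha) &
   A4 - A3 = (cabs (A4 - A3))%:C * - cis (- (pi * (beta + gamma)))].
Proof.
move=> /andP[a0 a1] /andP[b0 b1] /andP[c0 c1].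
have p0 := pi_gt0 R.
have pm (x : R) : 0 < x < 1 -> 0 <= pi * x <= pi.
  move=> /andP[x0 x1]; apply/andP; split; first by apply: mulr_ge0; exact: ltW.
  by rewrite ler_piMr // ltW.
have A30 : A3 != 0 by apply: contraTneq hA3 => ->; rewrite /= ltxx.
have A410 : A4 - 1 != 0.
  by rewrite subr_eq0; apply: contraTneq hA4 => ->; rewrite /= ltxx.
have pi2 (x : R) y : 2 * pi - x = pi * (1 + y) -> x = pi * (1 - y) by move=> h; have : pi * (1 + y) + pi * (1 - y) = 2 * pi by [ring]; lra.
have e3 : A3 = (cabs A3)%:C * cis (pi * (1 - beta)).
  apply: acos_polar => //; first by apply: pm; apply/andP; split; lra.
    exact: ltW.
  move: hangle2 => /pi2; rewrite /interior_angle hA1 hA2 !subr0 mul1r cabs1 mul1r ReJ //.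
have e4 : A4 - 1 = (cabs (A4 - 1))%:C * cis (pi * alpha).
  apply: acos_polar => //; first by apply: pm; rewrite a0.
    by rewrite ImB subr0 ltW.
  move: hangle1 => /pi2; rewrite /interior_angle hA1 hA2 sub0r.
  rewrite (_ : _ * _ = - (A4 - 1)); last by apply: Cext; rewrite !ReImE; ring.
  rewrite ReN cabsN cabs1 mulr1 mulNr => h.
  have hb : -1 <= Re (A4 - 1) / cabs (A4 - 1) <= 1.
    have := cabs_Re (A4 - 1); rewrite ler_norml => /andP[h1 h2].
    have q0 : 0 < cabs (A4 - 1) by rewrite cabs_gt0.
    by rewrite ler_pdivlMr // mulN1r h1 ler_pdivrMr // mul1r.
  have hb' : -1 <= - (Re (A4 - 1) / cabs (A4 - 1)) <= 1 by rewrite lerN2 lerNl andbC.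
  have : cos (pi * (1 - alpha)) = - (Re (A4 - 1) / cabs (A4 - 1)) by rewrite -h acosK.
  rewrite mulrBr mulr1 cosB cospi sinpi mulN1r mul0r addr0 => /oppr_inj <-.
  by rewrite cosK // in_itv /= pm // a0.
(* [A4] and [A1] lie on the same side of the line through [A2] and [A3]; this decides the sense of
   the turn at [A3]. *)
have g4 : Im (A4 * conjc A3) < 0.
  have [_ h _ _] := hconvex; move: h; rewrite /strictly_same_side hA1 hA2 !subr0 mul1r.
  rewrite [conjc A3]lock mulrC -lock ImJ mulNr oppr_gt0 pmulr_rlt0 //.
have A43 : A4 - A3 != 0.
  rewrite subr_eq0; apply: contraTneq g4 => ->; rewrite !ReImE -leNgt; lra.
split => //.
pose W := - (A4 - A3) * conjc A3.
have W0 : W != 0 by rewrite mulf_neq0 ?oppr_eq0 // conjc_eq0.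
have IW : 0 <= Im W.
  by rewrite /W; move: g4; rewrite !ReImE; lra.
have eW : W = (cabs W)%:C * cis (pi * (1 - gamma)).
  apply: acos_polar => //; first by apply: pm; apply/andP; split; lra.
  move: hangle3 => /pi2; rewrite /interior_angle hA2 sub0r cabsN => <-.
  rewrite /W cabsM cabsN cabsJ (mulrC (cabs A3)); congr (acos (_ / _)).
  by rewrite !ReImE; ring.
have cW : cabs W = cabs (A4 - A3) * cabs A3 by rewrite /W cabsM cabsN cabsJ.
have c30 : (cabs A3)%:C != 0 by rewrite rC_eq0 cabs_eq0.
have key : (A4 - A3) * (cis (- (pi * (1 - beta)))) = - (cabs (A4 - A3))%:C * cis (pi * (1 - gamma)).
  apply: (mulfI c30).
  have cA : conjc A3 = (cabs A3)%:C * cis (- (pi * (1 - beta))) by rewrite {1}e3 cis_conj.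
  have : - W = (A4 - A3) * conjc A3 by rewrite /W mulNr opprK.
  rewrite cA eW cW rCM => h; transitivity ((A4 - A3) * ((cabs A3)%:C * cis (- (pi * (1 - beta))))); first by ring.
  by rewrite -h; ring.
have hh : A4 - A3 = (A4 - A3) * cis (- (pi * (1 - beta))) * cis (pi * (1 - beta)).
  by rewrite -mulrA -cisD addNr cis0 mulr1.
rewrite key -mulrA -cisD in hh.
transitivity (- (cabs (A4 - A3))%:C * cis (pi * (1 - gamma) + pi * (1 - beta))); first exact: hh.
rewrite mulNr mulrN; congr (- (_ * _)).
by rewrite -(cis2pi (- _)); congr cis; ring.
Qed.

(** A similarity matching the first side matches the third vertex by the ratio hypothesis, and the
    fourth as the intersection of two lines of known directions. *)
Lemma quad_match : 0 < alpha < 1 -> 0 < beta < 1 -> 0 < gamma < 1 -> 0 < delta < 1 -> alpha + beta + gamma + delta = 2 ->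
  exists s b, s != 0 /\ [/\ A1 = s * vv 0 + b, A2 = s * vv 1 + b, A3 = s * vv 2 + b & A4 = s * vv 3 + b].
Proof.
move=> ha hb hc hd hs; have [e3 e4 e34] := quad_angles ha hb hc.
have [al0 al1 al2 al3] := alE.
have l1 := len_gt0 H 1; have lC : (len 1)%:C != 0 by rewrite rC_eq0 gt_eqF.
have d0 : dir 1 != 0 by rewrite -cabs_eq0 cabs_dir oner_eq0.
have v5 : vv 5 = vv 4 + (len 1)%:C * dir 1 := vv_next H 1.
have v6 : vv 6 = vv 5 + (len 2)%:C * dir 2 := vv_next H 2.
have v7 : vv 7 = vv 6 + (len 3)%:C * dir 3 := vv_next H 3.
have v8 : vv 8 = vv 7 + (len 4)%:C * dir 4 := vv_next H 4.
have e8 : vv 8 = vv 4 := vv_per H 4.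
have w4 : vv 4 = vv 0 := vv_per H 0.
have w5 : vv 5 = vv 1 := vv_per H 1.
have w6 : vv 6 = vv 2 := vv_per H 2.
have w7 : vv 7 = vv 3 := vv_per H 3.
have d2 : dir 2 = cis (- (pi * beta)) * dir 1 by rewrite -al1; exact: dir_turn H 1.
have d3 : dir 3 = cis (- (pi * (beta + gamma))) * dir 1.
  have -> : dir 3 = cis (- (pi * al 2)) * dir 2 := dir_turn H 2.
  by rewrite d2 al2 mulrA -cisD; congr (cis _ * _); ring.
have d4 : dir 4 = cis (pi * alpha) * dir 1.
  have -> : dir 4 = cis (- (pi * al 3)) * dir 3 := dir_turn H 3.
  rewrite d3 al3 mulrA -cisD; congr (_ * _); rewrite -(cis2pi (- _ - _)); congr cis.
  rewrite (_ : delta = 2 - alpha - beta - gamma); [ring|lra].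
(* The similarity sending the first side of the image polygon to the segment from 1 to 0. *)
pose s : R[i] := - ((len 1)%:C * dir 1)^-1; pose b := 1 - s * vv 0.
have s0 : s != 0 by rewrite oppr_eq0 invr_eq0 mulf_neq0.
have ld : (len 1)%:C * dir 1 != 0 := mulf_neq0 lC d0.
have sl : s * ((len 1)%:C * dir 1) = -1 by rewrite /s mulNr mulVf.
have sd (x : R) : s * (x%:C * dir 1) = - (x / len 1)%:C.
  rewrite rCM rCV /s; field; by rewrite d0 lC.
exists s, b; split => //.
have a2 : A2 = s * vv 1 + b by rewrite hA2 -w5 v5 /b -w4 mulrDr sl; ring.
have a3 : A3 = s * vv 2 + b.
  rewrite -w6 v6 (_ : s * (vv 5 + _) + b = (s * vv 5 + b) + s * ((len 2)%:C * dir 2)); last by ring.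
  rewrite w5 -a2 hA2 add0r d2.
  rewrite (_ : s * _ = cis (- (pi * beta)) * (s * ((len 2)%:C * dir 1))); last by ring.
  rewrite sd -hratio hA2 subr0 mulrN -mulNr mulrC; rewrite {1}e3; congr (_ * _).
  rewrite mulrBr mulr1 cisD; apply: Cext; rewrite !ReImE /= ?cospi ?sinpi; ring.
split => //.
  by rewrite hA1 /b addrC subrK.
set B := s * vv 3 + b.
have b4 : B - 1 = (len 4 / len 1)%:C * cis (pi * alpha).
  have : s * (vv 8 - vv 7) = - (len 4 / len 1)%:C * cis (pi * alpha).
    rewrite v8 d4 (_ : s * _ = cis (pi * alpha) * (s * ((len 4)%:C * dir 1))); last by ring.
    by rewrite sd mulrC.
  rewrite e8 w4 w7 => h; rewrite /B /b (_ : _ - 1 = - (s * (vv 0 - vv 3))); last by ring.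
  by rewrite h mulNr opprK.
have b34 : B - A3 = (len 3 / len 1)%:C * - cis (- (pi * (beta + gamma))).
  have h : s * (vv 7 - vv 6) = - (len 3 / len 1)%:C * cis (- (pi * (beta + gamma))).
    rewrite v7 d3 (_ : s * _ = cis (- (pi * (beta + gamma))) * (s * ((len 3)%:C * dir 1))); last by ring.
    by rewrite sd mulrC.
  by rewrite a3 /B -w7 -w6 mulrN -mulNr -h; ring.
set p := cabs (A4 - 1) in e4; set q := cabs (A4 - A3) in e34.
set p' := len 4 / len 1 in b4; set q' := len 3 / len 1 in b34.
(* two lines through 1 and A3 in distinct directions meet once *)
have eq1 : A4 - B = (p - p')%:C * cis (pi * alpha).
  by rewrite rCB mulrBl -e4 -b4; ring.
have eq2 : A4 - B = (q - q')%:C * - cis (- (pi * (beta + gamma))).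
  by rewrite rCB mulrBl -e34 -b34; ring.
suff : p - p' = 0 by move=> h; apply/eqP; rewrite -subr_eq0 eq1 h mul0r.
have : (A4 - B) * cis (pi * (beta + gamma)) = - (q - q')%:C.
  by rewrite eq2 mulrN mulNr -mulrA -cisD addNr cis0 mulr1.
rewrite eq1 -mulrA -cisD => /(congr1 (@complex.Im R)).
rewrite ImCM ImN ImC oppr0 /= => /eqP; rewrite mulf_eq0 => /orP[/eqP //|/eqP sin0]; exfalso.
have : sin (pi * delta) = 0.
  have -> : pi * delta = - (pi * alpha + pi * (beta + gamma)) + 2 * pi.
    by rewrite (_ : delta = 2 - alpha - beta - gamma); [ring|lra].
  by rewrite mulr_natl sinD2pi sinN sin0 oppr0.
have p0 := pi_gt0 R; move: hd => /andP[dd0 dd1].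
have : 0 < sin (pi * delta) by rewrite sin_gt0_pi // mulr_gt0 //= -[ltRHS]mulr1 ltr_pM2l.
by move=> + e; rewrite e ltxx.
Qed.

End polygon_shape.

(** * Side lengths as Euler and elliptic integrals *)

Section unit_interval_integrals.
Variable R : realType.
Local Notation mu := (@lebesgue_measure R).
Implicit Types (f w Phi : R -> R) (x y : R).

Lemma measurable_oo f w (a b : R) : (forall x, a < x < b -> {for x, continuous w}) ->
  (forall x, a < x < b -> f x = w x) -> measurable_fun (`]a, b[%classic : set R) f.
Proof.
move=> cw fw; apply: (@eq_measurable_fun _ _ _ _ `]a, b[%classic w).
  by move=> x; rewrite inE /= in_itv /= => hx; rewrite fw.
apply: subspace_continuous_measurable_fun => //.
by apply: continuous_in_subspaceT => x; rewrite inE /= in_itv /=; exact: cw.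
Qed.

(** The shift by 3 makes every interval of the exhaustion of the open unit interval nonempty. *)
Lemma invn3 (n : nat) : 0 < (n.+3%:R : R)^-1 <= 1 / 3.
Proof. by rewrite invr_gt0 ltr0n /= mul1r lef_pV2 ?posrE ?ltr0n // ler_nat. Qed.

Lemma invn3_cvg : (fun n => (n.+3%:R : R)^-1) @ \oo --> (0 : R).
Proof.
have h := @cvg_harmonic R; rewrite -(cvg_shiftn 2) in h.
apply: cvg_trans h; apply: near_eq_cvg; apply: nearW => n.
by rewrite /= /harmonic addn2.
Qed.

Lemma invn3_bigcup : \bigcup_n `[(n.+3%:R : R)^-1, 1 - (n.+3%:R)^-1]%classic = (`]0, 1[%classic : set R).
Proof.
apply/seteqP; split=> x /=.
  move=> [n _]; rewrite /= !in_itv /= => /andP[h1 h2].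
  by have := invn3 n; move: h1 h2; move: (n.+3%:R^-1 : R) => y h1 h2 /andP[h3 h4]; apply/andP; split; lra.
rewrite in_itv /= => /andP[x0 x1].
pose m := Num.min x (1 - x); have m0 : 0 < m by rewrite lt_min x0 subr_gt0.
have m1 : m <= x by rewrite ge_min lexx.
have m2 : m <= 1 - x by rewrite ge_min lexx orbT.
exists (Num.trunc m^-1) => //=; rewrite in_itv /=.
set n := Num.trunc m^-1.
have h : (n.+3%:R : R)^-1 <= m.
  rewrite -[leRHS]invrK lef_pV2 ?posrE ?invr_gt0 ?ltr0n //.
  by rewrite ltW // (lt_le_trans (truncnS_gt _)) // ler_nat ltnW.
by move: h; move: (n.+3%:R^-1 : R) => y h; apply/andP; split; lra.
Qed.

(** The integrand may be singular at the ends and its values there are arbitrary: the fundamental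
    theorem is used on inner intervals, and monotone convergence for the nonnegative [w] passes to
    the limit. *)
Lemma integral01_deriv f w Phi : (forall x, 0 < x < 1 -> {for x, continuous w}) ->
  (forall x, 0 < x < 1 -> f x = w x) -> (forall x, 0 < x < 1 -> 0 <= w x) ->
  (forall x, 0 <= x <= 1 -> {for x, continuous Phi}) ->
  (forall x, 0 < x < 1 -> is_derive x 1 Phi (w x)) ->
  (\int[mu]_(x in `[(0 : R)%R, (1 : R)%R]) (f x)%:E = (Phi 1 - Phi 0)%:E)%E.
Proof.
move=> cw fw w0 cP dP.
have mf := measurable_oo cw fw.
have mw := measurable_oo cw (fun x _ => erefl).
rewrite (@integral_itv_bndoo _ _ _ (EFin \o f)); last exact/measurable_EFinP.
have -> : (\int[mu]_(z in `](0 : R)%R, (1 : R)%R[) (EFin \o f) z = \int[mu]_(x in `](0 : R)%R, (1 : R)%R[) (w x)%:E)%E.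
  by apply: eq_integral => x; rewrite inE /= in_itv /= => /fw ->.
pose F (n : nat) : set R := `[(n.+3%:R : R)^-1, 1 - (n.+3%:R)^-1]%classic.
have Fsub n x : F n x -> 0 < x < 1.
  rewrite /F /= in_itv /=; have := invn3 n; move: (n.+3%:R^-1 : R) => y /andP[h3 h4] /andP[h1 h2].
  by apply/andP; split; lra.
have lim : (\int[mu]_(x in F n) (w x)%:E)%E @[n --> \oo] --> (\int[mu]_(x in `](0 : R)%R, (1 : R)%R[) (w x)%:E)%E.
  rewrite -invn3_bigcup; apply: ge0_nondecreasing_set_cvg_integral => //.
  - apply/nondecreasing_seqP => n; rewrite subsetEset => x; rewrite /F /= !in_itv /=.
    have : (n.+4%:R : R)^-1 <= (n.+3%:R)^-1 by rewrite lef_pV2 ?posrE ?ltr0n // ler_nat.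
    by move: (n.+3%:R^-1 : R) (n.+4%:R^-1 : R) => y y' h /andP[h1 h2]; apply/andP; split; lra.
  - by move=> n; exact: measurable_itv.
  - move=> n; apply/measurable_EFinP; apply: measurable_funS mw => //.
    by move=> x /Fsub; rewrite /= in_itv.
  - by move=> n x /Fsub /w0; rewrite lee_fin.
apply: (cvg_unique (@ereal_hausdorff R) lim).
have -> : (fun n => \int[mu]_(x in F n) (w x)%:E)%E = (fun n => (Phi (1 - (n.+3%:R)^-1) - Phi (n.+3%:R)^-1)%:E).
  apply/funext => n; have := invn3 n; rewrite /F; move: (n.+3%:R^-1 : R) => y /andP[h3 h4].
  have ab : y < 1 - y by lra.
  rewrite EFinB; apply: continuous_FTC2 => //.
  - apply: continuous_in_subspaceT => x; rewrite inE /= in_itv /= => /andP[h1 h2]; apply: cw; apply/andP; split; lra.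
  - split.
    + move=> x; rewrite in_itv /= => /andP[h1 h2].
      have hx : 0 < x < 1 by apply/andP; split; lra.
      by have := dP x hx => d; exact: ex_derive.
    + apply: cvg_at_right_filter; apply: cP; apply/andP; split; lra.
    + apply: cvg_at_left_filter; apply: cP; apply/andP; split; lra.
  - move=> x; rewrite in_itv /= => /andP[h1 h2].
    have hx : 0 < x < 1 by apply/andP; split; lra.
    by have d := dP x hx; rewrite derive1E; exact: derive_val.
apply: cvg_EFin; first by apply: nearW.
have -> : fine \o (fun n => (Phi (1 - (n.+3%:R)^-1) - Phi (n.+3%:R)^-1)%:E) = (fun n => Phi (1 - (n.+3%:R)^-1) - Phi (n.+3%:R)^-1) by [].
apply: cvgB.
  apply: (@cvg_comp _ _ _ (fun n => 1 - (n.+3%:R : R)^-1) Phi); last by apply: cP; rewrite ler01 lexx.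
  have h : (fun n => 1 - (n.+3%:R : R)^-1) @ \oo --> (1 - 0 : R) by apply: cvgB; [exact: cvg_cst|exact: invn3_cvg].
  by rewrite subr0 in h.
apply: (@cvg_comp _ _ _ (fun n => (n.+3%:R : R)^-1) Phi); first exact: invn3_cvg.
by apply: cP; rewrite ler01 lexx.
Qed.

Lemma Rintegral01_deriv f w Phi : (forall x, 0 < x < 1 -> {for x, continuous w}) ->
  (forall x, 0 < x < 1 -> f x = w x) -> (forall x, 0 < x < 1 -> 0 <= w x) ->
  (forall x, 0 <= x <= 1 -> {for x, continuous Phi}) ->
  (forall x, 0 < x < 1 -> is_derive x 1 Phi (w x)) ->
  \int[mu]_(x in `[0, 1]) f x = Phi 1 - Phi 0.
Proof. by move=> h1 h2 h3 h4 h5; rewrite /Rintegral (integral01_deriv h1 h2 h3 h4 h5). Qed.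

Lemma integral01_bounds f (c M : R) : (forall x, 0 < x < 1 -> {for x, continuous f}) ->
  (forall x, 0 < x < 1 -> 0 <= f x <= M) -> 0 <= c -> (forall x, 1 / 4 <= x <= 3 / 4 -> c <= f x) ->
  ((c / 2)%:E <= \int[mu]_(x in `[(0 : R)%R, (1 : R)%R]) (f x)%:E <= M%:E)%E.
Proof.
move=> cf fM c0 fc; have mf := measurable_oo cf (fun x _ => erefl).
have mE : measurable_fun (`]0, 1[%classic : set R) (EFin \o f) by exact/measurable_EFinP.
rewrite (@integral_itv_bndoo _ _ _ (EFin \o f)) //; apply/andP; split.
  apply: (@le_trans _ _ (\int[mu]_(x in `[(1 / 4 : R)%R, (3 / 4 : R)%R]) (f x)%:E)%E); last first.
    apply: ge0_subset_integral => //.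
      by move=> x /=; rewrite in_itv /= => /fM /andP[]; rewrite lee_fin.
    by move=> x /=; rewrite !in_itv /= => /andP[h1 h2]; apply/andP; split; lra.
  have -> : (c / 2)%:E = (\int[mu]_(x in `[(1 / 4 : R)%R, (3 / 4 : R)%R]) cst c%:E x)%E.
    rewrite integral_cst //= lebesgue_measure_itv /= lte_fin ifT; last by lra.
    by rewrite -EFinB -EFinM; congr (_%:E); field.
  apply: ge0_le_integral => //.
  - apply: measurable_funS mE => //.
    by move=> x /=; rewrite !in_itv /= => /andP[h1 h2]; apply/andP; split; lra.
have -> : M%:E = (\int[mu]_(x in `](0 : R)%R, (1 : R)%R[) cst M%:E x)%E.
  by rewrite integral_cst //= lebesgue_measure_itv /= lte_fin ltr01 -EFinB subr0 mule1.
apply: ge0_le_integral => //.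
- by move=> x /=; rewrite in_itv /= => /fM /andP[]; rewrite lee_fin.
- by move=> x /=; rewrite in_itv /= => /fM /andP[_]; rewrite lee_fin.
Qed.

Lemma powR_continuous (e x : R) : 0 < x -> {for x, continuous (fun u => u `^ e)}.
Proof.
move=> x0; apply: differentiable_continuous; apply/derivable1_diffP.
by apply: derivable_powR; rewrite in_itv /= x0.
Qed.

(** Allows [Beta] to cancel the normalisation in [Lauricella_FD]. The upper bound matters too: an
    infinite integral would be read as the real number 0. *)
Lemma Beta_gt0 (p q : R) : 0 < p < 1 -> 0 < q < 1 -> 0 < Beta (1 + p) (1 + q).
Proof.
move=> /andP[p0 p1] /andP[q0 q1].
have e1 : 1 + p - 1 = p by rewrite addrC addKr.
have e2 : 1 + q - 1 = q by rewrite addrC addKr.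
rewrite /Beta e1 e2 /Rintegral.
(* On the middle half of the interval the integrand is at least [x * (1 - x)], since both exponents
   are below 1, and this is at least 1/16. *)
have : ((1 / 16 / 2 : R)%:E <= \int[mu]_(x in `[(0 : R)%R, (1 : R)%R]) ((x `^ p * (1 - x) `^ q)%:E) <= (1 : R)%:E)%E; last first.
  case: (\int[mu]_(x in _) _)%E => [r| |] //=; rewrite ?leey ?leNye ?andbF // !lee_fin => /andP[h _]; lra.
apply: (@integral01_bounds (fun u => u `^ p * (1 - u) `^ q)).
- move=> x /andP[x0 x1]; apply: continuousM; first exact: powR_continuous.
  have c1 : {for x, continuous (fun u : R => 1 - u)} by apply: cvgB; [exact: cvg_cst|exact: cvg_id].
  have c2 : {for (1 - x), continuous (fun u : R => u `^ q)} by apply: powR_continuous; rewrite subr_gt0.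
  exact: (@continuous_comp _ _ _ (fun u : R => 1 - u) (fun u : R => u `^ q) x c1 c2).
- move=> x /andP[x0 x1]; have x1' : 0 < 1 - x by rewrite subr_gt0.
  have le1 (y e : R) : 0 < y -> y < 1 -> 0 < e -> y `^ e <= 1.
    move=> y0 y1 e0; apply: (@le_trans _ _ (1 `^ e)); last by rewrite powR1.
    by rewrite ge0_ler_powR ?nnegrE ?ler01 ?(ltW y0) ?(ltW e0) ?(ltW y1).
  rewrite mulr_ge0 ?powR_ge0 //= -[leRHS]mulr1 ler_pM ?powR_ge0 //; apply: le1 => //; lra.
- by lra.
- move=> x /andP[x0 x1].
  have h1 : x <= x `^ p by apply: ger1_powR; lra.
  have h2 : 1 - x <= (1 - x) `^ q by apply: ger1_powR; lra.
  apply: (@le_trans _ _ (x * (1 - x))); first by nra.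
  by rewrite ler_pM //; lra.
Qed.

End unit_interval_integrals.

Section distances.
Variable R : realType.
Implicit Types (x y s : R).

Lemma powRE x e : 0 < x -> x `^ e = expR (e * ln x).
Proof. by move=> x0; rewrite /powR gt_eqF. Qed.

Lemma cabs_one_sub_cis x : 0 < x < 2 * pi -> cabs (1 - cis x) = 2 * sin (x / 2).
Proof.
move=> /andP[h0 h1]; rewrite one_sub_cis cabsM cabs_cis mulr1 cabsR ger0_norm //.
by rewrite mulr_ge0 // sin_ge0_pi //; apply/andP; split; lra.
Qed.

Lemma wl_dist (th a : nat -> R) m x : (forall k, th k < th k.+1) -> (forall k, th k.+4 = th k + 2 * pi) ->
  (forall k, a k.+4 = a k) -> th m.+3 < x < th m.+4 ->
  wl th a m x = \sum_(k < 4) a k * ln (cabs (cis x - cis (th k))).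
Proof.
move=> h1 h2 h3; rewrite h2 => /andP[l1 l2].
pose g k := a k * ln (cabs (cis x - cis (th k))).
rewrite (_ : \sum_(k < 4) _ = \sum_(k < 4) g k) // (window m); last first.
  by move=> k; rewrite /g h3 h2 cis2pi.
have key k : th k < x < th k + 2 * pi -> 2 * sin ((x - th k) / 2) = cabs (cis x - cis (th k)).
  move=> /andP[a1 a2]; rewrite -cabs_one_sub_cis; last by apply/andP; split; lra.
  rewrite -[LHS]mulr1 -(cabs_cis (th k)) -cabsM mulrBl mul1r -cisD subrK.
  exact: cabs_distrC.
have [g1 g2 g3] : [/\ th m < th m.+1, th m.+1 < th m.+2 & th m.+2 < th m.+3] by [].
by rewrite /wl /g !key //; apply/andP; split; lra.
Qed.

Lemma derive_comp (f g : R -> R) x d e : is_derive x 1 g e -> is_derive (g x) 1 f d ->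
  is_derive x 1 (fun y => f (g y)) (d * e).
Proof. by move=> h1 h2; exact: (@is_derive1_comp R f g x d e h2 h1). Qed.

Lemma cont_comp (f g : R -> R) x : {for x, continuous g} -> {for (g x), continuous f} ->
  {for x, continuous (fun y => f (g y))}.
Proof. by move=> h1 h2; exact: (@continuous_comp _ _ _ g f x h1 h2). Qed.

End distances.

(** * Passage to the half-plane *)

Section half_plane.
Variable R : realType.
Variables (x0 y0 t : R).
Hypotheses (y0_gt0 : 0 < y0) (t_gt1 : 1 < t).
Implicit Types (s x : R) (k m : nat).

(* [cis (hp s)] is the image of [s] under a Cayley transform taking [x0 + i y0] to 0. *)
Definition hp s : R := 2 * atan ((s - x0) / y0).
Let z : R[i] := x0 +i* y0.

Lemma zs_neq0 s : s%:C - z != 0.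
Proof.
apply/eqP => /(congr1 (@complex.Im R)); rewrite !ReImE sub0r => /eqP.
by rewrite oppr_eq0 gt_eqF.
Qed.

Lemma zs_gt0 s : 0 < cabs (s%:C - z).
Proof. by rewrite cabs_gt0 zs_neq0. Qed.

Lemma zs_sqr s : cabs (s%:C - z) ^+ 2 = (s - x0) ^+ 2 + y0 ^+ 2.
Proof. by rewrite cabs_sqr !ReImE sub0r sqrrN. Qed.

Lemma hp_deriv s : is_derive s 1 hp (2 * y0 / cabs (s%:C - z) ^+ 2).
Proof.
have h1 : is_derive s 1 (fun s => (s - x0) / y0) y0^-1.
  apply/is_derive1_caratheodory; exists (fun=> y0^-1); split => //; last exact: cvg_cst.
  by move=> u; ring.
have h2 := @derive_comp R atan _ s _ _ h1 (is_derive1_atan ((s - x0) / y0)).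
have h3 := is_deriveZ 2 h2.
apply: is_derive_eq h3 _; rewrite zs_sqr /GRing.scale /=.
have n0 : y0 != 0 by rewrite gt_eqF.
have n1 : (s - x0) ^+ 2 + y0 ^+ 2 != 0 by rewrite gt_eqF // ltr_wpDl ?sqr_ge0 // exprn_gt0.
have n2 : 1 + ((s - x0) / y0) ^+ 2 != 0 by rewrite gt_eqF // ltr_wpDr ?sqr_ge0.
by field; rewrite n0 n1 /=; move: n1; rewrite addrC.
Qed.

Lemma hp_cont s : {for s, continuous hp}.
Proof. exact: derive_cont (hp_deriv s). Qed.

Lemma hp_lt s s' : s < s' -> hp s < hp s'.
Proof.
move=> ss; apply: (derive_gt0_lt ss (fun x _ => hp_deriv x)).
  by move=> x _; rewrite divr_gt0 ?mulr_gt0 ?exprn_gt0 // zs_gt0.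
by apply: continuous_subspaceT => x; exact: hp_cont.
Qed.

Lemma hp_bnd s : - pi < hp s < pi.
Proof.
have := atan_gtNpi2 ((s - x0) / y0); have := atan_ltpi2 ((s - x0) / y0).
by rewrite /hp => h1 h2; apply/andP; split; lra.
Qed.

Lemma cis_atan (v : R) : cis (atan v) = (Num.sqrt (1 + v ^+ 2))^-1%:C * (1 +i* v).
Proof.
have h := cos_atan v; have q0 : 0 < 1 + v ^+ 2 by rewrite ltr_wpDr ?sqr_ge0.
have c0 : cos (atan v) != 0 by rewrite h invr_eq0 sqrtr_eq0 -ltNge.
have e : sin (atan v) = v * cos (atan v) by rewrite -{2}(atanK v) /tan divfK.
apply: Cext; rewrite !ReImE /cis /= ?mul0r ?subr0 ?addr0 ?mulr1 ?e ?h //.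
by rewrite mulrC.
Qed.

Lemma cis_hp s : cis (hp s) = (z - s%:C) / (s%:C - conjc z).
Proof.
have q0 v : 0 < 1 + v ^+ 2 :> R by rewrite ltr_wpDr ?sqr_ge0.
have d0 : s%:C - conjc z != 0.
  apply/eqP => /(congr1 (@complex.Im R)); rewrite !ReImE sub0r opprK => /eqP.
  by rewrite gt_eqF.
rewrite /hp mulr2n mulrDl mul1r cisD cis_atan; set v := _ / y0.
have vE : s - x0 = v * y0 by rewrite /v divfK ?gt_eqF.
apply: (mulIf d0); rewrite divfK //.
have sq : ((Num.sqrt (1 + v ^+ 2))^-1)%:C * ((Num.sqrt (1 + v ^+ 2))^-1)%:C = ((1 + v ^+ 2)^-1)%:C :> R[i].
  by rewrite -rCM -invfM -expr2 sqr_sqrtr // ltW.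
rewrite mulrACA sq; have n1 : 1 + v ^+ 2 != 0 by rewrite gt_eqF.
have sE : s = v * y0 + x0 by rewrite -vE subrK.
rewrite sE; apply: Cext; rewrite !ReImE /=; by field.
Qed.

Lemma conjc_dist s : cabs (s%:C - conjc z) = cabs (s%:C - z).
Proof. by rewrite -cabsJ; congr cabs; apply: Cext; rewrite !ReImE; ring. Qed.

Lemma dist_hp s x : cabs (cis (hp s) - cis (hp x)) = 2 * y0 * `|s - x| / (cabs (s%:C - z) * cabs (x%:C - z)).
Proof.
have n u : u%:C - conjc z != 0 by rewrite -cabs_gt0 conjc_dist zs_gt0.
rewrite !cis_hp.
have -> : (z - s%:C) / (s%:C - conjc z) - (z - x%:C) / (x%:C - conjc z) =
    ((2 * y0 * (x - s))%:C * iC) / ((s%:C - conjc z) * (x%:C - conjc z)).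
  have -> : (2 * y0 * (x - s))%:C * iC = (z - conjc z) * (x%:C - s%:C) by apply: Cext; rewrite !ReImE; ring.
  by field; rewrite !n.
rewrite cabsM cabsV !cabsM cabs_i mulr1 !conjc_dist cabsR !normrM (distrC x) (gtr0_norm y0_gt0).
by rewrite ger0_norm.
Qed.

Lemma dist_hp_pi s : cabs (cis (hp s) - cis pi) = 2 * y0 / cabs (s%:C - z).
Proof.
have n u : u%:C - conjc z != 0 by rewrite -cabs_gt0 conjc_dist zs_gt0.
have -> : cis pi = -1 :> R[i] by apply: Cext; rewrite /cis /= ?cospi ?sinpi ?oppr0.
rewrite cis_hp opprK.
have -> : (z - s%:C) / (s%:C - conjc z) + 1 = ((2 * y0)%:C * iC) / (s%:C - conjc z).
  have -> : (2 * y0)%:C * iC = z - conjc z by apply: Cext; rewrite !ReImE; ring.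
  by field; rewrite n.
by rewrite cabsM cabsV !cabsM cabs_i mulr1 conjc_dist cabsR ger0_norm // mulr_ge0 // ltW.
Qed.

(** Arguments of the images of 0, 1, [t] and infinity, the last going to -1, continued with period
    4. *)
Definition thq (n : nat) : R := nth 0 [:: hp 0; hp 1; hp t; pi] (n %% 4) + 2 * pi * (n %/ 4)%:R.

Lemma thq_per n : thq n.+4 = thq n + 2 * pi.
Proof.
rewrite /thq -addn4 modnDr divnDr // divnn /= -addrA; congr (_ + _).
by rewrite natrD mulrDr mulr1.
Qed.

Lemma thqE : [/\ thq 0 = hp 0, thq 1 = hp 1, thq 2 = hp t, thq 3 = pi & thq 4 = hp 0 + 2 * pi].
Proof. by rewrite /thq /= !mulr0 !addr0 mulr1. Qed.

Lemma thqE' : [/\ thq 5 = hp 1 + 2 * pi & thq 6 = hp t + 2 * pi].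
Proof. by rewrite /thq /= !mulr1. Qed.

Lemma thq_lt n : thq n < thq n.+1.
Proof.
have [t0 t1 t2 t3 t4] := thqE.
move: n; apply: (@periodic_all (fun n => thq n < thq n.+1) 0).
- by move=> k; rewrite (thq_per k) (thq_per k.+1) ltrD2r.
- by rewrite t0 t1 hp_lt.
- by rewrite t1 t2 hp_lt.
- by rewrite t2 t3; case/andP: (hp_bnd t).
- by rewrite t3 t4; have /andP[] := hp_bnd 0; lra.
Qed.

Section arclength.
Variables (a : nat -> R) (kap : R) (F V : R[i] -> R[i]).
Hypothesis H : sc_data thq a kap F V.

(** The part of the arclength density that does not depend on [s]; it cancels in ratios of sides. *)
Definition arcC : R := expR (a 0%N * (ln (2 * y0) - ln (cabs (0%:C - z))) + a 1%N * (ln (2 * y0) - ln (cabs (1%:C - z)))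
  + a 2%N * (ln (2 * y0) - ln (cabs (t%:C - z))) + a 3%N * ln (2 * y0)) * (2 * y0).

(** The shift is needed because sides 1 and 2 belong to the arcs between [thq 4], [thq 5] and
    [thq 6], one turn later. *)
Definition Lam m s : R := lam thq a F m (hp s + 2 * pi).

Lemma arcC_gt0 : 0 < arcC.
Proof. by rewrite mulr_gt0 ?expR_gt0 ?mulr_gt0. Qed.

Lemma Lam_cont m s : {for s, continuous (Lam m)}.
Proof.
have c1 : {for s, continuous (fun s => hp s + 2 * pi)} by apply: cvgD; [exact: hp_cont|exact: cvg_cst].
have c2 : {for (hp s + 2 * pi), continuous (lam thq a F m)} := @lam_cont _ _ _ _ _ _ H m _.
have c3 := @cont_comp R (lam thq a F m) _ s c1 c2; exact: c3.
Qed.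

(** Chords of the circle become [2 y0 |s - x| / (|s - z| |x - z|)]. The exponents sum to [2 * kap]
    and the derivative of [hp] adds 2, so [|s - z|] has exponent -4 for the exterior map and
    disappears for the rectangle. *)
Lemma Lam_deriv m s : thq m.+3 < hp s + 2 * pi < thq m.+4 -> s != 0 -> s != 1 -> s != t ->
  is_derive s 1 (Lam m) (arcC * expR (a 0%N * ln `|s| + a 1%N * ln `|s - 1| + a 2%N * ln `|s - t|
    - (2 * kap + 2) * ln (cabs (s%:C - z)))).
Proof.
move=> hs s0 s1 st.
have h1 : is_derive s 1 (fun s => hp s + 2 * pi) (2 * y0 / cabs (s%:C - z) ^+ 2).
  have := is_deriveD (hp_deriv s) (is_derive_cst (2 * pi) s 1); rewrite addr0; exact.
have h2 := @derive_comp R (lam thq a F m) _ s _ _ h1 (lam_deriv H hs).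
apply: is_derive_eq h2 _.
rewrite (wl_dist (sc_th_lt H) (sc_th_per H) (sc_a_per H) hs) !big_ord_recr big_ord0 /= add0r.
have [-> -> -> -> _] := thqE; rewrite cis2pi !dist_hp dist_hp_pi.
have A : a 0%N + a 1%N + a 2%N + a 3%N = 2 * kap.
  by have := sc_suma H; rewrite !big_ord_recr big_ord0 /= add0r.
have y2 : 0 < 2 * y0 by rewrite mulr_gt0.
have ld x : s != x -> ln (2 * y0 * `|s - x| / (cabs (s%:C - z) * cabs (x%:C - z))) =
   ln (2 * y0) + ln `|s - x| - ln (cabs (s%:C - z)) - ln (cabs (x%:C - z)).
  move=> sx; have ax : 0 < `|s - x| by rewrite normr_gt0 subr_eq0.
  have p1 := zs_gt0 s; have p2 := zs_gt0 x.
  move: y2; set Y := 2 * y0 => Y0.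
  by rewrite ln_div ?posrE ?mulr_gt0 // !lnM ?posrE //; ring.
have p1 := zs_gt0 s.
rewrite !ld // ln_div ?posrE // subr0.
have -> : 2 * y0 / cabs (s%:C - z) ^+ 2 = (2 * y0) * expR (- (2 * ln (cabs (s%:C - z)))).
  by rewrite expRN; congr (_ / _); rewrite expRM_natl lnK.
rewrite /arcC; move: y2; set Y := 2 * y0 => Y0.
rewrite mulrCA [in RHS]mulrAC [RHS]mulrC; congr (_ * _).
rewrite -!expRD; congr expR.
rewrite (_ : kap = (a 0%N + a 1%N + a 2%N + a 3%N) / 2); last by rewrite A; field.
by field.
Qed.

Lemma len1E : len thq a F 1 = Lam 1 1 - Lam 1 0.
Proof.
have [t0 t1 t2 t3 t4] := thqE; have [t5 t6] := thqE'.
by rewrite /len /Lam t5 -t4 lam0 subr0.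
Qed.

Lemma len2E : len thq a F 2 = Lam 2 t - Lam 2 1.
Proof.
have [t5 t6] := thqE'.
by rewrite /len /Lam t6 -t5 lam0 subr0.
Qed.

Lemma Lam1_deriv s : 0 < s < 1 ->
  is_derive s 1 (Lam 1) (arcC * expR (a 0%N * ln s + a 1%N * ln (1 - s) + a 2%N * ln (t - s)
    - (2 * kap + 2) * ln (cabs (s%:C - z)))).
Proof.
move=> /andP[h0 h1]; have [_ _ _ _ t4] := thqE; have [t5 _] := thqE'.
have ht : s < t := lt_trans h1 t_gt1.
have := @Lam_deriv 1 s; rewrite t4 t5 !ltrD2r !hp_lt // (gt_eqF h0) (lt_eqF h1) (lt_eqF ht).
rewrite (gtr0_norm h0) (distrC s) (gtr0_norm (_ : 0 < 1 - s)) ?subr_gt0 // distrC (gtr0_norm (_ : 0 < t - s)) ?subr_gt0 //.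
by apply.
Qed.

Lemma Lam2_deriv s : 1 < s < t ->
  is_derive s 1 (Lam 2) (arcC * expR (a 0%N * ln s + a 1%N * ln (s - 1) + a 2%N * ln (t - s)
    - (2 * kap + 2) * ln (cabs (s%:C - z)))).
Proof.
move=> /andP[h0 h1]; have [t5 t6] := thqE'.
have s0 : 0 < s := lt_trans ltr01 h0.
have s1 : s == 1 = false by rewrite gt_eqF.
have := @Lam_deriv 2 s; rewrite t5 t6 !ltrD2r !hp_lt // s1 (gt_eqF s0) (lt_eqF h1).
rewrite (gtr0_norm s0) (gtr0_norm (_ : 0 < s - 1)) ?subr_gt0 // distrC (gtr0_norm (_ : 0 < t - s)) ?subr_gt0 //.
by apply.
Qed.

End arclength.

End half_plane.

Section special_functions.
Variable R : realType.
Implicit Types (x y s u : R) (w : R[i]).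

Lemma cpow_real x s : 0 < x -> cpow x%:C s = (x `^ s)%:C.
Proof.
move=> x0; rewrite /cpow /Arg /= lexx cabsR gtr0_norm // divff ?gt_eqF // acos1 mulr0 cos0 sin0.
by apply: Cext; rewrite !ReImE /= ?mulr1 ?mulr0 ?subr0 ?addr0.
Qed.

Lemma Arg_conj w : Im w != 0 \/ 0 < Re w -> Arg (conjc w) = - Arg w.
Proof.
move=> h; rewrite /Arg cabsJ ReJ ImJ oppr_ge0.
case: (ltgtP (Im w) 0) => [i0|i0|i0]; rewrite ?opprK //.
have r0 : 0 < Re w by case: h => //; rewrite i0 eqxx.
have -> : cabs w = Re w by rewrite cabsE i0 expr0n addr0 sqrtr_sqr gtr0_norm.
by rewrite divff ?gt_eqF // acos1 oppr0.
Qed.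

Lemma cpow_conj w s : Im w != 0 \/ 0 < Re w -> cpow w s * cpow (conjc w) s = ((cabs w `^ s) ^+ 2)%:C.
Proof.
move=> h; rewrite /cpow Arg_conj // cabsJ mulrN cosN sinN mulrACA -rCM -expr2.
set T := s * Arg w.
have -> : (cos T +i* sin T) * (cos T +i* - sin T) = 1 :> R[i].
  by have c := cos2Dsin2 T; apply: Cext; rewrite !ReImE ?Re1 ?Im1; [rewrite -c; ring|ring].
by rewrite mulr1.
Qed.

Lemma contM (f g : R -> R) x : {for x, continuous f} -> {for x, continuous g} -> {for x, continuous (fun y => f y * g y)}.
Proof. by move=> h1 h2; apply: cvgM. Qed.
Lemma contD (f g : R -> R) x : {for x, continuous f} -> {for x, continuous g} -> {for x, continuous (fun y => f y + g y)}.
Proof. by move=> h1 h2; apply: cvgD. Qed.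
Lemma contB (f g : R -> R) x : {for x, continuous f} -> {for x, continuous g} -> {for x, continuous (fun y => f y - g y)}.
Proof. by move=> h1 h2; apply: cvgB. Qed.
Lemma contV (f : R -> R) x : f x != 0 -> {for x, continuous f} -> {for x, continuous (fun y => (f y)^-1)}.
Proof. by move=> h1 h2; apply: cvgV. Qed.
Lemma contC (c x : R) : {for x, continuous (fun=> c)}. Proof. exact: cvg_cst. Qed.
Lemma contI x : {for x, continuous (fun y : R => y)}. Proof. exact: cvg_id. Qed.
Lemma contX2 x : {for x, continuous (fun y : R => y ^+ 2)}. Proof. exact: exprn_continuous. Qed.

Arguments contC c x : clear implicits.
Arguments contI x : clear implicits.
Arguments contX2 x : clear implicits.

Lemma cont_near_gt0 (f : R -> R) x : {for x, continuous f} -> 0 < f x -> \forall y \near x, 0 < f y.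
Proof. by move=> cf f0; exact: (cvgr_gt (f x) cf 0 f0). Qed.

Lemma cont_near_lt0 (f : R -> R) x : {for x, continuous f} -> f x < 0 -> \forall y \near x, f y < 0.
Proof. by move=> cf f0; exact: (cvgr_lt (f x) cf 0 f0). Qed.

Lemma near_gt (c x : R) : c < x -> \forall y \near x, c < y.
Proof. by move=> cx; exact: (cvgr_gt x (@cvg_id _ (nbhs x)) c cx). Qed.

Lemma cont_ln (f : R -> R) x : {for x, continuous f} -> 0 < f x -> {for x, continuous (fun y => ln (f y))}.
Proof. by move=> cf f0; apply: (@cont_comp R (@ln R) f x cf); exact: continuous_ln. Qed.

(** The two factors with conjugate arguments have opposite principal arguments and multiply to
    [|1 - u w| ^ (-4)]. The integrand is therefore real and positive, and any primitive of it
    evaluates the function. *)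
Lemma Lauricella_deriv (a e c x1 : R) w w' (Phi : R -> R) : w' = conjc w ->
  (forall u, 0 < u < 1 -> 0 < 1 - u * x1) ->
  (forall u, 0 < u < 1 -> Im (1 - u%:C * w) != 0 \/ 0 < Re (1 - u%:C * w)) ->
  (forall u, 0 <= u <= 1 -> {for u, continuous Phi}) ->
  (forall u, 0 < u < 1 -> is_derive u 1 Phi (expR ((a - 1) * ln u + (c - a - 1) * ln (1 - u)
     - e * ln (1 - u * x1) - 4 * ln (cabs (1 - u%:C * w))))) ->
  Lauricella_FD a [tuple e; 2; 2] c [tuple x1%:C; w; w'] = ((Beta a (c - a))^-1 * (Phi 1 - Phi 0))%:C.
Proof.
move=> -> h1 h2 cP dP.
pose W u := expR ((a - 1) * ln u + (c - a - 1) * ln (1 - u) - e * ln (1 - u * x1) - 4 * ln (cabs (1 - u%:C * w))).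
have wpos u : 0 < u < 1 -> 0 < cabs (1 - u%:C * w).
  move=> hu; rewrite cabs_gt0; case: (h2 u hu) => [i0|r0].
    by apply: contraNneq i0 => ->.
  by apply: contraTneq r0 => ->; rewrite /= ltxx.
have cW u : 0 < u < 1 -> {for u, continuous W}.
  move=> hu; have /andP[u0 u1] := hu.
  have cl (x : R) : {for u, continuous (fun u => 1 - u * x)} := contB (contC 1 u) (contM (contI u) (contC x u)).
  have c4 : {for u, continuous (fun u => ln (cabs (1 - u%:C * w)))}.
    apply: (cont_ln _ (wpos u hu)); apply: pcont_cabs.
    have -> : (fun y : R => 1 - y%:C * w) = (fun y => 1 + y%:C * (- w)) by apply/funext => y; rewrite mulrN.
    exact: pder_cont (pderD (pder_cst 1 u) (pderM (pder_id u) (pder_cst (- w) u))).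
  have c3 := cont_ln (cl x1) (h1 u hu).
  have c2 : {for u, continuous (fun u => ln (1 - u))}.
    by apply: (cont_ln (contB (contC 1 u) (contI u))); rewrite subr_gt0.
  have c1 : {for u, continuous (fun u => ln u)} := cont_ln (contI u) u0.
  apply: (@cont_comp R expR); last exact: continuous_expR.
  exact: contB (contB (contD (contM (contC (a - 1) u) c1) (contM (contC (c - a - 1) u) c2)) (contM (contC e u) c3)) (contM (contC 4 u) c4).
pose g u : R[i] := (u `^ (a - 1) * (1 - u) `^ (c - a - 1))%:C
    * \prod_(j < 3) cpow (1 - u%:C * tnth [tuple x1%:C; w; conjc w] j) (- tnth [tuple e; 2; 2] j).
change (((Beta a (c - a))^-1)%:C * ((\int[lebesgue_measure]_(u in `[0, 1]) Re (g u)) +i* (\int[lebesgue_measure]_(u in `[0, 1]) Im (g u))) = ((Beta a (c - a))^-1 * (Phi 1 - Phi 0))%:C).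
have gE u : 0 < u < 1 -> g u = (W u)%:C.
  move=> hu; have /andP[u0 u1] := hu; rewrite /g.
  have -> : \prod_(j < 3) cpow (1 - u%:C * tnth [tuple x1%:C; w; conjc w] j) (- tnth [tuple e; 2; 2] j) =
      cpow (1 - u%:C * x1%:C) (- e) * cpow (1 - u%:C * w) (- 2) * cpow (1 - u%:C * conjc w) (- 2).
    by rewrite !big_ord_recr big_ord0 Monoid.mul1m !(tnth_nth 0).
  have -> : 1 - u%:C * x1%:C = (1 - u * x1)%:C by rewrite rCB rCM rC1.
  have -> : 1 - u%:C * conjc w = conjc (1 - u%:C * w) by apply: Cext; rewrite !ReImE; ring.
  rewrite cpow_real ?h1 // -mulrA (cpow_conj _ (h2 u hu)) -!rCM; congr (_%:C).
  have u1' : 0 < 1 - u by rewrite subr_gt0.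
  rewrite !powRE ?h1 ?wpos // expr2 -!expRD /W; congr expR; ring.
have Wre : \int[lebesgue_measure]_(u in `[0, 1]) Re (g u) = Phi 1 - Phi 0.
  by apply: (@Rintegral01_deriv R _ W) => // u hu; rewrite ?gE // expR_ge0.
have Wim : \int[lebesgue_measure]_(u in `[0, 1]) Im (g u) = 0.
  rewrite (@Rintegral01_deriv R _ (fun=> 0) (fun=> 0)) ?subrr //.
  - by move=> x _; exact: cvg_cst.
  - by move=> x hx; rewrite gE.
  - by move=> x _; exact: cvg_cst.
rewrite Wre Wim; apply: Cext; rewrite !ReImE /=; ring.
Qed.

Lemma elliptic_deriv r (Phi : R -> R) : 0 < r < 1 ->
  (forall u, 0 <= u <= 1 -> {for u, continuous Phi}) ->
  (forall u, 0 < u < 1 -> is_derive u 1 Phi (expR (- (1 / 2) * (ln (1 - u ^+ 2) + ln (1 - r ^+ 2 * u ^+ 2))))) ->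
  elliptic_K r = Phi 1 - Phi 0.
Proof.
move=> /andP[r0 r1] cP dP; rewrite /elliptic_K.
have p1 u : 0 < u < 1 -> 0 < 1 - u ^+ 2 by move=> /andP[u0 u1]; rewrite subr_gt0 expr_lt1 // ltW.
have p2 u : 0 < u < 1 -> 0 < 1 - r ^+ 2 * u ^+ 2.
  move=> /andP[u0 u1]; rewrite subr_gt0 -exprMn expr_lt1 // ?mulr_ge0 ?ltW //.
  by rewrite -[ltRHS]mulr1 ltr_pM // ltW.
apply: (@Rintegral01_deriv R _ (fun u => expR (- (1 / 2) * (ln (1 - u ^+ 2) + ln (1 - r ^+ 2 * u ^+ 2))))) => //.
- move=> u hu; apply: (@cont_comp R expR); last exact: continuous_expR.
  have c1 := cont_ln (contB (contC 1 u) (contX2 u)) (p1 u hu).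
  have c2 := cont_ln (contB (contC 1 u) (contM (contC (r ^+ 2) u) (contX2 u))) (p2 u hu).
  exact: contM (contC (- (1 / 2)) u) (contD c1 c2).
- move=> u hu; have h1 := p1 u hu; have h2 := p2 u hu.
  rewrite -powR12_sqrt ?mulr_ge0 ?(ltW h1) ?(ltW h2) // -powRN powRE ?mulr_gt0 //.
  by rewrite lnM ?posrE // div1r.
Qed.

End special_functions.
Arguments contC {R} c x.
Arguments contI {R} x.
Arguments contX2 {R} x.

Section side_integrals.
Variable R : realType.
Variables (x0 y0 t : R).
Implicit Types (u s x : R).
Hypotheses (y0_gt0 : 0 < y0) (t_gt1 : 1 < t).
Let z : R[i] := x0 +i* y0.
Local Notation th := (thq x0 y0 t).
Local Notation Lam := (Lam x0 y0 t).
Variables (F V : R[i] -> R[i]).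

Section exterior.
Variable a : nat -> R.
Hypothesis H : sc_data th a 1 F V.
Local Notation C := (arcC x0 y0 t a).

(* the common factor between the paper's side integrals and the side lengths of the image of the disc *)
Let Lam_c m s : {for s, continuous (Lam a F m)}. Proof. exact: (Lam_cont y0_gt0 H). Qed.

Definition side_scale : R := expR (4 * ln (cabs z) - a 2%N * ln t) / C.

Lemma side_scale_gt0 : 0 < side_scale.
Proof. by rewrite divr_gt0 ?expR_gt0 // arcC_gt0. Qed.

Let z_neq0 : z != 0.
Proof. by apply/eqP => /(congr1 (@complex.Im R)) /= /eqP; rewrite gt_eqF. Qed.

Let zB_neq0 x : x%:C - z != 0. Proof. exact: zs_neq0. Qed.

(** On the first side the Euler variable is the half-plane parameter itself; extracting [t] from
    [t - u] and [z] from [u - z] produces [side_scale]. *)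
Lemma h1_side : 0 < a 0%N < 1 -> 0 < a 1%N < 1 ->
  (Beta (1 + a 0%N) (1 + a 1%N))%:C * Lauricella_FD (1 + a 0%N) [tuple - a 2%N; 2; 2] (2 + a 0%N + a 1%N)
      [tuple (1 / t)%:C; 1 / z; 1 / conjc z] = (side_scale * len th a F 1)%:C.
Proof.
move=> a0 a1; have t0 : 0 < t := lt_trans ltr01 t_gt1.
have Bp := Beta_gt0 a0 a1; have C0 := arcC_gt0 x0 t y0_gt0 a.
have zc : 0 < cabs z by rewrite cabs_gt0.
pose Phi u := side_scale * Lam a F 1 u.
have -> : Lauricella_FD (1 + a 0%N) [tuple - a 2%N; 2; 2] (2 + a 0%N + a 1%N) [tuple (1 / t)%:C; 1 / z; 1 / conjc z] =
    ((Beta (1 + a 0%N) (2 + a 0%N + a 1%N - (1 + a 0%N)))^-1 * (Phi 1 - Phi 0))%:C; last first.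
  rewrite -rCM; congr (_%:C).
  rewrite (_ : 2 + a 0%N + a 1%N - (1 + a 0%N) = 1 + a 1%N); last by ring.
  by rewrite /Phi -mulrBr len1E mulrA divff ?gt_eqF // mul1r.
apply: Lauricella_deriv.
- by rewrite !div1r; apply: (mulfI z_neq0); apply: (mulIf (_ : conjc z != 0)); rewrite ?conjc_eq0 //; rewrite mulfVK ?conjc_eq0 // -mulrA -conjCM mulVf // (_ : conjc 1 = 1) ?mulr1 //; apply: Cext; rewrite /= ?oppr0.
- move=> u /andP[u0 u1]; rewrite mul1r subr_gt0 ltr_pdivrMr // mul1r; exact: lt_trans t_gt1.
- move=> u /andP[u0 u1]; left.
  have -> : Im (1 - u%:C * (1 / z)) = u * y0 / cabs z ^+ 2.
    have zz : 1 / z = ((cabs z ^+ 2)^-1)%:C * conjc z.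
      by apply: (mulfI z_neq0); rewrite [RHS]mulrCA mulJ_cabs mul1r divff // -rCM mulVf ?rC1 // expf_neq0 // gt_eqF.
    by rewrite zz !ReImE /=; ring.
  by rewrite mulf_neq0 ?mulf_neq0 ?gt_eqF // invr_gt0 exprn_gt0.
- by move=> u _; apply: (contM (contC side_scale u)); exact: Lam_c.
- move=> u hu; have /andP[u0 u1] := hu.
  have d := is_deriveZ side_scale (Lam1_deriv y0_gt0 t_gt1 H hu).
  apply: is_derive_eq d _; rewrite /GRing.scale /= mulrA /side_scale divfK ?gt_eqF // -expRD; congr expR.
  have u1' : 0 < 1 - u by rewrite subr_gt0.
  have ut : 0 < t - u by rewrite subr_gt0 (lt_trans u1).
  have e1 : ln (1 - u * (1 / t)) = ln (t - u) - ln t.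
    by rewrite -ln_div ?posrE //; congr ln; field; rewrite gt_eqF.
  have e2 : ln (cabs (1 - u%:C * (1 / z))) = ln (cabs (u%:C - z)) - ln (cabs z).
    have -> : 1 - u%:C * (1 / z) = - ((u%:C - z) / z) by field.
    by rewrite cabsN cabsM cabsV ln_div ?posrE // cabs_gt0.
  by rewrite e1 e2 -/z; ring.
Qed.

(** The substitution [s = 1 + u (t - 1)]; the prefactor is what makes the scale agree with the one
    of the first side. *)
Lemma I_side_side : 0 < a 1%N < 1 -> 0 < a 2%N < 1 ->
  ((t - 1) `^ (1 + a 1%N + a 2%N) * cabs z ^+ 4 / (t `^ a 2%N * cabs (z - 1) ^+ 4))%:C
  * (Beta (1 + a 1%N) (1 + a 2%N))%:C
  * Lauricella_FD (1 + a 1%N) [tuple - a 0%N; 2; 2] (2 + a 1%N + a 2%N)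
      [tuple (- (t - 1))%:C; (t - 1)%:C / (z - 1); (t - 1)%:C / (conjc z - 1)] = (side_scale * len th a F 2)%:C.
Proof.
move=> a1 a2; have t0 : 0 < t := lt_trans ltr01 t_gt1.
have t1 : 0 < t - 1 by rewrite subr_gt0.
have Bp := Beta_gt0 a1 a2; have C0 := arcC_gt0 x0 t y0_gt0 a.
have zc : 0 < cabs z by rewrite cabs_gt0.
have z1n : z - 1 != 0 by have := zB_neq0 1; rewrite -oppr_eq0 opprB.
have z1c : 0 < cabs (z - 1) by rewrite cabs_gt0.
pose pref : R := (t - 1) `^ (1 + a 1%N + a 2%N) * cabs z ^+ 4 / (t `^ a 2%N * cabs (z - 1) ^+ 4).
have prefE : pref = expR ((1 + a 1%N + a 2%N) * ln (t - 1) + 4 * ln (cabs z) - (a 2%N * ln t + 4 * ln (cabs (z - 1)))).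
  by rewrite /pref !powRE // expRD expRD expRN expRD !expRM_natl !lnK ?posrE.
have pref0 : 0 < pref by rewrite prefE expR_gt0.
rewrite -/pref.
pose Phi u := side_scale / pref * Lam a F 2 (u * (t - 1) + 1).
have -> : Lauricella_FD (1 + a 1%N) [tuple - a 0%N; 2; 2] (2 + a 1%N + a 2%N)
      [tuple (- (t - 1))%:C; (t - 1)%:C / (z - 1); (t - 1)%:C / (conjc z - 1)] =
    ((Beta (1 + a 1%N) (2 + a 1%N + a 2%N - (1 + a 1%N)))^-1 * (Phi 1 - Phi 0))%:C; last first.
  rewrite -!rCM; congr (_%:C).
  rewrite (_ : 2 + a 1%N + a 2%N - (1 + a 1%N) = 1 + a 2%N); last by ring.
  rewrite /Phi -mulrBr mul1r mul0r add0r subrK len2E; move: Bp pref0; set B := Beta _ _ => B0 p0.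
  by field; rewrite !gt_eqF.
apply: Lauricella_deriv.
- apply: (mulIf (_ : conjc (z - 1) != 0)); rewrite ?conjc_eq0 // -conjCM divfK // conjCR.
  have cj : conjc (z - 1) = conjc z - 1 by apply: Cext; rewrite !ReImE ?Re1 ?Im1; ring.
  by rewrite -cj divfK // conjc_eq0.
- by move=> u /andP[u0 u1]; rewrite mulrN opprK ltr_wpDr ?mulr_ge0 // ltW.
- move=> u /andP[u0 u1]; left.
  have -> : Im (1 - u%:C * ((t - 1)%:C / (z - 1))) = u * (t - 1) * y0 / cabs (z - 1) ^+ 2.
    have zz : (z - 1)^-1 = ((cabs (z - 1) ^+ 2)^-1)%:C * conjc (z - 1).
      by apply: (mulfI z1n); rewrite [RHS]mulrCA mulJ_cabs divff // -rCM mulVf ?rC1 // expf_neq0 // gt_eqF.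
    by rewrite zz !ReImE /=; ring.
  by rewrite !mulf_neq0 ?gt_eqF // invr_gt0 exprn_gt0.
- move=> u _; have c1 := contD (contM (contI u) (contC (t - 1) u)) (contC 1 u).
  apply: (contM (contC (side_scale / pref) u)).
  by apply: (@cont_comp R (Lam a F 2) _ u c1); exact: Lam_c.
- move=> u hu; have /andP[u0 u1] := hu.
  have u1' : 0 < 1 - u by rewrite subr_gt0.
  have ut0 : 0 < u * (t - 1) by rewrite mulr_gt0.
  have ut1 : 0 < (1 - u) * (t - 1) by rewrite mulr_gt0.
  pose s := u * (t - 1) + 1.
  have hs : 1 < s < t by rewrite /s; apply/andP; split; lra.
  have d1 : is_derive u 1 (fun u => u * (t - 1) + 1) (t - 1).
    apply/is_derive1_caratheodory; exists (fun=> t - 1); split => //; last exact: cvg_cst.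
    by move=> v; ring.
  have d2 := @derive_comp R (Lam a F 2) _ u _ _ d1 (Lam2_deriv y0_gt0 H hs).
  apply: is_derive_eq (is_deriveZ (side_scale / pref) d2) _; rewrite /GRing.scale /= -/s.
  have e0 : ln (s - 1) = ln u + ln (t - 1) by rewrite /s addrK lnM ?posrE.
  have e1 : ln (t - s) = ln (1 - u) + ln (t - 1).
    by rewrite -lnM ?posrE //; congr ln; rewrite /s; ring.
  have e2 : ln (cabs (1 - u%:C * ((t - 1)%:C / (z - 1)))) = ln (cabs (s%:C - z)) - ln (cabs (z - 1)).
    have -> : 1 - u%:C * ((t - 1)%:C / (z - 1)) = - ((s%:C - z) / (z - 1)).
      rewrite (_ : s%:C = u%:C * (t - 1)%:C + 1); last by rewrite /s (rCD (u * (t - 1)) 1) (rCM u (t - 1)) rC1.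
      by move: ((t - 1)%:C) => T; field.
    by rewrite cabsN cabsM cabsV ln_div ?posrE // cabs_gt0.
  have e3 : 1 - u * - (t - 1) = s by rewrite /s; ring.
  rewrite e0 e1 e2 e3 -/z /side_scale prefE.
  have -> : expR (4 * ln (cabs z) - a 2%N * ln t) / C = C^-1 * expR (4 * ln (cabs z) - a 2%N * ln t) by rewrite mulrC.
  rewrite -expRN; set E1 := expR _; set E2 := expR _; set E3 := expR _.
  have -> : C^-1 * E1 * E2 * (C * E3 * (t - 1)) = (t - 1) * (E1 * E2 * E3) by field; rewrite gt_eqF.
  rewrite -{1}[t - 1]lnK ?posrE // /E1 /E2 /E3 -!expRD; congr expR; ring.
Qed.

End exterior.

Section rectangle.
Hypothesis H : sc_data th (fun=> - (1 / 2)) (-1) F V.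
Local Notation a := (fun _ : nat => - (1 / 2) : R).
Local Notation C := (arcC x0 y0 t a).

Let t0 : 0 < t. Proof. exact: lt_trans ltr01 t_gt1. Qed.
Let C0 : 0 < C. Proof. exact: arcC_gt0. Qed.
Let rr : R := 1 / Num.sqrt t.
Let sq0 : 0 < Num.sqrt t. Proof. by rewrite sqrtr_gt0. Qed.

Lemma rr_sqr : rr ^+ 2 = t^-1.
Proof. by rewrite /rr expr_div_n expr1n sqr_sqrtr ?div1r // ltW. Qed.

Lemma rr_bnd : 0 < rr < 1.
Proof.
rewrite divr_gt0 //= ltr_pdivrMr // mul1r.
by rewrite -(@ltr_pXn2r _ 2) ?nnegrE ?ltW // expr1n sqr_sqrtr ?ltW.
Qed.

Let Lam_c m s : {for s, continuous (Lam a F m)}. Proof. exact: (Lam_cont y0_gt0 H). Qed.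

(** The substitution [s = u ^ 2] takes the density on the first side to the integrand of
    [K (1 / sqrt t)]. *)
Definition ell_anti (u : R) : R := Num.sqrt t / (2 * C) * Lam a F 1 (u ^+ 2).

Lemma ell_anti_cont u : {for u, continuous ell_anti}.
Proof.
apply: (contM (contC (Num.sqrt t / (2 * C)) u)).
by apply: (@cont_comp R (Lam a F 1) _ u (contX2 u)); exact: Lam_c.
Qed.

Lemma ln_sqrt x : 0 < x -> ln (Num.sqrt x) = ln x / 2 :> R.
Proof. by move=> xp; rewrite -powR12_sqrt ?ltW // ln_powR mulrC. Qed.

Lemma ell_anti_deriv u : 0 < u < 1 ->
  is_derive u 1 ell_anti (expR (- (1 / 2) * (ln (1 - u ^+ 2) + ln (1 - rr ^+ 2 * u ^+ 2)))).
Proof.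
move=> /andP[u0 u1]; have u2 : 0 < u ^+ 2 < 1 by rewrite exprn_gt0 // expr_lt1 // ltW.
have /andP[v0 v1] := u2.
have d1 : is_derive u 1 (fun u => u ^+ 2) (2 * u).
  apply/is_derive1_caratheodory; exists (fun v => v + u); split; [by move=> v; ring| |by ring].
  by apply: cvgD; [exact: cvg_id|exact: cvg_cst].
have d2 := @derive_comp R (Lam a F 1) _ u _ _ d1 (Lam1_deriv y0_gt0 t_gt1 H u2).
apply: is_derive_eq (is_deriveZ (Num.sqrt t / (2 * C)) d2) _; rewrite /GRing.scale /=.
have e1 : ln (1 - rr ^+ 2 * u ^+ 2) = ln (t - u ^+ 2) - ln t.
  rewrite rr_sqr -ln_div ?posrE //; last by rewrite subr_gt0 (lt_trans v1).
  by congr ln; field; rewrite gt_eqF.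
have e2 : ln (u ^+ 2) = 2 * ln u by rewrite expr2 lnM ?posrE //; ring.
rewrite (_ : 2 * -1 + 2 = 0); last by ring.
rewrite mul0r subr0 e1 e2; set E := expR _.
have -> : Num.sqrt t / (2 * C) * (C * E * (2 * u)) = Num.sqrt t * u * E by field; rewrite gt_eqF.
have eu : u = expR (ln u) by rewrite lnK.
have es : Num.sqrt t = expR (ln t / 2) by rewrite -ln_sqrt // lnK // posrE.
by rewrite es {1}eu -!expRD; congr expR; field.
Qed.

Lemma elliptic_len1 : elliptic_K rr = Num.sqrt t / (2 * C) * len th a F 1.
Proof.
have -> := elliptic_deriv rr_bnd (fun u _ => @ell_anti_cont u) ell_anti_deriv.
by rewrite /ell_anti expr1n expr0n -mulrBr len1E.
Qed.

Let kk : R := Num.sqrt (1 - rr ^+ 2).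

Lemma kk_sqr : kk ^+ 2 = (t - 1) / t.
Proof.
rewrite /kk sqr_sqrtr rr_sqr; last by rewrite subr_ge0 invf_le1 // ltW.
by field; rewrite gt_eqF.
Qed.

Lemma kk_bnd : 0 < kk < 1.
Proof.
have h : 0 < 1 - rr ^+ 2 by rewrite rr_sqr subr_gt0 invf_lt1.
rewrite sqrtr_gt0 h /= -(@ltr_pXn2r _ 2) ?nnegrE ?sqrtr_ge0 ?ler01 // expr1n kk_sqr.
by rewrite ltr_pdivrMr // mul1r; lra.
Qed.

Lemma elliptic_len2 : elliptic_K kk = Num.sqrt t / (2 * C) * len th a F 2.
Proof.
have /andP[k0 k1] := kk_bnd; have t1 : 0 < t - 1 by rewrite subr_gt0.
(* The substitution [s = 1 / (1 - kk ^ 2 u ^ 2)] takes the unit interval to [[1, t]], because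
   [kk ^ 2 = 1 - 1 / t]. *)
pose D (u : R) : R := 1 - kk ^+ 2 * u ^+ 2.
have Dp u : 0 <= u <= 1 -> 0 < D u.
  move=> /andP[u0 u1]; rewrite subr_gt0 -exprMn expr_lt1 // ?mulr_ge0 ?(ltW k0) //.
  by apply: (@le_lt_trans _ _ kk) => //; rewrite ler_piMr // ltW.
have cD u : {for u, continuous D}.
  have c := contB (contC 1 u) (contM (contC (kk ^+ 2) u) (contX2 u)); exact: c.
pose Phi u := Num.sqrt t / (2 * C) * Lam a F 2 (D u)^-1.
have -> : elliptic_K kk = Phi 1 - Phi 0; last first.
  have D1 : (D 1)^-1 = t by rewrite /D expr1n mulr1 kk_sqr (_ : 1 - _ = t^-1) ?invrK //; field; rewrite gt_eqF.
  have D0 : (D 0)^-1 = 1 by rewrite /D expr0n mulr0 subr0 invr1.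
  by rewrite /Phi D1 D0 -mulrBr len2E.
apply: (elliptic_deriv kk_bnd).
  move=> u hu; have Dn : D u != 0 by rewrite gt_eqF // Dp.
  apply: (contM (contC (Num.sqrt t / (2 * C)) u)).
  by apply: (@cont_comp R (Lam a F 2) _ u (contV Dn (cD u))); exact: Lam_c.
move=> u hu; have /andP[u0 u1] := hu.
have hu' : 0 <= u <= 1 by rewrite !ltW.
have D0 := Dp u hu'.
have u2 : 0 < 1 - u ^+ 2 by rewrite subr_gt0 expr_lt1 // ltW.
have k2 := kk_sqr.
have s1 : (D u)^-1 - 1 = kk ^+ 2 * u ^+ 2 / D u.
  have e : kk ^+ 2 * u ^+ 2 = 1 - D u by rewrite /D opprB addrC subrK.
  by rewrite e mulrBl mul1r divff // gt_eqF.
have s2 : t - (D u)^-1 = (t - 1) * (1 - u ^+ 2) / D u.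
  have e : t * D u = t - (t - 1) * u ^+ 2 by rewrite /D k2; field; rewrite gt_eqF.
  apply: (mulIf (_ : D u != 0)); first by rewrite gt_eqF.
  rewrite mulrBl e mulVf ?gt_eqF // divfK ?gt_eqF //; ring.
have hs : 1 < (D u)^-1 < t.
  rewrite -subr_gt0 s1 divr_gt0 ?mulr_gt0 ?exprn_gt0 //= -subr_gt0 s2 divr_gt0 // mulr_gt0 //.
have dD : is_derive u 1 D (- (2 * kk ^+ 2 * u)).
  apply/is_derive1_caratheodory; exists (fun v => - (kk ^+ 2 * (v + u))); split; [by move=> v; rewrite /D; ring| |by ring].
  by apply: cvgN; apply: cvgM; [exact: cvg_cst|apply: cvgD; [exact: cvg_id|exact: cvg_cst]].
have dI : is_derive u 1 (fun u => (D u)^-1) (2 * kk ^+ 2 * u / D u ^+ 2).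
  have D0' : D u != 0 by rewrite gt_eqF.
  have := is_deriveV D0' dD; move=> h; apply: is_derive_eq h _.
  by rewrite /GRing.scale /=; field.
have d2 := @derive_comp R (Lam a F 2) _ u _ _ dI (Lam2_deriv y0_gt0 H hs).
apply: is_derive_eq (is_deriveZ (Num.sqrt t / (2 * C)) d2) _; rewrite /GRing.scale /=.
rewrite (_ : 2 * -1 + 2 = 0); last by ring.
rewrite mul0r subr0 s1 s2 lnV ?posrE //.
have e1 : ln (kk ^+ 2 * u ^+ 2 / D u) = 2 * ln kk + 2 * ln u - ln (D u).
  by rewrite ln_div ?posrE ?mulr_gt0 ?exprn_gt0 // lnM ?posrE ?exprn_gt0 // !expr2 !lnM ?posrE //; ring.
have e2 : ln ((t - 1) * (1 - u ^+ 2) / D u) = ln (t - 1) + ln (1 - u ^+ 2) - ln (D u).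
  by rewrite ln_div ?posrE ?mulr_gt0 // lnM ?posrE.
have e3 : ln kk = (ln (t - 1) - ln t) / 2.
  have : ln (kk ^+ 2) = ln (t - 1) - ln t by rewrite k2 ln_div ?posrE.
  by rewrite expr2 lnM ?posrE //; lra.
rewrite e1 e2 -/(D u); set E := expR _.
have -> : Num.sqrt t / (2 * C) * (C * E * (2 * kk ^+ 2 * u / D u ^+ 2)) = Num.sqrt t * (kk ^+ 2 * u * (D u ^+ 2)^-1 * E).
  by field; rewrite !gt_eqF.
have eD : (D u ^+ 2)^-1 = expR (- (2 * ln (D u))) by rewrite expRN expRM_natl lnK.
have ek : kk ^+ 2 = expR (2 * ln kk) by rewrite expRM_natl lnK.
have eu : u = expR (ln u) by rewrite lnK.
have es : Num.sqrt t = expR (ln t / 2) by rewrite -ln_sqrt // lnK // posrE.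
by rewrite eD ek es {1}eu /E -!expRD e3; congr expR; field.
Qed.

Lemma elliptic_ratio : elliptic_K kk / elliptic_K rr = len th a F 2 / len th a F 1.
Proof.
have l1 := len_gt0 H 1; rewrite elliptic_len1 elliptic_len2.
have n : Num.sqrt t / (2 * C) != 0 by rewrite gt_eqF // divr_gt0 // mulr_gt0.
by rewrite -mulf_div divff // mul1r.
Qed.

End rectangle.

End side_integrals.

Section elliptic_monotone.
Variable R : realType.
Implicit Types (r u t : R).

(** Arclength on the first side of the rectangle map with [z = i] and [t = r ^ (-2)] supplies the
    antiderivative up to the endpoint 1, where the integrand is singular. *)
Lemma elliptic_antiderivative r : 0 < r < 1 ->
  exists2 Phi : R -> R, (forall u, {for u, continuous Phi}) &
    forall u, 0 < u < 1 -> is_derive u 1 Phi (expR (- (1 / 2) * (ln (1 - u ^+ 2) + ln (1 - r ^+ 2 * u ^+ 2)))).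
Proof.
move=> /andP[r0 r1]; have t1 : 1 < (r ^+ 2)^-1.
  by rewrite invf_gt1 ?exprn_gt0 // expr_lt1 // ltW.
have th1 := thq_lt 0 (@ltr01 R) t1.
have S := rect_sc_data th1 (@thq_per R 0 1 (r ^+ 2)^-1).
exists (ell_anti 0 1 (r ^+ 2)^-1 (rect_sc (thq 0 1 (r ^+ 2)^-1))) => u.
  exact: (ell_anti_cont ltr01 S).
by move=> hu; have := ell_anti_deriv ltr01 t1 S hu; rewrite (rr_sqr t1) invrK.
Qed.

Let one_sub r u : 0 < r < 1 -> 0 < u < 1 -> 0 < 1 - r ^+ 2 * u ^+ 2.
Proof.
move=> /andP[r0 r1] /andP[u0 u1]; rewrite subr_gt0 -exprMn expr_lt1 // ?mulr_ge0 ?ltW //.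
by rewrite -[ltRHS]mulr1 ltr_pM // ltW.
Qed.

Lemma elliptic_K_gt0 r : 0 < r < 1 -> 0 < elliptic_K r.
Proof.
move=> hr; have [Phi cP dP] := elliptic_antiderivative hr.
rewrite (elliptic_deriv hr (fun u _ => cP u) dP) subr_gt0.
apply: (derive_gt0_lt ltr01 dP) => [x _|]; first exact: expR_gt0.
by apply: continuous_subspaceT => x; exact: cP.
Qed.

Lemma elliptic_K_lt r r' : 0 < r < 1 -> 0 < r' < 1 -> r < r' -> elliptic_K r < elliptic_K r'.
Proof.
move=> hr hr' rr; have [P1 c1 d1] := elliptic_antiderivative hr; have [P2 c2 d2] := elliptic_antiderivative hr'.
rewrite (elliptic_deriv hr (fun u _ => c1 u) d1) (elliptic_deriv hr' (fun u _ => c2 u) d2).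
suff : P2 0 - P1 0 < P2 1 - P1 1 by lra.
apply: (derive_gt0_lt ltr01 (fun x hx => is_deriveB (d2 x hx) (d1 x hx))) => [x hx|].
  have /andP[x0 x1] := hx; have /andP[r0 _] := hr.
  rewrite subr_gt0 ltr_expR !mulNr ltrN2 ltr_pM2l ?divr_gt0 // ltrD2l.
  rewrite ltr_ln ?posrE ?one_sub // ltrD2l ltrN2 ltr_pM2r ?exprn_gt0 //.
  by rewrite ltr_pXn2r ?nnegrE ?ltW // (lt_trans r0).
by apply: continuous_subspaceT => x; exact: contB (c2 x) (c1 x).
Qed.

Lemma sqrt_inv_bounds t : 1 < t -> 0 < 1 / Num.sqrt t < 1 /\ 0 < Num.sqrt (1 - (1 / Num.sqrt t) ^+ 2) < 1.
Proof. by move=> t1; split; [exact: rr_bnd|exact: kk_bnd]. Qed.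

Definition elliptic_modulus t : R := elliptic_K (Num.sqrt (1 - (1 / Num.sqrt t) ^+ 2)) / elliptic_K (1 / Num.sqrt t).

Let ratio_lt (x x' y y' : R) : 0 < x -> x < x' -> 0 < y' -> y' < y -> x / y < x' / y'.
Proof.
move=> x0 xx y0 yy; apply: (@lt_trans _ _ (x / y')).
  by rewrite ltr_pM2l // ltf_pV2 // posrE (lt_trans y0).
by rewrite ltr_pM2r // invr_gt0.
Qed.

Lemma elliptic_modulus_lt t t' : 1 < t -> t < t' -> elliptic_modulus t < elliptic_modulus t'.
Proof.
move=> t1 tt; have t1' := lt_trans t1 tt.
have [hr hk] := sqrt_inv_bounds t1; have [hr' hk'] := sqrt_inv_bounds t1'.
have t0 : 0 < t := lt_trans ltr01 t1; have t0' : 0 < t' := lt_trans ltr01 t1'.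
apply: ratio_lt; first exact: elliptic_K_gt0.
- apply: elliptic_K_lt => //; rewrite ltr_sqrt ?rr_sqr //; last by rewrite subr_gt0 invf_lt1.
  by rewrite ltrD2l ltrN2 ltf_pV2.
- exact: elliptic_K_gt0.
- by apply: elliptic_K_lt => //; rewrite !div1r ltf_pV2 ?posrE ?sqrtr_gt0 // ltr_sqrt.
Qed.

Lemma elliptic_modulus_inj t t' : 1 < t -> 1 < t' -> elliptic_modulus t = elliptic_modulus t' -> t = t'.
Proof.
move=> t1 t1' e; have [lt|lt|//] := ltgtP t t'.
  by have := elliptic_modulus_lt t1 lt; rewrite e ltxx.
by have := elliptic_modulus_lt t1' lt; rewrite e ltxx.
Qed.

End elliptic_monotone.

Definition quad_exp (R : realType) (al be ga de : R) (n : nat) : R := nth 0 [:: al; be; ga; de] (n %% 4).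

Lemma quad_exp_bnd (R : realType) (al be ga de : R) n : 0 < al < 1 -> 0 < be < 1 -> 0 < ga < 1 -> 0 < de < 1 ->
  0 < quad_exp al be ga de n < 1.
Proof.
move=> h1 h2 h3 h4; rewrite /quad_exp; have := ltn_pmod n (isT : (0 < 4)%N).
by case: (n %% 4)%N => [|[|[|[|//]]]].
Qed.

Section exterior_modulus.
Variable R : realType.
Variables (al be ga de : R).
Hypotheses (hal : 0 < al < 1) (hbe : 0 < be < 1) (hga : 0 < ga < 1) (hde : 0 < de < 1).
Hypothesis hsum : al + be + ga + de = 2.
Local Notation a := (quad_exp al be ga de).

Lemma quad_ext_sc (x0 y0 t : R) : 0 < y0 -> 1 < t ->
  \sum_(k < 4) (a k)%:C * cis (- thq x0 y0 t k) = 0 ->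
  sc_data (thq x0 y0 t) a 1 (ext_sc (thq x0 y0 t) a)
  (fun z : R[i] => scP (fun k : 'I_4 => a k) (fun k : 'I_4 => thq x0 y0 t k) z / z).
Proof.
move=> y00 t1 bal; apply: ext_sc_data => //.
- exact: thq_lt.
- exact: thq_per.
- by move=> k; exact: quad_exp_bnd.
by rewrite !big_ord_recr big_ord0 /= add0r.
Qed.

Lemma Mod_half_plane (x0 y0 t : R) (A1 A2 A3 A4 : R[i]) : 0 < y0 -> 1 < t ->
  \sum_(k < 4) (a k)%:C * cis (- thq x0 y0 t k) = 0 ->
  A1 = 1 -> A2 = 0 -> 0 < Im A3 -> 0 < Im A4 -> convex_quadrilateral A1 A2 A3 A4 ->
  exterior_angle A4 A1 A2 = pi * (1 + al) -> exterior_angle A1 A2 A3 = pi * (1 + be) ->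
  exterior_angle A2 A3 A4 = pi * (1 + ga) ->
  cabs (A3 - A2) = len (thq x0 y0 t) a (ext_sc (thq x0 y0 t) a) 2 / len (thq x0 y0 t) a (ext_sc (thq x0 y0 t) a) 1 ->
  Mod (exterior_of A1 A2 A3 A4) (Some A1) (Some A2) (Some A3) (Some A4) =
  elliptic_modulus t.
Proof.
move=> y00 t1 bal hA1 hA2 hA3 hA4 hc ha1 ha2 ha3 hr.
have S := quad_ext_sc y00 t1 bal.
have aE : [/\ a 0%N = al, a 1%N = be, a 2%N = ga & a 3%N = de] by [].
have [s [b [s0 [e1 e2 e3 e4]]]] := quad_match S aE hA1 hA2 hA3 hA4 hc ha1 ha2 ha3 hr hal hbe hga hde hsum.
have S' := rect_sc_data (thq_lt x0 y00 t1) (@thq_per R x0 y0 t).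
rewrite /elliptic_modulus (elliptic_ratio y00 t1 S').
pose v k : R[i] := nth 0 [:: A1; A2; A3; A4] k.
have hv k : (k < 4)%N -> v k = s * vv (thq x0 y0 t) (ext_sc (thq x0 y0 t) a) k + b by case: k => [|[|[|[|//]]]].
exact: (Mod_exterior (ext_mapP S (ext_sc_pole _ _) s0 hv) (rect_mapP S' (rect_sc_der0 _))).
Qed.

End exterior_modulus.

(** * The cubic *)

Section cubic.
Variable R : realType.
Variables (al be ga de : R).
Hypotheses (hal : 0 < al < 1) (hbe : 0 < be < 1) (hga : 0 < ga < 1) (hde : 0 < de < 1).
Hypothesis hsum : al + be + ga + de = 2.
Implicit Types (t x y u : R).

Let deE : de = 2 - al - be - ga. Proof. by rewrite -hsum; ring. Qed.

(* With [y2 = rho x - x ^+ 2], the balance of the prevertices reads [y2 * cden = - x * cq] and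
   [(x - 1) * (x - t) + cq = - (1 - de) * y2]; eliminating [y2] gives [cubic]. *)
Definition cden t x : R := de * x + ((al + be - 1) * t + (al + ga - 1)).
Definition cq t x : R := x * cden t x - al * t.
Definition cubic t x : R := cden t x * ((x - 1) * (x - t) + cq t x) - (1 - de) * (x * cq t x).

Lemma rho_denE t x : rho_den al be ga t x = cden t x.
Proof. by rewrite /rho_den /Defs.coefE /cden deE; ring. Qed.

Lemma cubicE t x : Defs.coefA al be ga t * x ^+ 3 + Defs.coefB al be ga t * x ^+ 2 + Defs.coefC al be ga t * x + Defs.coefD al be ga t = cubic t x.
Proof. by rewrite /Defs.coefA /Defs.coefB /Defs.coefC /Defs.coefD /Defs.coefE /cubic /cq /cden deE; ring. Qed.

(** Of the two sign patterns left by [admissible_cases], the one with positive [x];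
    [admissible_good] excludes the other. *)
Definition good t x : Prop := [/\ 0 < x, 0 < cden t x & cq t x < 0].

Lemma admissible_cases t x : 0 < t -> admissible_root al be ga t x <->
  cubic t x = 0 /\ cq t x < 0 /\ 0 < x * cden t x.
Proof.
move=> t0; have at0 : 0 < al * t by rewrite mulr_gt0 //; case/andP: hal.
have e : forall d, d != 0 -> (x ^+ 2 < al * t * x / d) = (x * (x * d - al * t) * d < 0).
  move=> d d0; rewrite -subr_lt0 -(pmulr_llt0 _ (_ : 0 < d ^+ 2)); last by rewrite exprn_even_gt0.
  by congr (_ < 0); field.
split=> [[h1 h2 h3]|[h1 [h2 h3]]].
  rewrite cubicE in h1; move: h2 h3; rewrite /rho rho_denE => h2; rewrite (e _ h2) => h3; split=> //.
  move: h3; rewrite mulrAC -/(cq t x) => h3.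
  have q0 : cq t x < 0.
    rewrite ltNge; apply/negP => q0; have xd : 0 < x * cden t x by move: q0; rewrite /cq; lra.
    by have := mulr_ge0 (ltW xd) q0; rewrite leNgt h3.
  by split=> //; rewrite nmulr_llt0 // in h3.
have d0 : cden t x != 0 by apply: contraTneq h3 => ->; rewrite mulr0 ltxx.
by split; rewrite ?cubicE ?rho_denE // /rho rho_denE (e _ d0) mulrAC -/(cq t x) pmulr_rlt0.
Qed.

Lemma cq_lt t x u : 0 < x -> 0 < cden t x -> x < u -> cq t x < cq t u.
Proof.
move=> x0 d0 xu; have /andP[e0 _] := hde.
have e : cq t u - cq t x = (u - x) * (de * u + cden t x) by rewrite /cq /cden; ring.
by rewrite -subr_gt0 e mulr_gt0 ?subr_gt0 // addr_gt0 // mulr_gt0 // (lt_trans x0).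
Qed.

Lemma cden_lt t x u : x < u -> cden t x < cden t u.
Proof. by move=> xu; rewrite /cden ltrD2r ltr_pM2l //; case/andP: hde. Qed.

Lemma cont_cden t x : {for x, continuous (cden t)}.
Proof. exact: contD (contM (contC de x) (contI x)) (contC _ x). Qed.
Lemma cont_cq t x : {for x, continuous (cq t)}.
Proof. exact: contB (contM (contI x) (@cont_cden t x)) (contC _ x). Qed.
Lemma cont_cubic t x : {for x, continuous (cubic t)}.
Proof.
have c1 := contM (contB (contI x) (contC 1 x)) (contB (contI x) (contC t x)).
exact: contB (contM (@cont_cden t x) (contD c1 (@cont_cq t x))) (contM (contC (1 - de) x) (contM (contI x) (@cont_cq t x))).
Qed.

Lemma ivt (f : R -> R) (a b : R) : a < b -> (forall x, {for x, continuous f}) -> f a * f b < 0 ->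
  exists2 c, a < c < b & f c = 0.
Proof.
move=> ab cf fab.
have [||c hc fc] := @IVT R f a b 0 (ltW ab).
- by apply: continuous_subspaceT => x; exact: cf.
- have [fa|fa] := lerP 0 (f a).
    have fb : f b <= 0 by rewrite leNgt; apply/negP => fb; move: fab; rewrite ltNge mulr_ge0 // ltW.
    by rewrite ge_min le_max fb fa orbT.
  have fb : 0 <= f b by rewrite leNgt; apply/negP => fb; move: fab; rewrite ltNge nmulr_rge0 // ltW.
  by rewrite ge_min le_max (ltW fa) fb orbT.
exists c => //; move: hc; rewrite in_itv /= => /andP[h1 h2].
rewrite !lt_neqAle h1 h2 !andbT; apply/andP; split; apply: contraTneq fab => e.
  by rewrite e fc mul0r ltxx.
by rewrite -e fc mulr0 ltxx.
Qed.

(** At a zero of [cq] the cubic reduces to [cden * (w - 1) * (w - t)], which is negative between 1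
    and [t]. This [w] is the right end of the good interval. *)
Lemma cq_root t : 1 < t -> exists w, [/\ 1 < w < t, 0 < cden t w, cq t w = 0 & cubic t w < 0].
Proof.
move=> t1; have t0 : 0 < t := lt_trans ltr01 t1; have tm : 0 < t - 1 by rewrite subr_gt0.
move: hal hbe hga => /andP[a0 a1] /andP[b0 b1] /andP[c0 c1].
have q1 : cq t 1 < 0.
  have -> : cq t 1 = - ((1 - be) * (t - 1)) by rewrite /cq /cden deE; ring.
  by rewrite oppr_lt0 mulr_gt0 // subr_gt0.
have qt : 0 < cq t t.
  have -> : cq t t = t * ((1 - ga) * (t - 1)) by rewrite /cq /cden deE; ring.
  by rewrite !mulr_gt0 // subr_gt0.
have [w hw qw] : exists2 w, 1 < w < t & cq t w = 0.
  by apply: ivt => // [x|]; [exact: cont_cq|rewrite nmulr_rlt0].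
have /andP[w1 w2] := hw; have w0 : 0 < w := lt_trans ltr01 w1.
have dw : 0 < cden t w.
  have e : w * cden t w = al * t by apply/eqP; rewrite -subr_eq0; apply/eqP; exact: qw.
  by rewrite -(pmulr_rgt0 _ w0) e mulr_gt0.
exists w; split=> //; rewrite /cubic qw addr0 !mulr0 subr0.
by rewrite pmulr_rlt0 // pmulr_rlt0 ?subr_lt0 // subr_gt0.
Qed.

(** With [cnu], the larger and the smaller of 0 and the zero of [cden]: outside the interval between
    them [x * cden t x] is positive. *)
Definition cmu t : R := Num.max 0 (- ((al + be - 1) * t + (al + ga - 1)) / de).
Definition cnu t : R := Num.min 0 (- ((al + be - 1) * t + (al + ga - 1)) / de).

Let m t : R := (al + be - 1) * t + (al + ga - 1).
Let de0 : 0 < de. Proof. by case/andP: hde. Qed.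

Let cden_zero t : cden t (- m t / de) = 0.
Proof. by rewrite /cden -/(m t) mulrC divfK ?addNr // gt_eqF. Qed.

Let cubic_at0 t : cubic t 0 = (1 - al) * m t * t.
Proof. by rewrite /cubic /cq /cden -/(m t); ring. Qed.

Let cubic_atden t : cubic t (- m t / de) = - (1 - de) * al * t * m t / de.
Proof. by rewrite /cubic /cq !cden_zero; field; rewrite gt_eqF. Qed.

Lemma cubic_mu t : 0 < t -> 0 <= cubic t (cmu t) /\ (m t != 0 -> 0 < cubic t (cmu t)).
Proof.
move=> t0; rewrite /cmu -/(m t); move: hal hde => /andP[a0 a1] /andP[_ d1].
case: (ltgtP (m t) 0) => h.
- have e : 0 < - m t / de by rewrite divr_gt0 // oppr_gt0.
  have p : 0 < cubic t (- m t / de).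
    have -> : cubic t (- m t / de) = (1 - de) * al * t * (- m t / de) by rewrite cubic_atden; ring.
    by apply: mulr_gt0 e; rewrite !mulr_gt0 ?subr_gt0.
  by rewrite max_r ?(ltW e) // (ltW p).
- have e : - m t / de < 0 by rewrite pmulr_llt0 ?invr_gt0 // oppr_lt0.
  have p : 0 < cubic t 0 by rewrite cubic_at0 !mulr_gt0 ?subr_gt0.
  by rewrite max_l ?(ltW e) // (ltW p).
- by rewrite h oppr0 mul0r maxxx cubic_at0 h mulr0 mul0r; split.
Qed.

Lemma cubic_nu t : 0 < t -> cubic t (cnu t) <= 0.
Proof.
move=> t0; rewrite /cnu -/(m t); move: hal hde => /andP[a0 a1] /andP[_ d1].
case: (ltgtP (m t) 0) => h.
- have e : 0 < - m t / de by rewrite divr_gt0 // oppr_gt0.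
  rewrite min_l ?(ltW e) // cubic_at0 mulrAC ltW // pmulr_rlt0 // mulr_gt0 ?subr_gt0 //.
- have e : - m t / de < 0 by rewrite pmulr_llt0 ?invr_gt0 // oppr_lt0.
  rewrite min_r ?(ltW e) // cubic_atden !mulNr oppr_le0 ltW //.
  by rewrite !mulr_gt0 ?subr_gt0 ?invr_gt0.
- by rewrite h oppr0 mul0r minxx cubic_at0 h mulr0 mul0r.
Qed.

Lemma mu_lt t x : (cmu t < x) = (0 < x) && (0 < cden t x).
Proof.
rewrite /cmu gt_max; congr (_ && _).
by rewrite ltr_pdivrMr // /cden -[RHS]subr_gt0 subr0 -subr_gt0 opprK mulrC.
Qed.

Lemma nu_gt t x : (x < cnu t) = (x < 0) && (cden t x < 0).
Proof.
rewrite /cnu lt_min; congr (_ && _).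
by rewrite ltr_pdivlMr // /cden -subr_lt0 opprK mulrC.
Qed.

Lemma nu_le_mu t : cnu t <= cmu t.
Proof. by rewrite /cnu /cmu ge_min le_max lexx. Qed.

Lemma good_root t : 1 < t -> exists2 x, good t x & cubic t x = 0.
Proof.
move=> t1; have t0 := lt_trans ltr01 t1; have [w [/andP[w1 wt] dw qw fw]] := cq_root t1.
have muw : cmu t < w by rewrite mu_lt dw (lt_trans ltr01).
have ok x : cmu t < x -> x < w -> good t x.
  by rewrite mu_lt => /andP[x0 d0] xw; split => //; rewrite -qw cq_lt.
have [p0 p1] := cubic_mu t0.
have [m0|m0] := eqVneq (m t) 0; last first.
  have [|x /andP[h1 h2] e] := ivt muw (@cont_cubic t); first by rewrite pmulr_rlt0 ?p1.
  by exists x => //; exact: ok.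
(* here the cubic has the inadmissible root 0, which is divided out *)
pose S x := de * ((x - 1) * (x - t) + cq t x) - (1 - de) * cq t x.
have fS x : cubic t x = x * S x by rewrite /cubic {1}/cden -/(m t) m0 addr0 /S; ring.
have cS x : {for x, continuous S}.
  have c1 := contM (contB (contI x) (contC 1 x)) (contB (contI x) (contC t x)).
  exact: contB (contM (contC de x) (contD c1 (@cont_cq t x))) (contM (contC (1 - de) x) (@cont_cq t x)).
have w0 : 0 < w := lt_trans ltr01 w1.
have S0 : 0 < S 0.
  have -> : S 0 = t * (de * (1 - al) + (1 - de) * al) by rewrite /S /cq; ring.
  by move: hal hde => /andP[? ?] /andP[? ?]; rewrite mulr_gt0 // addr_gt0 // mulr_gt0 // subr_gt0.
have Sw : S w < 0 by rewrite -(pmulr_rlt0 _ w0) -fS.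
have [|x /andP[h1 h2] e] := ivt w0 cS; first by rewrite pmulr_rlt0.
exists x; last by rewrite fS e mulr0.
by apply: ok => //; rewrite mu_lt h1 /cden -/(m t) m0 addr0 mulr_gt0.
Qed.

Lemma cubic_factor t x1 : cubic t x1 = 0 -> exists b c : R, forall x, cubic t x = (x - x1) * (2 * de ^+ 2 * x ^+ 2 + b * x + c).
Proof.
rewrite -cubicE => h; set B := Defs.coefB al be ga t; set C := Defs.coefC al be ga t; set D := Defs.coefD al be ga t.
exists (B + 2 * de ^+ 2 * x1), (C + (B + 2 * de ^+ 2 * x1) * x1) => x.
have A : Defs.coefA al be ga t = 2 * de ^+ 2 by rewrite /Defs.coefA /Defs.coefE deE; ring.
move: h; rewrite -cubicE A -/B -/C -/D => h.
have -> : D = - (2 * de ^+ 2 * x1 ^+ 3 + B * x1 ^+ 2 + C * x1) by apply/eqP; rewrite -addr_eq0 addrC h.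
ring.
Qed.

Lemma quadratic_neg (A b c u v x : R) : 0 < A -> u < x < v -> A * u ^+ 2 + b * u + c <= 0 -> A * v ^+ 2 + b * v + c < 0 ->
  A * x ^+ 2 + b * x + c < 0.
Proof.
move=> A0 /andP[ux xv] hu hv.
have e : (v - u) * (A * x ^+ 2 + b * x + c) = (v - x) * (A * u ^+ 2 + b * u + c) + (x - u) * (A * v ^+ 2 + b * v + c)
   - A * ((v - u) * (v - x) * (x - u)) by ring.
have uv : 0 < v - u by rewrite subr_gt0 (lt_trans ux).
rewrite -(pmulr_rlt0 _ uv) e.
have h1 : (v - x) * (A * u ^+ 2 + b * u + c) <= 0 by rewrite pmulr_rle0 // subr_gt0.
have h2 : (x - u) * (A * v ^+ 2 + b * v + c) < 0 by rewrite pmulr_rlt0 // subr_gt0.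
have h3 : 0 < A * ((v - u) * (v - x) * (x - u)) by rewrite !mulr_gt0 // subr_gt0.
lra.
Qed.

(** The quadratic cofactor of [x - x1] is convex, nonpositive at [cmu t] and negative at [w], hence
    negative on the good interval. The sign statement gives uniqueness of the root, and later its
    continuity in [t]. *)
Lemma good_cubic t x1 x : 1 < t -> good t x1 -> cubic t x1 = 0 -> good t x -> x != x1 -> 0 < (x1 - x) * cubic t x.
Proof.
move=> t1 [x10 d1 q1] f1 [x0 d0 q0] xx.
have t0 := lt_trans ltr01 t1; have [w [/andP[w1 wt] dw qw fw]] := cq_root t1.
have inw u : 0 < u -> 0 < cden t u -> cq t u < 0 -> u < w.
  move=> u0 du qu; rewrite ltNge le_eqVlt; apply/negP => /orP[/eqP e|wu].
    by move: qu; rewrite -e qw ltxx.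
  by have := cq_lt (lt_trans ltr01 w1) dw wu; rewrite qw ltNge ltW.
have x1w := inw x1 x10 d1 q1; have xw := inw x x0 d0 q0.
have [b [c fE]] := cubic_factor f1.
have A0 : 0 < 2 * de ^+ 2 by rewrite mulr_gt0 // exprn_gt0.
have mx : cmu t < x by rewrite mu_lt x0.
have mx1 : cmu t < x1 by rewrite mu_lt x10.
have [p0 _] := cubic_mu t0.
have g1 : 2 * de ^+ 2 * cmu t ^+ 2 + b * cmu t + c <= 0.
  by move: p0; rewrite fE nmulr_rge0 // subr_lt0.
have g2 : 2 * de ^+ 2 * w ^+ 2 + b * w + c < 0.
  by move: fw; rewrite fE pmulr_rlt0 // subr_gt0.
have g3 : 2 * de ^+ 2 * x ^+ 2 + b * x + c < 0 by apply: (quadratic_neg A0 _ g1 g2); rewrite mx.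
rewrite fE mulrA nmulr_rgt0 // -opprB mulNr oppr_lt0 -expr2 exprn_even_gt0 //= subr_eq0 //.
Qed.

(** A negative admissible root would lie left of [cnu t] and be a root of the cofactor, which is
    negative at [w]. Convexity then makes the cofactor negative at [cnu t] and the cubic positive
    there, against [cubic_nu]. *)
Lemma admissible_good t x : 1 < t -> admissible_root al be ga t x <-> good t x /\ cubic t x = 0.
Proof.
move=> t1; have t0 := lt_trans ltr01 t1; rewrite (admissible_cases _ t0); split; last first.
  by move=> [[x0 d0 q0] f0]; split=> //; split=> //; rewrite mulr_gt0.
move=> [f0 [q0 xd]]; split=> //.
have [x0|x0] := ltrP 0 x; first by split=> //; rewrite pmulr_rgt0 // in xd.
have xn0 : x < 0 by rewrite lt_neqAle x0 andbT; apply: contraTneq xd => ->; rewrite mul0r ltxx.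
have d0 : cden t x < 0 by rewrite nmulr_rgt0 // in xd.
have [x1 [x10 d1 q1] f1] := good_root t1; have [w [/andP[w1 wt] dw qw fw]] := cq_root t1.
have [b [c fE]] := cubic_factor f1.
have xnu : x < cnu t by rewrite nu_gt xn0.
have mx1 : cmu t < x1 by rewrite mu_lt x10.
have nx1 : cnu t < x1 := le_lt_trans (nu_le_mu t) mx1.
have x1w : x1 < w.
  rewrite ltNge le_eqVlt; apply/negP => /orP[/eqP e|wu]; first by move: q1; rewrite -e qw ltxx.
  by have := cq_lt (lt_trans ltr01 w1) dw wu; rewrite qw ltNge ltW.
have A0 : 0 < 2 * de ^+ 2 by rewrite mulr_gt0 // exprn_gt0.
have g2 : 2 * de ^+ 2 * w ^+ 2 + b * w + c < 0.
  by move: fw; rewrite fE pmulr_rlt0 // subr_gt0.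
have g1 : 2 * de ^+ 2 * x ^+ 2 + b * x + c <= 0.
  have xx1 : x - x1 != 0 by rewrite subr_eq0 lt_eqF // (lt_trans xnu).
  by move: f0 => /eqP; rewrite fE mulf_eq0 (negPf xx1) /= => /eqP ->.
have g3 : 2 * de ^+ 2 * cnu t ^+ 2 + b * cnu t + c < 0.
  by apply: (quadratic_neg A0 _ g1 g2); rewrite xnu (lt_trans nx1).
have := cubic_nu t0; rewrite fE leNgt => /negP[]; by rewrite nmulr_rgt0 // subr_lt0.
Qed.

Theorem admissible_unique t : 1 < t -> exists! x, admissible_root al be ga t x.
Proof.
move=> t1; have [x gx fx] := good_root t1; exists x; split; first by apply/admissible_good.
move=> x' /(admissible_good _ t1) [gx' fx']; apply/esym/eqP; apply/negPn/negP => xx.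
by have := good_cubic t1 gx fx gx' xx; rewrite fx' mulr0 ltxx.
Qed.

Local Notation x0 := (x0 al be ga).

Lemma x0_good t : 1 < t -> good t (x0 t) /\ cubic t (x0 t) = 0.
Proof.
move=> t1; apply/admissible_good => //; apply: xgetPex; have [x [h _]] := admissible_unique t1; by exists x.
Qed.

Lemma x0_unique t x : 1 < t -> good t x -> cubic t x = 0 -> x0 t = x.
Proof.
move=> t1 gx fx; have [y [hy uy]] := admissible_unique t1.
rewrite -(uy (x0 t)); first by apply: uy; apply/admissible_good.
by apply/admissible_good => //; exact: x0_good.
Qed.

Definition y2 t : R := rho al be ga t (x0 t) - x0 t ^+ 2.

Lemma y2E t : 1 < t -> y2 t = - x0 t * cq t (x0 t) / cden t (x0 t).
Proof.
move=> t1; have [[_ d0 _] _] := x0_good t1.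
by rewrite /y2 /rho rho_denE /cq; field; rewrite gt_eqF.
Qed.

Lemma y2_gt0 t : 1 < t -> 0 < y2 t.
Proof.
move=> t1; have [[x0 d0 q0] _] := x0_good t1.
by rewrite y2E // divr_gt0 // nmulr_rgt0 // oppr_lt0.
Qed.

Lemma balance_equations t : 1 < t -> y2 t * cden t (x0 t) = - x0 t * cq t (x0 t) /\
  (x0 t - 1) * (x0 t - t) + cq t (x0 t) = - (1 - de) * y2 t.
Proof.
move=> t1; have [[_ d0 _] f0] := x0_good t1; have dn : cden t (x0 t) != 0 by rewrite gt_eqF.
have e1 : y2 t * cden t (x0 t) = - x0 t * cq t (x0 t) by rewrite y2E // divfK.
split=> //; apply: (mulfI dn).
have -> : cden t (x0 t) * (- (1 - de) * y2 t) = - (1 - de) * (y2 t * cden t (x0 t)) by ring.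
by rewrite e1; apply/eqP; rewrite -subr_eq0; apply/eqP; rewrite -f0 /cubic; ring.
Qed.

(** Good points [a] and [b] close to the root on either side bracket a sign change; this persists
    for nearby parameters and traps their good root between [a] and [b]. *)
Lemma x0_cont t : 1 < t -> {for t, continuous x0}.
Proof.
move=> t1; have [gx fx] := x0_good t1; have [x00 d0 q0] := gx.
apply/cvgrPdist_lt => eps eps0 /=.
have cden_t x u : {for u, continuous (fun t => cden t x)}.
  exact: contD (contC (de * x) u) (contD (contM (contC (al + be - 1) u) (contI u)) (contC (al + ga - 1) u)).
have cq_t x u : {for u, continuous (fun t => cq t x)}.
  exact: contB (contM (contC x u) (cden_t x u)) (contM (contC al u) (contI u)).
have cubic_t x u : {for u, continuous (fun t => cubic t x)}.
  exact: contB (contM (cden_t x u) (contD (contM (contC (x - 1) u) (contB (contC x u) (contI u))) (cq_t x u)))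
    (contM (contC (1 - de) u) (contM (contC x u) (cq_t x u))).
have nearx (P : R -> Prop) : (\forall x \near x0 t, P x) -> exists a b : R, [/\ x0 t - eps < a, a < x0 t, x0 t < b, b < x0 t + eps & P a /\ P b].
  move=> /nbhs_ballP[e /= e0 h]; pose d := Num.min e eps / 2.
  have d0' : 0 < Num.min e eps by rewrite lt_min e0.
  have hm : Num.min e eps <= e /\ Num.min e eps <= eps by rewrite !ge_min !lexx orbT.
  exists (x0 t - d), (x0 t + d); rewrite /d; move: hm d0'; set M := Num.min e eps => -[m1 m2] M0.
  have Md : `|M / 2| < e by rewrite ger0_norm ?divr_ge0 ?ltW //; lra.
  split; [lra|lra|lra|lra|split; apply: h; rewrite /ball /=].
    by rewrite opprB addrCA subrr addr0.
  by rewrite opprD addNKr normrN.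
have N : \forall x \near x0 t, 0 < x /\ 0 < cden t x /\ cq t x < 0.
  apply: filterI; first exact: (cont_near_gt0 (contI (x0 t)) x00).
  by apply: filterI; [exact: (cont_near_gt0 (@cont_cden t (x0 t)) d0)|exact: (cont_near_lt0 (@cont_cq t (x0 t)) q0)].
have [a [b [a1 a2 b1 b2 [[a0 [da qa]] [b0 [db qb]]]]]] := nearx _ N.
have ga' : good t a by split.
have gb : good t b by split.
have fa : 0 < cubic t a.
  have h : a != x0 t by rewrite lt_eqF.
  by have := good_cubic t1 gx fx ga' h; rewrite pmulr_rgt0 // subr_gt0.
have fb : cubic t b < 0.
  have h : b != x0 t by rewrite gt_eqF.
  by have := good_cubic t1 gx fx gb h; rewrite nmulr_rgt0 // subr_lt0.
near=> u.
have [[u1 dau] [qbu [fau fbu]]] : (1 < u /\ 0 < cden u a) /\ cq u b < 0 /\ 0 < cubic u a /\ cubic u b < 0.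
  near: u; apply: filterI; first by apply: filterI; [exact: (near_gt t1)|exact: (cont_near_gt0 (cden_t a t) da)].
  apply: filterI; first exact: (cont_near_lt0 (cq_t b t) qb).
  by apply: filterI; [exact: (cont_near_gt0 (cubic_t a t) fa)|exact: (cont_near_lt0 (cubic_t b t) fb)].
have ab : a < b := lt_trans a2 b1.
have [|x /andP[ax xb] e] := ivt ab (@cont_cubic u); first by rewrite pmulr_rlt0.
have x0p : 0 < x := lt_trans a0 ax.
have dx : 0 < cden u x := lt_trans dau (cden_lt u ax).
have gxu : good u x by split=> //; exact: lt_trans (cq_lt x0p dx xb) qbu.
by rewrite (x0_unique u1 gxu e) ltr_distlC (lt_trans a1 ax) (lt_trans xb b2).
Unshelve. all: by end_near.
Qed.

Lemma y2_cont t : 1 < t -> {for t, continuous y2}.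
Proof.
move=> t1; have c := x0_cont t1; have [[_ d0 _] _] := x0_good t1.
have cd : {for t, continuous (fun t => rho_den al be ga t (x0 t))}.
  exact: contB (contB (contD (contM (contC (1 - Defs.coefE al be ga) t) c) (contM (contC (Defs.coefE al be ga) t) (contD (contI t) (contC 1 t)))) (contM (contC ga t) (contI t))) (contC be t).
have dn : rho_den al be ga t (x0 t) != 0 by rewrite rho_denE gt_eqF.
have cx2 : {for t, continuous (fun t => x0 t ^+ 2)} := @cont_comp R (fun x => x ^+ 2) x0 t c (contX2 (x0 t)).
rewrite (_ : y2 = fun t => al * t * x0 t * (rho_den al be ga t (x0 t))^-1 - x0 t ^+ 2) //.
apply: (@contB R _ (fun t => x0 t ^+ 2) t _ cx2).
apply: (@contM R _ _ t _ (@contV R (fun t => rho_den al be ga t (x0 t)) t dn cd)).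
apply: (@contM R _ _ t _ c); exact: contM (contC al t) (contI t).
Qed.

Definition y0 t : R := Num.sqrt (y2 t).

Lemma y0_gt0 t : 1 < t -> 0 < y0 t.
Proof. by move=> t1; rewrite sqrtr_gt0 y2_gt0. Qed.

Lemma y0_sqr t : 1 < t -> y0 t ^+ 2 = y2 t.
Proof. by move=> t1; rewrite sqr_sqrtr // ltW // y2_gt0. Qed.

Local Notation a := (quad_exp al be ga de).

Lemma balance_half_plane t : 1 < t -> \sum_(k < 4) (a k)%:C * cis (- thq (x0 t) (y0 t) t k) = 0.
Proof.
move=> t1; have [E1 E2] := balance_equations t1; have y00 := y0_gt0 t1; have yy := y0_sqr t1.
move: E1 E2 y00; rewrite -yy; set x := x0 t; set y := y0 t => E1 E2 y00.
have cc u : conjc (cis u) = cis (- u) :> R[i] by apply: Cext; rewrite /= ?cosN ?sinN.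
pose z : R[i] := x +i* y.
have cish s : cis (- hp x y s) = - (2 * y%:C * iC) / (s%:C - z) - 1.
  rewrite -cc.
  have n : s%:C - z != 0 by apply: zs_neq0.
  have n' : s%:C - conjc z != 0 by rewrite -cabs_eq0 conjc_dist cabs_eq0.
  have h : cis (hp x y s) * (s%:C - conjc z) = z - s%:C by rewrite cis_hp // divfK.
  have {}h : conjc (cis (hp x y s)) * (s%:C - z) = conjc z - s%:C.
    transitivity (conjc (cis (hp x y s) * (s%:C - conjc z))).
      by rewrite conjCM; congr (_ * _); apply: Cext; rewrite !ReImE /=; ring.
    by rewrite h; apply: Cext; rewrite !ReImE /=; ring.
  apply: (mulIf n); rewrite h mulrBl divfK // mul1r.
  by apply: Cext; rewrite !ReImE /=; ring.
have [t0' t1' t2' t3' _] := thqE x y t.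
rewrite !big_ord_recr big_ord0 /= add0r t0' t1' t2' t3' !cish.
have n0 : 0%:C - z != 0 by exact: zs_neq0. have n1 : 1%:C - z != 0 by exact: zs_neq0. have nt : t%:C - z != 0 by exact: zs_neq0.
have cp : cis (- pi) = -1 :> R[i] by apply: Cext; rewrite /= ?cosN ?sinN ?cospi ?sinpi ?oppr0.
rewrite cp /quad_exp /=.
(* By [cish] the balance says that [- 2 i y] times the sum of [a k / (s_k - z)] over the finite
   points equals 2, the total of the exponents. Here denominators are cleared, and the real and
   imaginary parts follow from the two balance equations. *)
have key : (- (2 * y%:C * iC)) * (al%:C * ((1%:C - z) * (t%:C - z)) + be%:C * ((0%:C - z) * (t%:C - z)) + ga%:C * ((0%:C - z) * (1%:C - z)))
   = 2 * ((0%:C - z) * (1%:C - z) * (t%:C - z)).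
  have E3 : (2 - de) * (x ^+ 2 - y ^+ 2) - ((al + be - 1) * t + (al + ga - 1) + 1 + t) * x + al * t = 3 * x ^+ 2 - y ^+ 2 - 2 * (1 + t) * x + t.
    by move: E2; rewrite /cq /cden => E2; lra.
  have E4 : y ^+ 2 * ((4 - 2 * de) * x - ((al + be - 1) * t + (al + ga - 1)) - 1 - t) = - x * ((x - 1) * (x - t)) + 3 * x * y ^+ 2 - (1 + t) * y ^+ 2.
    have : x * ((x - 1) * (x - t)) + x * cq t x = - (1 - de) * y ^+ 2 * x by rewrite -mulrDr E2 mulrC.
    by move: E1; rewrite /cq /cden; lra.
  have e3 : al + be + ga = 2 - de by rewrite -hsum; ring.
  move: (congr1 (fun v => y * v) E3) E4; rewrite deE => {}E3 E4.
  apply: Cext; rewrite !ReImE /=; lra.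
apply: (mulIf (_ : (0%:C - z) * (1%:C - z) * (t%:C - z) != 0)); first by rewrite !mulf_neq0.
rewrite mul0r.
have dC : de%:C = 2 - al%:C - be%:C - ga%:C :> R[i] by rewrite deE; apply: Cext; rewrite !ReImE /=; ring.
rewrite dC; set w := - _ * _ in key.
transitivity (w - 2 * ((0%:C - z) * (1%:C - z) * (t%:C - z))); last by rewrite key subrr.
rewrite /w; move: n0 n1 nt; move: (0%:C - z) (1%:C - z) (t%:C - z) (y%:C * iC : R[i]) => P0 P1 Pt I n0 n1 nt.
by field; rewrite n0 n1 nt.
Qed.

End cubic.

(** * The ratio of two sides *)

Section sine.
Variable R : realType.
Implicit Types (u v x : R).

Lemma sin_le_arg x : 0 <= x -> sin x <= x.
Proof.
rewrite le_eqVlt => /predU1P[<-|x0]; first by rewrite sin0.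
have [|c _ e] := @MVT R sin cos 0 x x0 (fun y _ => is_derive_sin y).
  by apply: continuous_subspaceT => y; exact: continuous_sin.
by move: e; rewrite sin0 !subr0 => ->; rewrite ler_piMl ?cos_le1 // ltW.
Qed.

Lemma sin_mono_le u v : 0 <= u -> u <= v -> v <= pi - u -> sin u <= sin v.
Proof.
move=> u0 uv vu; have p0 := pi_gt0 R.
have lesin x : x <= pi / 2 -> u <= x -> sin u <= sin x.
  move=> xp; rewrite le_eqVlt => /predU1P[->//|ux].
  by rewrite ltW // ltr_sin ?in_itv //=; apply/andP; split; lra.
have [vp|vp] := lerP v (pi / 2); first exact: lesin.
have -> : sin v = sin (pi - v) by rewrite sinB sinpi cospi mul0r sub0r mulN1r opprK.
apply: lesin; lra.
Qed.

End sine.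

(** * Side lengths compared with gaps between prevertices *)

Section side_bounds.
Variable R : realType.
Variables (th a : nat -> R) (F V : R[i] -> R[i]).
Hypothesis H : sc_data th a 1 F V.
Implicit Types (m k : nat) (x u : R).
Local Notation len := (len th a F).
Local Notation lam := (lam th a F).
Local Notation wl := (wl th a).
Local Notation dir := (dir th a).

Definition gap k : R := (th k.+1 - th k) / 2.
Definition chord k : R := cabs (cis (th k.+1) - cis (th k)).

Let th_lt k : th k < th k.+1. Proof. exact: (sc_th_lt H). Qed.
Let th_per k : th k.+4 = th k + 2 * pi. Proof. exact: (sc_th_per H). Qed.
Let a_bnd k : 0 < a k < 1. Proof. by have := sc_akap H k; rewrite mul1r. Qed.
Let a_sum m : a m + a m.+1 + a m.+2 + a m.+3 = 2.
Proof. by rewrite -(window m (sc_a_per H)) (sc_suma H) mulr1. Qed.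

Lemma gap_gt0 k : 0 < gap k.
Proof. by have := th_lt k; rewrite divr_gt0 ?subr_gt0. Qed.

Lemma gap_per k : gap k.+4 = gap k.
Proof. by rewrite /gap (th_per k) (th_per k.+1); congr (_ / _); ring. Qed.

Lemma gap_sum m : gap m + gap m.+1 + gap m.+2 + gap m.+3 = pi.
Proof. by rewrite /gap th_per; field. Qed.

Lemma gap_lt_pi k : gap k < pi.
Proof.
have := gap_sum k; have := gap_gt0 k.+1; have := gap_gt0 k.+2; have := gap_gt0 k.+3.
move: (gap k) (gap k.+1) (gap k.+2) (gap k.+3) (pi : R) => *; lra.
Qed.

Lemma chordE k : chord k = 2 * sin (gap k).
Proof.
have g0 := gap_gt0 k; have g1 := gap_lt_pi k; rewrite /gap -cabs_one_sub_cis; last first.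
  by move: g0 g1; rewrite /gap => g0 g1; apply/andP; split; lra.
rewrite /chord -[RHS]mulr1 -(cabs_cis (th k)) -cabsM mulrBl mul1r -cisD subrK.
exact: cabs_distrC.
Qed.

Lemma chord_per k : chord k.+4 = chord k.
Proof. by rewrite !chordE gap_per. Qed.

Let th_window m j : (j < 4)%N -> th m <= th (m + j)%N <= th m.+3.
Proof.
have q1 := ltW (th_lt m); have q2 := ltW (th_lt m.+1); have q3 := ltW (th_lt m.+2).
case: j => [|[|[|[|//]]]] _; rewrite ?addn0 ?addnS ?addn0 ?lexx ?q1 ?q3 ?(le_trans q1 q2) ?(le_trans q2 q3) //=.
by rewrite (le_trans q1 (le_trans q2 q3)).
by rewrite (le_trans q1 (le_trans q2 q3)).
Qed.

Let arc_sin m x j : (j < 4)%N -> th m.+3 < x < th m.+4 -> 0 < sin ((x - th (m + j)%N) / 2).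
Proof.
move=> j4 /andP[h1 h2]; rewrite th_per in h2; have /andP[h3 h4] := th_window m j4.
by apply: sin_gt0_pi; apply/andP; split; lra.
Qed.

(** No chord exceeds 2 and the exponents sum to 2, so the density is at most 4, on an arc of length
    twice the gap. *)
Lemma len_le m : len m <= 8 * gap m.+3.
Proof.
have tl := th_lt m.+3.
have d x : x \in `]th m.+3, th m.+4[ -> is_derive x 1 (lam m) (expR (wl m x)).
  by rewrite in_itv /= => hx; exact: (lam_deriv H).
have [|c + e] := MVT tl d; first exact: (lam_within H).
rewrite in_itv /= => hc; move: e; rewrite lam0 subr0 -/(len m) => ->.
have g0 : 0 < th m.+4 - th m.+3 by rewrite subr_gt0.
have -> : 8 * gap m.+3 = 4 * (th m.+4 - th m.+3) by rewrite /gap; field.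
rewrite ler_pM2r //.
have l2 : expR (2 * ln 2) = 4 :> R by rewrite expRM_natl lnK ?posrE //; ring.
rewrite -l2 ler_expR /wl.
have key j : (j < 4)%N -> a (m + j)%N * ln (2 * sin ((c - th (m + j)%N) / 2)) <= a (m + j)%N * ln 2.
  move=> j4; have s0 := arc_sin j4 hc; have /andP[a0 _] := a_bnd (m + j).
  rewrite ler_pM2l // ler_ln ?posrE ?mulr_gt0 //.
  by rewrite -[leRHS]mulr1 ler_pM2l // sin_le1.
have := key 0%N isT; have := key 1%N isT; have := key 2%N isT; have := key 3%N isT.
by have := a_sum m; rewrite !addnS addn0 => <-; lra.
Qed.

(** On the middle third of the arc all prevertices are at chord distance at least [2 sin (gap / 3)],
    which bounds the density below by its square. *)
Lemma len_ge m : 8 / 3 * gap m.+3 * sin (gap m.+3 / 3) ^+ 2 <= len m.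
Proof.
set g := gap m.+3; have g0 : 0 < g := gap_gt0 m.+3; have g1 : g < pi := gap_lt_pi m.+3.
have gE : th m.+4 = th m.+3 + 2 * g by rewrite /g /gap; field.
pose x1 := th m.+3 + 2 / 3 * g; pose x2 := th m.+3 + 4 / 3 * g.
have x12 : x1 < x2 by rewrite /x1 /x2; lra.
have hx : th m.+3 < x1 /\ x2 < th m.+4 by rewrite gE /x1 /x2; split; lra.
have [h1 h2] := hx.
have d x : x \in `]x1, x2[ -> is_derive x 1 (lam m) (expR (wl m x)).
  rewrite in_itv /= => /andP[y1 y2]; apply: (lam_deriv H); apply/andP; split; [exact: lt_trans y1|exact: lt_trans h2].
have [|c + e] := MVT x12 d; first exact: (lam_within H).
rewrite in_itv /= => /andP[c1 c2].
have big : lam m x2 - lam m x1 <= len m.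
  have q1 := lam_lt H (lexx (th m.+3)) h1 (ltW (lt_trans x12 h2)).
  have q2 := lam_lt H (ltW (lt_trans h1 x12)) h2 (lexx _).
  by rewrite lam0 in q1; rewrite -/(len m) in q2; lra.
apply: le_trans big; rewrite e.
have s0 : 0 < sin (g / 3) by apply: sin_gt0_pi; apply/andP; split; lra.
have hc : th m.+3 < c < th m.+4 by rewrite (lt_trans h1) //= (lt_trans _ h2).
have -> : 8 / 3 * g * sin (g / 3) ^+ 2 = expR (2 * ln (2 * sin (g / 3))) * (x2 - x1).
  by rewrite expRM_natl lnK ?posrE ?mulr_gt0 // /x1 /x2; field.
rewrite ler_pM2r ?subr_gt0 // ler_expR /wl.
have key j : (j < 4)%N -> a (m + j)%N * ln (2 * sin (g / 3)) <= a (m + j)%N * ln (2 * sin ((c - th (m + j)%N) / 2)).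
  move=> j4; have s1 := arc_sin j4 hc; have /andP[a0 _] := a_bnd (m + j).
  rewrite ler_pM2l // ler_ln ?posrE ?mulr_gt0 // ler_pM2l //.
  have /andP[h3 h4] := th_window m j4; move: gE c1 c2; rewrite th_per /x1 /x2 => gE c1 c2.
  by apply: sin_mono_le; lra.
have := key 0%N isT; have := key 1%N isT; have := key 2%N isT; have := key 3%N isT.
by have := a_sum m; rewrite !addnS addn0 => <-; lra.
Qed.

Hypothesis bal : \sum_(k < 4) (a k)%:C * cis (- th k) = 0.

(* [2 e = \sum_j a j * (e - e_j)] for the vertex [e] between the two chords *)
Lemma chord_add m : 2 * (1 - a m.+3) <= chord m + chord m.+1.
Proof.
have cc u : conjc (cis u) = cis (- u) :> R[i] by apply: Cext; rewrite /= ?cosN ?sinN.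
pose g k : R[i] := (a k)%:C * cis (- th k).
have gper k : g k.+4 = g k.
  by rewrite /g (sc_a_per H) th_per -!cc cis2pi.
have gs : g m + g m.+1 + g m.+2 + g m.+3 = 0 by rewrite -(window m gper).
pose e k : R[i] := cis (- th k).
have ce j k : cabs (e j - e k) = cabs (cis (th j) - cis (th k)).
  by rewrite -cabsJ; congr cabs; rewrite /e -!cc; apply: Cext; rewrite !ReImE /=; ring.
have key : 2 * e m.+1 = (a m)%:C * (e m.+1 - e m) + (a m.+2)%:C * (e m.+1 - e m.+2) + (a m.+3)%:C * (e m.+1 - e m.+3).
  have s2 : 2 = (a m)%:C + (a m.+1)%:C + (a m.+2)%:C + (a m.+3)%:C :> R[i].
    by rewrite -!rCD a_sum; apply: Cext; rewrite !ReImE /= ?addr0.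
  move: gs; rewrite /g -!/(e _) => gs.
  rewrite s2 -[LHS]subr0 -gs; ring.
have n2 : cabs (2 * e m.+1) = 2.
  have c2 : 2 = (2 : R)%:C :> R[i] by apply: Cext; rewrite !ReImE /= ?addr0.
  have n2' : `|2 : R| = 2 by apply: ger0_norm.
  by rewrite cabsM [cabs (e _)]cabs_cis mulr1 c2 cabsR.
have [/andP[p0 p1] [/andP[r0 r1] /andP[s0 s1]]] : 0 < a m < 1 /\ 0 < a m.+2 < 1 /\ 0 < a m.+3 < 1 by [].
have b1 : cabs ((a m)%:C * (e m.+1 - e m)) <= chord m.
  by rewrite cabsM cabsR gtr0_norm // ce ler_piMl ?cabs_ge0 // ltW.
have b2 : cabs ((a m.+2)%:C * (e m.+1 - e m.+2)) <= chord m.+1.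
  by rewrite cabsM cabsR gtr0_norm // ce cabs_distrC ler_piMl ?cabs_ge0 // ltW.
have b3 : cabs ((a m.+3)%:C * (e m.+1 - e m.+3)) <= 2 * a m.+3.
  rewrite cabsM cabsR gtr0_norm // ce mulrC ler_pM2r //.
  by apply: le_trans (cabsB _ _) _; rewrite !cabs_cis.
have t1 := cabsD ((a m)%:C * (e m.+1 - e m) + (a m.+2)%:C * (e m.+1 - e m.+2)) ((a m.+3)%:C * (e m.+1 - e m.+3)).
have t2 := cabsD ((a m)%:C * (e m.+1 - e m)) ((a m.+2)%:C * (e m.+1 - e m.+2)).
move: n2; rewrite key => n2; lra.
Qed.

Variable eps : R.
Hypotheses (eps0 : 0 < eps) (eps_le : forall k, eps <= 1 - a k).

Let chord_add_eps m : 2 * eps <= chord m + chord m.+1.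
Proof. by apply: le_trans (chord_add m); rewrite ler_pM2l. Qed.

Let chord_le m : chord m <= 2 * gap m.
Proof. by rewrite chordE ler_pM2l // sin_le_arg // ltW // gap_gt0. Qed.

Lemma eps_pi : eps < pi.
Proof.
have := chord_add_eps 0; have := chord_le 0; have := chord_le 1; have := gap_sum 0.
have := gap_gt0 2; have := gap_gt0 3; move: (gap 0) (gap 1) (gap 2) (gap 3) (pi : R) => *; lra.
Qed.

(** A short chord could also come from a gap close to [pi]; [chord_add] for the next two gaps leaves
    no room for that. *)
Lemma gap_small eta k : 0 < eta -> eta <= eps / 2 -> chord k < 2 * sin eta -> gap k < eta.
Proof.
move=> e0 e1; rewrite chordE ltr_pM2l // => hs; rewrite ltNge; apply/negP => hg.
have := gap_sum k; have := chord_add_eps k.+1; have := chord_le k.+1; have := chord_le k.+2.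
have := gap_gt0 k.+3; have := sin_mono_le (ltW e0) hg.
move: hs hg; move: (gap k) (gap k.+1) (gap k.+2) (gap k.+3) (pi : R) => g g1 g2 g3 p hs hg h1 h2 h3 h4 h5 h6.
have : sin eta <= sin g by apply: h1; lra.
by rewrite leNgt hs.
Qed.

(** The bound of [len_ge] for a gap equal to [eps / 2]. *)
Definition len_min : R := 4 / 3 * eps * sin (eps / 6) ^+ 2.

Lemma len_min_gt0 : 0 < len_min.
Proof.
have e := eps_pi; have e0 := eps0; have s : 0 < sin (eps / 6) by apply: sin_gt0_pi; apply/andP; split; lra.
by rewrite /len_min !mulr_gt0 // exprn_gt0.
Qed.

Lemma len_min_le m : eps / 2 <= gap m.+3 -> len_min <= len m.
Proof.
move=> h; apply: le_trans (len_ge m); have p1 := gap_lt_pi m.+3; have e := eps_pi; have e0 := eps0.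
have s : sin (eps / 6) <= sin (gap m.+3 / 3) by apply: sin_mono_le; lra.
have s0 : 0 < sin (eps / 6) by apply: sin_gt0_pi; apply/andP; split; lra.
have s2 : sin (eps / 6) ^+ 2 <= sin (gap m.+3 / 3) ^+ 2.
  by rewrite ler_pXn2r ?nnegrE ?(ltW s0) ?(le_trans (ltW s0)).
rewrite /len_min; apply: ler_pM => //; [by rewrite mulr_ge0 // ltW|by rewrite exprn_ge0 // ltW|lra].
Qed.

Variable K : R.
Hypothesis K0 : 0 < K.

Definition small_gap : R := Num.min (eps / 2) (K * len_min / 16).
Definition small_chord : R := 2 * sin small_gap.

Lemma small_gap_gt0 : 0 < small_gap.
Proof. by have l := len_min_gt0; rewrite /small_gap lt_min !divr_gt0 // mulr_gt0. Qed.

Lemma small_chord_gt0 : 0 < small_chord.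
Proof.
have g0 := small_gap_gt0; have e := eps_pi.
have g1 : small_gap <= eps / 2 by rewrite ge_min lexx.
by rewrite /small_chord mulr_gt0 // sin_gt0_pi // g0 /=; lra.
Qed.

(** Side [m.+1] lies over gap [m.+4]. By [chord_add] both adjacent chords exceed [eps], so both
    adjacent sides have length at least [len_min], while [len_le] makes this one tiny. *)
Lemma chord_small m : chord m.+4 < small_chord -> len m.+1 < K * len m /\ len m.+1 < K * len m.+2.
Proof.
move=> hc; have g0 := small_gap_gt0.
have e1 : small_gap <= eps / 2 by rewrite ge_min lexx.
have e2 : small_gap <= K * len_min / 16 by rewrite ge_min lexx orbT.
have hg := gap_small g0 e1 hc.
have s := sin_le_arg (ltW g0).
have l8 := len_le m.+1.
have n1 : eps / 2 <= gap m.+3.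
  by have := chord_add_eps m.+3; have := chord_le m.+3; have := hc; rewrite /small_chord; lra.
have n2 : eps / 2 <= gap m.+4.+1.
  by have := chord_add_eps m.+4; have := chord_le m.+4.+1; have := hc; rewrite /small_chord; lra.
have l1 := len_min_le n1; have l2 := len_min_le n2; have lm := len_min_gt0.
have k1 : K * len_min <= K * len m by rewrite ler_pM2l.
have k2 : K * len_min <= K * len m.+2 by rewrite ler_pM2l.
have kl : 0 < K * len_min by rewrite mulr_gt0.
move: k1 k2 kl e2 l8 hg; set X := K * len_min; set g := gap m.+4 => *; split; lra.
Qed.

End side_bounds.

(** Imaginary parts after a rotation that makes one of the last two sides real: with the angles
    fixed, the first two sides determine the others linearly. *)
Lemma closing_relations (R : realType) (al be ga de l0 l1 l2 l3 : R) : al + be + ga + de = 2 ->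
  l1%:C + l2%:C * cis (- (pi * be)) + l3%:C * cis (- (pi * (be + ga))) + l0%:C * cis (pi * al) = 0 ->
  l0 * sin (pi * de) = l1 * sin (pi * (be + ga)) + l2 * sin (pi * ga) /\
  l3 * sin (pi * de) = l1 * sin (pi * al) + l2 * sin (pi * (al + be)).
Proof.
move=> hs hc.
have ds (x : R) : x = 2 - de -> sin (pi * x) = - sin (pi * de).
  by move=> ->; rewrite mulrBr sinB (mulrC pi 2) mulr_natl sin2pi cos2pi mul0r sub0r mul1r.
have rot x : l1 * sin x + l2 * sin (x - pi * be) + l3 * sin (x - pi * (be + ga)) + l0 * sin (x + pi * al) = 0.
  have := congr1 (fun z => Im (cis x * z)) hc; rewrite mulr0 !mulrDr.
  rewrite !(mulrCA (cis x)) -!cisD (mulrC (cis x)) !ImD !ImCM /=; exact.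
split.
  have := rot (pi * (be + ga)); rewrite subrr sin0 -mulrBr -mulrDr (ds (be + ga + al)); last by rewrite -hs; ring.
  by rewrite (_ : be + ga - be = ga); [lra|ring].
have := rot (- (pi * al)); rewrite addNr sin0 sinN.
have -> : sin (- (pi * al) - pi * be) = - sin (pi * (al + be)) by rewrite -sinN; congr sin; ring.
have -> : sin (- (pi * al) - pi * (be + ga)) = sin (pi * de).
  rewrite -[RHS]opprK -(ds (al + be + ga)); last by rewrite -hs; ring.
  by rewrite -sinN; congr sin; ring.
lra.
Qed.

Section parameter_continuity.
Variable R : realType.
Implicit Types (p : R * R) (t u : R).

(** Continuity of a parameter integral, expressed through primitives. Compactness makes [k]
    uniformly close to its value at [t0], and the mean value theorem for the difference of
    primitives uses only [0 <= w <= 1]; powers that are not smooth at the ends go into [w]. *)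
Lemma primitive_param_cont (Phi k : R -> R -> R) (w : R -> R) t0 :
  (\forall t \near t0, (forall u, 0 <= u <= 1 -> {for u, continuous (Phi t)}) /\
     (forall u, 0 < u < 1 -> is_derive u 1 (Phi t) (w u * k t u))) ->
  (forall u, 0 < u < 1 -> 0 <= w u <= 1) ->
  (forall u, 0 <= u <= 1 -> k p.1 p.2 @[p --> (t0, u)] --> k t0 u) ->
  {for t0, continuous (fun t => Phi t 1 - Phi t 0)}.
Proof.
move=> hP hw hk; apply/cvgrPdist_le => eps eps0 /=.
have e4 : 0 < eps / 2 by rewrite divr_gt0.
have unif : \forall t \near t0, `[0, 1] `<=` [set u | `|k t u - k t0 u| <= eps].
  have /compact_near_coveringP cov := @segment_compact R 0 1.
  refine (cov R (nbhs t0) (fun t u => `|k t u - k t0 u| <= eps) (nbhs_filter t0) _) => u hu.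
  have {}hu : 0 <= u <= 1 by move: hu; rewrite /= in_itv.
  have /cvgrPdist_lt /(_ _ e4) [[A B] /= [hA hB] hAB] := hk u hu.
  exists (B, A) => //= -[u' t] /= [Bu At].
  have h1 : `|k t0 u - k t u'| < eps / 2 := hAB (t, u') (conj At Bu).
  have h2 : `|k t0 u - k t0 u'| < eps / 2 := hAB (t0, u') (conj (nbhs_singleton hA) Bu).
  rewrite (_ : k t u' - k t0 u' = (k t0 u - k t0 u') - (k t0 u - k t u')); last by ring.
  by apply: le_trans (ler_normB _ _) _; lra.
have [c0 d0] := nbhs_singleton hP.
apply: filterS2 hP unif => t [c1 d1] un.
have dd u : u \in `]0, 1[ -> is_derive u 1 (fun u => Phi t0 u - Phi t u) (w u * k t0 u - w u * k t u).
  by rewrite in_itv /= => hu; exact: is_deriveB (d0 u hu) (d1 u hu).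
have [|c + e] := MVT ltr01 dd.
  by apply: continuous_in_subspaceT => u; rewrite inE /= in_itv /= => hu; exact: contB (c0 u hu) (c1 u hu).
rewrite in_itv /= => hc; have /andP[w0 w1] := hw c hc.
have uc : `|k t c - k t0 c| <= eps by apply: un; rewrite /= in_itv /=; case/andP: hc => ? ?; rewrite !ltW.
rewrite (_ : Phi t0 1 - Phi t0 0 - (Phi t 1 - Phi t 0) = (Phi t0 1 - Phi t 1) - (Phi t0 0 - Phi t 0)); last by ring.
rewrite e subr0 mulr1 -mulrBr normrM (ger0_norm w0) distrC.
by apply: le_trans uc; rewrite ler_piMl.
Qed.

Lemma cvg_comp2 (g : R -> R) (f : R * R -> R) p l : f q @[q --> p] --> l -> {for l, continuous g} -> g (f q) @[q --> p] --> g l.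
Proof. by move=> h1 h2; exact: (@cvg_comp _ _ _ f g (nbhs p) (nbhs l) (nbhs (g l)) h1 h2). Qed.

Lemma cvg_fst2 p : q.1 @[q --> p] --> p.1.
Proof. by case: p => x y; exact: cvg_fst. Qed.
Lemma cvg_snd2 p : q.2 @[q --> p] --> p.2.
Proof. by case: p => x y; exact: cvg_snd. Qed.

End parameter_continuity.

Section side_ratio.
Variable R : realType.
Variables (al be ga de : R).
Hypotheses (hal : 0 < al < 1) (hbe : 0 < be < 1) (hga : 0 < ga < 1) (hde : 0 < de < 1).
Hypothesis hsum : al + be + ga + de = 2.
Implicit Types (t u : R).
Local Notation a := (quad_exp al be ga de).
Local Notation X := (x0 al be ga).
Local Notation Y := (y0 al be ga).
Local Notation Y2 := (y2 al be ga).
Local Notation th t := (thq (X t) (Y t) t).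
Local Notation F t := (ext_sc (th t) a).
Local Notation ell t m := (len (th t) a (F t) m).

Let sc t : 1 < t -> sc_data (th t) a 1 (F t) (fun z : R[i] => scP (fun k : 'I_4 => a k) (fun k : 'I_4 => th t k) z / z).
Proof.
move=> t1; apply: quad_ext_sc => //; first exact: (y0_gt0 hal hbe hga hde hsum).
exact: (balance_half_plane hal hbe hga hde hsum).
Qed.

Let Ygt0 t : 1 < t -> 0 < Y t. Proof. exact: (y0_gt0 hal hbe hga hde hsum). Qed.
Let Y2gt0 t : 1 < t -> 0 < Y2 t. Proof. exact: (y2_gt0 hal hbe hga hde hsum). Qed.

Let ln_dist t s : 1 < t -> 4 * ln (cabs (s%:C - X t +i* Y t)) = 2 * ln ((s - X t) ^+ 2 + Y2 t).
Proof.
move=> t1; have c := zs_gt0 (X t) (Ygt0 t1) s.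
rewrite -(y0_sqr hal hbe hga hde hsum t1) -zs_sqr expr2 lnM ?posrE //; ring.
Qed.

Let cvgX t u : 1 < t -> X q.1 @[q --> (t, u)] --> X t.
Proof. move=> t1; exact: cvg_comp2 (@cvg_fst2 R (t, u)) (x0_cont hal hbe hga hde hsum t1). Qed.
Let cvgY t u : 1 < t -> Y2 q.1 @[q --> (t, u)] --> Y2 t.
Proof. move=> t1; exact: cvg_comp2 (@cvg_fst2 R (t, u)) (y2_cont hal hbe hga hde hsum t1). Qed.

Let cvg_dist t u (f : R * R -> R) l : 1 < t -> f q @[q --> (t, u)] --> l ->
  ln ((f q - X q.1) ^+ 2 + Y2 q.1) @[q --> (t, u)] --> ln ((l - X t) ^+ 2 + Y2 t).
Proof.
move=> t1 hf; apply: (@cvg_comp2 R (@ln R) (fun q => (f q - X q.1) ^+ 2 + Y2 q.1)); last first.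
  by apply: continuous_ln; rewrite ltr_wpDl ?sqr_ge0 // Y2gt0.
apply: cvgD; last exact: cvgY.
by apply: (@cvg_comp2 R (fun x => x ^+ 2) (fun q => f q - X q.1)); [apply: cvgB => //; exact: cvgX|exact: contX2].
Qed.

Let weight (b c u : R) : 0 < b -> 0 < c -> 0 < u < 1 -> 0 <= expR (b * ln u + c * ln (1 - u)) <= 1.
Proof.
move=> b0 c0 /andP[u0 u1]; rewrite ltW ?expR_gt0 //= -[X in _ <= X]expR0 ler_expR.
have l1 : ln u < 0 by rewrite ln_lt0 // u0.
have l2 : ln (1 - u) < 0 by rewrite ln_lt0 //; apply/andP; split; lra.
by rewrite -[0]addr0; apply: lerD; rewrite pmulr_rle0 // ltW.
Qed.

(** Division by [arcC] leaves an integral over a fixed interval whose density is explicit in [t],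
    [x0] and [y2]. *)
Definition side1 t : R := ell t 1 / arcC (X t) (Y t) t a.
Definition side2 t : R := ell t 2 / arcC (X t) (Y t) t a.

Let C0 t : 1 < t -> 0 < arcC (X t) (Y t) t a. Proof. by move=> t1; exact: arcC_gt0 (Ygt0 t1) a. Qed.

Lemma side1_gt0 t : 1 < t -> 0 < side1 t.
Proof. by move=> t1; rewrite divr_gt0 ?C0 // (len_gt0 (sc t1)). Qed.

Lemma side1_cont t : 1 < t -> {for t, continuous side1}.
Proof.
move=> t1; pose Phi t u := Lam (X t) (Y t) t a (F t) 1 u / arcC (X t) (Y t) t a.
have -> : side1 = fun t => Phi t 1 - Phi t 0.
  by apply/funext => s; rewrite /side1 len1E mulrBl.
pose k t u := expR (ga * ln (t - u) - 2 * ln ((u - X t) ^+ 2 + Y2 t)).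
apply: (@primitive_param_cont R Phi k (fun u => expR (al * ln u + be * ln (1 - u)))).
- apply: filterS (near_gt t1) => s s1.
  split=> u hu.
    by apply: (@contM R _ (fun=> (arcC (X s) (Y s) s a)^-1) u _ (contC _ u)); exact: (Lam_cont (Ygt0 s1) (sc s1)).
  have d := is_deriveZ (arcC (X s) (Y s) s a)^-1 (Lam1_deriv (Ygt0 s1) s1 (sc s1) hu).
  have -> : Phi s = (arcC (X s) (Y s) s a)^-1 \*: Lam (X s) (Y s) s a (F s) 1.
    by apply/funext => v; rewrite /Phi mulrC.
  apply: is_derive_eq d _; rewrite /GRing.scale /= mulKf ?gt_eqF ?C0 // -expRD; congr expR.
  by rewrite (_ : 2 * 1 + 2 = 4); [rewrite ln_dist // /quad_exp /=; ring|ring].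
- by move=> u; apply: weight; [case/andP: hal|case/andP: hbe].
move=> u /andP[u0 u1]; apply: (@cvg_comp2 R expR (fun p => ga * ln (p.1 - p.2) - 2 * ln ((p.2 - X p.1) ^+ 2 + Y2 p.1))); last exact: continuous_expR.
apply: cvgB; apply: cvgM; try exact: cvg_cst; last by apply: cvg_dist => //; exact: cvg_snd2.
apply: (@cvg_comp2 R (@ln R) (fun p => p.1 - p.2)); first by apply: cvgB; [exact: cvg_fst2|exact: cvg_snd2].
by apply: continuous_ln; rewrite subr_gt0 (le_lt_trans u1).
Qed.

Lemma side2_cont t : 1 < t -> {for t, continuous side2}.
Proof.
move=> t1; pose Phi t u := Lam (X t) (Y t) t a (F t) 2 (u * (t - 1) + 1) / arcC (X t) (Y t) t a.
have -> : side2 = fun t => Phi t 1 - Phi t 0.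
  by apply/funext => s; rewrite /side2 len2E /Phi mulrBl mul1r mul0r add0r subrK.
pose k t u := (t - 1) * expR ((be + ga) * ln (t - 1) + al * ln (u * (t - 1) + 1) - 2 * ln ((u * (t - 1) + 1 - X t) ^+ 2 + Y2 t)).
apply: (@primitive_param_cont R Phi k (fun u => expR (be * ln u + ga * ln (1 - u)))).
- apply: filterS (near_gt t1) => s s1.
  have s10 : 0 < s - 1 by rewrite subr_gt0.
  have d1 u : is_derive u 1 (fun u => u * (s - 1) + 1) (s - 1).
    apply/is_derive1_caratheodory; exists (fun=> s - 1); split => //; last exact: cvg_cst.
    by move=> v; ring.
  split=> u hu.
    apply: (@contM R _ (fun=> (arcC (X s) (Y s) s a)^-1) u _ (contC _ u)).
    apply: (@cont_comp R (Lam (X s) (Y s) s a (F s) 2) (fun u => u * (s - 1) + 1) u); last exact: (Lam_cont (Ygt0 s1) (sc s1)).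
    exact: contD (contM (contI u) (contC (s - 1) u)) (contC 1 u).
  have /andP[u0 u1] := hu; have u1' : 0 < 1 - u by rewrite subr_gt0.
  have m0 : 0 < u * (s - 1) by rewrite mulr_gt0.
  have m1 : 0 < (1 - u) * (s - 1) by rewrite mulr_gt0.
  have hs : 1 < u * (s - 1) + 1 < s by apply/andP; split; lra.
  have d := is_deriveZ (arcC (X s) (Y s) s a)^-1 (@derive_comp R (Lam (X s) (Y s) s a (F s) 2) _ u _ _ (d1 u) (Lam2_deriv (Ygt0 s1) (sc s1) hs)).
  have -> : Phi s = (arcC (X s) (Y s) s a)^-1 \*: (fun u => Lam (X s) (Y s) s a (F s) 2 (u * (s - 1) + 1)).
    by apply/funext => v; rewrite /Phi mulrC.
  apply: is_derive_eq d _; rewrite /GRing.scale /= mulrA mulKf ?gt_eqF ?C0 //.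
  rewrite /k mulrCA mulrC; congr (_ * _); rewrite -expRD; congr expR.
  rewrite (_ : 2 * 1 + 2 = 4); last by ring.
  rewrite ln_dist // addrK (_ : s - (u * (s - 1) + 1) = (1 - u) * (s - 1)); last by ring.
  by rewrite !lnM ?posrE // /quad_exp /=; ring.
- by move=> u; apply: weight; [case/andP: hbe|case/andP: hga].
move=> u /andP[u0 u1]; have t10 : 0 < t - 1 by rewrite subr_gt0.
have c1 : q.1 - 1 @[q --> (t, u)] --> t - 1 by apply: cvgB; [exact: cvg_fst2|exact: cvg_cst].
have c2 : q.2 * (q.1 - 1) + 1 @[q --> (t, u)] --> u * (t - 1) + 1.
  by apply: cvgD; [apply: cvgM => //; exact: cvg_snd2|exact: cvg_cst].
apply: cvgM => //.
apply: (@cvg_comp2 R expR (fun p => (be + ga) * ln (p.1 - 1) + al * ln (p.2 * (p.1 - 1) + 1) - 2 * ln ((p.2 * (p.1 - 1) + 1 - X p.1) ^+ 2 + Y2 p.1))); last exact: continuous_expR.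
apply: cvgB; [apply: cvgD|]; (apply: cvgM; first exact: cvg_cst).
- by apply: (@cvg_comp2 R (@ln R) _ _ _ c1); exact: continuous_ln.
- by apply: (@cvg_comp2 R (@ln R) _ _ _ c2); apply: continuous_ln; rewrite ltr_wpDl // mulr_ge0 // ltW.
- exact: cvg_dist.
Qed.

Definition side_ratio t : R := ell t 2 / ell t 1.

Lemma side_ratioE t : 1 < t -> side_ratio t = side2 t / side1 t.
Proof.
move=> t1; have c := C0 t1; have l := len_gt0 (sc t1) 1.
by rewrite /side_ratio /side1 /side2 -[RHS]mulf_div divff ?mulr1 ?invr_eq0 ?gt_eqF.
Qed.

Lemma integral_side_ratio t : 1 < t -> I_side al be ga t / h1 al be ga t = (side_ratio t)%:C.
Proof.
move=> t1; have y00 := Ygt0 t1; have S := sc t1.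
have -> : I_side al be ga t = (side_scale (X t) (Y t) t a * ell t 2)%:C by exact: (I_side_side y00 t1 S).
have -> : h1 al be ga t = (side_scale (X t) (Y t) t a * ell t 1)%:C by exact: (h1_side y00 t1 S).
have l1 := len_gt0 S 1; have s0 := side_scale_gt0 (X t) t y00 a.
rewrite -rCV -rCM; congr (_%:C); rewrite /side_ratio -mulf_div divff ?mul1r ?gt_eqF //.
Qed.

Let sumC0 t : 1 < t -> (ell t 1)%:C + (ell t 2)%:C * cis (- (pi * be)) + (ell t 3)%:C * cis (- (pi * (be + ga)))
  + (ell t 4)%:C * cis (pi * al) = 0.
Proof.
move=> t1; have S := sc t1; pose D := dir (th t) a 1.
have D0 : D != 0 by rewrite -cabs_eq0 cabs_dir oner_eq0.
have d2 : dir (th t) a 2 = cis (- (pi * be)) * D by exact: (dir_turn S 1).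
have d3 : dir (th t) a 3 = cis (- (pi * (be + ga))) * D.
  have -> : dir (th t) a 3 = cis (- (pi * ga)) * dir (th t) a 2 by exact: (dir_turn S 2).
  by rewrite d2 mulrA -cisD; congr (cis _ * _); ring.
have d4 : dir (th t) a 4 = cis (pi * al) * D.
  rewrite (dir_per S 0); have -> : D = cis (- (pi * al)) * dir (th t) a 0 by exact: (dir_turn S 0).
  by rewrite mulrA -cisD subrr cis0 mul1r.
have e : vv (th t) (F t) 8 = vv (th t) (F t) 4 := vv_per S 4.
move: e; rewrite (vv_next S 4) (vv_next S 3) (vv_next S 2) (vv_next S 1) -/D d2 d3 d4 => e.
apply: (mulIf D0); rewrite mul0r; apply: (addrI (vv (th t) (F t) 4)); rewrite addr0 -[RHS]e; ring.
Qed.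

Let ell_closed t : 1 < t -> ell t 4 * sin (pi * de) = ell t 1 * sin (pi * (be + ga)) + ell t 2 * sin (pi * ga) /\
  ell t 3 * sin (pi * de) = ell t 1 * sin (pi * al) + ell t 2 * sin (pi * (al + be)).
Proof. by move=> t1; exact: closing_relations hsum (sumC0 t1). Qed.

Let ell_per t m : 1 < t -> ell t m.+4 = ell t m.
Proof.
move=> t1; have S := sc t1.
have e k : ell t k = Re (conjc (dir (th t) a k) * (vv (th t) (F t) k.+4 - vv (th t) (F t) k.+3)) by [].
by rewrite !e (dir_per S) !(vv_per S).
Qed.

(** Invariance of the cross-ratio: these products are [(t - 1) / t] and [1 / t] times the product of
    the diagonals, each of which is at most 2. One factor of each product is therefore small when
    [t] is extreme. *)
Let chords t : 1 < t -> chord (th t) 1 * chord (th t) 3 <= 4 * (t - 1) /\ chord (th t) 0 * chord (th t) 2 <= 4 / t.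
Proof.
move=> t1; have y00 := Ygt0 t1; have [h0 h1 h2 h3 h4] := thqE (X t) (Y t) t.
have t0 : 0 < t := lt_trans ltr01 t1.
rewrite /chord h0 h1 h2 h3 h4 cis2pi (cabs_distrC (cis pi)) !dist_hp // !dist_hp_pi //.
have p0 := zs_gt0 (X t) y00 0; have p1 := zs_gt0 (X t) y00 1; have pt := zs_gt0 (X t) y00 t.
have c02 : cabs (cis (hp (X t) (Y t) t) - cis (hp (X t) (Y t) 0)) <= 2.
  by apply: le_trans (cabsB _ _) _; rewrite !cabs_cis.
have c13 : cabs (cis (hp (X t) (Y t) 1) - cis pi) <= 2.
  by apply: le_trans (cabsB _ _) _; rewrite !cabs_cis.
move: c02 c13; rewrite dist_hp // dist_hp_pi // !subr0 normr1 !mulr1.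
rewrite (gtr0_norm t0) (gtr0_norm (_ : 0 < t - 1)) ?subr_gt0 //.
have tm : 0 < t - 1 by rewrite subr_gt0.
move: p0 p1 pt; set z0 := cabs _; set z1 := cabs _; set zt := cabs _; move: y00; set y := 2 * Y t => y00 p0 p1 pt c02 c13.
have y0' : 0 < y by rewrite mulr_gt0.
have A0 : 0 <= y * t / (zt * z0) by rewrite !mulr_ge0 ?invr_ge0 ?mulr_ge0 ?ltW.
have B0 : 0 <= y / z1 by rewrite divr_ge0 // ltW.
have AB : y * t / (zt * z0) * (y / z1) <= 4 by rewrite (_ : 4 = 2 * 2 :> R); [exact: ler_pM|ring].
split.
  have -> : y * (t - 1) / (zt * z1) * (y / z0) = (y * t / (zt * z0) * (y / z1)) * ((t - 1) / t).
    by field; rewrite !gt_eqF.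
  apply: ler_pM => //; [exact: mulr_ge0|by rewrite divr_ge0 // ltW|].
  by rewrite ler_pdivrMr // ler_peMr // ltW.
have -> : y / (z1 * z0) * (y / zt) = (y * t / (zt * z0) * (y / z1)) / t.
  by field; rewrite !gt_eqF.
by rewrite ler_pM2r // invr_gt0.
Qed.

Variables (L l3 l4 : R).
Hypotheses (L0 : 0 < L) (l30 : 0 < l3) (l40 : 0 < l4).
Hypothesis hclosed : 1%:C + L%:C * cis (- (pi * be)) + l3%:C * cis (- (pi * (be + ga))) + l4%:C * cis (pi * al) = 0.

Let sin_pos (x : R) : 0 < x < 1 -> 0 < sin (pi * x).
Proof.
move=> /andP[x0 x1]; have p := pi_gt0 R; apply: sin_gt0_pi; rewrite mulr_gt0 //=.
by rewrite -[ltRHS]mulr1 ltr_pM2l.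
Qed.

Let eps : R := Num.min (Num.min (1 - al) (1 - be)) (Num.min (1 - ga) (1 - de)).

Let eps0 : 0 < eps.
Proof. by move: hal hbe hga hde => /andP[_ ?] /andP[_ ?] /andP[_ ?] /andP[_ ?]; rewrite !lt_min !subr_gt0; apply/andP; split; apply/andP; split. Qed.

Let eps_le k : eps <= 1 - a k.
Proof.
rewrite /quad_exp; have := ltn_pmod k (isT : (0 < 4)%N).
by case: (k %% 4)%N => [|[|[|[|//]]]] _; rewrite /= /eps !ge_min lexx ?orbT.
Qed.

Let small K : 0 < K -> exists2 s, 0 < s & forall t m, 1 < t -> chord (th t) m < s ->
  ell t m.+1 < K * ell t m /\ ell t m.+1 < K * ell t m.+2.
Proof.
move=> K0; have t2 : 1 < (2 : R) by rewrite ltr1n.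
exists (small_chord eps K).
  exact: (small_chord_gt0 (sc t2) (balance_half_plane hal hbe hga hde hsum t2) eps0 eps_le K0).
move=> t m t1; rewrite -(chord_per (sc t1)) => hc.
exact: (chord_small (sc t1) (balance_half_plane hal hbe hga hde hsum t1) eps0 eps_le K0 hc).
Qed.

Let lt_sqr (x y s : R) : 0 < s -> 0 <= x -> 0 <= y -> x * y < s ^+ 2 -> x < s \/ y < s.
Proof.
move=> s0 x0 y0 h; have [xs|xs] := ltP x s; [by left|right].
rewrite ltNge; apply/negP => ys; move: h; rewrite ltNge expr2 => /negP[]; apply: ler_pM => //; exact: ltW.
Qed.

(* As [t] tends to 1, side 2 or side 4 collapses; the latter is impossible unless the ratio drops below [L]. *)
Lemma side_ratio_small : exists2 t, 1 < t & side_ratio t < L.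
Proof.
have K0 : 0 < Num.min L l4 by rewrite lt_min L0.
have [s s0 hs] := small K0.
(* Then [4 * (t - 1) = s ^ 2 / 2], so one of the chords 1 and 3 is shorter than [s]. *)
pose t := 1 + s ^+ 2 / 8; have t1 : 1 < t by rewrite ltrDl divr_gt0 // exprn_gt0.
exists t => //; have S := sc t1; have e1 := len_gt0 S 1.
rewrite /side_ratio ltr_pdivrMr //.
have [KL K4] : Num.min L l4 <= L /\ Num.min L l4 <= l4 by rewrite !ge_min !lexx orbT.
have [ch _] := chords t1.
have {}ch : chord (th t) 1 * chord (th t) 3 < s ^+ 2.
  apply: le_lt_trans ch _; rewrite /t addrAC subrr add0r.
  have : 0 < s ^+ 2 by rewrite exprn_gt0.
  lra.
have [c|c] := lt_sqr s0 (cabs_ge0 _) (cabs_ge0 _) ch.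
  have [h _] := hs t 1 t1 c; apply: lt_le_trans h _; by rewrite ler_pM2r.
have [_] := hs t 3 t1 c; rewrite (ell_per 1 t1) => h.
have {}h : ell t 4 < l4 * ell t 1 by apply: lt_le_trans h _; rewrite ler_pM2r.
(* Both polygons obey the same linear relation between sides 1, 2 and 4. Subtracting,
   [L - side_ratio t] has the sign of [l4 - ell t 4 / ell t 1]. *)
have [r1 _] := ell_closed t1; have [r2 _] := closing_relations hsum hclosed.
have sd := sin_pos hde; have sg := sin_pos hga.
rewrite -subr_gt0 -(pmulr_lgt0 _ sg).
have -> : (L * ell t 1 - ell t 2) * sin (pi * ga) = (l4 * ell t 1 - ell t 4) * sin (pi * de).
  rewrite !mulrBl r1 -mulrA (mulrC (ell t 1)) mulrA mulrAC -[l4 * _ * _]mulrAC r2; ring.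
by rewrite mulr_gt0 // subr_gt0.
Qed.

(* As [t] tends to infinity, side 1 or side 3 collapses. *)
Lemma side_ratio_big : exists2 t, 1 < t & L < side_ratio t.
Proof.
have K0 : 0 < Num.min L^-1 (l3 / L) by rewrite lt_min !divr_gt0 // invr_gt0 L0.
have [s s0 hs] := small K0.
(* Then [4 / t < s ^ 2], so one of the chords 0 and 2 is shorter than [s]; the 2 keeps [t] above
   1. *)
pose t := 2 + 8 / s ^+ 2; have t1 : 1 < t.
  have : 0 < 8 / s ^+ 2 by rewrite divr_gt0 // exprn_gt0.
  by rewrite /t; lra.
have t0 : 0 < t := lt_trans ltr01 t1.
exists t => //; have S := sc t1; have e1 := len_gt0 S 1; have e2 := len_gt0 S 2.
rewrite /side_ratio ltr_pdivlMr //.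
have [KL K3] : Num.min L^-1 (l3 / L) <= L^-1 /\ Num.min L^-1 (l3 / L) <= l3 / L by rewrite !ge_min !lexx orbT.
have [_ ch] := chords t1.
have {}ch : chord (th t) 0 * chord (th t) 2 < s ^+ 2.
  apply: le_lt_trans ch _; rewrite ltr_pdivrMr // /t mulrDr [X in _ + X]mulrC divfK ?gt_eqF ?exprn_gt0 //.
  have : 0 < s ^+ 2 by rewrite exprn_gt0.
  lra.
have [c|c] := lt_sqr s0 (cabs_ge0 _) (cabs_ge0 _) ch.
  have [_ h] := hs t 0 t1 c.
  have {}h : ell t 1 < L^-1 * ell t 2 by apply: lt_le_trans h _; rewrite ler_pM2r.
  by rewrite mulrC in h; rewrite mulrC -ltr_pdivlMr.
have [h _] := hs t 2 t1 c.
have {}h : L * ell t 3 < l3 * ell t 2.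
  have {}h : ell t 3 < l3 / L * ell t 2 by apply: lt_le_trans h _; rewrite ler_pM2r.
  by rewrite mulrC -ltr_pdivlMr // mulrAC.
have [_ r1] := ell_closed t1; have [_ r2] := closing_relations hsum hclosed.
have sd := sin_pos hde; have sa := sin_pos hal.
rewrite -subr_gt0 -(pmulr_lgt0 _ sa).
have -> : (ell t 2 - L * ell t 1) * sin (pi * al) = (l3 * ell t 2 - L * ell t 3) * sin (pi * de).
  rewrite !mulrBl -[L * ell t 3 * _]mulrA r1 [l3 * _ * _]mulrAC r2; ring.
by rewrite mulr_gt0 // subr_gt0.
Qed.

Lemma side_ratio_onto : exists2 t, 1 < t & side_ratio t = L.
Proof.
have [t1 h1 r1] := side_ratio_small; have [t2 h2 r2] := side_ratio_big.
pose f t := side2 t - L * side1 t.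
have fE t : 1 < t -> f t = (side_ratio t - L) * side1 t.
  by move=> ht; rewrite (side_ratioE ht) mulrBl divfK // gt_eqF // side1_gt0.
have fc t : 1 < t -> {for t, continuous f}.
  by move=> ht; exact: contB (side2_cont ht) (contM (contC L t) (side1_cont ht)).
have f1 : f t1 < 0 by rewrite fE // pmulr_llt0 ?side1_gt0 // subr_lt0.
have f2 : 0 < f t2 by rewrite fE // mulr_gt0 ?side1_gt0 // subr_gt0.
have main (u v : R) : 1 < u -> u <= v -> Num.min (f u) (f v) <= 0 <= Num.max (f u) (f v) -> exists2 t, 1 < t & side_ratio t = L.
  move=> hu uv hf; have [|c hc fc0] := @IVT R f u v 0 uv _ hf.
    apply: continuous_in_subspaceT => x; rewrite inE /= in_itv /= => /andP[ux _].
    by apply: fc; exact: lt_le_trans ux.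
  have hc1 : 1 < c by move: hc; rewrite in_itv /= => /andP[uc _]; exact: lt_le_trans uc.
  exists c => //; move: fc0; rewrite fE // => /eqP; rewrite mulf_eq0 (gt_eqF (side1_gt0 hc1)) orbF subr_eq0.
  by move=> /eqP.
have [h|h] := lerP t1 t2; first by apply: (main _ _ h1 h); rewrite ge_min le_max (ltW f1) (ltW f2) ?orbT.
by apply: (main _ _ h2 (ltW h)); rewrite ge_min le_max (ltW f1) (ltW f2) ?orbT.
Qed.

End side_ratio.

Theorem theorem3p22 (R : realType) (alpha beta gamma delta : R)
  (A1 A2 A3 A4 : R[i])
  (halpha : 0 < alpha < 1) (hbeta : 0 < beta < 1)
  (hgamma : 0 < gamma < 1) (hdelta : 0 < delta < 1)
  (hsum : alpha + beta + gamma + delta = 2)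
  (hA1 : A1 = 1) (hA2 : A2 = 0)
  (hA3 : 0 < complex.Im A3) (hA4 : 0 < complex.Im A4)
  (hconvex : convex_quadrilateral A1 A2 A3 A4)
  (hangle1 : exterior_angle A4 A1 A2 = pi * (1 + alpha))
  (hangle2 : exterior_angle A1 A2 A3 = pi * (1 + beta))
  (hangle3 : exterior_angle A2 A3 A4 = pi * (1 + gamma))
  (hangle4 : exterior_angle A3 A4 A1 = pi * (1 + delta)) :
  (forall t : R, 1 < t -> exists! x : R, admissible_root alpha beta gamma t x)
  /\
  (exists t : R,
     unique (fun s : R =>
       1 < s /\
       (cabs (A3 - A2))%:C = I_side alpha beta gamma s / h1 alpha beta gamma s)
       t
     /\
     let r : R := 1 / Num.sqrt t in
     Mod (exterior_of A1 A2 A3 A4) (Some A1) (Some A2) (Some A3) (Some A4)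
     = elliptic_K (Num.sqrt (1 - r ^+ 2)) / elliptic_K r).
Proof.
split=> [t t1|]; first exact: (admissible_unique halpha hbeta hgamma hdelta hsum t1).
have [e3 e4 e34] := quad_angles hA1 hA2 hA3 hA4 hconvex hangle1 hangle2 hangle3 halpha hbeta hgamma.
(* The given quadrilateral as a closed polygon with first side 1, rotated by [pi] so that this side
   points along the positive axis. *)
have cl : 1%:C + (cabs A3)%:C * cis (- (pi * beta)) + (cabs (A4 - A3))%:C * cis (- (pi * (beta + gamma)))
    + (cabs (A4 - 1))%:C * cis (pi * alpha) = 0.
  have cb : cis (- (pi * beta)) = - cis (pi * (1 - beta)) :> R[i].
    by rewrite mulrBr mulr1; apply: Cext; rewrite /= ?cosN ?sinN ?cosB ?sinB cospi sinpi; ring.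
  rewrite cb mulrN -e3 -e4 rC1.
  have -> : (cabs (A4 - A3))%:C * cis (- (pi * (beta + gamma))) = - (A4 - A3) by rewrite {2}e34 mulrN opprK.
  ring.
have L0 : 0 < cabs A3 by rewrite cabs_gt0; apply: contraTneq hA3 => ->; rewrite /= ltxx.
have l40 : 0 < cabs (A4 - 1).
  by rewrite cabs_gt0 subr_eq0; apply: contraTneq hA4 => ->; rewrite /= ltxx.
have l30 : 0 < cabs (A4 - A3).
  rewrite cabs_gt0 subr_eq0; apply/eqP => e; move: hconvex => [_ _ h _].
  have {}h : 0 < Im ((A1 - A3) * conjc (A4 - A3)) * Im ((A2 - A3) * conjc (A4 - A3)) := h.
  by move: h; rewrite e !ImM !ReJ !ImJ !ReB !ImB !subrr oppr0 !mulr0 addr0 mulr0 ltxx.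
have [t t1 rt] := side_ratio_onto halpha hbeta hgamma hdelta hsum L0 l30 l40 cl.
have A32 : A3 - A2 = A3 by rewrite hA2 subr0.
(* Stated for every solution [s]: two solutions describe the exterior of the same quadrilateral,
   hence have the same [elliptic_modulus], and injectivity gives uniqueness. *)
have modE s : 1 < s -> (cabs (A3 - A2))%:C = I_side alpha beta gamma s / h1 alpha beta gamma s ->
    Mod (exterior_of A1 A2 A3 A4) (Some A1) (Some A2) (Some A3) (Some A4) = elliptic_modulus s.
  move=> s1; rewrite (integral_side_ratio halpha hbeta hgamma hdelta hsum s1) => /(congr1 (@complex.Re R)) /= hs.
  apply: (Mod_half_plane halpha hbeta hgamma hdelta hsum _ s1 _ hA1 hA2 hA3 hA4 hconvex hangle1 hangle2 hangle3 hs).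
    exact: (y0_gt0 halpha hbeta hgamma hdelta hsum s1).
  exact: (balance_half_plane halpha hbeta hgamma hdelta hsum s1).
have ht : (cabs (A3 - A2))%:C = I_side alpha beta gamma t / h1 alpha beta gamma t.
  by rewrite (integral_side_ratio halpha hbeta hgamma hdelta hsum t1) rt A32.
exists t; split; last exact: modE.
split; first exact: conj t1 ht.
move=> s [s1 hs]; apply: (elliptic_modulus_inj t1 s1).
by rewrite -(modE t t1 ht) (modE s s1 hs).
Qed.
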